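(* Let $\gamma_k\to\infty$ be a sequence of positive numbers, for each $k$ let $(\bar q_{\gamma_k},\bar u_{\gamma_k})\in Q^{\mathrm{ad}}\times H_0^1(\Omega)$ be a solution (global minimizer) of the regularized problem $(P_{\gamma_k})$, and let $\bar p_{\gamma_k}\in H_0^1(\Omega)$ be the corresponding adjoint. Then there are a subsequence (not relabeled) and some $(\bar q,\bar u,\bar p)\in Q^{\mathrm{ad}}\times H_0^1(\Omega)\times H_0^1(\Omega)$ such that, as $k\to\infty$, $$\bar q_{\gamma_k}\to\bar q \quad\text{in } L^p(\Omega;\mathbb{R}^{2\times2}_{\mathrm{sym}})\ \text{ for all } 2\le p<\infty,$$ $$\bar u_{\gamma_k}\to\bar u \quad\text{in } W^{1,p}(\Omega)\ \text{ for all } 2\le p<\widehat p,$$ $$\bar p_{\gamma_k}\rightharpoonup\bar p \quad\text{weakly in } W^{1,2}(\Omega).$$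
   Context: Setting: $\Omega\subset\mathbb{R}^2$ is a bounded domain that is regular in the sense of Gröger; for the homogeneous Dirichlet condition on all of $\partial\Omega$ used here this means that every $x\in\partial\Omega$ has an open neighbourhood $U$ and a bi-Lipschitz map $\Phi$ of $U$ onto an open subset of $\mathbb{R}^2$ with $\Phi(x)=0$ and $\Phi(U\cap\Omega)=\{y\in\mathbb{R}^2: |y|<1,\ y_2<0\}$. Further $\psi\in\mathbb{R}$ is a constant with $\psi<0$, $f\in L^\infty(\Omega)$, $u_d\in L^2(\Omega)$, $\alpha>0$, and $0<q_{\min}<q_{\max}$ are real numbers. $\|\cdot\|$ and $(\cdot,\cdot)$ denote norm and scalar product of the respective $L^2$ space (scalar, vector- or matrix-valued). For symmetric matrices, $A\preccurlyeq B$ means that $B-A$ is positive semidefinite. $$Q^{\mathrm{ad}}=\{q\in L^2(\Omega;\mathbb{R}^{2\times2}_{\mathrm{sym}}) : q_{\min}I\preccurlyeq q(x)\preccurlyeq q_{\max}I \text{ for a.e. } x\in\Omega\}.$$ Smoothed maximum: for each $\gamma>0$, $\max_\gamma:\mathbb{R}\to[0,\infty)$ is a $C^2$ function such that $\max_\gamma(x)\le\max(0,x)$ for all $x$; $\max_\gamma(x)=\max(0,x)$ for all $x\ge\frac1{2\gamma}$ and all $x\le0$; $0\le\max_\gamma'(x)\le2$; $|\max_\gamma''(x)|\le M\gamma$; and $\frac1{c_1}\max_\gamma'(x)x\le\max_\gamma(x)\le c_2\max_\gamma'(x)x$ for all $x$, with constants $M>0$, $c_1,c_2\ge1$ independent of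 $\gamma$. Set $r(\gamma;u)=-\gamma\max_\gamma(\psi-u)$, so $\partial_u r(\gamma;u)=\gamma\max_\gamma'(\psi-u)$. State: for $\gamma>0$ and $q_\gamma\in Q^{\mathrm{ad}}$ there is a unique $u_\gamma\in H_0^1(\Omega)$ solving the regularized state equation $-\nabla\cdot(q_\gamma\nabla u_\gamma)+r(\gamma;u_\gamma)=f$ in $H^{-1}(\Omega)$, i.e. $(q_\gamma\nabla u_\gamma,\nabla v)+(r(\gamma;u_\gamma),v)=(f,v)$ for all $v\in H^1_0(\Omega)$. Problem $(P_\gamma)$: minimize $J(q_\gamma,u_\gamma)=\frac12\|u_\gamma-u_d\|^2+\frac\alpha2\|q_\gamma\|^2$ over all $q_\gamma\in Q^{\mathrm{ad}}$, $u_\gamma\in H_0^1(\Omega)$ satisfying the regularized state equation. Adjoint: the adjoint $\bar p_\gamma\in H_0^1(\Omega)$ belonging to $(\bar q_\gamma,\bar u_\gamma)$ is the unique solution of $-\nabla\cdot(\bar q_\gamma\nabla\bar p_\gamma)=\bar u_\gamma-u_d-\partial_ur(\gamma;\bar u_\gamma)\bar p_\gamma$ in $H^{-1}(\Omega)$. Exponent $\widehat p$: $\widehat p>2$ is a fixed number such that for every $p\in[2,\widehat p)$ there is a constant $C_p$, independent of $\gamma$ and $q_\gamma$, with $\|\nabla u_\gamma\|_{L^p(\Omega)}\le C_p\|f\|$ for every $\gamma>0$, every $q_\gamma\in Q^{\mathrm{ad}}$ and the corresponding solution $u_\gamma$ of the regularized state equation. *)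

(* Defs.v *)
From HB Require Import structures.
From mathcomp Require Import all_boot all_order all_algebra.
From mathcomp Require Import all_classical all_reals all_analysis.
Set Implicit Arguments.
Unset Strict Implicit.
Unset Printing Implicit Defensive.
Import Order.TTheory GRing.Theory Num.Theory.
Import numFieldNormedType.Exports.

Local Open Scope classical_set_scope.
Local Open Scope ring_scope.

(* The plane is R * R with its product topology and product Borel
   sigma-algebra.  The norm that MathComp-Analysis puts on R * R is the
   maximum norm; Euclidean lengths are written out where they matter. *)

Definition leb2 (R : realType) :
    {measure set (measurableTypeR R * measurableTypeR R) -> \bar R} :=
  (@lebesgue_measure R \x @lebesgue_measure R)%E.

Definition e_ (R : realType) (i : 'I_2) : R * R :=
  ((i == 0)%:R, (i == 1)%:R).

Definition fnorm (R : realType) (m n : nat) (A : 'M[R]_(m, n)) : R :=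
  Num.sqrt (\sum_(i < m) \sum_(j < n) A i j ^+ 2).

Definition dot (R : realType) (m n : nat) (A B : 'M[R]_(m, n)) : R :=
  \sum_(i < m) \sum_(j < n) A i j * B i j.

Definition loewner_le (R : realType) (n : nat) (A B : 'M[R]_n) : Prop :=
  forall x : 'cV[R]_n, 0 <= (x^T *m (B - A) *m x) 0 0.

Definition boundary (R : realType) (Omega : set (R * R)) : set (R * R) :=
  closure Omega `\` Omega°.

Definition bounded_domain (R : realType) (Omega : set (R * R)) : Prop :=
  [/\ Omega !=set0, open Omega, connected Omega & bounded_set Omega].

(* Bi-Lipschitz continuity does not depend on the choice of the norm. *)
Definition bilipschitz_on (R : realType) (U : set (R * R))
    (Phi : R * R -> R * R) : Prop :=
  exists2 L : R, 0 < L & forall x y, U x -> U y ->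
    `|Phi x - Phi y| <= L * `|x - y| /\ `|x - y| <= L * `|Phi x - Phi y|.

Definition groger_regular (R : realType) (Omega : set (R * R)) : Prop :=
  forall x, boundary Omega x ->
  exists (U : set (R * R)) (Phi : R * R -> R * R),
    [/\ open U /\ U x, bilipschitz_on U Phi, open (Phi @` U), Phi x = (0, 0)
      & Phi @` (U `&` Omega) =
        [set y | y.1 ^+ 2 + y.2 ^+ 2 < 1 /\ y.2 < 0]].

(* Lebesgue spaces.  Functions are defined on the whole plane and only their
   restriction to Omega counts; a class in L^p is given by a Borel
   representative. *)

Definition Lp (R : realType) (Omega : set (R * R)) (p : \bar R)
    (u : R * R -> R) : Prop :=
  (u \_ Omega) \in Lfun (leb2 R) p.

Definition Lpnorm (R : realType) (Omega : set (R * R)) (p : \bar R)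
    (u : R * R -> R) : \bar R :=
  ('N[leb2 R]_p[EFin \o (u \_ Omega)])%E.

Definition Lp_mx (R : realType) (m n : nat) (Omega : set (R * R)) (p : \bar R)
    (F : R * R -> 'M[R]_(m, n)) : Prop :=
  forall i j, Lp Omega p (fun x => F x i j).

Definition Lpnorm_mx (R : realType) (m n : nat) (Omega : set (R * R))
    (p : \bar R) (F : R * R -> 'M[R]_(m, n)) : \bar R :=
  Lpnorm Omega p (fun x => fnorm (F x)).

Definition ip (R : realType) (Omega : set (R * R)) (u v : R * R -> R) : R :=
  (\int[leb2 R]_(x in Omega) (u x * v x))%R.

Definition ip_mx (R : realType) (m n : nat) (Omega : set (R * R))
    (F G : R * R -> 'M[R]_(m, n)) : R :=
  (\int[leb2 R]_(x in Omega) dot (F x) (G x))%R.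

Definition cvg_Lp_mx (R : realType) (m n : nat) (Omega : set (R * R))
    (p : \bar R) (F : nat -> R * R -> 'M[R]_(m, n))
    (G : R * R -> 'M[R]_(m, n)) : Prop :=
  [/\ forall k, Lp_mx Omega p (F k), Lp_mx Omega p G
    & Lpnorm_mx Omega p (fun x => F k x - G x) @[k --> \oo] --> 0%E].

(* Test functions C_c^oo(Omega). *)

Definition iter_partial (R : realType) (s : seq 'I_2) (phi : R * R -> R) :
    R * R -> R :=
  foldr (fun i (g : R * R -> R) x => 'D_(e_ R i) g x) phi s.

Definition smooth (R : realType) (phi : R * R -> R) : Prop :=
  forall s : seq 'I_2, continuous (iter_partial s phi) /\
    forall i x, derivable (iter_partial s phi) x (e_ R i).

Definition test_function (R : realType) (Omega : set (R * R))
    (phi : R * R -> R) : Prop :=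
  smooth phi /\ exists K : set (R * R),
    [/\ compact K, K `<=` Omega & forall x, ~ K x -> phi x = 0].

(* Weak derivatives and Sobolev spaces. *)

Definition loc_integrable (R : realType) (Omega : set (R * R))
    (u : R * R -> R) : Prop :=
  forall K : set (R * R), compact K -> K `<=` Omega ->
    (leb2 R).-integrable K (EFin \o u).

Definition is_weak_partial (R : realType) (Omega : set (R * R)) (i : 'I_2)
    (u g : R * R -> R) : Prop :=
  [/\ loc_integrable Omega u, loc_integrable Omega g
    & forall phi, test_function Omega phi ->
      ip Omega u (fun x => 'D_(e_ R i) phi x) = - ip Omega g phi].

(* A chosen weak derivative, which is unique up to a null set of Omega;
   it is the default value when no weak derivative exists. *)
Definition weak_partial (R : realType) (Omega : set (R * R)) (i : 'I_2)
    (u : R * R -> R) : R * R -> R :=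
  get [set g | is_weak_partial Omega i u g].

Definition grad (R : realType) (Omega : set (R * R)) (u : R * R -> R) :
    R * R -> 'cV[R]_2 :=
  fun x => \col_i weak_partial Omega i u x.

Definition W1p (R : realType) (Omega : set (R * R)) (p : \bar R)
    (u : R * R -> R) : Prop :=
  Lp Omega p u /\
  forall i, exists2 g, is_weak_partial Omega i u g & Lp Omega p g.

Definition W1pnorm (R : realType) (Omega : set (R * R)) (p : \bar R)
    (u : R * R -> R) : \bar R :=
  (Lpnorm Omega p u + Lpnorm_mx Omega p (grad Omega u))%E.

Definition cvg_W1p (R : realType) (Omega : set (R * R)) (p : \bar R)
    (u : nat -> R * R -> R) (v : R * R -> R) : Prop :=
  [/\ forall k, W1p Omega p (u k), W1p Omega p v
    & W1pnorm Omega p (fun x => u k x - v x) @[k --> \oo] --> 0%E].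

Definition H10 (R : realType) (Omega : set (R * R)) (u : R * R -> R) : Prop :=
  W1p Omega 2%:E u /\ exists phi : nat -> R * R -> R,
    (forall n, test_function Omega (phi n)) /\
    cvg_W1p Omega 2%:E phi u.

(* Elements of the dual space of W^{1,p}(Omega).  Boundedness makes F
   independent of the representative. *)
Definition W1p_dual (R : realType) (Omega : set (R * R)) (p : \bar R)
    (F : (R * R -> R) -> R) : Prop :=
  (forall (a : R) u v, W1p Omega p u -> W1p Omega p v ->
     F (fun x => a * u x + v x) = a * F u + F v) /\
  exists C : R, forall u, W1p Omega p u ->
    (`|F u|%:E <= C%:E * W1pnorm Omega p u)%E.

Definition weak_cvg_W1p (R : realType) (Omega : set (R * R)) (p : \bar R)
    (u : nat -> R * R -> R) (v : R * R -> R) : Prop :=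
  [/\ forall k, W1p Omega p (u k), W1p Omega p v
    & forall F, W1p_dual Omega p F -> F (u k) @[k --> \oo] --> F v].

(* The control problem. *)

Definition Qad (R : realType) (Omega : set (R * R)) (qmin qmax : R)
    (q : R * R -> 'M[R]_2) : Prop :=
  [/\ Lp_mx Omega 2%:E q,
      {ae leb2 R, forall x, Omega x -> (q x)^T = q x}
    & {ae leb2 R, forall x, Omega x ->
        loewner_le qmin%:M (q x) /\ loewner_le (q x) qmax%:M}].

Definition smoothed_max (R : realType) (M c1 c2 : R) (mx : R -> R -> R) :
    Prop :=
  forall gamma : R, 0 < gamma ->
  [/\ (forall x, derivable (mx gamma) x 1) /\
        (forall x, derivable (derive1 (mx gamma)) x 1) /\
        continuous (derive1n 2 (mx gamma)),
      forall x, 0 <= mx gamma x <= Num.max 0 x,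
      forall x, (2 * gamma)^-1 <= x \/ x <= 0 -> mx gamma x = Num.max 0 x,
      forall x, 0 <= derive1 (mx gamma) x <= 2 /\
        `|derive1n 2 (mx gamma) x| <= M * gamma
    & forall x, c1^-1 * (derive1 (mx gamma) x * x) <= mx gamma x /\
        mx gamma x <= c2 * (derive1 (mx gamma) x * x)].

Definition r_ (R : realType) (mx : R -> R -> R) (psi gamma u : R) : R :=
  - gamma * mx gamma (psi - u).

Definition dr_ (R : realType) (mx : R -> R -> R) (psi gamma u : R) : R :=
  gamma * derive1 (mx gamma) (psi - u).

Definition is_state (R : realType) (Omega : set (R * R)) (mx : R -> R -> R)
    (psi : R) (f : R * R -> R) (gamma : R) (q : R * R -> 'M[R]_2)
    (u : R * R -> R) : Prop :=
  H10 Omega u /\ forall v, H10 Omega v ->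
    ip_mx Omega (fun x => q x *m grad Omega u x) (grad Omega v)
    + ip Omega (fun x => r_ mx psi gamma (u x)) v = ip Omega f v.

Definition is_adjoint (R : realType) (Omega : set (R * R)) (mx : R -> R -> R)
    (psi : R) (ud : R * R -> R) (gamma : R) (q : R * R -> 'M[R]_2)
    (u p : R * R -> R) : Prop :=
  H10 Omega p /\ forall v, H10 Omega v ->
    ip_mx Omega (fun x => q x *m grad Omega p x) (grad Omega v)
    = ip Omega (fun x => u x - ud x - dr_ mx psi gamma (u x) * p x) v.

Definition J (R : realType) (Omega : set (R * R)) (ud : R * R -> R)
    (alpha : R) (q : R * R -> 'M[R]_2) (u : R * R -> R) : R :=
  2^-1 * fine (Lpnorm Omega 2%:E (fun x => u x - ud x)) ^+ 2
  + alpha / 2 * fine (Lpnorm_mx Omega 2%:E q) ^+ 2.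

Definition solves_P (R : realType) (Omega : set (R * R)) (mx : R -> R -> R)
    (psi : R) (f ud : R * R -> R) (alpha qmin qmax gamma : R)
    (q : R * R -> 'M[R]_2) (u : R * R -> R) : Prop :=
  [/\ Qad Omega qmin qmax q, is_state Omega mx psi f gamma q u
    & forall q' u', Qad Omega qmin qmax q' ->
        is_state Omega mx psi f gamma q' u' ->
        J Omega ud alpha q u <= J Omega ud alpha q' u'].

Definition regularity_exponent (R : realType) (Omega : set (R * R))
    (mx : R -> R -> R) (psi : R) (f : R * R -> R) (qmin qmax phat : R) :
    Prop :=
  2 < phat /\ forall p : R, 2 <= p < phat ->
    exists C : R, forall (gamma : R) q u, 0 < gamma ->
      Qad Omega qmin qmax q -> is_state Omega mx psi f gamma q u ->
      (Lpnorm_mx Omega p%:E (grad Omega u) <= C%:E * Lpnorm Omega 2%:E f)%E.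

(* Main.v *)
(* Along a subsequence q_k, grad u_k and the fluxes q_k grad u_k converge weakly
   in L^2, to q_0, grad u_0 and s_0 say.  Testing the state equation with a smooth
   nondecreasing function of u_k bounds r(gamma_k; u_k) in L^2, so the fluxes
   have bounded divergence, and a div-curl argument with localized affine
   perturbations yields the pointwise positivity of the block matrix
   [[q_0 - qmin, t], [t^T, t . grad u_0]], where t = s_0 - qmin grad u_0.
   Its Schur complement  qh = qmin + t t^T / (t . grad u_0)  satisfies
   qmin <= qh <= q_0  and  qh grad u_0 = s_0.  The states of the coefficient qh with
   penalty gamma_k converge to u_0; comparing (q_k, u_k) with them by optimality
   gives limsup |q_k| <= |qh| <= |q_0|, so q_k -> q_0 = qh strongly in L^2.  Monotonicity
   of the penalty upgrades the weak convergence of the gradients to a strong one.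
   The L^p and W^{1,p} statements follow by interpolation with the uniform bounds,
   and the adjoints are bounded in H^1_0. *)
Require Import Defs.
From HB Require Import structures.
From mathcomp Require Import all_boot all_order all_algebra.
From mathcomp Require Import all_classical all_reals all_analysis.
From mathcomp Require Import measurable_realfun ess_sup_inf ring lra.
Set Implicit Arguments.
Unset Strict Implicit.
Unset Printing Implicit Defensive.
Import Order.TTheory GRing.Theory Num.Theory.
Import numFieldNormedType.Exports.
Local Open Scope classical_set_scope.
Local Open Scope ring_scope.

(** Weak limits do not commute with the product: [s_0] is in general not [q_0] times the gradient of
    [u_0], so comparing costs at [q_0] leads nowhere. It is enough to find an admissible coefficient
    that carries the limit flux and is no larger than [q_0]; the Schur complement is the smallest
    one that the block inequality permits, and no theory of H-convergence enters. The block
    inequality starts from [(q_k - qmin)(z + t xi_k) . (z + t xi_k) >= 0] with a constant vector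
    [z], a real [t] and the gradient [xi_k] of [u_k]. All terms pass to the limit weakly or by
    div-curl, except [- qmin t^2 |xi_k|^2]. Adding [qmin t^2 |xi_k - xi_0|^2] removes that term
    without harm to the sign, and the limit contains just [- qmin t^2 |xi_0|^2]. The competitors
    solve the equation with the same penalty parameter, which makes optimality applicable; their
    states tend to [u_0] because the limit multiplier is complementary to [u_0 - psi]. The norm
    comparison is used in the sharper form [(q_0 - qh, qh) >= 0], which yields strong convergence to
    [qh] at once. *)

Lemma cvg0_le (R : realType) (a b : nat -> R) :
  (forall n, 0 <= a n <= b n) -> b @ \oo --> 0 -> a @ \oo --> 0.
Proof.
move=> ab b0; apply: (@squeeze_cvgr _ _ _ _ (fun=> 0) b) => //.
- by apply: nearW => n; exact: ab.
- exact: cvg_cst.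
Qed.

Lemma cvg_epsP (R : realType) (a : nat -> R) (l : R) :
  a @ \oo --> l <-> forall e : R, 0 < e -> exists N, forall n, (N <= n)%N -> `|a n - l| <= e.
Proof.
split=> [/cvgrPdist_le al e e0|al].
  have [N _ NP] := al _ e0; exists N => n Nn; rewrite distrC; exact: NP.
apply/cvgrPdist_le => e e0; have [N NP] := al _ e0.
by exists N => // n Nn; rewrite distrC; exact: NP.
Qed.

Lemma cvg_subseq (T : topologicalType) (a : nat -> T) (l : T) (s : nat -> nat) :
  {homo s : i j / (i < j)%N} -> a @ \oo --> l -> (a \o s) @ \oo --> l.
Proof.
move=> hs al; apply: (cvg_comp s a _ al).
have sge n : (n <= s n)%N.
  by elim: n => // n IH; apply: (leq_ltn_trans IH); exact: hs.
move=> A [N _ NP]; exists N => // n /= Nn; apply: NP => /=.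
exact: leq_trans Nn (sge n).
Qed.

Lemma cvg_inv_succ (R : realType) : (fun n : nat => n.+1%:R^-1 : R) @ \oo --> (0 : R).
Proof. exact: cvg_harmonic. Qed.

Lemma homo_ltn_comp (s t : nat -> nat) : {homo s : i j / (i < j)%N} ->
  {homo t : i j / (i < j)%N} -> {homo (s \o t) : i j / (i < j)%N}.
Proof. by move=> hs ht i j /ht /hs. Qed.

Lemma homo_ltn_ge (s : nat -> nat) : {homo s : i j / (i < j)%N} ->
  forall n, (n <= s n)%N.
Proof. by move=> hs; elim=> // n IH; apply: (leq_ltn_trans IH); exact: hs. Qed.

Lemma homo_ltn_leq (s : nat -> nat) : {homo s : i j / (i < j)%N} ->
  {homo s : i j / (i <= j)%N}.
Proof.
move=> hs i j; rewrite leq_eqVlt => /predU1P[->//|/hs]; exact: ltnW.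
Qed.

Lemma bounded_subseq (R : realType) (a : nat -> R) (C : R) :
  (forall n, `|a n| <= C) ->
  exists2 s : nat -> nat, {homo s : i j / (i < j)%N} & cvgn (a \o s).
Proof.
move=> aC; have ba : bounded_fun a.
  exists C; split; first exact: num_real.
  by move=> x Cx n _; apply: le_trans (aC n) _; exact: ltW.
have [s /increasing_seqP hs cs] := bolzano_weierstrass ba.
exists s => //; apply: homo_ltn => [i j k|n]; [exact: ltn_trans|exact: hs].
Qed.

Lemma diagonal_subseq (R : realType) (a : nat -> nat -> R) (C : nat -> R) :
  (forall j n, `|a j n| <= C j) ->
  exists2 s : nat -> nat, {homo s : i j / (i < j)%N} & forall j, cvgn (a j \o s).
Proof.
move=> aC.
have step (j : nat) (s : nat -> nat) : {t : nat -> nat |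
    {homo t : i j / (i < j)%N} /\ cvgn (a j \o (s \o t))}.
  apply: cid; have [t ht ct] := @bounded_subseq R (a j \o s) (C j) (fun n => aC j (s n)).
  exists t; split => //; exact: ht.
(* Nested extractions: [s j.+1] refines [s j] so that [a j] converges along it. By [fact] the
   diagonal entry [s n n] is, for [n > j], the value of [s j.+1] at an index [t n >= n]; this
   suffices although [t] depends on [n]. *)
pose s := fix s (j : nat) : nat -> nat :=
  if j is j'.+1 then s j' \o sval (step j' (s j')) else id.
have hs j : {homo s j : i k / (i < k)%N}.
  elim: j => [//|j IH] /=; case: (step _ _) => t /= [ht _]; exact: homo_ltn_comp.
have cs j : cvgn (a j \o s j.+1) by rewrite /=; case: (step _ _) => t /= [_ ct].
have fact (j n : nat) : exists2 t : nat -> nat, {homo t : i k / (i < k)%N} &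
    s (j + n)%N = s j \o t.
  elim: n => [|n [t ht IH]]; first by rewrite addn0; exists id.
  rewrite addnS /=; case: (step (j + n)%N _) => t' /= [ht' _].
  by exists (t \o t'); [exact: homo_ltn_comp|rewrite IH].
exists (fun n => s n n).
  move=> i k ik; have [t ht ->] : exists2 t : nat -> nat,
      {homo t : i k / (i < k)%N} & s k = s i \o t.
    by have := fact i (k - i)%N; rewrite subnKC// ltnW.
  apply: hs => /=; apply: (leq_trans ik); exact: homo_ltn_ge.
move=> j; apply/cvg_ex; exists (lim ((a j \o s j.+1) @ \oo)).
apply/cvg_epsP => e e0; have [N NP] := (cvg_epsP _ _).1 (cs j) _ e0.
exists (maxn N j.+1) => n; rewrite geq_max => /andP[Nn jn].
have [t ht E] := fact j.+1 (n - j.+1)%N.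
rewrite subnKC// in E; rewrite /= E; apply: (NP (t n)).
exact: leq_trans Nn (homo_ltn_ge ht n).
Qed.

(** The vectors will be functions, not classes modulo null sets, so [b] is only positive
    semidefinite and limits are unique only up to seminorm zero. [S] singles out the space ([L2] or
    [H10]) among all functions; hence every law is relative to [S]. *)
Record preHilbert (R : realType) (V : lmodType R) (S : V -> Prop)
    (b : V -> V -> R) : Prop := PreHilbert {
  pH0 : S 0;
  pHD : forall x y, S x -> S y -> S (x + y);
  pHZ : forall (a : R) x, S x -> S (a *: x);
  pHC : forall x y, S x -> S y -> b x y = b y x;
  pHbD : forall x y z, S x -> S y -> S z -> b (x + y) z = b x z + b y z;
  pHbZ : forall a x y, S x -> S y -> b (a *: x) y = a * b x y;
  pH_ge0 : forall x, S x -> 0 <= b x x;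
  pH_complete : forall x : nat -> V, (forall n, S (x n)) ->
    (forall e : R, 0 < e -> exists N, forall m n, (N <= m)%N -> (N <= n)%N ->
       b (x m - x n) (x m - x n) <= e) ->
    exists2 y, S y & (fun n => b (x n - y) (x n - y)) @ \oo --> 0 }.

(** * Riesz representation and weak sequential compactness *)

Section PreHilbertTheory.
Variables (R : realType) (V : lmodType R) (S : V -> Prop) (b : V -> V -> R).
Hypothesis H : preHilbert S b.

Let S0 := pH0 H.
Let SD := pHD H.
Let SZ := pHZ H.

Lemma pHN x : S x -> S (- x).
Proof. by move=> Sx; rewrite -scaleN1r; exact: SZ. Qed.

Lemma pHB x y : S x -> S y -> S (x - y).
Proof. by move=> Sx Sy; apply: SD => //; exact: pHN. Qed.

Lemma pHbDr x y z : S x -> S y -> S z -> b z (x + y) = b z x + b z y.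
Proof.
move=> Sx Sy Sz; rewrite (pHC H Sz (SD Sx Sy)) (pHbD H)//.
by rewrite (pHC H Sx)// (pHC H Sy).
Qed.

Lemma pHbZr a x y : S x -> S y -> b y (a *: x) = a * b y x.
Proof. by move=> Sx Sy; rewrite (pHC H Sy (SZ a Sx)) (pHbZ H)// (pHC H Sx). Qed.

Lemma pHbNl x y : S x -> S y -> b (- x) y = - b x y.
Proof. by move=> Sx Sy; rewrite -scaleN1r (pHbZ H)// mulN1r. Qed.

Lemma pHbNr x y : S x -> S y -> b y (- x) = - b y x.
Proof. by move=> Sx Sy; rewrite -scaleN1r pHbZr// mulN1r. Qed.

Lemma pHbBl x y z : S x -> S y -> S z -> b (x - y) z = b x z - b y z.
Proof. by move=> Sx Sy Sz; rewrite (pHbD H)// ?pHbNl//; exact: pHN. Qed.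

Lemma pHbBr x y z : S x -> S y -> S z -> b z (x - y) = b z x - b z y.
Proof. by move=> Sx Sy Sz; rewrite pHbDr// ?pHbNr//; exact: pHN. Qed.

Lemma pH_sqD x y (t : R) : S x -> S y ->
  b (x + t *: y) (x + t *: y) = b x x + 2 * t * b x y + t ^+ 2 * b y y.
Proof.
move=> Sx Sy; have Sty := SZ t Sy.
rewrite (pHbD H)//; last exact: SD.
rewrite !pHbDr// !pHbZr// !(pHbZ H)// (pHC H Sy Sx); ring.
Qed.

Lemma pH_sqB x y : S x -> S y -> b (x - y) (x - y) = b x x - 2 * b x y + b y y.
Proof.
move=> Sx Sy; rewrite -[- y]scaleN1r pH_sqD//; ring.
Qed.

Lemma pH_CS x y : S x -> S y -> b x y ^+ 2 <= b x x * b y y.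
Proof.
move=> Sx Sy.
have P t : 0 <= b x x + 2 * t * b x y + t ^+ 2 * b y y.
  by rewrite -pH_sqD//; apply: (pH_ge0 H); apply: SD => //; exact: SZ.
have xx := pH_ge0 H Sx; have yy := pH_ge0 H Sy.
move: yy; rewrite le_eqVlt => /predU1P[yy0|yy].
  rewrite -yy0 mulr0; have [->|xy0] := eqVneq (b x y) 0; first by rewrite expr0n.
  (* For [b y y = 0] the expression is affine in the parameter, and this choice would make it equal
     to [-1]. *)
  have := P (- (b x x + 1) / (2 * b x y)).
  rewrite -yy0 mulr0 addr0.
  have -> : b x x + 2 * (- (b x x + 1) / (2 * b x y)) * b x y = -1 by field.
  by rewrite lerNr oppr0 ler10.
have := P (- b x y / b y y).
have -> : b x x + 2 * (- b x y / b y y) * b x y + (- b x y / b y y) ^+ 2 * b y y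
  = b x x - b x y ^+ 2 / b y y by field; rewrite gt_eqF.
by rewrite subr_ge0 ler_pdivrMr.
Qed.

Lemma pH_CSabs x y : S x -> S y -> `|b x y| <= Num.sqrt (b x x) * Num.sqrt (b y y).
Proof.
move=> Sx Sy; rewrite -(sqrtr_sqr (b x y)) -sqrtrM ?(pH_ge0 H)//.
by rewrite ler_sqrt ?mulr_ge0 ?(pH_ge0 H)//; exact: pH_CS.
Qed.

(* Boundedness is stated on squares so that no square roots are needed. *)
Definition bounded_linear (F : V -> R) : Prop :=
  [/\ forall x y, S x -> S y -> F (x + y) = F x + F y,
      forall a x, S x -> F (a *: x) = a * F x
    & exists2 C, 0 <= C & forall x, S x -> F x ^+ 2 <= C * b x x].

Lemma bounded_linearB F x y : bounded_linear F -> S x -> S y -> F (x - y) = F x - F y.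
Proof.
move=> [FD FZ _] Sx Sy; rewrite FD//; last exact: pHN.
by rewrite -scaleN1r FZ// mulN1r.
Qed.

Lemma bounded_linear_cvg F x y : bounded_linear F -> (forall n, S (x n)) -> S y ->
  (fun n : nat => b (x n - y) (x n - y)) @ \oo --> 0 -> (F \o x) @ \oo --> F y.
Proof.
move=> FL Sx Sy xy; have [_ _ [C _ FC]] := FL.
have C2 : (fun n => (F (x n) - F y) ^+ 2) @ \oo --> 0.
  apply: (@cvg0_le _ _ (fun n => C * b (x n - y) (x n - y))).
    move=> n; rewrite sqr_ge0 /= -(bounded_linearB FL)//; apply: FC; exact: pHB.
  by rewrite -[X in _ --> X](mulr0 C); apply: cvgM => //; exact: cvg_cst.
apply/cvg_epsP => e e0; have e20 : 0 < e ^+ 2 by rewrite exprn_gt0.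
have [N NP] := (cvg_epsP _ _).1 C2 _ e20.
exists N => n /NP; rewrite subr0 ger0_norm ?sqr_ge0// => h.
by rewrite -[leRHS](ger0_norm (ltW e0)) -ler_sqr ?nnegrE// !real_normK ?num_real.
Qed.

Lemma bounded_linear_b y : S y -> bounded_linear (b y).
Proof.
move=> Sy; split.
- by move=> x z Sx Sz; rewrite pHbDr.
- by move=> a x Sx; rewrite pHbZr.
- by exists (b y y); [exact: (pH_ge0 H)|move=> x Sx; exact: pH_CS].
Qed.

(** The parallelogram identity turns almost minimality into closeness: midpoints do not fall below
    [m], so [b (x k - x l) (x k - x l)] is at most [2 / (k + 1) + 2 / (l + 1)]. *)
Lemma minimizing_cauchy (x : nat -> V) (m : R) (Phi : V -> R) :
  (forall n, S (x n)) ->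
  (forall k l, m <= Phi (2^-1 *: (x k + x l))) ->
  (forall n, Phi (x n) <= m + n.+1%:R^-1) ->
  (forall y z, S y -> S z ->
    b (y - z) (y - z) = 2 * Phi y + 2 * Phi z - 4 * Phi (2^-1 *: (y + z))) ->
  exists2 y, S y & (fun n => b (x n - y) (x n - y)) @ \oo --> 0.
Proof.
move=> Sx mP xP par; apply: (pH_complete H) => // e e0.
have e4 : 0 < e / 4 by rewrite divr_gt0.
have [N NP] := (cvg_epsP _ _).1 (@cvg_inv_succ R) _ e4.
exists N => k l Nk Nl; rewrite par//.
have := NP _ Nk; have := NP _ Nl; rewrite !subr0 !ger0_norm ?invr_ge0//.
by move: (k.+1%:R^-1) (l.+1%:R^-1) (mP k l) (xP k) (xP l) => a1 a2 h1 h2 h3 h4 h5; lra.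
Qed.

(** Direct method: the functional [b v v - 2 F v] is bounded below by [- C], a minimizing sequence
    is Cauchy, and the vanishing first variation at the limit is the identity sought. *)
Lemma riesz F : bounded_linear F -> exists2 w, S w & forall v, S v -> b w v = F v.
Proof.
move=> FL; have [FD FZ [C C0 FC]] := FL.
have F0 : F 0 = 0 by have := FZ 0 0 S0; rewrite scale0r mul0r.
have b00 : b 0 0 = 0 by have := pHbZ H 0 S0 S0; rewrite scale0r mul0r.
pose Phi v := b v v - 2 * F v.
have lowb v : S v -> - C <= Phi v.
  move=> Sv; have C1 := FC _ Sv; have bv := pH_ge0 H Sv; rewrite /Phi.
  have h : (2 * F v) ^+ 2 <= (b v v + C) ^+ 2.
    by have := sqr_ge0 (b v v - C); rewrite !expr2 in C1 *; nra.
  have h0 : 0 <= b v v + C by rewrite addr_ge0.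
  suff : 2 * F v <= b v v + C by lra.
  apply: le_trans (ler_norm _) _.
  by rewrite -[leRHS]ger0_norm// -ler_sqr ?nnegrE// !real_normK ?num_real.
pose E := Phi @` [set v | S v].
have iE : has_inf E.
  split; first by exists (Phi 0), 0.
  by exists (- C) => _ [v Sv <-]; exact: lowb.
pose m := inf E.
have mP v : S v -> m <= Phi v by move=> Sv; apply: ge_inf; [exact: iE.2|exists v].
have xex n : exists x, S x /\ Phi x <= m + n.+1%:R^-1.
  have n0 : 0 < n.+1%:R^-1 :> R by rewrite invr_gt0.
  by have [_ [v Sv <-] /ltW h] := inf_adherent n0 iE; exists v.
have [x xP] := choice xex.
have Sx n : S (x n) by case: (xP n).
have hS y z : S y -> S z -> S (2^-1 *: (y + z)).
  by move=> Sy Sz; apply: SZ; exact: SD.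
have [w Sw xw] : exists2 y, S y & (fun n => b (x n - y) (x n - y)) @ \oo --> 0.
  apply: (@minimizing_cauchy x m Phi) => //.
  - by move=> k l; apply: mP; exact: hS.
  - by move=> n; case: (xP n).
  - move=> y z Sy Sz; rewrite /Phi FZ ?FD//; last exact: SD.
    have -> : b (2^-1 *: (y + z)) (2^-1 *: (y + z)) = 2^-1 * 2^-1 * b (y + z) (y + z).
      by rewrite (pHbZ H) ?pHbZr ?mulrA//; do ?[exact: SD|exact: hS].
    have -> : b (y + z) (y + z) = b y y + 2 * b y z + b z z.
      by have := pH_sqD 1 Sy Sz; rewrite scale1r => ->; ring.
    by rewrite pH_sqB//; field.
exists w => // v Sv.
have Pw : Phi w <= m.
  apply/ler_addgt0Pr => e e0.
  have sq := bounded_linear_cvg (bounded_linear_b Sw) Sx Sw xw.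
  have cF := bounded_linear_cvg FL Sx Sw xw.
  have cPhi : (fun n => Phi (x n)) @ \oo --> Phi w.
    have -> : (fun n => Phi (x n)) =
      (fun n => b (x n - w) (x n - w) + 2 * b w (x n) - b w w - 2 * F (x n)).
      apply/funext => n; rewrite /Phi pH_sqB// (pHC H Sw (Sx n)); ring.
    have -> : Phi w = 0 + 2 * b w w - b w w - 2 * F w by rewrite /Phi; ring.
    apply: cvgB; last by apply: cvgM => //; exact: cvg_cst.
    apply: cvgB; last exact: cvg_cst.
    by apply: cvgD => //; apply: cvgM => //; exact: cvg_cst.
  have e2 : 0 < e / 2 by rewrite divr_gt0.
  have [N1 N1P] := (cvg_epsP _ _).1 cPhi _ e2.
  have [N2 N2P] := (cvg_epsP _ _).1 (@cvg_inv_succ R) _ e2.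
  have := N1P _ (leq_maxl N1 N2); have := N2P _ (leq_maxr N1 N2).
  rewrite subr0 ger0_norm ?invr_ge0//; have := (xP (maxn N1 N2)).2.
  rewrite ler_norml => h1 h2 /andP[h3 _]; move: (_.+1%:R^-1) h1 h2 => i h1 h2; lra.
have P t : 0 <= 2 * t * (b w v - F v) + t ^+ 2 * b v v.
  have := mP (w + t *: v) (SD Sw (SZ t Sv)).
  rewrite /Phi pH_sqD// FD//; last exact: SZ.
  by rewrite FZ//; move: Pw; rewrite /Phi; lra.
have vv := pH_ge0 H Sv.
have [//|bF] := eqVneq (b w v) (F v).
have bF0 : b w v - F v != 0 by rewrite subr_eq0.
(* A descent step in the direction [v]; the denominator is [1 + b v v] because [b v v] may
   vanish. *)
have := P (- (b w v - F v) / (1 + b v v)).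
have -> : 2 * (- (b w v - F v) / (1 + b v v)) * (b w v - F v) +
   (- (b w v - F v) / (1 + b v v)) ^+ 2 * b v v =
   - ((b w v - F v) ^+ 2 * (2 + b v v) / (1 + b v v) ^+ 2).
  by field; rewrite gt_eqF// ltr_wpDr.
have v1 : 0 < 1 + b v v by rewrite ltr_wpDr.
have v2 : 0 < 2 + b v v by rewrite ltr_wpDr.
rewrite oppr_ge0 => h; suff : 0 < (b w v - F v) ^+ 2 * (2 + b v v) / (1 + b v v) ^+ 2.
  by rewrite ltNge h.
apply: divr_gt0; last exact: exprn_gt0.
by apply: mulr_gt0 => //; rewrite exprn_even_gt0.
Qed.

(** Iterated midpoints of the tail from index [n] on stand in for its convex hull: the parallelogram
    identity asks only for midpoints, and one-sided bounds on linear functionals carry over to them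
    by induction. *)
Inductive midconv_tail (x : nat -> V) (n : nat) : V -> Prop :=
| midconv_base k : (n <= k)%N -> midconv_tail x n (x k)
| midconv_mid y z : midconv_tail x n y -> midconv_tail x n z ->
    midconv_tail x n (2^-1 *: (y + z)).

Lemma midconv_S x n y : (forall k, S (x k)) -> midconv_tail x n y -> S y.
Proof. by move=> Sx; elim=> // *; apply: SZ; exact: SD. Qed.

Lemma midconv_le x n m y : (m <= n)%N -> midconv_tail x n y -> midconv_tail x m y.
Proof.
move=> mn; elim=> [k nk|y1 z1 _ h1 _ h2]; last exact: midconv_mid.
by apply: midconv_base; exact: leq_trans nk.
Qed.

Lemma midconv_ge x n y F a : (forall k, S (x k)) -> bounded_linear F ->
  (forall k, (n <= k)%N -> a <= F (x k)) -> midconv_tail x n y -> a <= F y.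
Proof.
move=> Sx [FD FZ _] h; elim=> // y1 z1 t1 h1 t2 h2.
have Sy := midconv_S Sx t1; have Sz := midconv_S Sx t2.
rewrite FZ ?FD//; [lra|exact: SD].
Qed.

Lemma bounded_linearN F : bounded_linear F -> bounded_linear (fun x => - F x).
Proof.
move=> [FD FZ [C C0 FC]]; split.
- by move=> x y Sx Sy; rewrite FD// opprD.
- by move=> a x Sx; rewrite FZ// mulrN.
- by exists C => // x Sx; rewrite sqrrN FC.
Qed.

(* Tail midpoint combinations of almost minimal norm are Cauchy. *)
Lemma midconv_strong (x : nat -> V) C : (forall n, S (x n)) ->
  (forall n, b (x n) (x n) <= C) ->
  exists y c, [/\ S y, forall n, midconv_tail x n (c n) &
    (fun n => b (c n - y) (c n - y)) @ \oo --> 0].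
Proof.
move=> Sx xC.
pose E n := (fun v => b v v) @` [set v | midconv_tail x n v].
have iE n : has_inf (E n).
  split; first by exists (b (x n) (x n)), (x n) => //; exact: midconv_base.
  by exists 0 => _ [v tv <-]; apply: (pH_ge0 H); exact: midconv_S tv.
pose d n := inf (E n).
have dP n v : midconv_tail x n v -> d n <= b v v.
  by move=> tv; apply: ge_inf; [exact: (iE n).2|exists v].
have dC n : d n <= C.
  by apply: le_trans (xC n); apply: dP; exact: midconv_base.
have d_nd m n : (m <= n)%N -> d m <= d n.
  move=> mn; apply: lb_le_inf; first exact: (iE n).1.
  by move=> _ [v tv <-]; apply: dP; exact: midconv_le tv.
have cd : cvgn d.
  apply: nondecreasing_is_cvgn; first by move=> m n; exact: d_nd.
  by exists C => _ [n _ <-]; exact: dC.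
have cex n : exists c, midconv_tail x n c /\ b c c <= d n + n.+1%:R^-1.
  have n0 : 0 < n.+1%:R^-1 :> R by rewrite invr_gt0.
  by have [_ [v tv <-] /ltW h] := inf_adherent n0 (iE n); exists v.
have [c cP] := choice cex.
have Sc n : S (c n) by apply: midconv_S (cP n).1.
have [y Sy cy] : exists2 y, S y & (fun n => b (c n - y) (c n - y)) @ \oo --> 0.
  apply: (pH_complete H) => // e e0.
  have e8 : 0 < e / 16 by rewrite divr_gt0.
  have [N1 N1P] := (cvg_epsP _ _).1 (@cvg_inv_succ R) _ e8.
  have [N2 N2P] := (cvg_epsP _ _).1 cd _ e8.
  exists (maxn N1 N2) => k l; rewrite !geq_max => /andP[k1 k2] /andP[l1 l2].
  have := N1P _ k1; have := N1P _ l1; rewrite !subr0 !ger0_norm ?invr_ge0//.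
  have := N2P _ k2; have := N2P _ l2; rewrite !ler_norml => /andP[_ h1] /andP[_ h2] h3 h4.
  have h5 : d (maxn N1 N2) <= b (2^-1 *: (c k + c l)) (2^-1 *: (c k + c l)).
    by apply: dP; apply: midconv_mid; [apply: midconv_le (cP k).1|apply: midconv_le (cP l).1];
      rewrite geq_max ?k1 ?l1.
  have := N2P _ (leq_maxr N1 N2); rewrite ler_norml => /andP[h6 _].
  have E1 : b (2^-1 *: (c k + c l)) (2^-1 *: (c k + c l)) =
      2^-1 * 2^-1 * (b (c k) (c k) + 2 * b (c k) (c l) + b (c l) (c l)).
    have Skl := SD (Sc k) (Sc l).
    rewrite (pHbZ H) ?pHbZr//; last exact: SZ.
    by rewrite mulrA; have := pH_sqD 1 (Sc k) (Sc l); rewrite scale1r => ->; ring.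
  move: (cP k).2 (cP l).2 h3 h4 h5; rewrite pH_sqB// E1.
  by move: (k.+1%:R^-1) (l.+1%:R^-1) => i1 i2 *; lra.
by exists y, c; split => // n; exact: (cP n).1.
Qed.

(** A diagonal extraction makes [b (x j)] converge along the sequence for every [j]. Midpoint
    combinations of any further subsequence have a strong limit, and all these limits have the same
    products with every [x j]; they therefore differ by a vector of seminorm zero. Bounded
    functionals cannot tell them apart, so they converge along the whole extracted sequence. *)
Theorem weak_compactness (x : nat -> V) C : (forall n, S (x n)) ->
  (forall n, b (x n) (x n) <= C) ->
  exists s : nat -> nat, {homo s : i j / (i < j)%N} /\
  exists2 y, S y & forall F, bounded_linear F -> (F \o x \o s) @ \oo --> F y.
Proof.
move=> Sx xC.
have C0 : 0 <= C by apply: le_trans (xC 0); exact: (pH_ge0 H).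
have bxx j n : `|b (x j) (x n)| <= C.
  apply: le_trans (pH_CSabs _ _) _ => //.
  rewrite -[leRHS](sqr_sqrtr C0) expr2 ler_pM ?sqrtr_ge0//.
    by rewrite ler_sqrt.
  by rewrite ler_sqrt.
have [s hs cs] := diagonal_subseq bxx.
pose z := x \o s.
have Sz n : S (z n) by exact: Sx.
have zC n : b (z n) (z n) <= C by exact: xC.
pose m j := lim (b (x j) \o z @ \oo).
have mP j : (b (x j) \o z) @ \oo --> m j by exact: cs.
have key t : {homo t : i j / (i < j)%N} -> exists y, exists c, [/\ S y,
    forall n, midconv_tail (z \o t) n (c n),
    (fun n => b (c n - y) (c n - y)) @ \oo --> 0 & forall j, b (x j) y = m j].
  move=> ht.
  have [y [c [Sy tc cy]]] := @midconv_strong (z \o t) C (fun n => Sz _) (fun n => zC _).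
  exists y, c; split => // j.
  have Sc n : S (c n) by apply: midconv_S (tc n) => k; exact: Sz.
  have := bounded_linear_cvg (bounded_linear_b (Sx j)) Sc Sy cy.
  suff : (b (x j) \o c) @ \oo --> m j.
    by move=> h1 h2; have := cvg_unique (@Rhausdorff R) h2 h1; exact.
  have mt := cvg_subseq ht (mP j).
  apply/cvg_epsP => e e0; have [N NP] := (cvg_epsP _ _).1 mt _ e0.
  exists N => n Nn /=; rewrite ler_norml.
  have L1 := bounded_linear_b (Sx j); have L2 := bounded_linearN L1.
  have h1 : m j - e <= b (x j) (c n).
    apply: (midconv_ge _ L1 _ (tc n)) => [k|k nk]; first exact: Sz.
    by have := NP _ (leq_trans Nn nk); rewrite ler_norml /= => /andP[h _]; lra.
  have h2 : - (m j + e) <= - b (x j) (c n).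
    apply: (midconv_ge _ L2 _ (tc n)) => [k|k nk]; first exact: Sz.
    by have := NP _ (leq_trans Nn nk); rewrite ler_norml /= => /andP[_ h]; lra.
  by apply/andP; split; lra.
have [y [c [Sy tc cy by_]]] := key id (fun _ _ => id).
exists s; split => //; exists y => // F FL.
have Sc n : S (c n) by apply: midconv_S (tc n) => k; exact: Sz.
(* A vector orthogonal to all [x j] is orthogonal to their iterated midpoints and, by continuity, to
   the limits of these. For the difference [w] of two candidate limits this gives [b w w = 0]. *)
have span0 w t d : S w -> (forall j, b (x j) w = 0) ->
    midconv_tail (z \o t) 0 d -> b w d = 0.
  move=> Sw w0; elim=> [k _|d1 d2 t1 h1 t2 h2]; first by rewrite (pHC H)//; [exact: w0|exact: Sz].
  have S1 : S d1 by apply: midconv_S t1 => k; exact: Sz.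
  have S2 : S d2 by apply: midconv_S t2 => k; exact: Sz.
  by rewrite pHbZr ?pHbDr// ?h1 ?h2 ?addr0 ?mulr0//; exact: SD.
have uniq t y' c' : S y' -> (forall n, midconv_tail (z \o t) n (c' n)) ->
    (fun n => b (c' n - y') (c' n - y')) @ \oo --> 0 ->
    (forall j, b (x j) y' = m j) -> F y' = F y.
  move=> Sy' tc' cy' by'.
  have Sc' n : S (c' n) by apply: midconv_S (tc' n) => k; exact: Sz.
  pose w := y' - y; have Sw : S w by exact: pHB.
  have w0 j : b (x j) w = 0 by rewrite pHbBr// by' by_ subrr.
  have h1 := bounded_linear_cvg (bounded_linear_b Sw) Sc' Sy' cy'.
  have h2 := bounded_linear_cvg (bounded_linear_b Sw) Sc Sy cy.
  have e1 : b w \o c' = fun=> 0.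
    by apply/funext => n /=; apply: (span0 w t) => //; exact: midconv_le (tc' n).
  have e2 : b w \o c = fun=> 0.
    by apply/funext => n /=; apply: (span0 w id) => //; exact: midconv_le (tc n).
  rewrite e1 in h1; rewrite e2 in h2.
  have k1 : b w y' = 0 by apply: (cvg_unique (@Rhausdorff R) h1); exact: cvg_cst.
  have k2 : b w y = 0 by apply: (cvg_unique (@Rhausdorff R) h2); exact: cvg_cst.
  have ww : b w w = 0 by rewrite {2}/w pHbBr// k1 k2 subrr.
  have [_ _ [K _ FK]] := FL.
  have := FK _ Sw; rewrite ww mulr0 => Fw.
  apply/eqP; rewrite -subr_eq0 -(bounded_linearB FL)// -sqrf_eq0 eq_le Fw.
  exact: sqr_ge0.
apply: contrapT => nF.
(* Mazur's argument: if [G (z n) > G y + e] happened along a subsequence, its midpoints would keep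
   the bound while converging strongly to some [y'] with [G y' = G y]. Used for [F] and for its
   negative. *)
have oneside G : bounded_linear G -> (forall t y' c', S y' ->
    (forall n, midconv_tail (z \o t) n (c' n)) ->
    (fun n => b (c' n - y') (c' n - y')) @ \oo --> 0 ->
    (forall j, b (x j) y' = m j) -> G y' = G y) ->
    forall e : R, 0 < e -> exists N, forall n, (N <= n)%N -> G (z n) <= G y + e.
  move=> GL Gu e e0; apply: contrapT => /forallNP nN.
  have ex N : exists n, (N <= n)%N /\ G y + e < G (z n).
    have /existsNP[n /not_implyP[Nn /negP]] := nN N.
    by rewrite -ltNge => ?; exists n.
  have [g gP] := choice ex.
  pose t := fix t n := if n is n'.+1 then g (t n').+1 else g 0.
  have ht : {homo t : i j / (i < j)%N}.
    apply: homo_ltn => [i j k|n]; first exact: ltn_trans.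
    exact: (gP (t n).+1).1.
  have tP n : G y + e < G (z (t n)) by case: n => [|n]; exact: (gP _).2.
  have [y' [c' [Sy' tc' cy' by']]] := key t ht.
  have Ey := Gu t y' c' Sy' tc' cy' by'.
  have Sc' n : S (c' n) by apply: midconv_S (tc' n) => k; exact: Sz.
  have := bounded_linear_cvg GL Sc' Sy' cy'.
  move=> /cvg_epsP /(_ _ (divr_gt0 e0 (ltr0n _ 2)))[N /(_ N (leqnn N))].
  rewrite Ey ler_norml /= => /andP[_ h1].
  have : G y + e <= G (c' N).
    by apply: (midconv_ge _ GL _ (tc' N)) => k *; [exact: Sz|rewrite ltW//; exact: tP].
  by lra.
apply: nF; apply/cvg_epsP => e e0.
have [N1 h1] := oneside F FL uniq e e0.
have [|N2 h2] := oneside _ (bounded_linearN FL) _ e e0.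
  by move=> t y' c' k1 k2 k3 k4 /=; rewrite (uniq t y' c').
exists (maxn N1 N2) => n; rewrite geq_max => /andP[n1 n2].
have := h1 _ n1; have := h2 _ n2; rewrite ler_norml /= => k1 k2.
by rewrite /comp /z /= in k1 k2 *; apply/andP; split; lra.
Qed.
End PreHilbertTheory.

Lemma cvg_sqr (R : realType) (a : nat -> R) (l : R) :
  a @ \oo --> l -> (fun n => a n ^+ 2) @ \oo --> l ^+ 2.
Proof.
move=> al; rewrite expr2.
have -> : (fun n => a n ^+ 2) = (fun n => a n * a n) by apply/funext => n; rewrite expr2.
exact: cvgM.
Qed.

Lemma aeS (d : measure_display) (T : measurableType d) (R : realType)
    (mu : {measure set T -> \bar R}) (P Q : T -> Prop) :
  (forall x, P x -> Q x) -> {ae mu, forall x, P x} -> {ae mu, forall x, Q x}.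
Proof. by move=> h; apply: filterS. Qed.

Lemma aeS2 (d : measure_display) (T : measurableType d) (R : realType)
    (mu : {measure set T -> \bar R}) (P Q S : T -> Prop) :
  (forall x, P x -> Q x -> S x) ->
  {ae mu, forall x, P x} -> {ae mu, forall x, Q x} -> {ae mu, forall x, S x}.
Proof. by move=> h; apply: filterS2. Qed.

(** * Real-valued integration, convergence theorems, and completeness of the square-integrable
    functions *)

Section RealIntegral.
Context d (T : measurableType d) (R : realType) (mu : {measure set T -> \bar R}).
Variables (D : set T) (mD : measurable D).
Local Notation Int f := (mu.-integrable D (EFin \o f)).
Local Notation I f := (\int[mu]_(x in D) f x)%R.
Local Notation ae P := {ae mu, forall x, D x -> P x}.

Implicit Types (f g h : T -> R).

Lemma Int_meas f : Int f -> measurable_fun D f.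
Proof. by move=> /measurable_int /measurable_EFinP. Qed.

Lemma Int_D f g : Int f -> Int g -> Int (fun x => f x + g x).
Proof. by move=> If Ig; have := integrableD mD If Ig; apply: eq_integrable. Qed.

Lemma Int_Z (k : R) f : Int f -> Int (fun x => k * f x).
Proof. by move=> If; have := integrableZl mD k If; apply: eq_integrable. Qed.

Lemma Int_N f : Int f -> Int (fun x => - f x).
Proof. by move=> If; have := integrableN If; apply: eq_integrable. Qed.

Lemma Int_B f g : Int f -> Int g -> Int (fun x => f x - g x).
Proof. by move=> If Ig; have := integrableB mD If Ig; apply: eq_integrable. Qed.

Lemma Int_0 : Int (fun=> 0).
Proof. exact: integrable0. Qed.

Lemma Int_abs f : Int f -> Int (fun x => `|f x|).
Proof. by move=> If; exact: integrable_norm. Qed.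

Lemma Int_le f g : measurable_fun D f -> Int g -> ae (fun x => `|f x| <= g x) -> Int f.
Proof.
move=> mf Ig fg; apply/integrableP; split; first exact/measurable_EFinP.
have /integrableP[mg gy] := Ig.
apply: le_lt_trans gy; apply: ae_ge0_le_integral => //.
- by apply/measurableT_comp => //; exact/measurable_EFinP.
- by apply/measurableT_comp.
- apply: aeS fg => x h Dx /=; rewrite lee_fin; apply: le_trans (h Dx) _.
  exact: ler_norm.
Qed.

Lemma Int_le_pt f g : measurable_fun D f -> Int g -> (forall x, D x -> `|f x| <= g x) -> Int f.
Proof. by move=> mf Ig fg; apply: (Int_le mf Ig); exact: aeW. Qed.

Lemma I_D f g : Int f -> Int g -> I (fun x => f x + g x) = I f + I g.
Proof. exact: RintegralD. Qed.

Lemma I_B f g : Int f -> Int g -> I (fun x => f x - g x) = I f - I g.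
Proof. exact: RintegralB. Qed.

Lemma I_Z (k : R) f : Int f -> I (fun x => k * f x) = k * I f.
Proof. by move=> If; exact: RintegralZl. Qed.

Lemma I_N f : Int f -> I (fun x => - f x) = - I f.
Proof.
move=> If; rewrite -mulN1r -I_Z//; apply: eq_Rintegral => x _; by rewrite mulN1r.
Qed.

Lemma I_eq_ae f g : measurable_fun D f -> measurable_fun D g ->
  ae (fun x => f x = g x) -> I f = I g.
Proof.
move=> mf mg fg; rewrite /Rintegral; congr fine.
apply: ae_eq_integral => //; [exact/measurable_EFinP|exact/measurable_EFinP|].
by apply: aeS fg => x h Dx /=; rewrite h.
Qed.

Lemma I_le f g : Int f -> Int g -> ae (fun x => f x <= g x) -> I f <= I g.
Proof.
move=> If Ig fg; have mf := Int_meas If; have mg := Int_meas Ig.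
(* The maximum equals [g] almost everywhere and dominates [f] at every point, which reduces the a.e.
   comparison to a pointwise one. *)
have mm : measurable_fun D (fun x => Num.max (f x) (g x)) by exact: measurable_maxr.
rewrite -(@I_eq_ae (fun x => Num.max (f x) (g x)) g mm mg); last first.
  by apply: aeS fg => x h Dx; exact/max_idPr/h.
apply: le_Rintegral => //.
  apply: (@Int_le_pt _ (fun x => `|f x| + `|g x|)) => //.
    by apply: Int_D; exact: Int_abs.
  by move=> x _; rewrite /Num.max; case: ifP => _; rewrite ?lerDr ?lerDl.
by move=> x _; rewrite le_max lexx.
Qed.

Lemma I_ge0 f : (forall x, D x -> 0 <= f x) -> 0 <= I f.
Proof. exact: Rintegral_ge0. Qed.

Lemma I_ge0_ae f : Int f -> ae (fun x => 0 <= f x) -> 0 <= I f.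
Proof.
move=> If f0; have := I_le Int_0 If f0.
by rewrite Rintegral_cst// mul0r.
Qed.

Lemma I_abs_le f : Int f -> `|I f| <= I (fun x => `|f x|).
Proof. by move=> If; exact: le_normr_Rintegral. Qed.

Lemma I_EFin f : Int f -> (\int[mu]_(x in D) (f x)%:E)%E = (I f)%:E.
Proof. by move=> If; rewrite /Rintegral fineK//; exact: integrable_fin_num. Qed.

(** Fatou's lemma in a form that also returns the integrability of the limit; with it, estimates
    proved for test functions or for approximating states pass to their limits. *)
Lemma fatou_real (g : nat -> T -> R) (f : T -> R) (C : R) :
  (forall n, Int (g n)) -> (forall n x, D x -> 0 <= g n x) ->
  measurable_fun D f -> ae (fun x => g ^~ x @ \oo --> f x) ->
  (exists N, forall n, (N <= n)%N -> I (g n) <= C) -> Int f /\ I f <= C.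
Proof.
move=> Ig g0 mf gf [N IgC].
have f0 : ae (fun x => 0 <= f x).
  apply: aeS gf => x h Dx; rewrite -(cvg_lim (@Rhausdorff R) (h Dx)).
  apply: limr_ge; first by apply/cvg_ex; exists (f x); exact: h.
  by apply: nearW => n; exact: g0.
have key : (\int[mu]_(x in D) `|(f x)%:E| <= C%:E)%E.
  apply: (@le_trans _ _ (\int[mu]_(x in D) limn_einf (fun n => (g n x)%:E))%E).
    apply: ae_ge0_le_integral => //.
    - by apply/measurableT_comp => //; exact/measurable_EFinP.
    - move=> x Dx; rewrite limn_einf_lim; apply: lime_ge.
        by apply: ereal_nondecreasing_is_cvgn; exact: nondecreasing_einfs.
      apply: nearW => n; apply/ereal_infP => _ [k _ <-].
      by rewrite lee_fin; exact: g0.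
    - have -> : (fun x => limn_einf (fun n => (g n x)%:E)) =
          (fun x => - limn_esup (fun n => - (g n x)%:E))%E.
        apply/funext => x; rewrite -limn_einfN; congr limn_einf.
        by apply/funext => n; rewrite /comp oppeK.
      apply/measurableT_comp => //; apply: measurable_fun_limn_esup => n.
      by apply/measurableT_comp => //; apply/measurable_EFinP; exact: Int_meas.
    apply: aeS2 gf f0 => x h1 h2 Dx /=.
    have : (fun n => (g n x)%:E) @ \oo --> (f x)%:E by apply/fine_cvgP => /=; split; [exact: nearW|exact: h1].
    by move=> /cvg_limn_einf_sup [-> _]; rewrite lee_fin ger0_norm// h2.
  have F1 n : measurable_fun D (fun x => (g n x)%:E) by exact/measurable_EFinP/Int_meas.
  have F2 n x : D x -> (0 <= (g n x)%:E)%E by move=> Dx; rewrite lee_fin; exact: g0.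
  apply: (le_trans (fatou mu mD F1 F2)).
  rewrite limn_einf_lim; apply: lime_le.
    by apply: ereal_nondecreasing_is_cvgn; exact: nondecreasing_einfs.
  (* The bound on the integrals holds only from [N] on, so the infimum over the tail from [n] is
     compared with its member of index [maxn n N]. *)
  apply: nearW => n; apply: (@le_trans _ _ (\int[mu]_(x in D) (g (maxn n N) x)%:E)%E).
    apply: ge_ereal_inf; exists (\int[mu]_(x in D) (g (maxn n N) x)%:E)%E => //.
    by exists (maxn n N) => //=; exact: leq_maxl.
  by rewrite I_EFin// lee_fin; apply: IgC; exact: leq_maxr.
have If : Int f.
  apply/integrableP; split; first exact/measurable_EFinP.
  by apply: le_lt_trans key _; exact: ltry.
split => //; rewrite -lee_fin -I_EFin//; apply: le_trans key.
apply: le_integral => //; first exact: (integrable_abse If).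
by move=> x Dx; rewrite lee_fin ler_norm.
Qed.

Lemma dct_real (g : nat -> T -> R) (f h : T -> R) :
  (forall n, measurable_fun D (g n)) -> measurable_fun D f ->
  ae (fun x => g ^~ x @ \oo --> f x) -> Int h ->
  (forall n, ae (fun x => `|g n x| <= h x)) ->
  [/\ Int f, (fun n => I (fun x => `|g n x - f x|)) @ \oo --> 0
    & (fun n => I (g n)) @ \oo --> I f].
Proof.
move=> mg mf gf Ih gh.
have Ig n : Int (g n) by apply: (Int_le (mg n) Ih).
have [] := @dominated_convergence _ _ _ mu D mD (fun n => EFin \o g n) (EFin \o f) (EFin \o h).
- by move=> n; exact/measurable_EFinP.
- exact/measurable_EFinP.
- apply: aeS gf => x k Dx; apply/fine_cvgP => /=; split; first exact: nearW.
  exact: k.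
- exact: Ih.
- apply: aeS (ae_foralln gh) => x k n Dx; by rewrite lee_fin; exact: k.
move=> If k1 k2; split=> //.
- have /fine_cvgP[_ k1'] : (fun n => \int[mu]_(x in D) (`|g n x - f x|)%:E)%E @ \oo --> 0%:E by exact: k1.
  exact: k1'.
- have /fine_cvgP[_ k2'] : (fun n => \int[mu]_(x in D) (g n x)%:E)%E @ \oo --> (I f)%:E.
    by rewrite -I_EFin.
  exact: k2'.
Qed.

(** The [L^1] norms are dominated by a geometric series, so the sum of the [|h n|] has a finite
    integral and is finite a.e. Both the a.e. convergent subsequences and the completeness of [L^2]
    come from this. *)
Lemma summable_ae (h : nat -> T -> R) (C : R) : (forall n, Int (h n)) ->
  (forall n, I (fun x => `|h n x|) <= C * 2^-1 ^+ n) ->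
  ae (fun x => cvgn (series (fun n => `|h n x|))).
Proof.
move=> Ih hC.
have C0 : 0 <= C.
  have := hC 0%N; rewrite expr0 mulr1; apply: le_trans; exact: I_ge0.
pose F x := (\sum_(n <oo) (`|h n x|)%:E)%E.
have mh n : measurable_fun D (fun x => (`|h n x|)%:E).
  by apply/measurable_EFinP/measurableT_comp => //; exact: Int_meas.
have mF : measurable_fun D F.
  by apply: ge0_emeasurable_sum => // n x _ _; rewrite lee_fin.
have IF : (mu.-integrable D F).
  apply/integrableP; split => //.
  under eq_integral do rewrite gee0_abs ?nneseries_ge0//.
  rewrite integral_nneseries//.
  apply: (@le_lt_trans _ _ (\sum_(n <oo) (C * 2^-1 ^+ n)%:E)%E).
    apply: lee_nneseries => [n _ _|n _]; first by apply: integral_ge0.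
    by rewrite I_EFin ?lee_fin; [exact: hC|exact: Int_abs].
  apply: (@le_lt_trans _ _ (C * 2)%:E); last exact: ltry.
  apply: lime_le; first by apply: is_cvg_nneseries => n _ _; rewrite lee_fin mulr_ge0.
  apply: nearW => n; rewrite sumEFin lee_fin -mulr_sumr ler_wpM2l//.
  have -> : \sum_(0 <= i < n) 2^-1 ^+ i = 2 - 2 * 2^-1 ^+ n :> R.
    elim: n => [|n IH]; first by rewrite big_geq// expr0 mulr1 subrr.
    by rewrite big_nat_recr//= IH exprS; field.
  by rewrite gerBl mulr_ge0.
apply: aeS (integrable_ae mD IF) => x Fx Dx; have {}Fx := Fx Dx.
apply: nondecreasing_is_cvgn.
  by apply/nondecreasing_seqP => n; rewrite /series /= big_nat_recr//= lerDl.
exists (fine (F x)) => _ [n _ <-]; rewrite -lee_fin fineK// /series /= -sumEFin.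
by apply: nneseries_lim_ge => k _ _; rewrite lee_fin.
Qed.

Lemma ae_subseq (f : nat -> T -> R) (g : T -> R) : (forall n, Int (f n)) -> Int g ->
  (fun n => I (fun x => `|f n x - g x|)) @ \oo --> 0 ->
  exists2 s : nat -> nat, {homo s : i j / (i < j)%N} &
    ae (fun x => (fun n => f (s n) x) @ \oo --> g x).
Proof.
move=> If Ig /cvg_epsP fg.
have ex n N : exists k, (N < k)%N /\ I (fun x => `|f k x - g x|) <= 1 * 2^-1 ^+ n.
  have p0 : 0 < 2^-1 ^+ n :> R by rewrite exprn_gt0.
  have [K KP] := fg _ p0.
  exists (maxn K N.+1); split; first exact: leq_maxr.
  have := KP _ (leq_maxl K N.+1); rewrite subr0 mul1r ger0_norm//.
  exact: I_ge0.
have [c cP] := choice (fun p => ex p.1 p.2).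
pose s := fix s n := if n is n'.+1 then c (n, s n') else c (0, 0)%N.
have hs : {homo s : i j / (i < j)%N}.
  by apply: homo_ltn => [i j k|n]; [exact: ltn_trans|exact: (cP (n.+1, s n)).1].
exists s => //.
have : ae (fun x => cvgn (series (fun n => `|f (s n) x - g x|))).
  apply: (@summable_ae (fun n x => f (s n) x - g x) 1) => [n|n]; first exact: Int_B.
  by case: n => [|n]; exact: (cP (_, _)).2.
apply: aeS => x k Dx; have := cvg_series_cvg_0 (k Dx).
move=> /cvg_epsP k0; apply/cvg_epsP => e /k0[N NP].
by exists N => n /NP; rewrite subr0 normr_id.
Qed.

Hypothesis finD : (mu D < +oo)%E.

Lemma Int_cst c : Int (fun=> c).
Proof.
apply/integrableP; split; first exact/measurable_EFinP.
by rewrite integral_cst// lte_mul_pinfty.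
Qed.

Definition L2 (f : T -> R) : Prop := measurable_fun D f /\ Int (fun x => f x ^+ 2).

Lemma L2M f g : L2 f -> L2 g -> Int (fun x => f x * g x).
Proof.
move=> [mf If] [mg Ig]; apply: (@Int_le_pt _ (fun x => f x ^+ 2 + g x ^+ 2)).
- exact: measurable_funM.
- exact: Int_D.
- move=> x _; rewrite ler_norml; apply/andP.
  by have := sqr_ge0 (f x + g x); have := sqr_ge0 (f x - g x); rewrite !expr2; split; nra.
Qed.

Lemma L2D f g : L2 f -> L2 g -> L2 (fun x => f x + g x).
Proof.
move=> Lf Lg; have [mf If] := Lf; have [mg Ig] := Lg; split; first exact: measurable_funD.
have := Int_D (Int_D If Ig) (Int_Z 2 (L2M Lf Lg)); apply: eq_integrable => // x _ /=.
by congr EFin; ring.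
Qed.

Lemma L2Z a f : L2 f -> L2 (fun x => a * f x).
Proof.
move=> [mf If]; split; first by apply: measurable_funM.
by have := Int_Z (a ^+ 2) If; apply: eq_integrable => // x _ /=; rewrite exprMn.
Qed.

Lemma L2N f : L2 f -> L2 (fun x => - f x).
Proof.
by move=> /(L2Z (-1)); congr L2; apply/funext => x; rewrite mulN1r.
Qed.

Lemma L2B f g : L2 f -> L2 g -> L2 (fun x => f x - g x).
Proof. by move=> Lf Lg; apply: L2D => //; exact: L2N. Qed.

Lemma L2_cst c : L2 (fun=> c).
Proof. by split=> //; exact: Int_cst. Qed.

Lemma L2_Int f : L2 f -> Int f.
Proof.
by move=> Lf; have := L2M Lf (L2_cst 1); apply: eq_integrable => // x _ /=; rewrite mulr1.
Qed.

Lemma L2_le f g : measurable_fun D f -> L2 g -> ae (fun x => `|f x| <= `|g x|) -> L2 f.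
Proof.
move=> mf [mg Ig] fg; split => //; apply: (Int_le _ Ig) => //.
  exact: measurable_funX.
apply: aeS fg => x h Dx; rewrite normrX -[leRHS]real_normK ?num_real//.
by rewrite ler_sqr ?nnegrE// h.
Qed.

Lemma L2_bounded f K : measurable_fun D f -> (forall x, D x -> `|f x| <= K) -> L2 f.
Proof.
move=> mf fK; apply: (L2_le mf (L2_cst K)); apply: aeW => x Dx.
by apply: le_trans (fK _ Dx) _; exact: ler_norm.
Qed.

Lemma L2_bM (K : R) f g : measurable_fun D f -> ae (fun x => `|f x| <= K) -> L2 g ->
  L2 (fun x => f x * g x).
Proof.
move=> mf fK Lg; apply: (L2_le _ (L2Z K Lg)); first by apply: measurable_funM => //; case: Lg.
apply: aeS fK => x h Dx; rewrite !normrM ler_wpM2r//.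
by apply: le_trans (h Dx) _; exact: ler_norm.
Qed.

(* The elementary bound 2|h| <= 2^k h^2 + 2^-k replaces Hoelder's inequality. *)
Lemma L2_complete (f : nat -> T -> R) : (forall n, L2 (f n)) ->
  (forall e : R, 0 < e -> exists N, forall m n, (N <= m)%N -> (N <= n)%N ->
     I (fun x => (f m x - f n x) ^+ 2) <= e) ->
  exists2 g, L2 g & (fun n => I (fun x => (f n x - g x) ^+ 2)) @ \oo --> 0.
Proof.
move=> Lf cf.
have ex n N : exists k, (N < k)%N /\ forall i j, (k <= i)%N -> (k <= j)%N ->
    I (fun x => (f i x - f j x) ^+ 2) <= (2^-1 ^+ n) ^+ 2.
  have p0 : 0 < (2^-1 ^+ n) ^+ 2 :> R by rewrite !exprn_gt0.
  have [K KP] := cf _ p0.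
  exists (maxn K N.+1); split; first exact: leq_maxr.
  by move=> i j; rewrite !geq_max => /andP[h1 _] /andP[h2 _]; exact: KP.
have [c cP] := choice (fun p => ex p.1 p.2).
pose s := fix s n := if n is n'.+1 then c (n, s n') else c (0, 0)%N.
have hs : {homo s : i j / (i < j)%N}.
  by apply: homo_ltn => [i j k|n]; [exact: ltn_trans|exact: (cP (n.+1, s n)).1].
have sP n i j : (s n <= i)%N -> (s n <= j)%N ->
    I (fun x => (f i x - f j x) ^+ 2) <= (2^-1 ^+ n) ^+ 2.
  by case: n => [|n]; exact: (cP (_, _)).2.
pose h n x := f (s n.+1) x - f (s n) x.
have Lh n : L2 (h n) by exact: L2B.
have hC n : I (fun x => `|h n x|) <= (1 + fine (mu D)) / 2 * 2^-1 ^+ n.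
  have p0 : 0 < 2^-1 ^+ n :> R by exact: exprn_gt0.
  apply: (@le_trans _ _ (I (fun x => (2^-1 / 2^-1 ^+ n) * h n x ^+ 2 + 2^-1 * 2^-1 ^+ n))).
    apply: I_le; [exact/Int_abs/L2_Int| |].
      by apply: Int_D; [apply: Int_Z; case: (Lh n)|exact: Int_cst].
    apply: aeW => x _; rewrite -(@real_normK _ (h n x)) ?num_real//.
    move: (2^-1 ^+ n : R) p0 (`|h n x|) => p p0 t.
    rewrite -subr_ge0; have -> : 2^-1 / p * t ^+ 2 + 2^-1 * p - t = 2^-1 / p * (t - p) ^+ 2.
      by field; rewrite gt_eqF.
    by rewrite mulr_ge0 ?sqr_ge0// mulr_ge0 ?invr_ge0// ltW.
  rewrite I_D; [|by apply: Int_Z; case: (Lh n)|exact: Int_cst].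
  rewrite I_Z; last by case: (Lh n).
  rewrite Rintegral_cst//.
  set t := \int[mu]_(x in D) _.
  have : t <= (2^-1 ^+ n) ^+ 2 by apply: sP => //; exact: homo_ltn_leq.
  move: (2^-1 ^+ n : R) p0 (t) => p p0 {}t tp.
  have : 2^-1 / p * t <= 2^-1 * p.
    by rewrite -mulrA ler_wpM2l// mulrC ler_pdivrMr// -expr2.
  lra.
have ser := summable_ae (fun n => L2_Int (Lh n)) hC.
(* An upper limit is measurable on all of [D]; where the subsequence converges it is the limit, and
   elsewhere its value is immaterial. *)
pose g x := fine (limn_esup (fun n => (f (s n) x)%:E)).
have mf n : measurable_fun D (f n) by case: (Lf n).
have mg : measurable_fun D g.
  apply/measurableT_comp => //; apply: measurable_fun_limn_esup => n.
  exact/measurable_EFinP.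
have fg : ae (fun x => (fun n => f (s n) x) @ \oo --> g x).
  apply: aeS ser => x k Dx; have k1 := normed_cvg (k Dx).
  have k2 : cvgn (fun n => f (s n) x).
    have k2 : cvgn (fun n => f (s 0%N) x + series (fun n => h n x) n).
      by apply: is_cvgD => //; exact: is_cvg_cst.
    have -> : (fun n => f (s n) x) = (fun n => f (s 0%N) x + series (fun n => h n x) n).
      apply/funext; rewrite /series /= /h; elim=> [|n IH]; first by rewrite big_geq// addr0.
      by rewrite big_nat_recr//= addrA -IH addrC subrK.
    exact: k2.
  set l := lim ((fun n => f (s n) x) @ \oo) in k2.
  suff -> : g x = l by [].
  have : (fun n => (f (s n) x)%:E) @ \oo --> l%:E.
    by apply/fine_cvgP => /=; split; [exact: nearW|exact: k2].
  by move=> /cvg_limn_einf_sup [_]; rewrite /g => ->.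
have key m e : 0 < e -> (exists N, forall n, (N <= n)%N -> I (fun x => (f m x - f n x) ^+ 2) <= e) ->
    Int (fun x => (f m x - g x) ^+ 2) /\ I (fun x => (f m x - g x) ^+ 2) <= e.
  move=> e0 [N NP].
  apply: (@fatou_real (fun n x => (f m x - f (s n) x) ^+ 2)).
  - by move=> n; case: (L2B (Lf m) (Lf (s n))).
  - by move=> n x _; exact: sqr_ge0.
  - by apply: measurable_funX; exact: measurable_funB.
  - apply: aeS fg => x k Dx; apply: cvg_sqr.
    by apply: cvgB; [exact: cvg_cst|exact: k].
  - by exists N => n Nn; apply: NP; apply: leq_trans Nn (homo_ltn_ge hs n).
have Lg : L2 g.
  have [N NP] := cf 1 ltr01.
  have Lm : L2 (fun x => f N x - g x).
    split; first exact: measurable_funB.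
    by apply: (key N 1 ltr01 _).1; exists N => n Nn; exact: NP.
  by have := L2B (Lf N) Lm; congr L2; apply/funext => x; rewrite opprB addrCA subrr addr0.
exists g => //; apply/cvg_epsP => e e0; have [N NP] := cf e e0.
exists N => n Nn; rewrite subr0 ger0_norm; last by apply: I_ge0 => x _; exact: sqr_ge0.
by apply: (key n e e0 _).2; exists N => m Nm; exact: NP.
Qed.

Definition ipL2 (f g : T -> R) : R := I (fun x => f x * g x).

Lemma preHilbert_L2 : preHilbert L2 ipL2.
Proof.
split.
- exact: (L2_cst 0).
- by move=> f g; exact: L2D.
- by move=> a f; exact: L2Z.
- by move=> f g _ _; rewrite /ipL2; apply: eq_Rintegral => x _; rewrite mulrC.
- move=> f g h Lf Lg Lh; rewrite /ipL2 -I_D; [|exact: L2M|exact: L2M].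
  by apply: eq_Rintegral => x _; rewrite mulrDl.
- move=> a f g Lf Lg; rewrite /ipL2 -I_Z; last exact: L2M.
  by apply: eq_Rintegral => x _; rewrite mulrA.
- by move=> f _; apply: I_ge0 => x _; rewrite -expr2 sqr_ge0.
- move=> f Lf cf; have [|g Lg fg] := L2_complete Lf.
    move=> e e0; have [N NP] := cf e e0; exists N => m n Nm Nn.
    by have := NP m n Nm Nn; congr (_ <= _); apply: eq_Rintegral => x _; rewrite -expr2.
  by exists g.
Qed.
End RealIntegral.

(** * Smooth functions of one variable: bumps, sigmoids and the soft penalty *)

Section Smooth1.
Variable R : realType.
Implicit Types (h g : R -> R).

(** A coinductive style of definition: it suffices to exhibit a class of derivable functions that is
    stable under derivation, without any formula for higher derivatives. *)
Definition smooth1 h : Prop := exists2 C : set (R -> R), C h &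
  forall g, C g -> (forall x, derivable g x 1) /\ C (derive1 g).

Lemma smooth1_derivable h x : smooth1 h -> derivable h x 1.
Proof. by move=> [C Ch CP]; exact: (CP _ Ch).1. Qed.

Lemma smooth1_derive h : smooth1 h -> smooth1 (derive1 h).
Proof. by move=> [C Ch CP]; exists C => //; exact: (CP _ Ch).2. Qed.

Lemma smooth1_is_derive h (x : R) : smooth1 h -> is_derive x 1 h (derive1 h x).
Proof.
by move=> sh; apply: DeriveDef; [exact: smooth1_derivable|rewrite derive1E].
Qed.

Lemma derivable1_continuous h : (forall x, derivable h x 1) -> continuous h.
Proof. by move=> dh x; apply: differentiable_continuous; apply/derivable1_diffP. Qed.

Lemma smooth1_continuous h : smooth1 h -> continuous h.
Proof. by move=> sh; apply: derivable1_continuous => x; exact: smooth1_derivable. Qed.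

Lemma smooth1_primitive h h' : (forall x : R, is_derive x 1 h (h' x)) -> smooth1 h' -> smooth1 h.
Proof.
move=> dh [C Ch' CP]; have E : derive1 h = h'.
  by apply/funext => x; rewrite derive1E; apply: derive_val.
exists [set g | g = h \/ C g]; first by left.
move=> g [->|Cg]; last by have [d1 d2] := CP _ Cg; split => //; right.
split; first by move=> x; have [] := dh x.
by right; rewrite E.
Qed.

(** Member [0] is the classical flat function. The power of [1 / x] is a parameter because the
    derivative of member [n] combines the members [n + 1] and [n + 2], so that the span of the
    family is stable under derivation. *)
Definition bump_fun (n : nat) (x : R) : R :=
  if 0 < x then x^-1 ^+ n * expR (- x^-1) else 0.

Lemma bump_fun_ge0 n x : 0 <= bump_fun n x.
Proof.
rewrite /bump_fun; case: ifP => // x0; rewrite mulr_ge0 ?expR_ge0//.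
by rewrite exprn_ge0// invr_ge0 ltW.
Qed.

(** From [exp y >= y^(n+1) / (n+1)!] at [y = 1 / x]. Dividing member [n] by [x] gives member
    [n + 1], so this linear bound sends the difference quotient at the origin to zero. *)
Lemma bump_fun_le n x : 0 < x -> bump_fun n x <= (n.+1)`!%:R * x.
Proof.
move=> x0; rewrite /bump_fun x0 expRN.
have y0 : 0 < x^-1 by rewrite invr_gt0.
have := expR_ge1Dxn n (ltW y0); have := expR_gt0 x^-1.
move: (expR x^-1) => E E0 h.
have f0 : 0 < (n.+1)`!%:R :> R by rewrite ltr0n fact_gt0.
have h2 : x^-1 ^+ n.+1 <= E * (n.+1)`!%:R.
  by rewrite -ler_pdivrMr//; apply: le_trans h; rewrite lerDr.
rewrite ler_pdivrMr// -(ler_pM2r y0) -exprSr; apply: le_trans h2 _.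
by rewrite (_ : _ * x * E / x = E * (n.+1)`!%:R)//; field; rewrite gt_eqF.
Qed.

Lemma bump_fun_derive n (x : R) :
  is_derive x 1 (bump_fun n) (bump_fun n.+2 x - n%:R * bump_fun n.+1 x).
Proof.
have [x0|x0|<-] := ltgtP 0 x.
- refine (near_eq_is_derive (f := fun x : R => x^-1 ^+ n * expR (- x^-1)) _ _).
    near=> y; rewrite /bump_fun ifT//; near: y; exact: lt_nbhsr.
  have xn0 : x != 0 by rewrite gt_eqF.
  have dV : is_derive x 1 (fun y : R => y^-1) (- x ^- 2).
    by have := is_deriveV xn0 (is_derive_id x 1); rewrite /GRing.scale /= mulr1.
  have dX : is_derive x 1 (fun y : R => y^-1 ^+ n) (n%:R * x^-1 ^+ n.-1 * - x ^- 2).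
    have -> : (fun y : R => y^-1 ^+ n) = (fun y : R => y^-1) ^+ n.
      by apply/funext => y; elim: n => [|n IH]; rewrite ?expr0// !exprS IH.
    exact: is_deriveX.
  have dE : is_derive x 1 (fun y : R => expR (- y^-1)) (expR (- x^-1) * x ^- 2).
    have dN : is_derive x 1 (fun y : R => - y^-1) (x ^- 2).
      by have := is_deriveN dV; rewrite opprK.
    exact: (@is_derive1_comp R expR (fun y => - y^-1) x _ _ (is_derive_expR _) dN).
  have := is_deriveM dX dE; rewrite /GRing.scale /= => h.
  apply: is_derive_eq; rewrite /bump_fun x0.
  case: n {dX h} => [|n]; rewrite /= ?mul0r ?mulr0 ?subr0 ?addr0.
    by rewrite expr0 mul1r -exprVn; ring.
  by rewrite -[x ^- 2]exprVn !exprS; ring.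
- refine (near_eq_is_derive (f := fun x : R => 0 : R) _ _).
    near=> y; rewrite /bump_fun ifF//; apply/negbTE; rewrite -leNgt ltW//.
    near: y; exact: lt_nbhsl.
  have -> : bump_fun n.+2 x - n%:R * bump_fun n.+1 x = 0.
    by rewrite /bump_fun ltNge ltW//= mulr0 subr0.
  exact: is_derive_cst.
have b0 m : bump_fun m 0 = 0 by rewrite /bump_fun ltxx.
rewrite !b0 mulr0 subr0.
have key : h^-1 *: ((bump_fun n \o shift 0) (h *: 1) - bump_fun n 0) @[h --> 0^'] --> (0:R).
  apply/cvgrPdist_le => /= e e0; near=> h.
  rewrite /= b0 subr0 addr0 sub0r normrN.
  have -> : (h%:A : R) = h by rewrite /GRing.scale /= mulr1.
  rewrite normrM.
  have [h0|h0] := leP h 0.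
    by rewrite /bump_fun ltNge h0 normr0 mulr0 ltW.
  rewrite (ger0_norm (bump_fun_ge0 _ _)) gtr0_norm ?invr_gt0//.
  have -> : h^-1 * bump_fun n h = bump_fun n.+1 h by rewrite /bump_fun h0 exprS mulrA.
  apply: le_trans (bump_fun_le _ h0) _; rewrite -ler_pdivlMl ?ltr0n ?fact_gt0//.
  rewrite -[leLHS]gtr0_norm//; near: h.
  apply: dnbhs0_le; by rewrite mulr_gt0// invr_gt0 ltr0n fact_gt0.
apply: DeriveDef; first by apply/cvg_ex; exists 0.
exact: cvg_lim key.
Unshelve. all: by end_near. Qed.

Inductive bump_span : (R -> R) -> Prop :=
| bump_span_base n : bump_span (bump_fun n)
| bump_span_add f g : bump_span f -> bump_span g -> bump_span (fun x => f x + g x)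
| bump_span_scale a f : bump_span f -> bump_span (fun x => a * f x).

Lemma smooth1_bump n : smooth1 (bump_fun n).
Proof.
exists bump_span; first exact: bump_span_base.
have key g : bump_span g -> exists2 g', (forall x : R, is_derive x 1 g (g' x)) & bump_span g'.
  elim=> [m|f1 f2 _ [f1' d1 b1] _ [f2' d2 b2]|a f _ [f' d b]].
  - exists (fun x => bump_fun m.+2 x + - m%:R * bump_fun m.+1 x).
      by move=> x; rewrite mulNr; exact: bump_fun_derive.
    by apply: bump_span_add; [|apply: bump_span_scale]; exact: bump_span_base.
  - exists (fun x => f1' x + f2' x); last exact: bump_span_add.
    by move=> x; exact: is_deriveD.
  - exists (fun x => a * f' x); last exact: bump_span_scale.
    by move=> x; exact: is_deriveZ.
move=> g /key[g' dg bg]; split; first by move=> x; have [] := dg x.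
by have -> : derive1 g = g' by apply/funext => x; rewrite derive1E; apply: derive_val.
Qed.

Definition sigmoid (c k x : R) : R := (1 + expR (c * x + k))^-1.

Lemma sigmoid_bounds c k x : 0 < sigmoid c k x < 1.
Proof.
have E := expR_gt0 (c * x + k).
have E1 : 0 < 1 + expR (c * x + k) by rewrite addr_gt0.
by rewrite /sigmoid invr_gt0 E1/= invf_lt1// ltrDl.
Qed.

Lemma is_derive_affine (c k x : R) : is_derive x 1 (fun x => c * x + k) c.
Proof.
have h : is_derive x 1 (fun x : R => c * x) c.
  by have := is_deriveZ c (is_derive_id x 1); rewrite /GRing.scale /= mulr1.
by have := is_deriveD h (is_derive_cst k x 1); rewrite addr0.
Qed.

Lemma is_derive_exp_affine (c k x : R) :
  is_derive x 1 (fun x => 1 + expR (c * x + k)) (expR (c * x + k) * c).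
Proof.
have h := @is_derive1_comp R expR (fun x => c * x + k) x _ _ (is_derive_expR _) (is_derive_affine c k x).
by have := is_deriveD (is_derive_cst (1 : R) x 1) h; rewrite add0r.
Qed.

Lemma sigmoid_derive c k (x : R) :
  is_derive x 1 (sigmoid c k) (- c * (sigmoid c k x * (1 - sigmoid c k x))).
Proof.
have E1 : 1 + expR (c * x + k) != 0 by rewrite gt_eqF// addr_gt0// expR_gt0.
have := @is_deriveV R (fun x => 1 + expR (c * x + k)) x _ _ E1 (is_derive_exp_affine c k x).
rewrite /GRing.scale /= => h; apply: is_derive_eq.
by rewrite /sigmoid; field.
Qed.

(** Polynomials in one logistic function are stable under derivation because its derivative is [- c]
    times [sigmoid] times [1 - sigmoid]. The class serves to prove [softneg] smooth, whose
    derivative is affine in a sigmoid. *)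
Inductive sigmoid_alg (c k : R) : (R -> R) -> Prop :=
| sigmoid_alg_base : sigmoid_alg c k (sigmoid c k)
| sigmoid_alg_cst a : sigmoid_alg c k (fun=> a)
| sigmoid_alg_add f g : sigmoid_alg c k f -> sigmoid_alg c k g ->
    sigmoid_alg c k (fun x => f x + g x)
| sigmoid_alg_mul f g : sigmoid_alg c k f -> sigmoid_alg c k g ->
    sigmoid_alg c k (fun x => f x * g x).

Lemma smooth1_sigmoid c k f : sigmoid_alg c k f -> smooth1 f.
Proof.
move=> sf; exists (sigmoid_alg c k) => //.
have key g : sigmoid_alg c k g ->
    exists2 g', (forall x : R, is_derive x 1 g (g' x)) & sigmoid_alg c k g'.
  elim=> [|a|f1 f2 a1 [f1' d1 b1] a2 [f2' d2 b2]|f1 f2 a1 [f1' d1 b1] a2 [f2' d2 b2]].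
  - exists (fun x => - c * (sigmoid c k x * (1 + -1 * sigmoid c k x))).
      by move=> x; rewrite mulN1r; exact: sigmoid_derive.
    apply: sigmoid_alg_mul; first exact: sigmoid_alg_cst.
    apply: sigmoid_alg_mul; first exact: sigmoid_alg_base.
    apply: sigmoid_alg_add; first exact: sigmoid_alg_cst.
    by apply: sigmoid_alg_mul; [exact: sigmoid_alg_cst|exact: sigmoid_alg_base].
  - by exists (fun=> 0); [move=> x; exact: is_derive_cst|exact: sigmoid_alg_cst].
  - exists (fun x => f1' x + f2' x); last exact: sigmoid_alg_add.
    by move=> x; exact: is_deriveD.
  - exists (fun x => f1 x * f2' x + f2 x * f1' x).
      by move=> x; exact: is_deriveM.
    by apply: sigmoid_alg_add; exact: sigmoid_alg_mul.
move=> g /key[g' dg bg]; split; first by move=> x; have [] := dg x.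
by have -> : derive1 g = g' by apply/funext => x; rewrite derive1E; apply: derive_val.
Qed.

(* A smooth substitute for [- gamma * (psi - s)^+], vanishing at [0]. *)
Definition softneg (gamma psi s : R) : R :=
  ln (1 + expR (gamma * psi)) - ln (1 + expR (- gamma * s + gamma * psi)).

Lemma softneg_derive gamma psi (s : R) :
  is_derive s 1 (softneg gamma psi)
    (gamma * (1 - sigmoid (- gamma) (gamma * psi) s)).
Proof.
have E1 : 0 < 1 + expR (- gamma * s + gamma * psi) by rewrite addr_gt0// expR_gt0.
have h := @is_derive1_comp R (@ln R) (fun s => 1 + expR (- gamma * s + gamma * psi)) s _ _ (is_derive1_ln E1) (is_derive_exp_affine (- gamma) (gamma * psi) s).
have := is_deriveB (is_derive_cst (ln (1 + expR (gamma * psi))) s 1) h.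
rewrite /softneg => {}h; apply: is_derive_eq.
by rewrite /sigmoid; field; rewrite gt_eqF.
Qed.

Lemma smooth1_softneg gamma psi : smooth1 (softneg gamma psi).
Proof.
apply: smooth1_primitive (softneg_derive gamma psi) _.
apply: (@smooth1_sigmoid (- gamma) (gamma * psi)).
have -> : (fun s => gamma * (1 - sigmoid (- gamma) (gamma * psi) s)) =
    (fun s => gamma * (1 + -1 * sigmoid (- gamma) (gamma * psi) s)).
  by apply/funext => s; rewrite mulN1r.
apply: sigmoid_alg_mul; first exact: sigmoid_alg_cst.
apply: sigmoid_alg_add; first exact: sigmoid_alg_cst.
by apply: sigmoid_alg_mul; [exact: sigmoid_alg_cst|exact: sigmoid_alg_base].
Qed.

Lemma softneg0 gamma psi : softneg gamma psi 0 = 0.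
Proof. by rewrite /softneg mulr0 add0r subrr. Qed.

(** Both [1] and [exp t] are at most [exp (max 0 t)], their sum exceeds the larger of the two, and
    [2 <= exp 1]. *)
Lemma ln1DexpR_bounds (t : R) : Num.max 0 t <= ln (1 + expR t) <= Num.max 0 t + 1.
Proof.
have E := expR_gt0 t; have E1 : 0 < 1 + expR t by rewrite addr_gt0.
have l0 : 0 <= ln (1 + expR t) by apply: ln_ge0; rewrite lerDl ltW.
have lt : t <= ln (1 + expR t).
  by rewrite -[leLHS]expRK ler_ln ?posrE// lerDr.
rewrite ge_max l0 lt /=.
have e2 : 2 <= expR 1 :> R by apply: le_trans (expR_ge1Dx 1); lra.
rewrite -[leRHS]expRK ler_ln ?posrE ?expR_gt0// expRD.
have M0 : 0 <= Num.max 0 t by rewrite le_max lexx.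
have e1 : 1 <= expR (Num.max 0 t) by rewrite -expR0 ler_expR.
have e3 : expR t <= expR (Num.max 0 t) by rewrite ler_expR le_max lexx orbT.
nra.
Qed.

Lemma softneg_approx gamma psi s : 0 < gamma -> psi < 0 ->
  `|softneg gamma psi s + gamma * Num.max 0 (psi - s)| <= 2.
Proof.
move=> g0 p0; have /andP[h1 h2] := ln1DexpR_bounds (- gamma * s + gamma * psi).
have /andP[h3 h4] := ln1DexpR_bounds (gamma * psi).
have gp : gamma * psi <= 0 by rewrite mulr_ge0_le0// ltW.
have E : Num.max 0 (- gamma * s + gamma * psi) = gamma * Num.max 0 (psi - s).
  have -> : - gamma * s + gamma * psi = gamma * (psi - s) by ring.
  by rewrite -[X in Num.max X _](mulr0 gamma) maxr_pMr// ltW.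
rewrite (max_idPl gp) in h3 h4; rewrite E in h1 h2.
rewrite /softneg ler_norml; apply/andP; split; lra.
Qed.

End Smooth1.

(** * Smooth functions and test functions in the plane *)

Section Smooth2.
Variable R : realType.
Implicit Types (f g : R * R -> R) (Omega : set (R * R)).
Local Notation "'d_ i f" := (fun x => 'D_(e_ R i) f x) (at level 10, i, f at level 9).

Lemma dir_derive_quotient f (x v : R * R) :
  (fun h : R => h^-1 *: ((f \o shift x) (h *: v) - f x)) =
  (fun h : R => h^-1 *: (((fun t : R => f (x + t *: v)) \o shift 0) (h *: 1) -
     (fun t : R => f (x + t *: v)) 0)).
Proof.
apply/funext => h /=; rewrite addr0 scale0r addr0 [h *: v + x]addrC.
by congr (_ *: (f (_ + _ *: _) - _)); rewrite /GRing.scale /= mulr1.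
Qed.

(** Restriction to a line makes the one-variable rules available for directional derivatives, in
    particular the chain rule with an outer function of one variable. *)
Lemma dir_deriveP f (x v : R * R) (d : R) :
  is_derive x v f d <-> is_derive (0 : R) 1 (fun t : R => f (x + t *: v)) d.
Proof.
have E := dir_derive_quotient f x v.
split=> -[d1 d2]; apply: DeriveDef.
- by rewrite /derivable -E.
- by rewrite /derive -E.
- by rewrite /derivable E.
- by rewrite /derive E.
Qed.

Lemma is_derive_comp_dir (h : R -> R) f (x v : R * R) (a b : R) :
  is_derive (f x) 1 h a -> is_derive x v f b -> is_derive x v (fun y => h (f y)) (a * b).
Proof.
move=> dh /dir_deriveP df; apply/dir_deriveP.
apply: (@is_derive1_comp R h (fun t => f (x + t *: v)) 0 a b) => //.
by rewrite scale0r addr0.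
Qed.

Lemma is_derive_fst (x v : R * R) : is_derive x v (fun y : R * R => y.1) v.1.
Proof.
apply/dir_deriveP.
have -> : (fun t : R => (x + t *: v).1) = (fun t => v.1 * t + x.1).
  by apply/funext => t; rewrite /= addrC mulrC.
exact: is_derive_affine.
Qed.

Lemma is_derive_snd (x v : R * R) : is_derive x v (fun y : R * R => y.2) v.2.
Proof.
apply/dir_deriveP.
have -> : (fun t : R => (x + t *: v).2) = (fun t => v.2 * t + x.2).
  by apply/funext => t; rewrite /= addrC mulrC.
exact: is_derive_affine.
Qed.

Lemma iter_partial_rcons (s : seq 'I_2) i f :
  iter_partial (rcons s i) f = iter_partial s ('d_ i f).
Proof. by rewrite /iter_partial foldr_rcons. Qed.

Lemma smooth_D f i : smooth f -> smooth ('d_ i f).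
Proof. by move=> sf s; have := sf (rcons s i); rewrite iter_partial_rcons. Qed.

Lemma smooth_continuous f : smooth f -> continuous f.
Proof. by move=> /(_ [::])[]. Qed.

Lemma smooth_derivable f i x : smooth f -> derivable f x (e_ R i).
Proof. by move=> /(_ [::])[_]. Qed.

Lemma smooth_is_derive f i x : smooth f -> is_derive x (e_ R i) f ('D_(e_ R i) f x).
Proof. by move=> sf; apply: DeriveDef => //; exact: smooth_derivable. Qed.

(** A class closed under the operations needed for constructing test functions and, by the product
    and chain rules, under partial derivatives; all iterated derivatives are then handled by
    [smooth_algP] at once. *)
Inductive smooth_alg : (R * R -> R) -> Prop :=
| smooth_alg_base f : smooth f -> smooth_alg f
| smooth_alg_cst a : smooth_alg (fun=> a)
| smooth_alg_fst : smooth_alg (fun x => x.1)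
| smooth_alg_snd : smooth_alg (fun x => x.2)
| smooth_alg_add f g : smooth_alg f -> smooth_alg g -> smooth_alg (fun x => f x + g x)
| smooth_alg_mul f g : smooth_alg f -> smooth_alg g -> smooth_alg (fun x => f x * g x)
| smooth_alg_comp h f : smooth1 h -> smooth_alg f -> smooth_alg (fun x => h (f x)).

Lemma smooth_alg_continuous f : smooth_alg f -> continuous f.
Proof.
elim=> [{}f sf|a|||f1 f2 _ c1 _ c2|f1 f2 _ c1 _ c2|h {}f sh _ cf] x.
- exact: smooth_continuous.
- exact: cvg_cst.
- exact: cvg_fst.
- exact: cvg_snd.
- by apply: cvgD; [exact: c1|exact: c2].
- by apply: cvgM; [exact: c1|exact: c2].
- by apply: (@continuous_comp _ _ _ f h); [exact: cf|exact: smooth1_continuous].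
Qed.

Lemma smooth_alg_derive f i : smooth_alg f -> exists2 f',
  (forall x, is_derive x (e_ R i) f (f' x)) & smooth_alg f'.
Proof.
elim=> [{}f sf|a|||f1 f2 a1 [f1' d1 b1] a2 [f2' d2 b2]
  |f1 f2 a1 [f1' d1 b1] a2 [f2' d2 b2]|h {}f sh af [f' d b]].
- exists ('d_ i f); first by move=> x; exact: smooth_is_derive.
  by apply: smooth_alg_base; exact: smooth_D.
- by exists (fun=> 0); [move=> x; exact: is_derive_cst|exact: smooth_alg_cst].
- by exists (fun=> (e_ R i).1); [move=> x; exact: is_derive_fst|exact: smooth_alg_cst].
- by exists (fun=> (e_ R i).2); [move=> x; exact: is_derive_snd|exact: smooth_alg_cst].
- exists (fun x => f1' x + f2' x); last exact: smooth_alg_add.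
  by move=> x; exact: is_deriveD.
- exists (fun x => f1 x * f2' x + f2 x * f1' x).
    by move=> x; exact: is_deriveM.
  by apply: smooth_alg_add; exact: smooth_alg_mul.
- exists (fun x => derive1 h (f x) * f' x).
    by move=> x; apply: is_derive_comp_dir => //; exact: smooth1_is_derive.
  by apply: smooth_alg_mul => //; apply: smooth_alg_comp => //; exact: smooth1_derive.
Qed.

Lemma smooth_algP f : smooth_alg f -> smooth f.
Proof.
move=> sf s; elim/last_ind: s f sf => [|s i IH] f sf.
  split; first exact: smooth_alg_continuous.
  by move=> i x; have [f' df _] := smooth_alg_derive i sf; have [] := df x.
rewrite iter_partial_rcons; apply: IH; have [f' df sf'] := smooth_alg_derive i sf.
by have -> : 'd_ i f = f' by apply/funext => x; apply: derive_val.
Qed.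

Lemma smoothM f g : smooth f -> smooth g -> smooth (fun x => f x * g x).
Proof. by move=> sf sg; apply: smooth_algP; apply: smooth_alg_mul; exact: smooth_alg_base. Qed.

Lemma smoothDD f g : smooth f -> smooth g -> smooth (fun x => f x + g x).
Proof. by move=> sf sg; apply: smooth_algP; apply: smooth_alg_add; exact: smooth_alg_base. Qed.

Lemma smooth_cst a : smooth (fun=> a : R).
Proof. by apply: smooth_algP; exact: smooth_alg_cst. Qed.

Lemma derive_mul f g i x : smooth f -> smooth g ->
  'D_(e_ R i) (fun y => f y * g y) x = f x * 'D_(e_ R i) g x + g x * 'D_(e_ R i) f x.
Proof.
move=> sf sg; have df := smooth_is_derive i x sf; have dg := smooth_is_derive i x sg.
by have := is_deriveM df dg => h; apply: derive_val.
Qed.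

Lemma derive_add f g i x : smooth f -> smooth g ->
  'D_(e_ R i) (fun y => f y + g y) x = 'D_(e_ R i) f x + 'D_(e_ R i) g x.
Proof.
move=> sf sg; have df := smooth_is_derive i x sf; have dg := smooth_is_derive i x sg.
by have := is_deriveD df dg => h; apply: derive_val.
Qed.

Lemma derive_scale (a : R) f i x : smooth f ->
  'D_(e_ R i) (fun y => a * f y) x = a * 'D_(e_ R i) f x.
Proof.
move=> sf; have df := smooth_is_derive i x sf.
by have := is_deriveZ a df => h; apply: derive_val.
Qed.

Lemma derive_smooth1_comp h f i x : smooth1 h -> smooth f ->
  'D_(e_ R i) (fun y => h (f y)) x = derive1 h (f x) * 'D_(e_ R i) f x.
Proof.
move=> sh sf; have df := smooth_is_derive i x sf.
by have := is_derive_comp_dir (smooth1_is_derive (f x) sh) df => k; apply: derive_val.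
Qed.

Lemma compact_closed2 (K : set (R * R)) : compact K -> closed K.
Proof. by apply: compact_closed; exact: norm_hausdorff. Qed.

Lemma test_smooth Omega f : test_function Omega f -> smooth f.
Proof. by case. Qed.

Lemma test_out Omega f x : test_function Omega f -> ~ Omega x -> f x = 0.
Proof. by move=> [_ [K [_ KO K0]]] nx; apply: K0 => /KO. Qed.

Lemma test_D Omega f i : test_function Omega f -> test_function Omega ('d_ i f).
Proof.
move=> [sf [K [cK KO K0]]]; split; first exact: smooth_D.
exists K; split => // x nKx.
have E : \forall y \near x, cst (0:R) y = f y.
  have oK : open (~` K) by apply: closed_openC; exact: compact_closed2.
  have : nbhs x (~` K) by apply: open_nbhs_nbhs.
  by apply: filterS => y /K0 ->.
by rewrite -(near_eq_derive _ E); apply: derive_val.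
Qed.

Lemma test_mulr Omega f g : smooth g -> test_function Omega f ->
  test_function Omega (fun x => g x * f x).
Proof.
move=> sg [sf [K [cK KO K0]]]; split; first exact: smoothM.
by exists K; split => // x /K0 ->; rewrite mulr0.
Qed.

Lemma test_add Omega f g : test_function Omega f -> test_function Omega g ->
  test_function Omega (fun x => f x + g x).
Proof.
move=> [sf [K [cK KO K0]]] [sg [L [cL LO L0]]]; split; first exact: smoothDD.
exists (K `|` L); split.
- exact: compactU.
- by move=> x [/KO|/LO].
- by move=> x /not_orP[/K0 -> /L0 ->]; rewrite addr0.
Qed.

Lemma test_scale Omega (a : R) f : test_function Omega f ->
  test_function Omega (fun x => a * f x).
Proof. by apply: test_mulr; exact: smooth_cst. Qed.

Lemma test_comp Omega h f : smooth1 h -> h 0 = 0 -> test_function Omega f ->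
  test_function Omega (fun x => h (f x)).
Proof.
move=> sh h0 [sf [K [cK KO K0]]]; split.
  by apply: smooth_algP; apply: smooth_alg_comp => //; exact: smooth_alg_base.
by exists K; split => // x /K0 ->.
Qed.

Lemma test_0 Omega : test_function Omega (fun=> 0 : R).
Proof.
split; first exact: smooth_cst.
by exists set0; split => //; exact: compact0.
Qed.

(* A test function that is positive exactly on an open box. *)
Definition box_bump (a1 b1 a2 b2 : R) (x : R * R) : R :=
  bump_fun 0 (x.1 - a1) * bump_fun 0 (b1 - x.1) *
  (bump_fun 0 (x.2 - a2) * bump_fun 0 (b2 - x.2)).

Lemma bump_fun0_bounds (x : R) : 0 <= bump_fun 0 x < 1.
Proof.
rewrite bump_fun_ge0 /bump_fun /=; case: ifP => x0; last exact: ltr01.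
by rewrite expr0 mul1r expR_lt1 oppr_lt0 invr_gt0.
Qed.

Lemma bump_fun0_gt0 (x : R) : (0 < bump_fun 0 x) = (0 < x).
Proof.
by rewrite /bump_fun; case: ifP => // x0; rewrite ?ltxx// expr0 mul1r expR_gt0.
Qed.

Lemma box_bump_bounds a1 b1 a2 b2 x : 0 <= box_bump a1 b1 a2 b2 x < 1.
Proof.
rewrite /box_bump.
have /andP[p1 q1] := bump_fun0_bounds (x.1 - a1).
have /andP[p2 q2] := bump_fun0_bounds (b1 - x.1).
have /andP[p3 q3] := bump_fun0_bounds (x.2 - a2).
have /andP[p4 q4] := bump_fun0_bounds (b2 - x.2).
rewrite !mulr_ge0//=.
have h1 : bump_fun 0 (x.1 - a1) * bump_fun 0 (b1 - x.1) < 1 by nra.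
have h2 : bump_fun 0 (x.2 - a2) * bump_fun 0 (b2 - x.2) < 1 by nra.
have h3 : 0 <= bump_fun 0 (x.1 - a1) * bump_fun 0 (b1 - x.1) by rewrite mulr_ge0.
have h4 : 0 <= bump_fun 0 (x.2 - a2) * bump_fun 0 (b2 - x.2) by rewrite mulr_ge0.
nra.
Qed.

Lemma box_bump_gt0 a1 b1 a2 b2 x :
  a1 < x.1 < b1 -> a2 < x.2 < b2 -> 0 < box_bump a1 b1 a2 b2 x.
Proof.
move=> /andP[h1 h2] /andP[h3 h4].
by rewrite /box_bump !mulr_gt0// bump_fun0_gt0 subr_gt0.
Qed.

Lemma box_bump_eq0 a1 b1 a2 b2 x :
  ~ (a1 < x.1 < b1 /\ a2 < x.2 < b2) -> box_bump a1 b1 a2 b2 x = 0.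
Proof.
have bz (t : R) : t <= 0 -> bump_fun 0 t = 0 by move=> t0; rewrite /bump_fun ltNge t0.
rewrite /box_bump => h.
have [h1|h1] := leP x.1 a1; first by rewrite (bz (x.1 - a1)) ?subr_le0// !mul0r.
have [h2|h2] := leP b1 x.1; first by rewrite (bz (b1 - x.1)) ?subr_le0// mulr0 mul0r.
have [h3|h3] := leP x.2 a2; first by rewrite (bz (x.2 - a2)) ?subr_le0// mul0r mulr0.
have [h4|h4] := leP b2 x.2; first by rewrite (bz (b2 - x.2)) ?subr_le0// !mulr0.
by exfalso; apply: h; rewrite h1 h2 h3 h4.
Qed.

Lemma test_box_bump Omega a1 b1 a2 b2 :
  `[a1, b1] `*` `[a2, b2] `<=` Omega -> test_function Omega (box_bump a1 b1 a2 b2).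
Proof.
move=> bO; split.
  apply: smooth_algP; rewrite /box_bump.
  have s1 a : smooth_alg (fun x : R * R => bump_fun 0 (x.1 - a)).
    apply: smooth_alg_comp; first exact: smooth1_bump.
    by apply: smooth_alg_add; [exact: smooth_alg_fst|exact: smooth_alg_cst].
  have s2 a : smooth_alg (fun x : R * R => bump_fun 0 (x.2 - a)).
    apply: smooth_alg_comp; first exact: smooth1_bump.
    by apply: smooth_alg_add; [exact: smooth_alg_snd|exact: smooth_alg_cst].
  have s3 a : smooth_alg (fun x : R * R => bump_fun 0 (a - x.1)).
    apply: (@smooth_alg_comp _ (fun x => a - x.1)); first exact: smooth1_bump.
    have -> : (fun x : R * R => a - x.1) = (fun x => a + -1 * x.1).
      by apply/funext => x; rewrite mulN1r.
    apply: smooth_alg_add; first exact: smooth_alg_cst.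
    by apply: smooth_alg_mul; [exact: smooth_alg_cst|exact: smooth_alg_fst].
  have s4 a : smooth_alg (fun x : R * R => bump_fun 0 (a - x.2)).
    apply: (@smooth_alg_comp _ (fun x => a - x.2)); first exact: smooth1_bump.
    have -> : (fun x : R * R => a - x.2) = (fun x => a + -1 * x.2).
      by apply/funext => x; rewrite mulN1r.
    apply: smooth_alg_add; first exact: smooth_alg_cst.
    by apply: smooth_alg_mul; [exact: smooth_alg_cst|exact: smooth_alg_snd].
  by apply: smooth_alg_mul; apply: smooth_alg_mul.
exists (`[a1, b1] `*` `[a2, b2]); split => //.
  by apply: compact_setX; exact: segment_compact.
move=> x nx; apply: box_bump_eq0 => -[/andP[h1 h2] /andP[h3 h4]].
by apply: nx; split; rewrite /= in_itv/= ?ltW.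
Qed.

End Smooth2.

(** * Measurability and the fundamental theorem of calculus on sections of the plane *)

Section Plane.
Variable R : realType.
Local Notation P := (measurableTypeR R * measurableTypeR R)%type.
Local Notation leb := (@lebesgue_measure R).
Local Notation mu2 := (leb2 R).

Lemma open_measurable2 (U : set (R * R)) : open U -> measurable (U : set P).
Proof.
move=> oU.
pose box (q : rat * rat * (rat * rat)) : set P :=
  `](ratr q.1.1 : R), ratr q.1.2[ `*` `](ratr q.2.1 : R), ratr q.2.2[.
have -> : U = \bigcup_q (if pselect (box q `<=` U) then box q else set0).
  apply/seteqP; split => [[x y] Uxy|x [q _]]; last by case: pselect => // h /h.
  have [e /= e0 eU] : exists2 e : R, 0 < e & ball (x, y) e `<=` U.
    by apply/nbhs_ballP; apply: open_nbhs_nbhs.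
  have xe : x - e < x by rewrite ltrBlDr ltrDl.
  have ex : x < x + e by rewrite ltrDl.
  have ye : y - e < y by rewrite ltrBlDr ltrDl.
  have ey : y < y + e by rewrite ltrDl.
  have [q1 /[!in_itv]/= /andP[a1 a2]] := rat_in_itvoo xe.
  have [q2 /[!in_itv]/= /andP[b1 b2]] := rat_in_itvoo ex.
  have [q3 /[!in_itv]/= /andP[c1 c2]] := rat_in_itvoo ye.
  have [q4 /[!in_itv]/= /andP[d1 d2]] := rat_in_itvoo ey.
  exists (q1, q2, (q3, q4)) => //; case: pselect => [h|nh]; [|exfalso; apply: nh].
    by split; rewrite /= in_itv/= ?a2 ?b1 ?c2 ?d1.
  move=> [s t] []; rewrite /= !in_itv/= => /andP[s1 s2] /andP[t1 t2]; apply: eU; split => /=.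
    by rewrite /ball /= ltr_norml; apply/andP; split; lra.
  by rewrite /ball /= ltr_norml; apply/andP; split; lra.
apply: countable_bigcupT_measurable; first exact: countableP.
move=> q; case: pselect => h; last exact: measurable0.
by apply: measurableX; exact: measurable_itv.
Qed.

Lemma closed_measurable2 (K : set (R * R)) : closed K -> measurable (K : set P).
Proof. by move=> /closed_openC /open_measurable2 /measurableC; rewrite setCK. Qed.

Lemma compact_measurable2 (K : set (R * R)) : compact K -> measurable (K : set P).
Proof. by move=> /compact_closed2 /closed_measurable2. Qed.

Lemma continuous_measurable2 (f : R * R -> R) (D : set P) : continuous f ->
  measurable D -> measurable_fun D f.
Proof.
move=> cf mD; apply: (@measurable_funS _ _ _ _ setT) => //.
apply: (measurability _ (RGenOpens.measurableE R)).
move=> _ [_ [a [b ->] <-]]; rewrite setTI; apply: open_measurable2.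
by move/continuousP : cf => /(_ _ (interval_open _ _)); apply.
Qed.

Lemma bounded_set_box (Omega : set (R * R)) : bounded_set Omega ->
  exists2 B : R, 0 < B & forall x, Omega x -> -B < x.1 < B /\ -B < x.2 < B.
Proof.
move=> [M [_ hM]]; pose B := Num.max 1 (M + 1).
have MB : M < B by rewrite lt_max ltrDl ltr01 orbT.
exists (B + 1); first by rewrite ltr_wpDr// lt_max ltr01.
move=> [x y] Oxy; have : Num.max `|x| `|y| <= B by exact: (hM _ MB _ Oxy).
rewrite ge_max => /andP[h1 h2].
have B1 : B < B + 1 by rewrite ltrDl.
by rewrite -!ltr_norml (le_lt_trans h1 B1) (le_lt_trans h2 B1).
Qed.

Lemma leb2_box_fin (a b c d : R) : (mu2 (`[a, b] `*` `[c, d]) < +oo)%E.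
Proof.
have -> : mu2 (`[a, b] `*` `[c, d]) = (leb `[a, b] * leb `[c, d])%E.
  by apply: product_measure1E; exact: measurable_itv.
rewrite !lebesgue_measure_itv/=.
by case: ifP => _; case: ifP => _; rewrite ?mul0e ?mule0 ?ltry// -!EFinD -EFinM ltry.
Qed.

Lemma leb2_bounded_fin (Omega : set (R * R)) : measurable (Omega : set P) ->
  bounded_set Omega -> (mu2 Omega < +oo)%E.
Proof.
move=> mO /bounded_set_box[B B0 OB].
apply: le_lt_trans (leb2_box_fin (- B) B (- B) B); apply: le_measure.
- by rewrite inE.
- by rewrite inE; apply: measurableX.
- move=> [x y] /OB /= [/andP[h1 h2] /andP[h3 h4]].
  by split; rewrite /= in_itv/= !ltW.
Qed.

Lemma is_derive_fst_section (f : R * R -> R) (x y d : R) :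
  is_derive (x, y) (e_ R 0) f d -> is_derive x 1 (fun t => f (t, y)) d.
Proof.
move=> /dir_deriveP h.
have h' : is_derive (1 * x + - x) 1 (fun t : R => f ((x, y) + t *: e_ R 0)) d.
  by rewrite mul1r subrr.
have := @is_derive1_comp R (fun t : R => f ((x, y) + t *: e_ R 0)) (fun t => 1 * t + - x) x _ _
  h' (is_derive_affine 1 (- x) x).
rewrite mulr1; congr is_derive; apply/funext => t /=.
by congr (f (_, _)); rewrite /e_ /= /GRing.scale /=; ring.
Qed.

Lemma is_derive_snd_section (f : R * R -> R) (x y d : R) :
  is_derive (x, y) (e_ R 1) f d -> is_derive y 1 (fun t => f (x, t)) d.
Proof.
move=> /dir_deriveP h.
have h' : is_derive (1 * y + - y) 1 (fun t : R => f ((x, y) + t *: e_ R 1)) d.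
  by rewrite mul1r subrr.
have := @is_derive1_comp R (fun t : R => f ((x, y) + t *: e_ R 1)) (fun t => 1 * t + - y) y _ _
  h' (is_derive_affine 1 (- y) y).
rewrite mulr1; congr is_derive; apply/funext => t /=.
by congr (f (_, _)); rewrite /e_ /= /GRing.scale /=; ring.
Qed.

Lemma FTC_continuous (F F' : R -> R) (a b : R) : (forall t : R, is_derive t 1 F (F' t)) ->
  continuous F' -> a <= b -> \int[leb]_(t in `[a, b]) F' t = F b - F a.
Proof.
move=> dF cF'; rewrite le_eqVlt => /predU1P[->|ab].
  by rewrite set_itv1 Rintegral_set1 subrr.
have cF : continuous F by apply: derivable1_continuous => t; have [] := dF t.
rewrite /Rintegral (@continuous_FTC2 _ F' F)//.
- exact: continuous_subspaceT.
- split; first by move=> t _; have [] := dF t.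
  + by apply: cvg_at_right_filter; exact: cF.
  + by apply: cvg_at_left_filter; exact: cF.
- by move=> t _; rewrite derive1E; apply: derive_val.
Qed.

Lemma smooth_section_fst (f : R * R -> R) (y : R) : continuous f -> continuous (fun t => f (t, y)).
Proof.
move=> cf t; apply: (@continuous_comp _ _ _ (fun t => (t, y)) f); last exact: cf.
exact: (@cvg_pair _ _ _ (nbhs t) (nbhs t) (nbhs y) _ _ _ id (fun=> y) cvg_id (cvg_cst y)).
Qed.

Lemma smooth_section_snd (f : R * R -> R) (x : R) : continuous f -> continuous (fun t => f (x, t)).
Proof.
move=> cf t; apply: (@continuous_comp _ _ _ (fun t => (x, t)) f); last exact: cf.
exact: (@cvg_pair _ _ _ (nbhs t) (nbhs x) (nbhs t) _ _ _ (fun=> x) id (cvg_cst x) cvg_id).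
Qed.

Lemma FTC_fst (f : R * R -> R) (a b y : R) : smooth f -> a <= b ->
  \int[leb]_(t in `[a, b]) 'D_(e_ R 0) f (t, y) = f (b, y) - f (a, y).
Proof.
move=> sf ab; apply: (FTC_continuous (F := fun t => f (t, y)) (F' := fun t => 'D_(e_ R 0) f (t, y))) => //.
- by move=> t; apply: is_derive_fst_section; exact: smooth_is_derive.
- exact/(@smooth_section_fst (fun z => 'D_(e_ R 0) f z))/smooth_continuous/smooth_D.
Qed.

Lemma FTC_snd (f : R * R -> R) (a b x : R) : smooth f -> a <= b ->
  \int[leb]_(t in `[a, b]) 'D_(e_ R 1) f (x, t) = f (x, b) - f (x, a).
Proof.
move=> sf ab; apply: (FTC_continuous (F := fun t => f (x, t)) (F' := fun t => 'D_(e_ R 1) f (x, t))) => //.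
- by move=> t; apply: is_derive_snd_section; exact: smooth_is_derive.
- exact/(@smooth_section_snd (fun z => 'D_(e_ R 1) f z))/smooth_continuous/smooth_D.
Qed.

End Plane.

(** * Integration by parts and integral inequalities for test functions *)

Section TestInequalities.
Variable R : realType.
Local Notation P := (measurableTypeR R * measurableTypeR R)%type.
Local Notation leb := (@lebesgue_measure R).
Local Notation mu2 := (leb2 R).
Variables (Omega : set (R * R)) (B : R).
Hypothesis OB : forall x, Omega x -> - B < x.1 < B /\ - B < x.2 < B.
Hypothesis B0 : 0 < B.
Hypothesis mO : measurable (Omega : set P).
Local Notation test := (test_function Omega).
Local Notation "'d_ i f" := (fun x => 'D_(e_ R i) f x) (at level 10, i, f at level 9).
Local Notation J f := (\int[mu2]_(z in setT) f z).
Implicit Types (f g w : R * R -> R).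

Lemma test_bounded f : test f -> exists2 K : R, 0 <= K & forall x, `|f x| <= K.
Proof.
move=> [sf [K [cK KO K0]]].
have cf : continuous f by exact: smooth_continuous.
have /compact_bounded[M [_ hM]] : compact (f @` K).
  by apply: continuous_compact => //; exact: continuous_subspaceT.
have MB : M < Num.max 0 (M + 1) by rewrite lt_max ltrDl ltr01 orbT.
exists (Num.max 0 (M + 1)); first by rewrite le_max lexx.
move=> x; have [Kx|/K0 ->] := pselect (K x); first by apply: (hM _ MB); exists x.
by rewrite normr0 le_max lexx.
Qed.

Lemma test_outbox f x : test f -> ~ (- B < x.1 < B /\ - B < x.2 < B) -> f x = 0.
Proof. by move=> tf nx; apply: (test_out tf) => /OB. Qed.

Lemma test_measurable f (D : set P) : test f -> measurable D -> measurable_fun D f.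
Proof. by move=> tf; apply: continuous_measurable2; apply: smooth_continuous; exact: test_smooth tf. Qed.

Lemma test_integrable f : test f -> mu2.-integrable setT (EFin \o f).
Proof.
move=> tf; have [K K0 fK] := test_bounded tf.
pose Q : set P := `[- B, B] `*` `[- B, B].
have mQ : measurable Q by apply: measurableX; exact: measurable_itv.
have iQ : mu2.-integrable Q (EFin \o (fun=> K)).
  by apply: Int_cst => //; exact: leb2_box_fin.
have iQT : mu2.-integrable setT (EFin \o ((fun=> K) \_ Q)).
  by have := (integrable_mkcond (EFin \o (fun=> K)) mQ).1 iQ; rewrite restrict_EFin.
apply: (@Int_le_pt _ _ _ mu2 setT measurableT _ ((fun=> K) \_ Q)) => //; first exact: test_measurable.
move=> x _; rewrite patchE; case: ifPn => [_|]; first exact: fK.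
rewrite notin_setE => nQ; rewrite (test_outbox tf) ?normr0// => -[/andP[h1 h2] /andP[h3 h4]].
by apply: nQ; split; rewrite /= in_itv/= !ltW.
Qed.

Lemma test_section_fst f y : test f -> leb.-integrable setT (EFin \o (fun t => f (t, y))).
Proof.
move=> tf; have [K K0 fK] := test_bounded tf.
have iQT : leb.-integrable setT (EFin \o ((fun=> K) \_ `[- B, B])).
  have iQ : leb.-integrable `[- B, B] (EFin \o (fun=> K)).
    apply: (@Int_cst _ _ _ leb `[- B, B]%classic); first exact: measurable_itv.
    rewrite /= lebesgue_measure_itv/=; case: ifP => _; last exact: ltry.
    by rewrite -EFinD ltry.
  have mI : measurable (`[- B, B]%classic : set (measurableTypeR R)) by exact: measurable_itv.
  by have := (integrable_mkcond (EFin \o (fun=> K)) mI).1 iQ; rewrite restrict_EFin.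
apply: (@Int_le_pt _ _ _ leb setT measurableT _ ((fun=> K) \_ `[- B, B])) => //.
  by apply: continuous_measurable_fun; apply: smooth_section_fst; apply: smooth_continuous; exact: test_smooth tf.
move=> x _; rewrite patchE; case: ifPn => [_|]; first exact: fK.
rewrite notin_setE => nQ; rewrite (test_outbox tf) ?normr0// => -[/andP[h1 h2] /andP[h3 h4]].
by apply: nQ; rewrite /= in_itv/= !ltW.
Qed.

Lemma test_section_snd f x : test f -> leb.-integrable setT (EFin \o (fun t => f (x, t))).
Proof.
move=> tf; have [K K0 fK] := test_bounded tf.
have iQT : leb.-integrable setT (EFin \o ((fun=> K) \_ `[- B, B])).
  have iQ : leb.-integrable `[- B, B] (EFin \o (fun=> K)).
    apply: (@Int_cst _ _ _ leb `[- B, B]%classic); first exact: measurable_itv.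
    rewrite /= lebesgue_measure_itv/=; case: ifP => _; last exact: ltry.
    by rewrite -EFinD ltry.
  have mI : measurable (`[- B, B]%classic : set (measurableTypeR R)) by exact: measurable_itv.
  by have := (integrable_mkcond (EFin \o (fun=> K)) mI).1 iQ; rewrite restrict_EFin.
apply: (@Int_le_pt _ _ _ leb setT measurableT _ ((fun=> K) \_ `[- B, B])) => //.
  by apply: continuous_measurable_fun; apply: smooth_section_snd; apply: smooth_continuous; exact: test_smooth tf.
move=> y _; rewrite patchE; case: ifPn => [_|]; first exact: fK.
rewrite notin_setE => nQ; rewrite (test_outbox tf) ?normr0// => -[/andP[h1 h2] /andP[h3 h4]].
by apply: nQ; rewrite /= in_itv/= !ltW.
Qed.

Lemma test_fubini_snd (h : R * R -> R) : mu2.-integrable setT (EFin \o h) ->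
  (forall y, leb.-integrable setT (EFin \o (fun t => h (t, y)))) ->
  J h = \int[leb]_y (\int[leb]_x h (x, y)).
Proof.
move=> ih hs; rewrite /Rintegral; congr fine.
transitivity (\int[leb]_y fubini_G leb (EFin \o h) y)%E.
  by apply/esym; exact: (integral21_prod_meas1 ih).
apply: eq_integral => y _; rewrite /fubini_G /=.
exact: (I_EFin measurableT (hs y)).
Qed.

Lemma test_fubini_fst (h : R * R -> R) : mu2.-integrable setT (EFin \o h) ->
  (forall x, leb.-integrable setT (EFin \o (fun t => h (x, t)))) ->
  J h = \int[leb]_x (\int[leb]_y h (x, y)).
Proof.
move=> ih hs; rewrite /Rintegral; congr fine.
transitivity (\int[leb]_x fubini_F leb (EFin \o h) x)%E.
  by apply/esym; exact: (integral12_prod_meas1 ih).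
apply: eq_integral => x _; rewrite /fubini_F /=.
exact: (I_EFin measurableT (hs x)).
Qed.

Lemma Rintegral_supp (h : R -> R) (a b : R) :
  (forall t, ~ (a <= t <= b) -> h t = 0) ->
  \int[leb]_t h t = \int[leb]_(t in `[a, b]) h t.
Proof.
move=> h0; rewrite [RHS]Rintegral_mkcond; apply: eq_Rintegral => t _.
rewrite patchE; case: ifPn => //; rewrite notin_setE /= in_itv /= => n.
exact: h0.
Qed.

(** Fubini reduces the claim to one variable, where the fundamental theorem leaves values of [f] on
    edges of the box of half-width [B]. They vanish because [f] is zero outside [Omega], which lies
    in the open box. *)
Lemma J_derive f i : test f -> J ('d_ i f) = 0.
Proof.
move=> tf; have tD := test_D i tf; have sf := test_smooth tf.
have NB : - B <= B by rewrite -subr_ge0 opprK addr_ge0// ltW.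
have [->|->] : i = 0 \/ i = 1 by case: i tD => -[|[|//]] ? _; [left|right]; exact: val_inj.
  rewrite test_fubini_snd; last 2 first.
  - by apply: test_integrable; exact: test_D.
  - by move=> y; exact: (test_section_fst y (test_D 0 tf)).
  have -> : (fun y => \int[leb]_x 'D_(e_ R 0) f (x, y)) = fun=> 0; last by rewrite Rintegral_cst// mul0r.
  apply/funext => y; rewrite (@Rintegral_supp _ (- B) B).
    rewrite FTC_fst// !(test_outbox tf) ?subrr//= => -[]; rewrite ltxx ?andbF//.
  move=> t nt; apply: (test_outbox (test_D 0 tf)) => -[/andP[h1 h2] _].
  by apply: nt; rewrite !ltW.
rewrite test_fubini_fst; last 2 first.
- by apply: test_integrable; exact: test_D.
- by move=> y; exact: (test_section_snd y (test_D 1 tf)).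
have -> : (fun x => \int[leb]_y 'D_(e_ R 1) f (x, y)) = fun=> 0; last by rewrite Rintegral_cst// mul0r.
apply/funext => x; rewrite (@Rintegral_supp _ (- B) B).
  rewrite FTC_snd// !(test_outbox tf) ?subrr//= => -[_]; rewrite ltxx ?andbF//.
move=> t nt; apply: (test_outbox (test_D 1 tf)) => -[_ /andP[h1 h2]].
by apply: nt; rewrite !ltW.
Qed.

Lemma J_Omega (h : R * R -> R) : (forall z, ~ Omega z -> h z = 0) ->
  \int[mu2]_(z in Omega) h z = J h.
Proof.
move=> h0; rewrite Rintegral_mkcond; apply: eq_Rintegral => z _.
by rewrite patchE; case: ifPn => //; rewrite notin_setE => /h0 ->.
Qed.

Lemma test_IntOmega f : test f -> mu2.-integrable Omega (EFin \o f).
Proof. by move=> tf; apply: integrableS (test_integrable tf). Qed.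

Lemma test_ibp f g i : test f -> smooth g ->
  ip Omega g ('d_ i f) = - ip Omega ('d_ i g) f.
Proof.
move=> tf sg; rewrite /ip.
have tD := test_D i tf.
have i1 : mu2.-integrable Omega (EFin \o (fun x => g x * 'D_(e_ R i) f x)).
  by apply: test_IntOmega; exact: test_mulr.
have i2 : mu2.-integrable Omega (EFin \o (fun x => 'D_(e_ R i) g x * f x)).
  by apply: test_IntOmega; apply: (@test_mulr _ _ f ('d_ i g)) => //; exact: smooth_D.
apply/eqP; rewrite -addr_eq0 -(I_D mO i1 i2); apply/eqP.
have t := test_mulr sg tf.
rewrite -(J_derive i t) -J_Omega; last first.
  by move=> z nz; apply: (test_out (test_D i t)).
by apply: eq_Rintegral => z _; rewrite derive_mul// ?[f z * _]mulrC//; exact: test_smooth tf.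
Qed.

End TestInequalities.

Section TestInequalities2.
Variable R : realType.
Local Notation P := (measurableTypeR R * measurableTypeR R)%type.
Local Notation leb := (@lebesgue_measure R).
Local Notation mu2 := (leb2 R).
Variables (Omega : set (R * R)) (B : R).
Hypothesis OB : forall x, Omega x -> - B < x.1 < B /\ - B < x.2 < B.
Hypothesis B0 : 0 < B.
Hypothesis mO : measurable (Omega : set P).
Local Notation test := (test_function Omega).
Local Notation "'d_ i f" := (fun x => 'D_(e_ R i) f x) (at level 10, i, f at level 9).
Local Notation J f := (\int[mu2]_(z in setT) f z).
Implicit Types (f g w : R * R -> R).

Lemma test_power f m : test f -> test (fun z => f z ^+ m.+1).
Proof.
move=> tf; elim: m => [|m IH].
  by have -> : (fun z => f z ^+ 1) = f by apply/funext => z; rewrite expr1.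
have -> : (fun z => f z ^+ m.+2) = (fun z => f z * f z ^+ m.+1).
  by apply/funext => z; rewrite exprS.
by apply: test_mulr => //; exact: test_smooth tf.
Qed.

Lemma derive_power f m i z : test f ->
  'D_(e_ R i) (fun z => f z ^+ m.+1) z = m.+1%:R * f z ^+ m * 'D_(e_ R i) f z.
Proof.
move=> tf; have sf := test_smooth tf; elim: m => [|m IH].
  have -> : (fun z => f z ^+ 1) = f by apply/funext => y; rewrite expr1.
  by rewrite expr0 !mul1r.
have -> : (fun z => f z ^+ m.+2) = (fun z => f z * f z ^+ m.+1).
  by apply/funext => y; rewrite exprS.
rewrite derive_mul//; last exact: test_smooth (test_power m tf).
rewrite IH -[m.+2%:R]natr1 exprS; ring.
Qed.

Lemma test_le_int_fst f (x y : R) : test f ->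
  (`|f (x, y)|%:E <= \int[leb]_t (`|'D_(e_ R 0) f (t, y)|)%:E)%E.
Proof.
move=> tf; have tD := test_D 0 tf.
have is0 := test_section_fst OB y tD.
have [xB|xB] := leP x (- B).
  rewrite (test_outbox OB tf) ?normr0//=; last by move=> [/andP[]]; rewrite ltNge xB.
  by apply: integral_ge0 => t _; rewrite lee_fin.
have E := FTC_fst y (test_smooth tf) (ltW xB).
have f0 : f (- B, y) = 0.
  by apply: (test_outbox OB tf) => -[/andP[]]; rewrite /= ltxx.
rewrite f0 subr0 in E; rewrite -E.
have mI : measurable (`[- B, x]%classic : set (measurableTypeR R)) by exact: measurable_itv.
have iI : leb.-integrable `[- B, x] (EFin \o (fun t => 'D_(e_ R 0) f (t, y))).
  by apply: integrableS is0.
have := I_abs_le mI iI; rewrite -lee_fin -(I_EFin mI (Int_abs iI)) => h.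
apply: (le_trans h); apply: ge0_subset_integral => //.
by apply/measurable_EFinP; exact: Int_meas (Int_abs is0).
Qed.

Lemma test_le_int_snd f (x y : R) : test f ->
  (`|f (x, y)|%:E <= \int[leb]_t (`|'D_(e_ R 1) f (x, t)|)%:E)%E.
Proof.
move=> tf; have tD := test_D 1 tf.
have is0 := test_section_snd OB x tD.
have [yB|yB] := leP y (- B).
  rewrite (test_outbox OB tf) ?normr0//=; last by move=> [_ /andP[]]; rewrite ltNge yB.
  by apply: integral_ge0 => t _; rewrite lee_fin.
have E := FTC_snd x (test_smooth tf) (ltW yB).
have f0 : f (x, - B) = 0.
  by apply: (test_outbox OB tf) => -[_ /andP[]]; rewrite /= ltxx.
rewrite f0 subr0 in E; rewrite -E.
have mI : measurable (`[- B, y]%classic : set (measurableTypeR R)) by exact: measurable_itv.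
have iI : leb.-integrable `[- B, y] (EFin \o (fun t => 'D_(e_ R 1) f (x, t))).
  by apply: integrableS is0.
have := I_abs_le mI iI; rewrite -lee_fin -(I_EFin mI (Int_abs iI)) => h.
apply: (le_trans h); apply: ge0_subset_integral => //.
by apply/measurable_EFinP; exact: Int_meas (Int_abs is0).
Qed.

Lemma test_abs_integrable f : test f -> mu2.-integrable setT (EFin \o (fun z => `|f z|)).
Proof. by move=> tf; apply: Int_abs; exact: (test_integrable OB tf). Qed.

(** The majorant of [g (x, y)] is a function of [x] times a function of [y], so its iterated
    integral factorizes. *)
Lemma tonelli_le_mul (a b g : P -> \bar R) :
  measurable_fun setT a -> (forall z, (0 <= a z)%E) ->
  measurable_fun setT b -> (forall z, (0 <= b z)%E) ->
  measurable_fun setT g -> (forall z, (0 <= g z)%E) ->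
  (forall x y, (g (x, y) <= (\int[leb]_s b (x, s)) * (\int[leb]_t a (t, y)))%E) ->
  (\int[mu2]_z g z <= (\int[mu2]_z a z) * (\int[mu2]_z b z))%E.
Proof.
move=> ma a0 mb b0 mg g0 gab.
pose A := fubini_G leb a; pose Bx := fubini_F leb b.
have A0 y : (0 <= A y)%E by apply: integral_ge0.
have Bx0 x : (0 <= Bx x)%E by apply: integral_ge0.
have mA : measurable_fun setT A by exact: (measurable_fun_fubini_tonelli_G (m1:=leb) a ma a0).
have mB : measurable_fun setT Bx by exact: (measurable_fun_fubini_tonelli_F (m2:=leb) b mb b0).
have IA : (\int[mu2]_z a z = \int[leb]_y A y)%E by exact: (fubini_tonelli2 (m1:=leb) (m2:=leb) a ma a0).
have IB : (\int[mu2]_z b z = \int[leb]_x Bx x)%E by exact: (fubini_tonelli1 (m1:=leb) (m2:=leb) b mb b0).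
have IG : (\int[mu2]_z g z = \int[leb]_x \int[leb]_y g (x, y))%E.
  by exact: (fubini_tonelli1 (m1:=leb) (m2:=leb) g mg g0).
rewrite IG IA IB; apply: (@le_trans _ _ (\int[leb]_x (Bx x * \int[leb]_y A y))%E).
  apply: ge0_le_integral => //.
  - by move=> x _; apply: integral_ge0.
  - exact: (measurable_fun_fubini_tonelli_F (m2:=leb) g mg g0).
  - by apply: emeasurable_funM.
  move=> x _; rewrite -ge0_integralZl//.
  apply: ge0_le_integral => //.
  - exact: (measurableT_comp mg (@pair1_measurable _ _ (measurableTypeR R) (measurableTypeR R) x)).
  - by apply: measurable_funeM.
have kA : (0 <= \int[leb]_y A y)%E by exact: integral_ge0.
under eq_integral do rewrite muleC.
by rewrite ge0_integralZl.
Qed.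

(** The Gagliardo-Nirenberg argument: one factor [|f|] is bounded by the integral of the first
    derivative along the horizontal line, the other by that of the second derivative along the
    vertical line, and the product of these bounds separates the variables. *)
Lemma test_gagliardo f : test f ->
  J (fun z => f z ^+ 2) <= J (fun z => `|'D_(e_ R 0) f z|) * J (fun z => `|'D_(e_ R 1) f z|).
Proof.
move=> tf; have t0 := test_D 0 tf; have t1 := test_D 1 tf.
have i0 := test_abs_integrable t0; have i1 := test_abs_integrable t1.
have tf2 : test (fun z => f z ^+ 2) by exact: test_power.
have i2 := test_integrable OB tf2.
have := @tonelli_le_mul (fun z => (`|'D_(e_ R 0) f z|)%:E) (fun z => (`|'D_(e_ R 1) f z|)%:E)
  (fun z => (f z ^+ 2)%:E).
rewrite (I_EFin measurableT i0) (I_EFin measurableT i1) (I_EFin measurableT i2) -EFinM lee_fin.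
apply.
- by apply/measurable_EFinP; exact: Int_meas i0.
- by move=> z; rewrite lee_fin.
- by apply/measurable_EFinP; exact: Int_meas i1.
- by move=> z; rewrite lee_fin.
- by apply/measurable_EFinP; exact: Int_meas i2.
- by move=> z; rewrite lee_fin sqr_ge0.
- move=> x y; rewrite -real_normK ?num_real// expr2 EFinM.
  by apply: lee_pmul; rewrite ?lee_fin//; [exact: test_le_int_snd|exact: test_le_int_fst].
Qed.

(** The lower limit lies one unit to the left of the box, so that the fundamental theorem applies at
    every [x >= - B], the edge included. This primitive carries the compactness argument of
    [rellich0]. *)
Definition primitive1 w (z : R * R) : R := \int[leb]_(t in `[- B - 1, z.1]) w (t, z.2).

Lemma primitive1_derive w (x y : R) : test w -> - B <= x ->
  is_derive x 1 (fun t => primitive1 w (t, y)) (w (x, y)).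
Proof.
move=> tw xB; have cw : continuous (fun t => w (t, y)).
  by apply: smooth_section_fst; apply: smooth_continuous; exact: test_smooth tw.
have [] := @continuous_FTC1_closed R (fun t => w (t, y)) (- B - 1) x (x + 1).
- by rewrite ltrDl.
- by apply: integrableS (test_section_fst OB y tw).
- by rewrite (lt_le_trans _ xB)// ltrBlDr ltrDl.
- exact: cw.
by move=> h1 h2; apply: DeriveDef; [exact: h1|rewrite -derive1E; exact: h2].
Qed.

(** Along vertical lines [w] is the integral of its second derivative. The primitive is thus a
    pairing of that derivative with the indicator of a rectangle, and weak convergence of the
    derivative gives pointwise convergence of the primitive. *)
Lemma primitive1_rect w (x y : R) : test w -> - B <= y -> - B <= x ->
  primitive1 w (x, y) =
  \int[mu2]_(z in (`[- B - 1, x] `*` `[- B - 1, y])) 'D_(e_ R 1) w z.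
Proof.
move=> tw yB xB; have tD := test_D 1 tw.
pose Q : set P := `[- B - 1, x] `*` `[- B - 1, y].
have mQ : measurable Q by apply: measurableX; exact: measurable_itv.
rewrite [RHS]Rintegral_mkcond -/Q.
have E (t s : R) : (('d_ 1 w) \_ Q) (t, s) =
    ((fun t => (((fun s => 'D_(e_ R 1) w (t, s)) \_ `[- B - 1, y]) s)) \_ `[- B - 1, x]) t.
  rewrite !patchE; have [tx|ntx] := boolP (t \in (`[- B - 1, x]%classic : set R)).
    have [sy|nsy] := boolP (s \in (`[- B - 1, y]%classic : set R)).
      by rewrite ifT//; apply/mem_set; split; apply/set_mem.
    by rewrite ifF//; apply/negbTE; rewrite notin_setE => -[_ /mem_set]; exact/negP.
  by rewrite ifF//; apply/negbTE; rewrite notin_setE => -[/mem_set + _]; exact/negP.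
have mI (c : R) : measurable (`[- B - 1, c]%classic : set (measurableTypeR R)) by exact: measurable_itv.
have iw := test_integrable OB tD.
rewrite test_fubini_fst; last 2 first.
- rewrite -restrict_EFin; apply: (integrable_mkcond _ mQ).1; exact: integrableS iw.
- move=> t; have -> : (fun s => (('d_ 1 w) \_ Q) (t, s)) =
      (if t \in (`[- B - 1, x]%classic : set R) then (fun s => 'D_(e_ R 1) w (t, s)) \_ `[- B - 1, y] else fun=> 0).
    by apply/funext => s; rewrite E patchE; case: ifP.
  case: ifP => _; last exact: integrable0.
  rewrite -restrict_EFin; apply: (integrable_mkcond _ (mI y)).1.
  by apply: integrableS (test_section_snd OB t tD).
rewrite /primitive1 /= Rintegral_mkcond; apply: eq_Rintegral => t _.
rewrite patchE; case: ifPn => tx.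
  have -> : (fun s => (('d_ 1 w) \_ Q) (t, s)) = (fun s => 'D_(e_ R 1) w (t, s)) \_ `[- B - 1, y].
    by apply/funext => s; rewrite E patchE tx.
  rewrite -Rintegral_mkcond FTC_snd//; first last.
  - by rewrite lerBlDr (le_trans yB)// lerDl.
  - exact: test_smooth tw.
  rewrite (test_outbox OB tw (x := (t, - B - 1))) ?subr0//= => -[_ /andP[]].
  by rewrite ltrBrDr ltNge lerDl ler01.
have -> : (fun s => (('d_ 1 w) \_ Q) (t, s)) = fun=> 0.
  by apply/funext => s; rewrite E patchE (negbTE tx).
by rewrite Rintegral_cst// mul0r.
Qed.

Lemma measurable_primitive1 w : test w -> measurable_fun (setT : set P) (primitive1 w).
Proof.
move=> tw.
(* Measurability in the moving end point comes from Tonelli's theorem with a third variable confined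
   to [[- B - 1, x]]. The factors [1] and [-1] produce the positive and negative parts, since
   Tonelli wants nonnegative integrands. *)
pose Q := [set p : P * measurableTypeR R | (- B - 1 <= p.2) && (p.2 <= p.1.1)].
have mQ : measurable Q.
  have -> : Q = (fun p => (- B - 1 <= p.2) && (p.2 <= p.1.1)) @^-1` [set true] by [].
  rewrite -[X in measurable X]setTI; apply: measurable_and => //.
    by apply: measurable_fun_ler.
  by apply: measurable_fun_ler => //; apply: measurableT_comp.
pose F (s : R) (p : P * measurableTypeR R) : \bar R :=
  (Num.max 0 (s * w (p.2, p.1.2)) * \1_Q p)%:E.
have F0 s p : (0 <= F s p)%E.
  by rewrite lee_fin mulr_ge0// le_max lexx.
have mw : measurable_fun setT (fun p : P * measurableTypeR R => w (p.2, p.1.2)).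
  have mw : measurable_fun (setT : set P) w by exact: test_measurable tw measurableT.
  apply: (measurableT_comp mw); apply: measurable_fun_pair => //.
  by apply: measurableT_comp.
have mF s : measurable_fun setT (F s).
  apply/measurable_EFinP; apply: measurable_funM; last exact: measurable_indic.
  by apply: measurable_maxr => //; apply: measurable_funM.
have mI s : measurable_fun setT (fubini_F leb (F s)).
  exact: (measurable_fun_fubini_tonelli_F (m2:=leb) (F s)).
have -> : primitive1 w = (fun z => fine (fubini_F leb (F 1) z) - fine (fubini_F leb (F (-1)) z)).
  apply/funext => -[x y]; rewrite /primitive1 /fubini_F /= /F Rintegral_mkcond.
  have iw := test_section_fst OB y tw.
  have E s : (fun t : R => (Num.max 0 (s * w (t, y)) * \1_Q ((x, y), t))%:E) =
     EFin \o ((fun t => Num.max 0 (s * w (t, y))) \_ `[- B - 1, x]).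
    apply/funext => t /=; rewrite patchE indicE /Q.
    have -> : (((x, y), t) \in [set p : P * measurableTypeR R | (- B - 1 <= p.2) && (p.2 <= p.1.1)]) =
        (t \in (`[- B - 1, x]%classic : set R)).
      by apply/idP/idP => /set_mem /= h; apply/mem_set => //=; rewrite ?in_itv// in h *.
    by case: ifP => _; rewrite ?mulr1 ?mulr0.
  rewrite !E.
  have iM s : leb.-integrable setT (EFin \o ((fun t => Num.max 0 (s * w (t, y))) \_ `[- B - 1, x])).
    have mII : measurable (`[- B - 1, x]%classic : set (measurableTypeR R)) by exact: measurable_itv.
    rewrite -restrict_EFin; apply: (integrable_mkcond _ mII).1; apply: (@integrableS _ _ _ _ setT) => //.
    apply: (@Int_le_pt _ _ _ leb setT measurableT _ (fun t => `|s| * `|w (t, y)|)).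
    - apply: measurable_maxr => //; apply: measurable_funM => //; exact: Int_meas iw.
    - by apply: Int_Z => //; exact: Int_abs.
    - move=> t _; rewrite -normrM; case: (leP 0 (s * w (t, y))) => h.
        by rewrite ger0_norm.
      by rewrite normr0.
  have J1 := I_B measurableT (iM 1) (iM (-1)).
  rewrite /Rintegral in J1; rewrite -J1 /Rintegral; congr fine.
  apply: eq_integral => t _; congr EFin; rewrite !patchE; case: ifP => _; last by rewrite subr0.
  rewrite mul1r mulN1r; case: (leP 0 (w (t, y))) => h.
    by rewrite maxElt ltNge oppr_le0 h /= subr0.
  by rewrite maxElt oppr_gt0 h sub0r opprK.
by apply: measurable_funB; apply: measurableT_comp.
Qed.

Lemma primitive1_bound w z : test w -> Omega z ->
  `|primitive1 w z| <= J (fun z => `|'D_(e_ R 1) w z|).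
Proof.
move=> tw; case: z => x y /OB[/andP[x1 _] /andP[y1 _]] /=; have tD := test_D 1 tw.
rewrite (primitive1_rect tw (ltW y1) (ltW x1)).
have mQ : measurable (`[- B - 1, x] `*` `[- B - 1, y] : set P).
  by apply: measurableX; exact: measurable_itv.
have iQ : mu2.-integrable (`[- B - 1, x] `*` `[- B - 1, y]) (EFin \o ('d_ 1 w)).
  by apply: integrableS (test_integrable OB tD).
apply: le_trans (I_abs_le mQ iQ) _.
have iA := test_abs_integrable tD.
rewrite -lee_fin -(I_EFin measurableT iA) -(I_EFin mQ (Int_abs iQ)).
by apply: ge0_subset_integral => //; apply/measurable_EFinP; exact: Int_meas iA.
Qed.

Lemma test_mul_primitive w f : test w -> test f ->
  mu2.-integrable setT (EFin \o (fun z => f z * primitive1 w z)).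
Proof.
move=> tw tf.
apply: (@Int_le_pt _ _ _ mu2 setT measurableT _ (fun z => J (fun z => `|'D_(e_ R 1) w z|) * `|f z|)).
- by apply: measurable_funM; [exact: test_measurable tf measurableT|exact: measurable_primitive1].
- by apply: Int_Z => //; exact: test_abs_integrable.
- move=> z _; rewrite normrM mulrC; have [Oz|nOz] := pselect (Omega z).
    by rewrite ler_wpM2r//; exact: primitive1_bound.
  by rewrite (test_out tf nOz) normr0 !mulr0.
Qed.

(** On each horizontal line [w] is the derivative of its primitive; integration by parts leaves no
    boundary terms since [w] vanishes at both ends. The [L^2] norm is thereby controlled by a
    derivative, which is merely bounded, and a primitive, which will converge strongly. *)
Lemma test_rellich_identity w : test w ->
  J (fun z => w z ^+ 2) = - J (fun z => 'D_(e_ R 0) w z * primitive1 w z).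
Proof.
move=> tw; have tD := test_D 0 tw; have sw := test_smooth tw.
have tw2 := test_power 1 tw.
have NB : - B < B by rewrite -subr_gt0 opprK addr_gt0.
have i1 := test_mul_primitive tw tD.
have sec y : leb.-integrable setT (EFin \o (fun t => 'D_(e_ R 0) w (t, y) * primitive1 w (t, y))).
  apply: (@Int_le_pt _ _ _ leb setT measurableT _
    (fun t => J (fun z => `|'D_(e_ R 1) w z|) * `|'D_(e_ R 0) w (t, y)|)).
  - apply: measurable_funM; first exact: Int_meas (test_section_fst OB y tD).
    have := measurable_primitive1 tw => h.
    exact: (measurableT_comp h (@pair2_measurable _ _ (measurableTypeR R) (measurableTypeR R) y)).
  - by apply: Int_Z => //; apply: Int_abs => //; exact: (test_section_fst OB y tD).
  - move=> t _; rewrite normrM mulrC; have [Oz|nOz] := pselect (Omega (t, y)).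
      by rewrite ler_wpM2r//; exact: primitive1_bound.
    by rewrite (test_out tD nOz) normr0 !mulr0.
have i1N : mu2.-integrable setT (EFin \o (fun z => - ('D_(e_ R 0) w z * primitive1 w z))).
  exact: (Int_N measurableT i1).
have secN y : leb.-integrable setT (EFin \o (fun t => - ('D_(e_ R 0) w (t, y) * primitive1 w (t, y)))).
  exact: (Int_N measurableT (sec y)).
rewrite -(I_N measurableT i1).
rewrite (test_fubini_snd (test_integrable OB tw2) (fun y => test_section_fst OB y tw2)).
rewrite (test_fubini_snd i1N secN).
apply: eq_Rintegral => y _; rewrite (I_N measurableT (sec y)).
rewrite (@Rintegral_supp _ _ (- B) B); last first.
  move=> t nt; rewrite (test_outbox OB tw) ?expr0n// => -[/andP[h1 h2] _].
  by apply: nt; rewrite !ltW.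
rewrite (@Rintegral_supp _ (fun t => 'D_(e_ R 0) w (t, y) * primitive1 w (t, y)) (- B) B); last first.
  move=> t nt; rewrite (test_outbox OB tD) ?mul0r// => -[/andP[h1 h2] _].
  by apply: nt; rewrite !ltW.
have cw : continuous (fun t => w (t, y)).
  by apply: smooth_section_fst; exact: smooth_continuous.
have cD : continuous (fun t => 'D_(e_ R 0) w (t, y)).
  by apply: (@smooth_section_fst _ ('d_ 0 w)); apply: smooth_continuous; exact: smooth_D.
have dw (t : R) : is_derive t 1 (fun t => w (t, y)) ('D_(e_ R 0) w (t, y)).
  by apply: is_derive_fst_section; exact: smooth_is_derive.
have dv (t : R) : - B <= t -> is_derive t 1 (fun t => primitive1 w (t, y)) (w (t, y)).
  exact: primitive1_derive.
have cv (t : R) : - B <= t -> {for t, continuous (fun t => primitive1 w (t, y))}.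
  by move=> tB; apply: differentiable_continuous; apply/derivable1_diffP; have [] := dv t tB.
have := @Rintegration_by_parts R (fun t => w (t, y)) (fun t => primitive1 w (t, y))
  (fun t => 'D_(e_ R 0) w (t, y)) (fun t => w (t, y)) (- B) B NB.
have wB : w (B, y) = 0 by apply: (test_outbox OB tw) => -[/andP[_]]; rewrite /= ltxx.
have wNB : w (- B, y) = 0 by apply: (test_outbox OB tw) => -[/andP[]]; rewrite /= ltxx.
rewrite wB wNB !mul0r subr0 sub0r => <-.
- by apply: eq_Rintegral => t _; rewrite expr2.
- exact: continuous_subspaceT.
- split; first by move=> t _; have [] := dw t.
  + by apply: cvg_at_right_filter; exact: cw.
  + by apply: cvg_at_left_filter; exact: cw.
- by move=> t _; rewrite derive1E; have [_ ->] := dw t.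
- exact: continuous_subspaceT.
- split.
  + by move=> t; rewrite in_itv/= => /andP[/ltW h _]; have [] := dv t h.
  + by apply: cvg_at_right_filter; exact: cv.
  + by apply: cvg_at_left_filter; apply: cv; exact: ltW.
- by move=> t; rewrite in_itv/= => /andP[/ltW h _]; rewrite derive1E; have [_ ->] := dv t h.
Qed.

End TestInequalities2.

(** * Signs and equalities detected by test functions *)

Section FundamentalLemma.
Variable R : realType.
Local Notation P := (measurableTypeR R * measurableTypeR R)%type.
Local Notation mu2 := (leb2 R).
Variable (Omega : set (R * R)).

Lemma mul01_dist (a b c d : R) : 0 <= a <= 1 -> 0 <= d <= 1 ->
  `|a * b - c * d| <= `|a - c| + `|b - d|.
Proof.
move=> /andP[a0 a1] /andP[d0 d1].
have -> : a * b - c * d = (a - c) * d + a * (b - d) by ring.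
apply: le_trans (ler_normD _ _) _; rewrite !normrM (ger0_norm d0) (ger0_norm a0).
by apply: lerD; [rewrite ler_piMr|rewrite ler_piMl].
Qed.

Definition obox (a b c d : R) : set P := [set x | (a < x.1 < b) && (c < x.2 < d)].
Definition cbox (a b c d : R) : set P := [set x | (a <= x.1 <= b) && (c <= x.2 <= d)].

Lemma oboxE a b c d : obox a b c d = `]a, b[%classic `*` `]c, d[%classic.
Proof.
by apply/seteqP; split => x /=; rewrite /obox /= !in_itv/=; [move=> /andP|move=> [-> ->]].
Qed.

Lemma cboxE a b c d : cbox a b c d = `[a, b]%classic `*` `[c, d]%classic.
Proof.
by apply/seteqP; split => x /=; rewrite /cbox /= !in_itv/=; [move=> /andP|move=> [-> ->]].
Qed.

Lemma measurable_obox a b c d : measurable (obox a b c d).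
Proof. by rewrite oboxE; apply: measurableX; exact: measurable_itv. Qed.

Lemma measurable_cbox a b c d : measurable (cbox a b c d).
Proof. by rewrite cboxE; apply: measurableX; exact: measurable_itv. Qed.

Section Box.
Variables (a1 b1 a2 b2 : R).
Local Notation Q := (cbox a1 b1 a2 b2).
Local Notation Qo := (obox a1 b1 a2 b2).
Hypothesis QO : Q `<=` Omega.
Variable h : R * R -> R.
Hypothesis ih : mu2.-integrable Q (EFin \o h).
Hypothesis h0 : forall x, 0 <= h x.
Let mQ : measurable Q := measurable_cbox a1 b1 a2 b2.
Let mQo : measurable Qo := measurable_obox a1 b1 a2 b2.

Implicit Types (phi psi eta : R * R -> R) (A C D : set P).

Definition ind (A : set P) (x : R * R) : R := \1_(A `&` Qo) x.

Definition err (phi : R * R -> R) (A : set P) : R :=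
  \int[mu2]_(x in Q) (h x * `|phi x - ind A x|).

Definition cutoff (phi : R * R -> R) : Prop :=
  [/\ test_function Omega phi, forall x, 0 <= phi x <= 1 & forall x, ~ Qo x -> phi x = 0].

(** The weight [h] inside [err] will be [|g|] for the function [g] under test, so the approximation
    is exactly the one that pairings with [g] can see. Approximable sets form a sigma-algebra
    containing the boxes, hence all Borel sets. *)
Definition approximable (A : set P) : Prop :=
  measurable A /\ forall e : R, 0 < e -> exists2 phi, cutoff phi & err phi A <= e.

Lemma ind01 A x : 0 <= ind A x <= 1.
Proof. by rewrite /ind indicE; case: (_ \in _); rewrite ?ler01 ?lexx. Qed.

Lemma cutoff01 phi : cutoff phi -> forall x, 0 <= phi x <= 1. Proof. by case. Qed.

Lemma cutoff_meas phi : cutoff phi -> measurable_fun Q phi.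
Proof. by move=> [tf _ _]; exact: test_measurable tf mQ. Qed.

Lemma measurable_ind A : measurable A -> measurable_fun Q (ind A).
Proof. by move=> mA; apply: measurable_indic; exact: measurableI. Qed.

Lemma dist01 (a b : R) : 0 <= a <= 1 -> 0 <= b <= 1 -> `|a - b| <= 1.
Proof. by move=> /andP[? ?] /andP[? ?]; rewrite ler_norml; apply/andP; split; lra. Qed.

Lemma err_int phi A : measurable_fun Q phi -> (forall x, 0 <= phi x <= 1) -> measurable A ->
  mu2.-integrable Q (EFin \o (fun x => h x * `|phi x - ind A x|)).
Proof.
move=> mf f01 mA.
have mhh : measurable_fun Q h by exact: Int_meas ih.
have m1 := measurable_ind mA.
apply: (Int_le_pt mQ _ ih).
  by apply: measurable_funM => //; apply: measurableT_comp => //; exact: measurable_funB.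
move=> x _; rewrite normrM normr_id (ger0_norm (h0 x)) ler_piMr//.
exact: dist01 (f01 x) (ind01 A x).
Qed.

Lemma cutoff_diff phi psi : cutoff phi -> cutoff psi -> cutoff (fun x => phi x * (1 - psi x)).
Proof.
move=> [tf f01 f0] [tg g01 g0]; split.
- have -> : (fun x => phi x * (1 - psi x)) = (fun x => (1 + -1 * psi x) * phi x).
    by apply/funext => x; ring.
  apply: test_mulr => //; apply: smoothDD; first exact: smooth_cst.
  by apply: smoothM; [exact: smooth_cst|exact: test_smooth tg].
- move=> x; have /andP[p0 p1] := f01 x; have /andP[q0 q1] := g01 x.
  by rewrite mulr_ge0 ?subr_ge0//= mulr_ile1 ?subr_ge0// gerBl.
- by move=> x /f0 ->; rewrite mul0r.
Qed.

Lemma cutoff_union phi psi : cutoff phi -> cutoff psi ->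
  cutoff (fun x => phi x + psi x * (1 - phi x)).
Proof.
move=> cf cg; have [tf f01 f0] := cf; have [tg g01 g0] := cg.
have [th _ _] := cutoff_diff cg cf; split.
- exact: test_add.
- move=> x; have /andP[p0 p1] := f01 x; have /andP[q0 q1] := g01 x.
  have p2 : 0 <= 1 - phi x by rewrite subr_ge0.
  have k1 : 0 <= psi x * (1 - phi x) by exact: mulr_ge0.
  have k2 : psi x * (1 - phi x) <= 1 - phi x by rewrite ler_piMl.
  by apply/andP; split; lra.
- by move=> x nx; rewrite f0// g0// mul0r addr0.
Qed.

Lemma err_le2 (phi psi eta : R * R -> R) A C D : cutoff phi -> cutoff psi -> cutoff eta ->
  measurable A -> measurable C -> measurable D ->
  (forall x, `|eta x - ind D x| <= `|phi x - ind A x| + `|psi x - ind C x|) ->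
  err eta D <= err phi A + err psi C.
Proof.
move=> cp cs ce mA mC mD H.
have i1 := err_int (cutoff_meas cp) (cutoff01 cp) mA.
have i2 := err_int (cutoff_meas cs) (cutoff01 cs) mC.
have i3 := err_int (cutoff_meas ce) (cutoff01 ce) mD.
rewrite /err -(I_D mQ i1 i2); apply: (I_le mQ i3); first exact: (Int_D mQ i1 i2).
by apply: aeW => x _; rewrite -mulrDr ler_wpM2l.
Qed.

(** A bump [be] with values in [(0, 1)] on the box is sharpened to [1 - (1 - be)^n], written as a
    recursion so that [cutoff_union] applies; dominated convergence with majorant [h] concludes. *)
Lemma approx_box (c1 d1 c2 d2 : R) (A : set P) : a1 <= c1 -> d1 <= b1 -> a2 <= c2 -> d2 <= b2 ->
  measurable A -> A `&` Qo = obox c1 d1 c2 d2 -> approximable A.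
Proof.
move=> ac1 db1 ac2 db2 mA AE; split=> // e e0.
pose be := box_bump c1 d1 c2 d2.
have be0 x : ~ obox c1 d1 c2 d2 x -> be x = 0.
  by move=> nx; apply: box_bump_eq0 => -[h1 h2]; apply: nx; rewrite /obox /= h1 h2.
have cb : cutoff be.
  split.
  - apply: test_box_bump => -[x y] [] /=; rewrite !in_itv/= => /andP[x1 x2] /andP[y1 y2].
    apply: QO; rewrite /cbox /=.
    by rewrite (le_trans ac1 x1) (le_trans x2 db1) (le_trans ac2 y1) (le_trans y2 db2).
  - by move=> x; have /andP[p0 /ltW p1] := box_bump_bounds c1 d1 c2 d2 x; rewrite /be p0 p1.
  - move=> x nx; apply: be0; rewrite -AE => -[_]; exact: nx.
pose phi := fix phi n : R * R -> R :=
  if n is n'.+1 then (fun x => phi n' x + be x * (1 - phi n' x)) else fun=> 0.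
have cphi n : cutoff (phi n).
  elim: n => [|n IH] /=; last exact: cutoff_union.
  by split; [exact: test_0|move=> x; rewrite lexx ler01|].
have be01 x : 0 <= 1 - be x.
  by rewrite subr_ge0; have /andP[_ /ltW] := box_bump_bounds c1 d1 c2 d2 x.
have E n x : `|phi n x - ind A x| = (1 - be x) ^+ n * ind A x.
  rewrite /ind AE indicE; have [Ax|nAx] := pselect (obox c1 d1 c2 d2 x).
    rewrite mem_set//= mulr1.
    have -> : phi n x - 1 = - (1 - be x) ^+ n.
      elim: n => [|n IH] /=; first by rewrite sub0r expr0.
      by rewrite exprS -mulrN -IH; ring.
    by rewrite normrN ger0_norm// exprn_ge0.
  rewrite memNset// mulr0 subr0; apply/eqP; rewrite normr_eq0; apply/eqP.
  by elim: n => [//|n IH] /=; rewrite IH be0// mul0r addr0.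
have cvx x : (fun n => h x * `|phi n x - ind A x|) @ \oo --> (0 : R).
  rewrite -(mulr0 (h x)); apply: cvgM; first exact: cvg_cst.
  have -> : (fun n => `|phi n x - ind A x|) = (fun n => (1 - be x) ^+ n * ind A x).
    by apply/funext => n; rewrite E.
  have [Ax|nAx] := pselect (obox c1 d1 c2 d2 x); last first.
    have -> : ind A x = 0 by rewrite /ind AE indicE memNset.
    by under eq_fun do rewrite mulr0; exact: cvg_cst.
  rewrite -(mul0r (ind A x)); apply: cvgM; last exact: cvg_cst.
  apply: cvg_expr; rewrite ger0_norm// gtrBl.
  by move: Ax => /andP[]; exact: box_bump_gt0.
have [|||||_ _ cv] := @dct_real _ _ _ mu2 Q mQ (fun n x => h x * `|phi n x - ind A x|) (fun=> 0) h.
- by move=> n; exact: Int_meas (err_int (cutoff_meas (cphi n)) (cutoff01 (cphi n)) mA).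
- exact: measurable_cst.
- by apply: aeW => x _; exact: cvx.
- exact: ih.
- move=> n; apply: aeW => x _; rewrite normrM normr_id (ger0_norm (h0 x)) ler_piMr//.
  exact: dist01 (cutoff01 (cphi n) x) (ind01 A x).
rewrite Rintegral_cst// mul0r in cv.
have [N NP] := (cvg_epsP _ _).1 cv _ e0.
exists (phi N) => //; have := NP _ (leqnn N); rewrite subr0; exact: le_trans (ler_norm _).
Qed.

Lemma approxT : approximable setT.
Proof. by apply: (@approx_box a1 b1 a2 b2) => //; rewrite setTI. Qed.

Lemma approxC A : approximable A -> approximable (~` A).
Proof.
move=> [mA hA]; split; first exact: measurableC.
have [_ hT] := approxT.
move=> e e0; have e2 : 0 < e / 2 by rewrite divr_gt0.
have [phi cphi hphi] := hA _ e2; have [psi cpsi hpsi] := hT _ e2.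
have cd := cutoff_diff cpsi cphi.
exists (fun x => psi x * (1 - phi x)) => //.
apply: (@le_trans _ _ (err psi setT + err phi A)); last by lra.
apply: err_le2 => //; first exact: measurableC.
move=> x; have k1 := cutoff01 cpsi x; have /andP[k2 k3] := ind01 A x.
have -> : ind (~` A) x = ind setT x * (1 - ind A x).
  rewrite /ind setTI !indicE !in_setI in_setC.
  by case: (x \in Qo); case: (x \in A); rewrite /= ?mul0r ?mul1r ?subr0 ?subrr.
apply: le_trans (mul01_dist _ _ k1 _) _; first by rewrite subr_ge0 k3 gerBl.
have -> : 1 - phi x - (1 - ind A x) = - (phi x - ind A x) by ring.
by rewrite normrN.
Qed.

Lemma approxU A C : approximable A -> approximable C -> approximable (A `|` C).
Proof.
move=> [mA hA] [mC hC]; split; first exact: measurableU.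
move=> e e0; have e2 : 0 < e / 2 by rewrite divr_gt0.
have [phi cphi hphi] := hA _ e2; have [psi cpsi hpsi] := hC _ e2.
have cd := cutoff_union cphi cpsi.
exists (fun x => phi x + psi x * (1 - phi x)) => //.
apply: (@le_trans _ _ (err phi A + err psi C)); last by lra.
apply: err_le2 => //; first exact: measurableU.
move=> x; have /andP[q0 q1] := cutoff01 cphi x; have /andP[k2 k3] := ind01 C x.
have -> : ind (A `|` C) x = 1 - (1 - ind A x) * (1 - ind C x).
  rewrite /ind !indicE !in_setI in_setU.
  by case: (x \in Qo); case: (x \in A); case: (x \in C); rewrite /= ?subr0 ?subrr ?mul0r ?mulr0 ?mul1r ?subr0 ?subrr.
have -> : phi x + psi x * (1 - phi x) - (1 - (1 - ind A x) * (1 - ind C x)) =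
   - ((1 - phi x) * (1 - psi x) - (1 - ind A x) * (1 - ind C x)) by ring.
rewrite normrN; apply: le_trans (mul01_dist _ _ _ _) _.
- by rewrite subr_ge0 q1 gerBl.
- by rewrite subr_ge0 k3 gerBl.
have -> : 1 - phi x - (1 - ind A x) = - (phi x - ind A x) by ring.
have -> : 1 - psi x - (1 - ind C x) = - (psi x - ind C x) by ring.
by rewrite !normrN.
Qed.

Lemma approx_bigcup (A : nat -> set P) : (forall n, approximable (A n)) ->
  approximable (\bigcup_n A n).
Proof.
move=> hA; have mU : measurable (\bigcup_n A n).
  by apply: bigcupT_measurable => n; case: (hA n).
split=> // e e0; have e2 : 0 < e / 2 by rewrite divr_gt0.
pose C := fix C n : set P := if n is n'.+1 then C n' `|` A n' else set0.
have aC n : approximable (C n).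
  elim: n => [|n IH] /=; last exact: approxU.
  by have := approxC approxT; rewrite setCT.
have CE n x : C n x <-> exists2 k, (k < n)%N & A k x.
  elim: n => [|n IH] /=; first by split => // -[].
  split=> [[/IH[k kn Ak]|An]|[k]].
  - by exists k => //; exact: ltnW.
  - by exists n.
  - by rewrite ltnS leq_eqVlt => /predU1P[->|kn] Ak; [right|left; apply/IH; exists k].
have mC n : measurable (C n) by case: (aC n).
have [|||||_ _ cv] := @dct_real _ _ _ mu2 Q mQ (fun n x => h x * `|ind (C n) x - ind (\bigcup_n A n) x|) (fun=> 0) h.
- move=> n; apply: Int_meas; apply: err_int => //; [exact: measurable_ind|exact: ind01].
- exact: measurable_cst.
- apply: aeW => x _; rewrite -(mulr0 (h x)); apply: cvgM; first exact: cvg_cst.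
  have [[k _ Ak]|nU] := pselect ((\bigcup_n A n) x).
    apply: cvg_near_cst; exists k.+1 => // n /= kn.
    have Cn : C n x by apply/CE; exists k.
    have Ux : (\bigcup_n A n) x by exists k.
    by rewrite /ind !indicE !in_setI (mem_set Cn) (mem_set Ux) subrr normr0.
  apply: cvg_near_cst; apply: nearW => n.
  have nC : ~ C n x by move=> /CE[k _ Ak]; apply: nU; exists k.
  by rewrite /ind !indicE !in_setI (memNset nC) (memNset nU) subrr normr0.
- exact: ih.
- move=> n; apply: aeW => x _; rewrite normrM normr_id (ger0_norm (h0 x)) ler_piMr//.
  exact: dist01 (ind01 _ x) (ind01 _ x).
rewrite Rintegral_cst// mul0r in cv.
have [N NP] := (cvg_epsP _ _).1 cv _ e2.
have {NP} NP := le_trans (ler_norm _) (NP _ (leqnn N)); rewrite subr0 in NP.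
have [_ /(_ _ e2)[phi cphi hphi]] := aC N.
exists phi => //.
have i1 := err_int (cutoff_meas cphi) (cutoff01 cphi) (mC N).
have i2 := err_int (measurable_ind (mC N)) (ind01 (C N)) mU.
have i3 := err_int (cutoff_meas cphi) (cutoff01 cphi) mU.
apply: (@le_trans _ _ (err phi (C N) + err (ind (C N)) (\bigcup_n A n))); last first.
  by rewrite /err; move: NP hphi; rewrite /err; lra.
rewrite /err -(I_D mQ i1 i2); apply: (I_le mQ i3); first exact: (Int_D mQ i1 i2).
apply: aeW => x _; rewrite -mulrDr ler_wpM2l//.
by rewrite -[X in `|X|](subrKA (ind (C N) x)); exact: ler_normD.
Qed.

Lemma approximable_sigma_algebra : sigma_algebra setT approximable.
Proof.
split.
- by have := approxC approxT; rewrite setCT.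
- by move=> A aA; rewrite setTD; exact: approxC.
- by move=> F aF; exact: approx_bigcup.
Qed.

Lemma approx_preimage (p : P -> measurableTypeR R) :
  (forall c d : R, approximable (p @^-1` `]c, d[%classic)) ->
  forall I, measurable I -> approximable (p @^-1` I).
Proof.
move=> hp I mI; have [s0 sC sU] := approximable_sigma_algebra.
pose G := [set I : set (measurableTypeR R) | approximable (p @^-1` I)].
have sub : <<s @RGenOpens.G R >> `<=` G.
  apply: smallest_sub; first split.
  - by rewrite /G /= preimage_set0.
  - by move=> A /= GA; rewrite /G /= setTD preimage_setC -setTD; exact: sC.
  - by move=> F GF; rewrite /G /= preimage_bigcup; exact: sU.
  - by move=> _ [c [d ->]]; exact: hp.
apply: sub; have := RGenOpens.measurableE R => E.
have mI' : (@ocitv R).-sigma.-measurable I by exact: mI.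
by rewrite E in mI'.
Qed.

Lemma approx_measurable A : measurable A -> approximable A.
Proof.
move=> mA; apply: (smallest_sub (C := sigma_algebra setT)
  (G := preimage_set_system setT (@fst R R) (@measurable _ (measurableTypeR R)) `|`
    preimage_set_system setT (@snd R R) (@measurable _ (measurableTypeR R)))).
- exact: approximable_sigma_algebra.
- rewrite subUset; split => _ [I mI <-]; rewrite setTI.
  + apply: (@approx_preimage fst) mI => c d.
    apply: (@approx_box (Num.max a1 c) (Num.min b1 d) a2 b2) => //.
    * by rewrite le_max lexx.
    * by rewrite ge_min lexx.
    * have -> : fst @^-1` `]c, d[%classic = `]c, d[%classic `*` setT :> set P.
        by apply/seteqP; split => x //= [].
      by apply: measurableX => //; exact: measurable_itv.
    * apply/seteqP; split => x; rewrite /obox /= in_itv/= gt_max lt_min.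
        by move=> [/andP[-> ->] /andP[/andP[-> ->] ->]].
      by move=> /andP[/andP[/andP[-> ->] /andP[-> ->]] ->].
  + apply: (@approx_preimage snd) mI => c d.
    apply: (@approx_box a1 b1 (Num.max a2 c) (Num.min b2 d)) => //.
    * by rewrite le_max lexx.
    * by rewrite ge_min lexx.
    * have -> : snd @^-1` `]c, d[%classic = setT `*` `]c, d[%classic :> set P.
        by apply/seteqP; split => x //= [].
      by apply: measurableX => //; exact: measurable_itv.
    * apply/seteqP; split => x; rewrite /obox /= in_itv/= gt_max lt_min.
        by move=> [/andP[-> ->] /andP[-> /andP[-> ->]]].
      by move=> /andP[-> /andP[/andP[-> ->] /andP[-> ->]]].
- exact: mA.
Qed.
End Box.

(** Cutoffs approximate the indicator of the set where [g < 0]. The integral of [g] over that set is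
    nonpositive by its choice and nonnegative as a limit, so [g] times the indicator vanishes
    a.e. *)
Lemma nonneg_of_cutoff (a1 b1 a2 b2 : R) (g : R * R -> R) :
  cbox a1 b1 a2 b2 `<=` Omega ->
  mu2.-integrable (cbox a1 b1 a2 b2) (EFin \o g) ->
  (forall phi, cutoff a1 b1 a2 b2 phi ->
     0 <= \int[mu2]_(x in cbox a1 b1 a2 b2) (g x * phi x)) ->
  {ae mu2, forall x, obox a1 b1 a2 b2 x -> 0 <= g x}.
Proof.
set Q := cbox _ _ _ _; set Qo := obox _ _ _ _ => QO ig gphi.
have mQ : measurable Q by exact: measurable_cbox.
have mg := Int_meas ig; have iag := Int_abs ig.
pose A : set P := Q `&` g @^-1` `]-oo, 0[%classic.
have mA : measurable A by apply: mg => //; exact: measurable_itv.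
have QoQ : Qo `<=` Q.
  move=> x; rewrite /Qo /Q /obox /cbox /= => /andP[/andP[? ?] /andP[? ?]].
  by rewrite !ltW.
pose iA := ind a1 b1 a2 b2 A.
have miA : measurable_fun Q iA by exact: measurable_ind.
have iA01 x : 0 <= iA x <= 1 by exact: ind01.
have bnd (f : R * R -> R) : measurable_fun Q f -> (forall x, 0 <= f x <= 1) ->
    mu2.-integrable Q (EFin \o (fun x => g x * f x)).
  move=> mf f01; apply: (Int_le_pt mQ _ iag); first exact: measurable_funM.
  move=> x _; rewrite normrM ler_piMr//; have /andP[p0 p1] := f01 x; by rewrite ger0_norm.
have igA := bnd _ miA iA01.
have npos x : g x * iA x <= 0.
  rewrite /iA /ind indicE; have [Ax|nAx] := pselect ((A `&` Qo) x).
    by rewrite (mem_set Ax) mulr1 ltW//; case: Ax => -[_]; rewrite /= in_itv.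
  by rewrite (memNset nAx) mulr0.
have ge : 0 <= \int[mu2]_(x in Q) (g x * iA x).
  rewrite leNgt; apply/negP => lt0.
  pose e := - (\int[mu2]_(x in Q) (g x * iA x)) / 2.
  have e0 : 0 < e by rewrite divr_gt0// oppr_gt0.
  have [_ /(_ e e0)[phi cphi hphi]] := approx_measurable QO iag (fun x => normr_ge0 (g x)) mA.
  have mphi : measurable_fun Q phi by exact: cutoff_meas cphi.
  have phi01 := cutoff01 cphi.
  have igp := bnd _ mphi phi01.
  have := gphi _ cphi.
  have : \int[mu2]_(x in Q) (g x * phi x) - \int[mu2]_(x in Q) (g x * iA x) <= e.
    rewrite -I_B//; apply: le_trans hphi; rewrite /err; apply: I_le => //.
    - exact: Int_B.
    - by apply: err_int => //; exact: mA.
    apply: aeW => x _; rewrite -mulrBr -normrM; exact: ler_norm.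
  by rewrite /e; lra.
have int0 : (\int[mu2]_(x in Q) `|(g x * iA x)%:E| = 0)%E.
  have iN := Int_N mQ igA.
  transitivity (\int[mu2]_(x in Q) (- (g x * iA x))%:E)%E.
    by apply: eq_integral => x _; rewrite /= ler0_norm.
  rewrite (I_EFin mQ iN) (I_N mQ igA); congr EFin; apply/eqP; rewrite eq_le oppr_le0 ge /=.
  have := I_ge0_ae mQ iN; rewrite (I_N mQ igA); apply.
  by apply: aeW => x _; rewrite oppr_ge0.
have := (ae_eq_integral_abs mu2 mQ (measurable_int _ igA)).1 int0.
apply: aeS => x /= hx Qox; have := hx (QoQ _ Qox) => -[].
rewrite leNgt => g0; apply/negP => gx; move: g0.
rewrite /iA /ind indicE mem_set ?mulr1; last first.
  by split => //; split; [exact: QoQ|rewrite /= in_itv/=].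
by move=> g0; rewrite g0 ltxx in gx.
Qed.

(** A sign version of the fundamental lemma of the calculus of variations: countably many rational
    boxes cover [Omega], so the exceptional null sets can be united. Uniqueness of weak derivatives
    and the passage of inequalities to weak limits rest on it. *)
Theorem nonneg_of_test (g : R * R -> R) : open Omega -> loc_integrable Omega g ->
  (forall phi, test_function Omega phi -> (forall x, 0 <= phi x) -> 0 <= ip Omega g phi) ->
  {ae mu2, forall x, Omega x -> 0 <= g x}.
Proof.
move=> oO lg gphi.
pose cb (q : rat * rat * (rat * rat)) : set P :=
  cbox (ratr q.1.1) (ratr q.1.2) (ratr q.2.1) (ratr q.2.2).
pose ob (q : rat * rat * (rat * rat)) : set P :=
  obox (ratr q.1.1) (ratr q.1.2) (ratr q.2.1) (ratr q.2.2).
have key q : {ae mu2, forall x, cb q `<=` Omega -> ob q x -> 0 <= g x}.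
  have [sub|nsub] := pselect (cb q `<=` Omega); last by apply: aeW.
  have cK : compact (cb q).
    by rewrite /cb cboxE; apply: compact_setX; exact: segment_compact.
  have mcb : measurable (cb q) by exact: measurable_cbox.
  suff h : {ae mu2, forall x, ob q x -> 0 <= g x} by apply: aeS h => x h _; exact: h.
  apply: (nonneg_of_cutoff sub (lg _ cK sub)) => phi [tp p01 p0].
  have pos x : 0 <= phi x by have /andP[] := p01 x.
  have := gphi _ tp pos; rewrite /ip.
  suff -> : \int[mu2]_(x in Omega) (g x * phi x) =
    \int[mu2]_(x in cb q) (g x * phi x) by [].
  rewrite Rintegral_mkcond [RHS]Rintegral_mkcond.
  apply: eq_Rintegral => x _; rewrite !patchE.
  have [xq|nq] := pselect (ob q x).
    have xc : cb q x.
      move: xq; rewrite /ob /cb /obox /cbox /= => /andP[/andP[? ?] /andP[? ?]].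
      by rewrite !ltW.
    by rewrite (mem_set xc) (mem_set (sub _ xc)).
  by rewrite (p0 _ nq) mulr0; case: ifP; case: ifP.
pose F n x := if unpickle n is Some q then cb q `<=` Omega -> ob q x -> 0 <= g x else True.
have aF n : {ae mu2, forall x, F n x}.
  by rewrite /F; case: unpickle => [q|]; [exact: key|exact: aeW].
apply: aeS (ae_foralln aF) => -[x y] hF Oxy.
have [e /= e0 eO] : exists2 e : R, 0 < e & ball (x, y) e `<=` Omega.
  by apply/nbhs_ballP; apply: open_nbhs_nbhs.
have xe : x - e < x by rewrite ltrBlDr ltrDl.
have ex : x < x + e by rewrite ltrDl.
have ye : y - e < y by rewrite ltrBlDr ltrDl.
have ey : y < y + e by rewrite ltrDl.
have [q1 /[!in_itv]/= /andP[s1 s2]] := rat_in_itvoo xe.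
have [q2 /[!in_itv]/= /andP[t1 t2]] := rat_in_itvoo ex.
have [q3 /[!in_itv]/= /andP[s3 s4]] := rat_in_itvoo ye.
have [q4 /[!in_itv]/= /andP[t3 t4]] := rat_in_itvoo ey.
have := hF (pickle (q1, q2, (q3, q4))); rewrite /F pickleK; apply.
  move=> [s t]; rewrite /cb /cbox /= => /andP[/andP[k1 k2] /andP[k3 k4]]; apply: eO; split => /=.
    by rewrite /ball /= ltr_norml; apply/andP; split; lra.
  by rewrite /ball /= ltr_norml; apply/andP; split; lra.
by rewrite /ob /obox /= s2 t1 s4 t3.
Qed.

End FundamentalLemma.

Lemma powR_seq_cvg0 (R : realType) (a : nat -> R) (r : R) : 0 < r -> (forall n, 0 <= a n) ->
  a @ \oo --> 0 -> (fun n => a n `^ r) @ \oo --> 0.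
Proof.
move=> r0 a0 /cvg_epsP ca; apply/cvg_epsP => e e0.
have d0 : 0 < e `^ r^-1 by rewrite powR_gt0.
have [N NP] := ca _ d0; exists N => n Nn; have := NP n Nn.
rewrite !subr0 ger0_norm// ger0_norm ?powR_ge0// => h.
have -> : e = (e `^ r^-1) `^ r by rewrite -powRrM mulVf ?gt_eqF// powRr1// ltW.
by apply: ge0_ler_powR; rewrite ?nnegrE ?powR_ge0// ltW.
Qed.

(** * Lebesgue norms on the domain expressed through real integrals *)

Section LpPlane.
Variable R : realType.
Local Notation P := (measurableTypeR R * measurableTypeR R)%type.
Local Notation mu2 := (leb2 R).
Variable (Omega : set (R * R)).
Hypothesis mO : measurable (Omega : set P).
Local Notation I f := (\int[mu2]_(x in Omega) f x)%R.
Local Notation Int f := (mu2.-integrable Omega (EFin \o f)).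
Implicit Types (f g u v : R * R -> R) (s : R).

Lemma measurable_powR_abs f s (D : set P) : measurable_fun D f ->
  measurable_fun D (fun x => `|f x| `^ s).
Proof.
move=> mf; apply: (measurableT_comp (measurable_powR s)).
exact: measurableT_comp.
Qed.

Lemma powR_Lpnorm f s : s != 0 ->
  (Lpnorm Omega s%:E f `^ s = \int[mu2]_(x in Omega) (`|f x| `^ s)%:E)%E.
Proof.
move=> s0; rewrite /Lpnorm poweR_Lnorm// [RHS]integral_mkcond.
apply: eq_integral => x _; rewrite /= !patchE; case: ifPn => // _.
by rewrite /= normr0 powR0.
Qed.

Lemma LpnormE f s : 0 < s -> Int (fun x => `|f x| `^ s) ->
  Lpnorm Omega s%:E f = (I (fun x => `|f x| `^ s) `^ s^-1)%:E.
Proof.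
move=> s0 If; have := @powR_Lpnorm f s; rewrite gt_eqF// => /(_ isT) E.
have : ((Lpnorm Omega s%:E f `^ s) `^ s^-1 = Lpnorm Omega s%:E f)%E.
  by rewrite -poweRrM divff ?gt_eqF// poweRe1// Lnorm_ge0.
by rewrite E (I_EFin mO If) poweR_EFin => <-.
Qed.

Lemma LpP f s : 0 < s ->
  Lp Omega s%:E f <-> measurable_fun Omega f /\ Int (fun x => `|f x| `^ s).
Proof.
move=> s0; rewrite /Lp; split.
  rewrite inE => /andP[]; rewrite !inE /= => m fin.
  have mf : measurable_fun Omega f by apply/(measurable_restrictT _ mO).
  split=> //; apply/integrableP; split; first by apply/measurable_EFinP; exact: measurable_powR_abs.
  under eq_integral do rewrite /= ger0_norm ?powR_ge0//.
  rewrite -powR_Lpnorm ?gt_eqF//; exact: poweR_lty.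
move=> [mf If]; rewrite inE; apply/andP; split; rewrite !inE /=.
  exact/(measurable_restrictT _ mO).
by rewrite /finite_norm -/(Lpnorm _ _ _) LpnormE// ltry.
Qed.

Lemma powR2_sq (t : R) : `|t| `^ 2 = t ^+ 2.
Proof. by rewrite powR_mulrn// real_normK ?num_real. Qed.

Lemma Lp2P f : Lp Omega 2%:E f <-> L2 mu2 Omega f.
Proof.
rewrite LpP// /L2; have -> // : (fun x => `|f x| `^ 2) = (fun x => f x ^+ 2).
by apply/funext => x; rewrite powR2_sq.
Qed.

Lemma Lpnorm2E f : L2 mu2 Omega f ->
  Lpnorm Omega 2%:E f = (Num.sqrt (I (fun x => f x ^+ 2)))%:E.
Proof.
move=> [mf If]; have E : (fun x => `|f x| `^ 2) = (fun x => f x ^+ 2).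
  by apply/funext => x; rewrite powR2_sq.
rewrite LpnormE ?E// powR12_sqrt//.
by apply: I_ge0 => x _; exact: sqr_ge0.
Qed.

Lemma Lpnorm_ae f g p : measurable_fun Omega f -> measurable_fun Omega g ->
  {ae mu2, forall x, Omega x -> f x = g x} -> 0 < p -> Lpnorm Omega p%:E f = Lpnorm Omega p%:E g.
Proof.
move=> mf mg fg p0.
have E : (Lpnorm Omega p%:E f `^ p = Lpnorm Omega p%:E g `^ p)%E.
  have p0' : p != 0 by rewrite gt_eqF.
  rewrite (powR_Lpnorm f p0') (powR_Lpnorm g p0'); apply: ae_eq_integral => //.
  - by apply/measurable_EFinP; exact: measurable_powR_abs.
  - by apply/measurable_EFinP; exact: measurable_powR_abs.
  - by apply: aeS fg => x h Ox /=; rewrite h.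
have inv (h : R * R -> R) : ((Lpnorm Omega p%:E h `^ p) `^ p^-1 = Lpnorm Omega p%:E h)%E.
  by rewrite -poweRrM divff ?gt_eqF// poweRe1// Lnorm_ge0.
by rewrite -(inv f) E inv.
Qed.

Lemma Lpnorm_cvg0 (f : nat -> R * R -> R) s : 0 < s ->
  (forall n, Int (fun x => `|f n x| `^ s)) ->
  (fun n => I (fun x => `|f n x| `^ s)) @ \oo --> 0 ->
  (fun n => Lpnorm Omega s%:E (f n)) @ \oo --> 0%E.
Proof.
move=> s0 If c0.
have -> : (fun n => Lpnorm Omega s%:E (f n)) =
    (fun n => (I (fun x => `|f n x| `^ s) `^ s^-1)%:E).
  by apply/funext => n; rewrite LpnormE.
apply/fine_cvgP; split; first exact: nearW.
apply: powR_seq_cvg0 => //; first by rewrite invr_gt0.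
by move=> n; apply: I_ge0 => x _; exact: powR_ge0.
Qed.

End LpPlane.

(** * The space [H10] as a closure of graphs of gradients *)

Section Sobolev.
Variable R : realType.
Local Notation P := (measurableTypeR R * measurableTypeR R)%type.
Local Notation mu2 := (leb2 R).
Variable (Omega : set (R * R)).
Hypothesis oO : open Omega.
Hypothesis bO : bounded_set Omega.
Local Notation I f := (\int[mu2]_(x in Omega) f x)%R.
Local Notation Int f := (mu2.-integrable Omega (EFin \o f)).
Local Notation L2O := (L2 mu2 Omega).
Local Notation test := (test_function Omega).
Local Notation "'d_ i f" := (fun x => 'D_(e_ R i) f x) (at level 10, i, f at level 9).
Local Notation ae_eqO f g := {ae mu2, forall x, Omega x -> f x = g x}.
Implicit Types (f u v w phi : R * R -> R) (g h : 'I_2 -> R * R -> R).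

Definition mOmega : measurable (Omega : set P) := open_measurable2 oO.
Local Notation mO := mOmega.
Definition finOmega : (mu2 Omega < +oo)%E := leb2_bounded_fin mO bO.
Local Notation finO := finOmega.
Local Notation pH2 := (preHilbert_L2 mO finO).

Definition sqdist f u : R := I (fun x => (f x - u x) ^+ 2).
Local Notation dist2 := sqdist.

Lemma test_L2 phi : test phi -> L2O phi.
Proof.
move=> tp; have [K K0 hK] := test_bounded tp.
by apply: (L2_bounded mO finO (K := K)); [exact: test_measurable tp mO|move=> x _; exact: hK].
Qed.

Lemma ip_linear_cvg (f : nat -> R * R -> R) u v : (forall n, L2O (f n)) -> L2O u -> L2O v ->
  (fun n => dist2 (f n) u) @ \oo --> 0 -> (fun n => ip Omega (f n) v) @ \oo --> ip Omega u v.
Proof.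
move=> Lf Lu Lv fu.
have := bounded_linear_cvg pH2 (bounded_linear_b pH2 Lv) Lf Lu fu.
have E w : ipL2 mu2 Omega v w = ip Omega w v.
  by apply: eq_Rintegral => x _; rewrite mulrC.
have -> // : (fun n => ip Omega (f n) v) = ipL2 mu2 Omega v \o f.
  by apply/funext => n; rewrite /= E.
by rewrite -E.
Qed.

Lemma dist2_expand f u : L2O f -> L2O u ->
  dist2 f u = I (fun x => f x ^+ 2) - 2 * ip Omega f u + I (fun x => u x ^+ 2).
Proof. by move=> Lf Lu; have := pH_sqB pH2 Lf Lu. Qed.

Lemma dist2_ge0 f u : 0 <= dist2 f u.
Proof. by apply: I_ge0 => x _; exact: sqr_ge0. Qed.

Lemma dist2_sym f u : dist2 f u = dist2 u f.
Proof. by apply: eq_Rintegral => x _; rewrite -sqrrN opprB. Qed.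

Lemma dist2_triangle f u v : L2O f -> L2O u -> L2O v ->
  dist2 f v <= 2 * dist2 f u + 2 * dist2 u v.
Proof.
move=> Lf Lu Lv; rewrite /dist2.
have [_ i1] := L2B mO Lf Lu; have [_ i2] := L2B mO Lu Lv; have [_ i3] := L2B mO Lf Lv.
have j1 := Int_Z mO 2 i1; have j2 := Int_Z mO 2 i2.
rewrite -(I_Z mO 2 i1) -(I_Z mO 2 i2) -(I_D mO j1 j2).
apply: (I_le mO i3); first exact: (Int_D mO j1 j2).
apply: aeW => x _; have := sqr_ge0 ((f x - u x) - (u x - v x)); rewrite !expr2; lra.
Qed.

Lemma sq_cvg (f : nat -> R * R -> R) u : (forall n, L2O (f n)) -> L2O u ->
  (fun n => dist2 (f n) u) @ \oo --> 0 ->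
  (fun n => I (fun x => f n x ^+ 2)) @ \oo --> I (fun x => u x ^+ 2).
Proof.
move=> Lf Lu fu; have c1 := ip_linear_cvg Lf Lu Lu fu.
have E : ip Omega u u = I (fun x => u x ^+ 2) by [].
have -> : (fun n => I (fun x => f n x ^+ 2)) =
    (fun n => dist2 (f n) u + 2 * ip Omega (f n) u - I (fun x => u x ^+ 2)).
  by apply/funext => n; rewrite dist2_expand//; ring.
have E2 : 0 + 2 * ip Omega u u - I (fun x => u x ^+ 2) = I (fun x => u x ^+ 2).
  by rewrite E; ring.
rewrite -[X in _ --> X]E2; apply: cvgB; last exact: cvg_cst.
by apply: cvgD => //; apply: cvgM => //; exact: cvg_cst.
Qed.

Lemma ipD_l f u v : L2O f -> L2O u -> L2O v ->
  ip Omega (fun x => f x + u x) v = ip Omega f v + ip Omega u v.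
Proof. exact: (pHbD pH2). Qed.

Lemma ipZ_l a f v : L2O f -> L2O v -> ip Omega (fun x => a * f x) v = a * ip Omega f v.
Proof. exact: (pHbZ pH2). Qed.

Lemma ipC f u : ip Omega f u = ip Omega u f.
Proof. by apply: eq_Rintegral => x _; rewrite mulrC. Qed.

Lemma ip_eq_ae f f' v : measurable_fun Omega f -> measurable_fun Omega f' ->
  measurable_fun Omega v -> ae_eqO f f' -> ip Omega f v = ip Omega f' v.
Proof.
move=> mf mf' mv E; apply: (I_eq_ae mO); [exact: measurable_funM|exact: measurable_funM|].
by apply: aeS E => x h Ox; rewrite h.
Qed.

Lemma L2_ae f u : measurable_fun Omega f -> L2O u -> ae_eqO f u -> L2O f.
Proof.
move=> mf Lu E; apply: (L2_le mO mf Lu); apply: aeS E => x h Ox; by rewrite h.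
Qed.

Lemma dist2_ae f f' u u' : L2O f -> L2O f' -> L2O u -> L2O u' -> ae_eqO f f' -> ae_eqO u u' ->
  dist2 f u = dist2 f' u'.
Proof.
move=> [mf _] [mf' _] [mu _] [mu' _] E E'; apply: (I_eq_ae mO).
- by apply: measurable_funX; exact: measurable_funB.
- by apply: measurable_funX; exact: measurable_funB.
- by apply: aeS2 E E' => x h h' Ox; rewrite h// h'.
Qed.

Lemma loc_mul_test u phi : loc_integrable Omega u -> test phi -> Int (fun x => u x * phi x).
Proof.
move=> lu tp; have [_ [K [cK KO K0]]] := tp.
have mK : measurable (K : set P) by exact: compact_measurable2.
have iK : mu2.-integrable K (EFin \o (fun x => u x * phi x)).
  have [M M0 hM] := test_bounded tp; have iu := lu _ cK KO.
  apply: (@Int_le_pt _ _ _ mu2 K mK _ (fun x => M * `|u x|)).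
  - by apply: measurable_funM; [exact: Int_meas iu|exact: test_measurable tp mK].
  - by apply: Int_Z => //; exact: Int_abs.
  - by move=> x _; rewrite normrM mulrC ler_wpM2r.
have iT : mu2.-integrable setT (EFin \o ((fun x => u x * phi x) \_ K)).
  by rewrite -restrict_EFin; apply: (integrable_mkcond _ mK).1; exact: iK.
have E : (fun x => u x * phi x) \_ K = (fun x => u x * phi x).
  apply/funext => x; rewrite patchE; case: ifPn => //; rewrite notin_setE => /K0 ->.
  by rewrite mulr0.
by rewrite E in iT; apply: integrableS iT; [exact: measurableT|exact: mO|].
Qed.

Lemma L2_loc u : L2O u -> loc_integrable Omega u.
Proof.
move=> Lu K cK KO; apply: integrableS (L2_Int mO finO Lu) => //; first exact: mO.
exact: compact_measurable2.
Qed.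

Lemma loc_integrableD a u v : loc_integrable Omega u -> loc_integrable Omega v ->
  loc_integrable Omega (fun x => a * u x + v x).
Proof.
move=> lu lv K cK KO; have mK : measurable (K : set P) by exact: compact_measurable2.
apply: (@Int_D _ _ _ mu2 K mK (fun x => a * u x) v); last exact: lv.
exact: (Int_Z mK a (lu K cK KO)).
Qed.

Lemma is_weak_partialD i a u v f f' : is_weak_partial Omega i u f ->
  is_weak_partial Omega i v f' ->
  is_weak_partial Omega i (fun x => a * u x + v x) (fun x => a * f x + f' x).
Proof.
move=> [lu lf hu] [lv lf' hv]; split; [exact: loc_integrableD|exact: loc_integrableD|].
move=> phi tp; have tD := test_D i tp.
have h1 := loc_mul_test lu tD; have h2 := loc_mul_test lv tD.
have h3 := loc_mul_test lf tp; have h4 := loc_mul_test lf' tp.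
rewrite /ip; transitivity (a * ip Omega u ('d_ i phi) + ip Omega v ('d_ i phi)).
  rewrite /ip -(I_Z mO a h1) -(I_D mO (Int_Z mO a h1) h2); apply: eq_Rintegral => x _; ring.
rewrite hu// hv//; transitivity (- (a * ip Omega f phi + ip Omega f' phi)); first by ring.
congr (- _); rewrite /ip -(I_Z mO a h3) -(I_D mO (Int_Z mO a h3) h4).
by apply: eq_Rintegral => x _; ring.
Qed.

(** Both differences of the two candidates have vanishing pairing with every test function, so each
    of them is nonnegative a.e. *)
Lemma is_weak_partial_uniq i u f f' : is_weak_partial Omega i u f ->
  is_weak_partial Omega i u f' -> ae_eqO f f'.
Proof.
move=> [lu lf hu] [_ lf' hu'].
have key (k k' : R * R -> R) : loc_integrable Omega k -> loc_integrable Omega k' ->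
    (forall phi, test phi -> ip Omega k phi = ip Omega k' phi) ->
    {ae mu2, forall x, Omega x -> 0 <= -1 * k x + k' x}.
  move=> lk lk' kk; apply: (nonneg_of_test oO (loc_integrableD (-1) lk lk')) => phi tp _.
  have h1 := loc_mul_test lk tp; have h2 := loc_mul_test lk' tp.
  have -> : ip Omega (fun x => -1 * k x + k' x) phi = -1 * ip Omega k phi + ip Omega k' phi.
    rewrite /ip -(I_Z mO (-1) h1) -(I_D mO (Int_Z mO (-1) h1) h2).
    by apply: eq_Rintegral => x _; ring.
  by rewrite kk// mulN1r addNr.
have E phi : test phi -> ip Omega f phi = ip Omega f' phi.
  by move=> tp; apply: oppr_inj; rewrite -hu// -hu'.
have E' phi : test phi -> ip Omega f' phi = ip Omega f phi by move=> tp; rewrite E.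
apply: aeS2 (key _ _ lf lf' E) (key _ _ lf' lf E') => x h1 h2 Ox.
have := h1 Ox; have := h2 Ox; lra.
Qed.

Lemma weak_partialP i u f : is_weak_partial Omega i u f ->
  is_weak_partial Omega i u (weak_partial Omega i u).
Proof. by move=> h; rewrite /weak_partial; apply: (@getPex _ [set g | is_weak_partial Omega i u g]); exists f. Qed.

Lemma weak_partial_ae i u f : is_weak_partial Omega i u f ->
  ae_eqO (weak_partial Omega i u) f.
Proof. by move=> h; apply: (is_weak_partial_uniq (weak_partialP h) h). Qed.

Lemma loc_integrable_measurable u : loc_integrable Omega u -> measurable_fun Omega u.
Proof.
move=> lu.
pose E (n : nat) : set P :=
  if unpickle n is Some q then
    let q : rat * rat * (rat * rat) := q in
    if pselect (cbox (ratr q.1.1 : R) (ratr q.1.2) (ratr q.2.1) (ratr q.2.2) `<=` Omega)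
    then cbox (ratr q.1.1 : R) (ratr q.1.2) (ratr q.2.1) (ratr q.2.2) else set0
  else set0.
have mE n : measurable (E n).
  rewrite /E; case: unpickle => [q|]; last exact: measurable0.
  by case: pselect => h /=; [exact: measurable_cbox|exact: measurable0].
have -> : Omega = \bigcup_n E n.
  apply/seteqP; split => [[x y] Oxy|x [n _]]; last first.
    by rewrite /E; case: unpickle => [q|//]; case: pselect => // h /= /h.
  have [e /= e0 eO] : exists2 e : R, 0 < e & ball (x, y) e `<=` Omega.
    by apply/nbhs_ballP; apply: open_nbhs_nbhs.
  have xe : x - e < x by rewrite ltrBlDr ltrDl.
  have ex : x < x + e by rewrite ltrDl.
  have ye : y - e < y by rewrite ltrBlDr ltrDl.
  have ey : y < y + e by rewrite ltrDl.
  have [q1 /[!in_itv]/= /andP[s1 s2]] := rat_in_itvoo xe.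
  have [q2 /[!in_itv]/= /andP[t1 t2]] := rat_in_itvoo ex.
  have [q3 /[!in_itv]/= /andP[s3 s4]] := rat_in_itvoo ye.
  have [q4 /[!in_itv]/= /andP[t3 t4]] := rat_in_itvoo ey.
  exists (pickle (q1, q2, (q3, q4))); first exact: Logic.I.
  rewrite /E pickleK; case: pselect => [h|nh].
    by rewrite /cbox /= !ltW.
  exfalso; apply: nh => -[s t]; rewrite /cbox /= => /andP[/andP[k1 k2] /andP[k3 k4]].
  by apply: eO; split => /=; rewrite /ball /= ltr_norml; apply/andP; split; lra.
apply/measurable_fun_bigcup => // n; rewrite /E; case: unpickle => [q|]; last exact: measurable_fun_set0.
case: pselect => h /=; last exact: measurable_fun_set0.
apply: Int_meas (lu _ _ h); rewrite cboxE.
by apply: compact_setX; exact: segment_compact.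
Qed.

(** The gradient [g] is carried as data. Unlike the chosen derivative [weak_partial], it can be
    added, multiplied and passed to the limit by explicit formulas; [H10_graph] and [graph_H10]
    translate. *)
Definition H1graph u g : Prop :=
  [/\ L2O u, forall i, L2O (g i) & exists phi : nat -> R * R -> R,
    [/\ forall n, test (phi n), (fun n => dist2 (phi n) u) @ \oo --> 0
      & forall i, (fun n => dist2 ('d_ i (phi n)) (g i)) @ \oo --> 0]].
Local Notation graph := H1graph.

Lemma test_graph phi : test phi -> graph phi (fun i => 'd_ i phi).
Proof.
move=> tp; split; [exact: test_L2|by move=> i; apply: test_L2; exact: test_D|].
have d0 f : dist2 f f = 0.
  rewrite /dist2; have -> : (fun x => (f x - f x) ^+ 2) = (fun=> 0).
    by apply/funext => x; rewrite subrr expr0n.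
  by rewrite Rintegral_cst ?mul0r//; exact: mO.
exists (fun=> phi); split => //.
- by rewrite d0; exact: cvg_cst.
- by move=> i; rewrite d0; exact: cvg_cst.
Qed.

Lemma graph_weak_partial u g i : graph u g -> is_weak_partial Omega i u (g i).
Proof.
move=> [Lu Lg [phi [tp pu pg]]]; split; [exact: L2_loc|exact: L2_loc|move=> psi ts].
have tD := test_D i ts.
have c1 := ip_linear_cvg (fun n => test_L2 (tp n)) Lu (test_L2 tD) pu.
have c2 := ip_linear_cvg (fun n => test_L2 (test_D i (tp n))) (Lg i) (test_L2 ts) (pg i).
have E : (fun n => ip Omega (phi n) ('d_ i psi)) = (fun n => - ip Omega ('d_ i (phi n)) psi).
  apply/funext => n; have [B B0 OB] := bounded_set_box bO.
  by apply: (test_ibp OB B0 mO) => //; exact: test_smooth (tp n).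
rewrite E in c1; apply: (cvg_unique (@Rhausdorff R) c1); exact: cvgN.
Qed.

Lemma test_is_weak_partial phi i : test phi -> is_weak_partial Omega i phi ('d_ i phi).
Proof. by move=> tp; exact: (graph_weak_partial i (test_graph tp)). Qed.

Lemma dist2_lin a f f' u u' : L2O f -> L2O f' -> L2O u -> L2O u' ->
  dist2 (fun x => a * f x + f' x) (fun x => a * u x + u' x) <=
  2 * a ^+ 2 * dist2 f u + 2 * dist2 f' u'.
Proof.
move=> Lf Lf' Lu Lu'; rewrite /dist2.
have [_ i1] := L2B mO Lf Lu; have [_ i2] := L2B mO Lf' Lu'.
have [_ i3] := L2B mO (L2D mO (L2Z mO a Lf) Lf') (L2D mO (L2Z mO a Lu) Lu').
have j1 := Int_Z mO (2 * a ^+ 2) i1; have j2 := Int_Z mO 2 i2.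
rewrite -(I_Z mO (2 * a ^+ 2) i1) -(I_Z mO 2 i2) -(I_D mO j1 j2).
apply: (I_le mO i3); first exact: (Int_D mO j1 j2).
apply: aeW => x _; have := sqr_ge0 (a * (f x - u x) - (f' x - u' x)); rewrite !expr2; lra.
Qed.

Lemma graph_lin a u v g h : graph u g -> graph v h ->
  graph (fun x => a * u x + v x) (fun i x => a * g i x + h i x).
Proof.
move=> [Lu Lg [phi [tp pu pg]]] [Lv Lh [psi [ts sv sh]]]; split.
- exact: (L2D mO (L2Z mO a Lu) Lv).
- by move=> i; exact: (L2D mO (L2Z mO a (Lg i)) (Lh i)).
have lim0 (c1 c2 : nat -> R) : c1 @ \oo --> 0 -> c2 @ \oo --> 0 ->
    (fun n => 2 * a ^+ 2 * c1 n + 2 * c2 n) @ \oo --> 0.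
  move=> h1 h2; have -> : (0 : R) = 2 * a ^+ 2 * 0 + 2 * 0 by rewrite !mulr0 addr0.
  by apply: cvgD; apply: cvgM => //; exact: cvg_cst.
exists (fun n x => a * phi n x + psi n x); split.
- by move=> n; apply: test_add => //; exact: test_scale.
- apply: cvg0_le (lim0 _ _ pu sv) => n; rewrite dist2_ge0 /=.
  by apply: dist2_lin => //; exact: test_L2.
- move=> i; apply: cvg0_le (lim0 _ _ (pg i) (sh i)) => n; rewrite dist2_ge0 /=.
  have -> : 'd_ i (fun x => a * phi n x + psi n x) =
      (fun x => a * 'D_(e_ R i) (phi n) x + 'D_(e_ R i) (psi n) x).
    apply/funext => x; have sp := test_smooth (tp n); have ss := test_smooth (ts n).
    rewrite derive_add//; first by rewrite derive_scale.
    exact: test_smooth (test_scale a (tp n)).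
  by apply: dist2_lin => //; apply: test_L2; exact: test_D.
Qed.

(** Diagonal choice: each [u n] is replaced by a test function whose squared distances to [u n] and
    to its gradient are at most [1 / (n + 1)]. *)
Lemma graph_closed (u : nat -> R * R -> R) (g : nat -> 'I_2 -> R * R -> R) v h :
  (forall n, graph (u n) (g n)) -> L2O v -> (forall i, L2O (h i)) ->
  (fun n => dist2 (u n) v) @ \oo --> 0 -> (forall i, (fun n => dist2 (g n i) (h i)) @ \oo --> 0) ->
  graph v h.
Proof.
move=> G Lv Lh uv gh; split => //.
have ex n : exists phi, [/\ test phi, dist2 phi (u n) <= n.+1%:R^-1 &
    forall i, dist2 ('d_ i phi) (g n i) <= n.+1%:R^-1].
  have [_ _ [phi [tp pu pg]]] := G n.
  have n0 : 0 < n.+1%:R^-1 :> R by rewrite invr_gt0.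
  have [N NP] := (cvg_epsP _ _).1 pu _ n0.
  have [N0 NP0] := (cvg_epsP _ _).1 (pg 0) _ n0.
  have [N1 NP1] := (cvg_epsP _ _).1 (pg 1) _ n0.
  pose M := maxn N (maxn N0 N1); exists (phi M); split => //.
  - by have := NP M (leq_maxl _ _); rewrite subr0; apply: le_trans; exact: ler_norm.
  - move=> i; have [->|->] : i = 0 \/ i = 1 by case: i => -[|[|//]] ?; [left|right]; exact: val_inj.
      have := NP0 M (leq_trans (leq_maxl _ _) (leq_maxr _ _)); rewrite subr0; apply: le_trans; exact: ler_norm.
    have := NP1 M (leq_trans (leq_maxr _ _) (leq_maxr _ _)); rewrite subr0; apply: le_trans; exact: ler_norm.
have [phi phiP] := choice ex.
have Lu n : L2O (u n) by case: (G n).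
have Lg n i : L2O (g n i) by case: (G n).
have lim0 (c : nat -> R) : c @ \oo --> 0 -> (fun n => 2 * n.+1%:R^-1 + 2 * c n) @ \oo --> (0 : R).
  move=> h1; have -> : (0 : R) = 2 * 0 + 2 * 0 by rewrite !mulr0 addr0.
  by apply: cvgD; apply: cvgM => //; [exact: cvg_cst|exact: cvg_inv_succ|exact: cvg_cst].
exists phi; split.
- by move=> n; case: (phiP n).
- apply: cvg0_le (lim0 _ uv) => n; rewrite dist2_ge0 /=; have [tp hp _] := phiP n.
  apply: (le_trans (dist2_triangle (test_L2 tp) (Lu n) Lv)).
  by rewrite lerD2r ler_wpM2l.
- move=> i; apply: cvg0_le (lim0 _ (gh i)) => n; rewrite dist2_ge0 /=; have [tp _ hp] := phiP n.
  apply: (le_trans (dist2_triangle (test_L2 (test_D i tp)) (Lg n i) (Lh i))).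
  by rewrite lerD2r ler_wpM2l.
Qed.

End Sobolev.

Lemma lipschitz_derive1 (R : realType) (h : R -> R) (L : R) : (forall x, derivable h x 1) ->
  (forall x, `|derive1 h x| <= L) -> forall x y, `|h x - h y| <= L * `|x - y|.
Proof.
move=> dh hL.
have key x y : x < y -> `|h y - h x| <= L * `|y - x|.
  move=> xy; have [||c _ ->] := @MVT R h (derive1 h) x y xy.
  - by move=> z _; apply: DeriveDef => //; rewrite derive1E.
  - by apply: continuous_subspaceT => z; exact: derivable1_continuous.
  - by rewrite normrM ler_wpM2r.
move=> x y; have [xy|xy|->] := ltgtP x y.
- by rewrite distrC [`|x - y|]distrC; exact: key.
- exact: key.
- by rewrite !subrr normr0 mulr0.
Qed.

Section Sobolev2.
Variable R : realType.
Local Notation P := (measurableTypeR R * measurableTypeR R)%type.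
Local Notation mu2 := (leb2 R).
Variable (Omega : set (R * R)).
Hypothesis oO : open Omega.
Hypothesis bO : bounded_set Omega.
Local Notation I f := (\int[mu2]_(x in Omega) f x)%R.
Local Notation Int f := (mu2.-integrable Omega (EFin \o f)).
Local Notation L2O := (L2 mu2 Omega).
Local Notation test := (test_function Omega).
Local Notation "'d_ i f" := (fun x => 'D_(e_ R i) f x) (at level 10, i, f at level 9).
Local Notation ae_eqO f g := {ae mu2, forall x, Omega x -> f x = g x}.
Local Notation mO := (mOmega oO).
Local Notation finO := (finOmega oO bO).
Local Notation pH2 := (preHilbert_L2 mO finO).
Local Notation graph := (H1graph Omega).
Local Notation dist2 := (sqdist Omega).
Local Notation pd i u := (weak_partial Omega i u).
Implicit Types (f u v w phi : R * R -> R) (g h : 'I_2 -> R * R -> R).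

Lemma ord2 (i : 'I_2) : i = 0 \/ i = 1.
Proof. by case: i => -[|[|//]] ?; [left|right]; exact: val_inj. Qed.

Lemma big_ord2 (F : 'I_2 -> R) : \sum_(i < 2) F i = F 0 + F 1.
Proof. by rewrite !big_ord_recl big_ord0 addr0; congr (_ + F _); exact: val_inj. Qed.

Lemma big_ord1' (F : 'I_1 -> R) : \sum_(i < 1) F i = F 0.
Proof. by rewrite big_ord_recl big_ord0 addr0. Qed.

Lemma fnorm_col (A : 'cV[R]_2) : fnorm A = Num.sqrt (A 0 0 ^+ 2 + A 1 0 ^+ 2).
Proof. by rewrite /fnorm big_ord2 !big_ord1'. Qed.

Lemma fnorm_mx2 (A : 'M[R]_2) :
  fnorm A = Num.sqrt ((A 0 0 ^+ 2 + A 0 1 ^+ 2) + (A 1 0 ^+ 2 + A 1 1 ^+ 2)).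
Proof. by rewrite /fnorm !big_ord2. Qed.

Lemma dot_col (A B : 'cV[R]_2) : dot A B = A 0 0 * B 0 0 + A 1 0 * B 1 0.
Proof. by rewrite /dot big_ord2 !big_ord1'. Qed.

Lemma mulmx_col2 (A : 'M[R]_2) (z : 'cV[R]_2) i : (A *m z) i 0 = A i 0 * z 0 0 + A i 1 * z 1 0.
Proof. by rewrite mxE big_ord2. Qed.

Lemma gradE u x i : grad Omega u x i 0 = pd i u x.
Proof. by rewrite /grad mxE. Qed.

Lemma fnorm_grad u x : fnorm (grad Omega u x) = Num.sqrt (pd 0 u x ^+ 2 + pd 1 u x ^+ 2).
Proof. by rewrite fnorm_col !gradE. Qed.

Lemma measurable_sqrt_sum (a b : R * R -> R) : measurable_fun Omega a -> measurable_fun Omega b ->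
  measurable_fun Omega (fun x => Num.sqrt (a x ^+ 2 + b x ^+ 2)).
Proof.
move=> ma mb.
have -> : (fun x => Num.sqrt (a x ^+ 2 + b x ^+ 2)) = (fun x => (a x ^+ 2 + b x ^+ 2) `^ 2^-1).
  by apply/funext => x; rewrite powR12_sqrt// addr_ge0// sqr_ge0.
apply: (measurableT_comp (measurable_powR 2^-1)).
by apply: measurable_funD; apply: measurable_funX.
Qed.

Lemma Lpnorm_grad_ae w g p : 0 < p -> (forall i, is_weak_partial Omega i w (g i)) ->
  Lpnorm_mx Omega p%:E (grad Omega w) =
  Lpnorm Omega p%:E (fun x => Num.sqrt (g 0 x ^+ 2 + g 1 x ^+ 2)).
Proof.
move=> p0 wp; have W i := weak_partialP (wp i).
have m1 i : measurable_fun Omega (pd i w).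
  by have [_ l _] := W i; exact: (loc_integrable_measurable oO l).
have m2 i : measurable_fun Omega (g i).
  by have [_ l _] := wp i; exact: (loc_integrable_measurable oO l).
rewrite /Lpnorm_mx; have -> : (fun x => fnorm (grad Omega w x)) =
    (fun x => Num.sqrt (pd 0 w x ^+ 2 + pd 1 w x ^+ 2)).
  by apply/funext => x; rewrite fnorm_grad.
apply: (Lpnorm_ae mO) => //; [exact: measurable_sqrt_sum|exact: measurable_sqrt_sum|].
apply: aeS2 (weak_partial_ae oO (wp 0)) (weak_partial_ae oO (wp 1)) => x h0 h1 Ox.
by rewrite h0// h1.
Qed.

Lemma L2_sqrt_sum (a b : R * R -> R) : L2O a -> L2O b ->
  L2O (fun x => Num.sqrt (a x ^+ 2 + b x ^+ 2)).
Proof.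
move=> [ma ia] [mb ib]; split; first exact: measurable_sqrt_sum.
have := Int_D mO ia ib; apply: eq_integrable; first exact: mO.
by move=> x _ /=; rewrite sqr_sqrtr// addr_ge0// sqr_ge0.
Qed.

Lemma W1pnorm2E w g : L2O w -> (forall i, L2O (g i)) ->
  (forall i, is_weak_partial Omega i w (g i)) ->
  W1pnorm Omega 2%:E w = (Num.sqrt (I (fun x => w x ^+ 2)) +
    Num.sqrt (I (fun x => g 0 x ^+ 2) + I (fun x => g 1 x ^+ 2)))%:E.
Proof.
move=> Lw Lg wp; rewrite /W1pnorm (Lpnorm2E mO Lw) (Lpnorm_grad_ae _ wp)//.
rewrite (Lpnorm2E mO (L2_sqrt_sum (Lg 0) (Lg 1))) -EFinD.
have [_ i0] := Lg 0; have [_ i1] := Lg 1; rewrite -(I_D mO i0 i1).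
congr (_ + Num.sqrt _)%:E; apply: eq_Rintegral => x _.
by rewrite sqr_sqrtr// addr_ge0// sqr_ge0.
Qed.

Lemma W1p2P u : W1p Omega 2%:E u <-> L2O u /\
  forall i, exists2 f, is_weak_partial Omega i u f & L2O f.
Proof.
rewrite /W1p; split => -[/(Lp2P mO) Lu h]; split => //; try exact/(Lp2P mO).
  by move=> i; have [f wf /(Lp2P mO) Lf] := h i; exists f.
by move=> i; have [f wf Lf] := h i; exists f => //; exact/(Lp2P mO).
Qed.

Lemma sqrt_sum_cvg0 (a b c : nat -> R) : (forall n, 0 <= a n) -> (forall n, 0 <= b n) ->
  (forall n, 0 <= c n) ->
  (fun n => Num.sqrt (a n) + Num.sqrt (b n + c n)) @ \oo --> 0 <->
  [/\ a @ \oo --> 0, b @ \oo --> 0 & c @ \oo --> 0].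
Proof.
move=> a0 b0 c0; split.
  move=> /cvg_sqr; rewrite expr0n /= => h.
  have le (t : nat -> R) : (forall n, 0 <= t n) -> (forall n, t n <= a n + (b n + c n)) -> t @ \oo --> 0.
    move=> t0 th; apply: cvg0_le h => n; rewrite t0 /=; apply: le_trans (th n) _.
    rewrite sqrrD sqr_sqrtr// sqr_sqrtr ?addr_ge0// lerD2r lerDl.
    by rewrite mulrn_wge0// mulr_ge0.
  split; apply: le => // n; have := a0 n; have := b0 n; have := c0 n; lra.
move=> [ca cb cc]; rewrite -[X in _ --> X](addr0 0).
have sq (t : nat -> R) : (forall n, 0 <= t n) -> t @ \oo --> 0 -> (fun n => Num.sqrt (t n)) @ \oo --> 0.
  move=> t0 ct; have -> : (fun n => Num.sqrt (t n)) = (fun n => t n `^ 2^-1).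
    by apply/funext => n; rewrite powR12_sqrt.
  have h2 : 0 < 2^-1 :> R by rewrite invr_gt0.
  exact: (powR_seq_cvg0 h2 t0 ct).
apply: cvgD; first exact: sq.
apply: sq; first by move=> n; rewrite addr_ge0.
by rewrite -(addr0 0); exact: cvgD.
Qed.

Lemma W1pnorm2_cvg0 (w : nat -> R * R -> R) (g : nat -> 'I_2 -> R * R -> R) :
  (forall n, L2O (w n)) -> (forall n i, L2O (g n i)) ->
  (forall n i, is_weak_partial Omega i (w n) (g n i)) ->
  (fun n => W1pnorm Omega 2%:E (w n)) @ \oo --> 0%E <->
  [/\ (fun n => I (fun x => w n x ^+ 2)) @ \oo --> 0 &
    forall i, (fun n => I (fun x => g n i x ^+ 2)) @ \oo --> 0].
Proof.
move=> Lw Lg wp.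
have -> : (fun n => W1pnorm Omega 2%:E (w n)) =
    (fun n => (Num.sqrt (I (fun x => w n x ^+ 2)) +
    Num.sqrt (I (fun x => g n 0 x ^+ 2) + I (fun x => g n 1 x ^+ 2)))%:E).
  by apply/funext => n; rewrite (W1pnorm2E (Lw n) (Lg n) (wp n)).
have nn f : 0 <= I (fun x => f x ^+ 2) by apply: I_ge0 => x _; exact: sqr_ge0.
have S := sqrt_sum_cvg0 (fun n => nn (w n)) (fun n => nn (g n 0)) (fun n => nn (g n 1)).
split.
  move=> /fine_cvgP[_] /S[ca cb cc]; split => // i; by have [->|->] := ord2 i.
move=> [ca cb]; apply/fine_cvgP; split; first exact: nearW.
by apply/S; split.
Qed.

Lemma wp_sub i u v f f' : is_weak_partial Omega i u f -> is_weak_partial Omega i v f' ->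
  is_weak_partial Omega i (fun x => u x - v x) (fun x => f x - f' x).
Proof.
move=> h h'; have := is_weak_partialD oO (-1) h' h.
by congr is_weak_partial; apply/funext => x; rewrite mulN1r addrC.
Qed.

(** The norm in [H10] involves a freshly chosen derivative of each difference; since weak
    derivatives are unique a.e., the difference of the derivatives may be used in its place. *)
Lemma H10_graph u : H10 Omega u -> graph u (fun i => pd i u).
Proof.
move=> [/W1p2P[Lu hw] [phi [tp [_ _ c]]]].
have wp i : is_weak_partial Omega i u (pd i u) by have [f wf _] := hw i; exact: weak_partialP wf.
have mpd i : measurable_fun Omega (pd i u).
  by have [_ l _] := wp i; exact: (loc_integrable_measurable oO l).
have Lg i : L2O (pd i u).
  have [f wf Lf] := hw i; exact: (L2_ae oO (mpd i) Lf (weak_partial_ae oO wf)).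
split => //; exists phi.
have := (W1pnorm2_cvg0 (w := fun n x => phi n x - u x)
  (g := fun n i x => 'D_(e_ R i) (phi n) x - pd i u x) _ _ _).1 _.
case=> //.
- by move=> n; apply: (L2B mO) => //; exact: test_L2.
- by move=> n i; apply: (L2B mO) => //; apply: test_L2 => //; exact: test_D.
- by move=> n i; apply: wp_sub => //; exact: test_is_weak_partial.
Qed.

Lemma graph_W1p u g : graph u g -> W1p Omega 2%:E u.
Proof.
move=> G; have [Lu Lg _] := G; apply/W1p2P; split => // i.
by exists (g i) => //; exact: graph_weak_partial.
Qed.

Lemma graph_H10 u g : graph u g -> H10 Omega u.
Proof.
move=> G; have [Lu Lg [phi [tp pu pg]]] := G; split; first exact: graph_W1p G.
exists phi; split => //; split.
- by move=> n; apply: graph_W1p; exact: test_graph (tp n).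
- exact: graph_W1p G.
apply/(W1pnorm2_cvg0 (g := fun n i x => 'D_(e_ R i) (phi n) x - g i x)) => //.
- by move=> n; apply: (L2B mO) => //; exact: test_L2.
- by move=> n i; apply: (L2B mO) => //; apply: test_L2 => //; exact: test_D.
- move=> n i; apply: wp_sub; first exact: test_is_weak_partial.
  exact: graph_weak_partial.
Qed.

Lemma graph_pd_ae u g i : graph u g -> ae_eqO (pd i u) (g i).
Proof. by move=> G; apply: (weak_partial_ae oO); exact: graph_weak_partial G. Qed.

Lemma H10_lin a u v : H10 Omega u -> H10 Omega v -> H10 Omega (fun x => a * u x + v x).
Proof. by move=> /H10_graph Gu /H10_graph Gv; exact: (graph_H10 (graph_lin oO bO a Gu Gv)). Qed.

Lemma pd_lin a u v i : H10 Omega u -> H10 Omega v ->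
  ae_eqO (pd i (fun x => a * u x + v x)) (fun x => a * pd i u x + pd i v x).
Proof.
move=> /H10_graph Gu /H10_graph Gv.
exact: (graph_pd_ae i (graph_lin oO bO a Gu Gv)).
Qed.

Lemma H10_L2 u : H10 Omega u -> L2O u. Proof. by move=> /H10_graph[]. Qed.
Lemma H10_pd i u : H10 Omega u -> L2O (pd i u). Proof. by move=> /H10_graph[_ /(_ i)]. Qed.
Lemma test_H10 phi : test phi -> H10 Omega phi.
Proof. by move=> tp; exact: graph_H10 (test_graph oO bO tp). Qed.

Lemma test_pd phi i : test phi -> ae_eqO (pd i phi) ('d_ i phi).
Proof. by move=> tp; exact: (graph_pd_ae i (test_graph oO bO tp)). Qed.

Lemma graph_mul_test u g psi : graph u g -> test psi ->
  graph (fun x => psi x * u x) (fun i x => psi x * g i x + u x * 'D_(e_ R i) psi x).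
Proof.
move=> [Lu Lg [phi [tp pu pg]]] ts.
have [M M0 hM] := test_bounded ts.
have bM f : test f -> forall k, L2O k -> L2O (fun x => f x * k x).
  move=> tf k Lk; have [K K0 hK] := test_bounded tf.
  by apply: (L2_bM mO (K := K)) => //; [exact: test_measurable tf mO|exact: aeW].
have dM f K k k' : test f -> (forall x, `|f x| <= K) -> L2O k -> L2O k' ->
    dist2 (fun x => f x * k x) (fun x => f x * k' x) <= K ^+ 2 * dist2 k k'.
  move=> tf hK Lk Lk'; have [_ i1] := L2B mO Lk Lk'.
  have [_ i2] := L2B mO (bM f tf k Lk) (bM f tf k' Lk').
  rewrite /dist2 -(I_Z mO (K ^+ 2) i1); apply: (I_le mO i2); first exact: (Int_Z mO _ i1).
  apply: aeW => x _; rewrite -mulrBr exprMn ler_wpM2r ?sqr_ge0//.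
  rewrite -[leLHS]real_normK ?num_real// ler_sqr ?nnegrE//.
  by rewrite (le_trans (normr_ge0 _) (hK x)).
have tD i := test_D i ts.
have LD i : L2O (fun x => psi x * g i x + u x * 'D_(e_ R i) psi x).
  apply: (L2D mO); first exact: bM.
  have -> : (fun x => u x * 'D_(e_ R i) psi x) = (fun x => 'D_(e_ R i) psi x * u x).
    by apply/funext => x; rewrite mulrC.
  exact: bM (tD i) _ Lu.
split => //; first exact: bM.
exists (fun n x => psi x * phi n x); split.
- by move=> n; apply: test_mulr => //; exact: test_smooth ts.
- apply: (@cvg0_le _ _ (fun n => M ^+ 2 * dist2 (phi n) u)).
    by move=> n; rewrite dist2_ge0 /=; apply: dM => //; exact: test_L2.
  by rewrite -(mulr0 (M ^+ 2)); apply: cvgM => //; exact: cvg_cst.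
move=> i; have [K K0 hK] := test_bounded (tD i).
apply: (@cvg0_le _ _ (fun n => 2 * (M ^+ 2 * dist2 ('d_ i (phi n)) (g i)) +
    2 * (K ^+ 2 * dist2 (phi n) u))).
  move=> n; rewrite dist2_ge0 /=.
  have tDn := test_D i (tp n).
  have -> : 'd_ i (fun x => psi x * phi n x) =
      (fun x => 1 * (psi x * 'D_(e_ R i) (phi n) x) + 'D_(e_ R i) psi x * phi n x).
    apply/funext => x; rewrite derive_mul; [|exact: test_smooth ts|exact: test_smooth (tp n)].
    by ring.
  have -> : (fun x => psi x * g i x + u x * 'D_(e_ R i) psi x) =
      (fun x => 1 * (psi x * g i x) + 'D_(e_ R i) psi x * u x).
    by apply/funext => x; ring.
  have L1 := bM _ ts _ (test_L2 oO bO tDn); have L2' := bM _ (tD i) _ (test_L2 oO bO (tp n)).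
  apply: (le_trans (dist2_lin oO 1 L1 L2' (bM _ ts _ (Lg i)) (bM _ (tD i) _ Lu))).
  rewrite expr1n mulr1; apply: lerD; rewrite ler_wpM2l//.
    apply: dM; [exact: ts|exact: hM|exact: (test_L2 oO bO tDn)|exact: Lg].
  apply: dM; [exact: tD|exact: hK|exact: (test_L2 oO bO (tp n))|exact: Lu].
have E : 2 * (M ^+ 2 * 0) + 2 * (K ^+ 2 * 0) = 0 :> R by rewrite !mulr0 addr0.
rewrite -[X in _ --> X]E; apply: cvgD; apply: cvgM; do ?exact: cvg_cst.
  by apply: cvgM; [exact: cvg_cst|exact: pg].
by apply: cvgM; [exact: cvg_cst|exact: pu].
Qed.

End Sobolev2.

(** * Moment bounds, the Poincare inequality and Rellich compactness *)

Section Sobolev3.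
Variable R : realType.
Local Notation P := (measurableTypeR R * measurableTypeR R)%type.
Local Notation mu2 := (leb2 R).
Variable (Omega : set (R * R)).
Hypothesis oO : open Omega.
Hypothesis bO : bounded_set Omega.
Local Notation I f := (\int[mu2]_(x in Omega) f x)%R.
Local Notation Int f := (mu2.-integrable Omega (EFin \o f)).
Local Notation L2O := (L2 mu2 Omega).
Local Notation test := (test_function Omega).
Local Notation "'d_ i f" := (fun x => 'D_(e_ R i) f x) (at level 10, i, f at level 9).
Local Notation ae_eqO f g := {ae mu2, forall x, Omega x -> f x = g x}.
Local Notation mO := (mOmega oO).
Local Notation finO := (finOmega oO bO).
Local Notation pH2 := (preHilbert_L2 mO finO).
Local Notation graph := (H1graph Omega).
Local Notation dist2 := (sqdist Omega).
Local Notation pd i u := (weak_partial Omega i u).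
Implicit Types (f u v w phi : R * R -> R) (g h : 'I_2 -> R * R -> R).

Lemma ip_CS u v : L2O u -> L2O v ->
  ip Omega u v ^+ 2 <= I (fun x => u x ^+ 2) * I (fun x => v x ^+ 2).
Proof. exact: (pH_CS pH2). Qed.

Lemma L2_abs u : L2O u -> L2O (fun x => `|u x|).
Proof.
move=> Lu; apply: (L2_le mO _ Lu); last by apply: aeW => x _; rewrite normr_id.
by apply: measurableT_comp => //; exact: Lu.1.
Qed.

Lemma I_abs_CS u v : L2O u -> L2O v ->
  I (fun x => `|u x * v x|) ^+ 2 <= I (fun x => u x ^+ 2) * I (fun x => v x ^+ 2).
Proof.
move=> Lu Lv; have := ip_CS (L2_abs Lu) (L2_abs Lv).
rewrite /ip; have -> : (fun x => `|u x| * `|v x|) = (fun x => `|u x * v x|).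
  by apply/funext => x; rewrite normrM.
have E w : (fun x => `|w x| ^+ 2) = (fun x => w x ^+ 2).
  by apply/funext => x; rewrite real_normK ?num_real.
by rewrite !E.
Qed.

Lemma dist2_ae_subseq (u : nat -> R * R -> R) v : (forall n, L2O (u n)) -> L2O v ->
  (fun n => dist2 (u n) v) @ \oo --> 0 ->
  exists2 s : nat -> nat, {homo s : i j / (i < j)%N} &
    {ae mu2, forall x, Omega x -> (fun n => u (s n) x) @ \oo --> v x}.
Proof.
move=> Lu Lv uv; apply: (ae_subseq mO (fun n => L2_Int mO finO (Lu n)) (L2_Int mO finO Lv)).
apply/cvg_epsP => e e0.
have c0 : 0 <= I (fun=> 1 ^+ 2) by apply: I_ge0 => x _; rewrite expr1n.
have [] := (cvg_epsP _ _).1 uv (e ^+ 2 / (1 + I (fun=> 1 ^+ 2))).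
  by rewrite divr_gt0 ?exprn_gt0//; lra.
move=> N NP; exists N => n /NP; rewrite !subr0 ger0_norm ?dist2_ge0// => h.
have i0 : 0 <= I (fun x => `|u n x - v x|) by apply: I_ge0.
rewrite ger0_norm// -ler_sqr ?nnegrE ?(ltW e0)//.
have := I_abs_CS (L2B mO (Lu n) Lv) (L2_cst mO finO 1).
have -> : (fun x => `|(u n x - v x) * 1|) = (fun x => `|u n x - v x|).
  by apply/funext => x; rewrite mulr1.
set K := I (fun=> 1 ^+ 2) in c0 h *; rewrite -/(dist2 (u n) v) => k.
move: h; rewrite ler_pdivlMr; last by lra.
have := dist2_ge0 Omega (u n) v; lra.
Qed.

Lemma prod_le_of_squares (X Y a b : R) : X ^+ 2 <= a -> Y ^+ 2 <= b -> X * Y <= a + b.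
Proof.
move=> hX hY; have := sqr_ge0 (X - Y); have := sqr_ge0 X; have := sqr_ge0 Y; lra.
Qed.

(** Induction with [test_gagliardo] applied to [w^(m+1)], whose derivative is [(m+1) w^m] times that
    of [w]. Cauchy-Schwarz isolates the moment of order [2 m], and the factors [(m+1)^2] accumulate
    to [(m!)^2]. This yields the embedding of [H10] into every [L^p] with finite [p]. *)
Lemma test_moment w m : test w ->
  I (fun x => w x ^+ (2 * m)) <=
  (m`!%:R) ^+ 2 * I (fun=> 1) *
    (I (fun x => 'D_(e_ R 0) w x ^+ 2) + I (fun x => 'D_(e_ R 1) w x ^+ 2)) ^+ m.
Proof.
move=> tw; have [B B0 OB] := bounded_set_box bO.
set G := _ + _; have G0 : 0 <= G by apply: addr_ge0; apply: I_ge0 => x _; exact: sqr_ge0.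
elim: m => [|m IH]; first by rewrite muln0 fact0 expr1n !mul1r mulr1.
have tf := test_power m tw.
have := test_gagliardo OB tf.
have LD i : L2O ('d_ i w) by apply: (test_L2 oO bO); exact: test_D.
have Lm : L2O (fun x => m.+1%:R * w x ^+ m).
  apply: (L2Z mO); case: (m) => [|k]; last by apply: (test_L2 oO bO); exact: test_power.
  have -> : (fun x => w x ^+ 0) = (fun=> 1) by apply/funext => x; rewrite expr0.
  exact: (L2_cst mO finO).
have E i : \int[mu2]_(z in setT) `|'D_(e_ R i) (fun z => w z ^+ m.+1) z| =
    I (fun z => `|m.+1%:R * w z ^+ m * 'D_(e_ R i) w z|).
  rewrite -(J_Omega (Omega := Omega)); last by move=> z nz; rewrite (test_out (test_D i tf) nz) normr0.
  by apply: eq_Rintegral => z _; rewrite (derive_power _ _ _ tw).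
have E2 : \int[mu2]_(z in setT) (w z ^+ m.+1) ^+ 2 = I (fun z => w z ^+ (2 * m.+1)).
  rewrite -(J_Omega (Omega := Omega)); last by move=> z nz; rewrite (test_out tf nz) expr0n.
  by apply: eq_Rintegral => z _; rewrite -exprM mulnC.
rewrite [X in X <= _]E2 [X in _ <= X * _]E [X in _ <= _ * X]E.
have nm : I (fun x => (m.+1%:R * w x ^+ m) ^+ 2) = m.+1%:R ^+ 2 * I (fun x => w x ^+ (2 * m)).
  rewrite -(I_Z mO); last first.
    have [_] := Lm; have -> : (fun x => (m.+1%:R * w x ^+ m) ^+ 2) =
      (fun x => m.+1%:R ^+ 2 * w x ^+ (2 * m)).
      by apply/funext => x; rewrite exprMn -exprM mulnC.
    move=> /(Int_Z mO (m.+1%:R ^- 2)); apply: eq_integrable; first exact: mO.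
    by move=> x _ /=; rewrite mulKf// expf_neq0// pnatr_eq0.
  by apply: eq_Rintegral => x _; rewrite exprMn -exprM mulnC.
have c i := I_abs_CS Lm (LD i).
move: (c 0) (c 1); rewrite nm.
set N := I (fun x => w x ^+ (2 * m)) in IH *.
move=> hX hY /le_trans; apply; apply: le_trans (prod_le_of_squares hX hY) _.
have N0 : 0 <= N by apply: I_ge0 => x _; rewrite exprM exprn_ge0 ?sqr_ge0.
rewrite -mulrDr -/G.
clearbody N G; rewrite factS natrM [G ^+ _]exprS.
have -> : (m.+1%:R * m`!%:R) ^+ 2 * I (fun=> 1) * (G * G ^+ m) =
  m.+1%:R ^+ 2 * ((m`!)%:R ^+ 2 * I (fun=> 1) * G ^+ m) * G by ring.
by rewrite ler_wpM2r// ler_wpM2l ?sqr_ge0.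
Qed.

Lemma graph_cvg_sq u g : graph u g -> exists phi : nat -> R * R -> R,
  [/\ forall n, test (phi n), (fun n => dist2 (phi n) u) @ \oo --> 0,
   (forall i, (fun n => dist2 ('d_ i (phi n)) (g i)) @ \oo --> 0) &
   {ae mu2, forall x, Omega x -> (fun n => phi n x) @ \oo --> u x}].
Proof.
move=> [Lu Lg [phi [tp pu pg]]].
have [s hs hae] := dist2_ae_subseq (fun n => test_L2 oO bO (tp n)) Lu pu.
exists (phi \o s); split; [by move=> n; exact: tp|exact: cvg_subseq hs pu| |exact: hae].
by move=> i; exact: cvg_subseq hs (pg i).
Qed.

(** The strict inequality leaves room for the approximating test functions, whose Dirichlet
    integrals are eventually below [G]; Fatou's lemma passes the bound to [u]. *)
Lemma graph_moment u g m (G : R) : graph u g ->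
  I (fun x => g 0 x ^+ 2) + I (fun x => g 1 x ^+ 2) < G ->
  Int (fun x => u x ^+ (2 * m)) /\
  I (fun x => u x ^+ (2 * m)) <= (m`!%:R) ^+ 2 * I (fun=> 1) * G ^+ m.
Proof.
move=> gr GG; have [Lu Lg _] := gr; have [phi [tp pu pg pae]] := graph_cvg_sq gr.
have LD n i : L2O ('d_ i (phi n)) by apply: (test_L2 oO bO); exact: test_D.
have cG : (fun n => I (fun x => 'D_(e_ R 0) (phi n) x ^+ 2) +
    I (fun x => 'D_(e_ R 1) (phi n) x ^+ 2)) @ \oo -->
    I (fun x => g 0 x ^+ 2) + I (fun x => g 1 x ^+ 2).
  by apply: cvgD; apply: (sq_cvg oO bO) => //; exact: pg.
have key (X Y : R) : `|X - Y| <= G - Y -> 0 <= X -> X ^+ m <= G ^+ m.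
  move=> + X0; rewrite ler_norml => /andP[_ h].
  by apply: lerXn2r; rewrite ?nnegrE//; lra.
apply: (fatou_real mO (g := fun n x => phi n x ^+ (2 * m))).
- move=> n; clear key; case: m => [|m].
    have -> : (fun x => phi n x ^+ (2 * 0)) = (fun=> 1).
      by apply/funext => x; rewrite muln0 expr0.
    exact: (Int_cst mO finO).
  rewrite mulnS.
  exact: (L2_Int mO finO (test_L2 oO bO (test_power (1 + 2 * m) (tp n)))).
- by move=> n x _; rewrite exprM exprn_ge0 ?sqr_ge0.
- by apply: measurable_funX; exact: Lu.1.
- apply: aeS pae => x h Ox.
  exact: (cvg_comp (fun n => phi n x) (fun t => t ^+ (2 * m)) (h Ox) (@exprn_continuous R (2 * m) (u x))).
have e0 : 0 < G - (I (fun x => g 0 x ^+ 2) + I (fun x => g 1 x ^+ 2)) by lra.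
have [N NP] := (cvg_epsP _ _).1 cG _ e0; exists N => n Nn.
apply: (le_trans (test_moment m (tp n))).
rewrite ler_wpM2l//; first by rewrite mulr_ge0 ?sqr_ge0//; exact: I_ge0.
apply: (key _ _ (NP n Nn)).
by apply: addr_ge0; apply: I_ge0 => x _; exact: sqr_ge0.
Qed.

(** The case [m = 1] of the moment bound, with [G] decreasing to the Dirichlet integral. *)
Lemma graph_poincare u g : graph u g -> I (fun x => u x ^+ 2) <=
  I (fun=> 1) * (I (fun x => g 0 x ^+ 2) + I (fun x => g 1 x ^+ 2)).
Proof.
move=> gr; set G := _ + _ .
have c0 : 0 <= I (fun=> 1) by apply: I_ge0.
apply/ler_addgt0Pr => e e0.
have GG : G < G + e / (1 + I (fun=> 1)) by rewrite ltrDl divr_gt0//; lra.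
have [_] := graph_moment 1 gr GG; rewrite muln1 factS fact0 muln1 expr1n mul1r expr1 mulrDr.
move=> /le_trans; apply; rewrite lerD2l mulrA ler_pdivrMr; last by lra.
by move: c0; set c := I (fun=> 1); nra.
Qed.

Lemma I_0 : I (fun=> 0) = 0. Proof. by rewrite /Rintegral integral0. Qed.

Lemma ip_cvg0 (f : nat -> R * R -> R) v : (forall n, L2O (f n)) -> L2O v ->
  (fun n => I (fun x => f n x ^+ 2)) @ \oo --> 0 -> (fun n => ip Omega (f n) v) @ \oo --> 0.
Proof.
move=> Lf Lv f0; have <- : ip Omega (fun=> 0) v = 0.
  by rewrite -[RHS]I_0; apply: eq_Rintegral => x _; rewrite mul0r.
apply: (ip_linear_cvg oO bO Lf (L2_cst mO finO 0) Lv).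
have -> // : (fun n => dist2 (f n) (fun=> 0)) = (fun n => I (fun x => f n x ^+ 2)).
by apply/funext => n; apply: eq_Rintegral => x _; rewrite subr0.
Qed.

Lemma sq_cvg0 (a : nat -> R) : (fun n => a n ^+ 2) @ \oo --> 0 -> a @ \oo --> 0.
Proof.
move=> /cvg_epsP h; apply/cvg_epsP => e e0.
have [N NP] := h _ (exprn_gt0 2 e0); exists N => n /NP.
rewrite !subr0 normrX ler_sqr ?nnegrE// ltW//.
Qed.

Lemma Rintegral_rect (h : R * R -> R) (A : set P) : (forall z, ~ Omega z -> h z = 0) ->
  \int[mu2]_(z in A) h z = ip Omega h \1_A.
Proof.
move=> h0; rewrite Rintegral_mkcond /ip (J_Omega (Omega := Omega)); last first.
  by move=> z nz; rewrite h0// mul0r.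
by apply: eq_Rintegral => z _; rewrite patchE indicE; case: ifP; rewrite ?mulr1 ?mulr0.
Qed.

(** After replacing each [w n] by a nearby test function, weak convergence of the second derivative
    sends the primitives in the first variable to zero pointwise. They are uniformly bounded, hence
    tend to zero in [L^2], and [test_rellich_identity] concludes. *)
Lemma rellich0 (w : nat -> R * R -> R) (g : nat -> 'I_2 -> R * R -> R) C :
  (forall n, graph (w n) (g n)) -> (forall n i, I (fun x => g n i x ^+ 2) <= C) ->
  (forall k, L2O k -> (fun n => ip Omega (g n 1) k) @ \oo --> 0) ->
  (fun n => I (fun x => w n x ^+ 2)) @ \oo --> 0.
Proof.
move=> G bg wg; have [B B0 OB] := bounded_set_box bO.
have approx n : exists phi, [/\ test phi, dist2 phi (w n) <= n.+1%:R^-1 &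
    forall i, dist2 ('d_ i phi) (g n i) <= n.+1%:R^-1].
  have [Lw Lg [phi [tp pu pg]]] := G n.
  have e0 : 0 < n.+1%:R^-1 :> R by rewrite invr_gt0 ltr0n.
  have [N0 P0] := (cvg_epsP _ _).1 pu _ e0.
  have [N1 P1] := (cvg_epsP _ _).1 (pg 0) _ e0.
  have [N2 P2] := (cvg_epsP _ _).1 (pg 1) _ e0.
  pose N := maxn N0 (maxn N1 N2).
  have n0 : (N0 <= N)%N by rewrite leq_maxl.
  have n1 : (N1 <= N)%N by rewrite /N maxnCA leq_maxl.
  have n2 : (N2 <= N)%N by rewrite /N maxnC -maxnA maxnCA leq_maxl.
  have nrm (a b : R) : `|a - 0| <= b -> a <= b by rewrite subr0; exact: le_trans (ler_norm _).
  exists (phi N); split; [exact: tp|exact: nrm (P0 N n0)|move=> i].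
  by have [->|->] := ord2 i; [exact: nrm (P1 N n1)|exact: nrm (P2 N n2)].
have [phi hphi] := choice approx.
have tp n : test (phi n) by have [] := hphi n.
have Lp n : L2O (phi n) := test_L2 oO bO (tp n).
have LD n i : L2O ('d_ i (phi n)) := test_L2 oO bO (test_D i (tp n)).
have Lw n : L2O (w n) by have [] := G n.
have Lg n i : L2O (g n i) by have [_ + _] := G n.
have z0 : L2O (fun=> 0) by exact: (L2_cst mO finO).
have dz v : dist2 v (fun=> 0) = I (fun x => v x ^+ 2).
  by apply: eq_Rintegral => x _; rewrite subr0.
have harm1 (n : nat) : n.+1%:R^-1 <= 1 :> R by rewrite invf_le1 ?ler1n ?ltr0n.
pose K := 2 * C + 2.
have key (a b c : R) : a <= 2 * b + 2 * c -> b <= 1 -> c <= C -> a <= K by rewrite /K; lra.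
have bD n i : I (fun x => 'D_(e_ R i) (phi n) x ^+ 2) <= K.
  have := dist2_triangle oO (LD n i) (Lg n i) z0; rewrite !dz => t.
  have [_ _ /(_ i) h] := hphi n; have h' := le_trans h (harm1 n).
  exact: (key _ _ _ t h' (bg n i)).
have K0 : 0 <= K := le_trans (I_ge0 mu2 (fun x _ => sqr_ge0 _)) (bD 0%N 0).
have harm0 : (fun n : nat => n.+1%:R^-1 : R) @ \oo --> (0 : R) := @cvg_inv_succ R.
have wD k : L2O k -> (fun n => ip Omega ('d_ 1 (phi n)) k) @ \oo --> 0.
  move=> Lk.
  have dD : (fun n => I (fun x => ('D_(e_ R 1) (phi n) x - g n 1 x) ^+ 2)) @ \oo --> 0.
    apply: cvg0_le harm0 => n; have [_ _ /(_ 1) h] := hphi n.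
    by apply/andP; split; [exact: dist2_ge0|exact: h].
  have dd := ip_cvg0 (fun n => L2B mO (LD n 1) (Lg n 1)) Lk dD.
  rewrite -[X in _ --> X](addr0 0); apply: cvg_trans (cvgD dd (wg k Lk)).
  apply: near_eq_cvg; apply: nearW => n.
  apply: (etrans (esym (ipD_l oO bO (L2B mO (LD n 1) (Lg n 1)) (Lg n 1) Lk))).
  by apply: eq_Rintegral => x _; rewrite subrK.
pose psi n := primitive1 B (phi n).
have mpsi n : measurable_fun (Omega : set P) (psi n).
  by apply: (measurable_funTS (measurable_primitive1 OB (tp n))).
(* The squared [L^1] norm of the second derivative is at most [K] times the area of [Omega]; the
   summand [1] avoids a square root through [X <= 1 + X^2]. *)
pose M := 1 + K * I (fun=> 1 ^+ 2).
have bpsi n x : Omega x -> `|psi n x| <= M.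
  move=> Ox; apply: (le_trans (primitive1_bound OB (tp n) Ox)).
  rewrite -(J_Omega (Omega := Omega)); last first.
    by move=> z nz; rewrite (test_out (test_D 1 (tp n)) nz) normr0.
  have := I_abs_CS (LD n 1) (L2_cst mO finO 1).
  have -> : (fun x => `|'D_(e_ R 1) (phi n) x * 1|) = (fun x => `|'D_(e_ R 1) (phi n) x|).
    by apply/funext => z; rewrite mulr1.
  move=> t; have t' := le_trans t (ler_wpM2r _ (bD n 1)).
  have key2 (X Y : R) : X ^+ 2 <= Y -> X <= 1 + Y.
    by have := sqr_ge0 (X - 1); have := sqr_ge0 X; lra.
  exact: (key2 _ _ (t' (I_ge0 mu2 (fun x _ => sqr_ge0 1)))).
have cpsi x : Omega x -> (fun n => psi n x) @ \oo --> 0.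
  move=> Ox; have [] := OB x Ox => /andP[x1 x2] /andP[y1 y2].
  pose A : set P := `[- B - 1, x.1]%classic `*` `[- B - 1, x.2]%classic.
  have mA : measurable A by apply: measurableX.
  have L1 : L2O \1_A.
    apply: (L2_bounded mO finO (K := 1)); first exact: measurable_indic.
    by move=> z _; rewrite indicE; case: (_ \in _); rewrite ?normr1 ?normr0.
  apply: cvg_trans (wD _ L1); apply: near_eq_cvg; apply: nearW => n.
  have := primitive1_rect OB (tp n) (ltW y1) (ltW x1); rewrite -surjective_pairing.
  rewrite /psi => ->; rewrite (Rintegral_rect A)//.
  by move=> z nz; exact: (test_out (test_D 1 (tp n)) nz).
have [|||||_ _ cI] := @dct_real _ _ _ mu2 Omega mO (fun n x => psi n x ^+ 2) (fun=> 0) (fun=> M ^+ 2).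
- by move=> n; exact: measurable_funX.
- exact: measurable_cst.
- by apply: aeW => x Ox; have := cvg_sqr (cpsi x Ox); rewrite expr0n.
- exact: (Int_cst mO finO).
- move=> n; apply: aeW => x Ox; rewrite normrX ler_sqr ?nnegrE//; first exact: bpsi.
  exact: le_trans (bpsi n x Ox).
have Lpsi n : L2O (psi n) by apply: (L2_bounded mO finO (K := M)) => // x; exact: bpsi.
rewrite I_0 in cI.
have cphi : (fun n => I (fun x => phi n x ^+ 2)) @ \oo --> 0.
  apply: sq_cvg0; apply: (@cvg0_le _ _ (fun n => K * I (fun x => psi n x ^+ 2))); last first.
    by rewrite -(mulr0 K); apply: cvgM; [exact: cvg_cst|exact: cI].
  move=> n; rewrite sqr_ge0 /=.
  have -> : I (fun x => phi n x ^+ 2) = - ip Omega ('d_ 0 (phi n)) (psi n).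
    rewrite (J_Omega (Omega := Omega)); last first.
      by move=> z nz; rewrite (test_out (tp n) nz) expr0n.
    rewrite (test_rellich_identity OB B0 (tp n)) /ip (J_Omega (Omega := Omega))//.
    by move=> z nz; rewrite (test_out (test_D 0 (tp n)) nz) mul0r.
  rewrite sqrrN; apply: (le_trans (ip_CS (LD n 0) (Lpsi n))).
  by apply: ler_wpM2r; [apply: I_ge0 => x _; exact: sqr_ge0|exact: bD].
apply: (@cvg0_le _ _ (fun n => 2 * n.+1%:R^-1 + 2 * I (fun x => phi n x ^+ 2))); last first.
  rewrite -[X in _ --> X](_ : 2 * 0 + 2 * 0 = 0); last by rewrite mulr0 addr0.
  by apply: cvgD; apply: cvgM => //; exact: cvg_cst.
move=> n; apply/andP; split; first by apply: I_ge0 => x _; exact: sqr_ge0.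
have := dist2_triangle oO (Lw n) (Lp n) z0; rewrite !dz => /le_trans; apply.
have [_ h _] := hphi n; rewrite dist2_sym.
by rewrite lerD2r ler_wpM2l.
Qed.
End Sobolev3.

(** * Testing an equation with a monotone function of its solution *)

Section Energy.
Variable R : realType.
Local Notation P := (measurableTypeR R * measurableTypeR R)%type.
Local Notation mu2 := (leb2 R).
Variable (Omega : set (R * R)).
Hypothesis oO : open Omega.
Hypothesis bO : bounded_set Omega.
Local Notation I f := (\int[mu2]_(x in Omega) f x)%R.
Local Notation Int f := (mu2.-integrable Omega (EFin \o f)).
Local Notation L2O := (L2 mu2 Omega).
Local Notation test := (test_function Omega).
Local Notation "'d_ i f" := (fun x => 'D_(e_ R i) f x) (at level 10, i, f at level 9).
Local Notation ae_eqO f g := {ae mu2, forall x, Omega x -> f x = g x}.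
Local Notation mO := (mOmega oO).
Local Notation finO := (finOmega oO bO).
Local Notation pH2 := (preHilbert_L2 mO finO).
Local Notation graph := (H1graph Omega).
Local Notation dist2 := (sqdist Omega).
Local Notation pd i u := (weak_partial Omega i u).
Implicit Types (f u v w phi : R * R -> R) (g h : 'I_2 -> R * R -> R).
Variables qmin qmax : R.
Hypothesis qmin0 : 0 < qmin.
Local Notation Qad := (Qad Omega qmin qmax).
Local Notation H10 := (H10 Omega).
Implicit Types (q : R * R -> 'M[R]_2).

Definition pairing2 g h : R := ip Omega (g 0) (h 0) + ip Omega (g 1) (h 1).
Local Notation ip2 := pairing2.
Definition grad_sq u : R := I (fun x => pd 0 u x ^+ 2) + I (fun x => pd 1 u x ^+ 2).
Local Notation D2 := grad_sq.

Lemma cvg_seq_ext (a b : nat -> R) (l : R) : (forall n, a n = b n) -> a @ \oo --> l -> b @ \oo --> l.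
Proof. by move=> /funext ->. Qed.

Lemma cvg_ge0 (a : nat -> R) (l : R) : a @ \oo --> l -> (forall n, 0 <= a n) -> 0 <= l.
Proof.
move=> al a0; rewrite -(cvg_lim _ al)//; apply: limr_ge; last exact: nearW.
by apply/cvg_ex; exists l.
Qed.

Lemma ip_eq_ae_r u v v' : L2O u -> L2O v -> L2O v' -> ae_eqO v v' -> ip Omega u v = ip Omega u v'.
Proof.
move=> [mu _] [mv _] [mv' _] E; rewrite [LHS]ipC [RHS]ipC.
by apply: (ip_eq_ae oO).
Qed.

Lemma I_sq_ge0 u : 0 <= I (fun x => u x ^+ 2).
Proof. by apply: I_ge0 => x _; exact: sqr_ge0. Qed.

Lemma I_abs_cvg0 (f : nat -> R * R -> R) v : (forall n, L2O (f n)) -> L2O v ->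
  (fun n => I (fun x => f n x ^+ 2)) @ \oo --> 0 ->
  (fun n => I (fun x => `|v x * f n x|)) @ \oo --> 0.
Proof.
move=> Lf Lv f0; apply: sq_cvg0.
apply: (@cvg0_le _ _ (fun n => I (fun x => v x ^+ 2) * I (fun x => f n x ^+ 2))); last first.
  by rewrite -(mulr0 (I (fun x => v x ^+ 2))); apply: cvgM; [exact: cvg_cst|exact: f0].
by move=> n; rewrite sqr_ge0 /=; exact: (I_abs_CS oO bO).
Qed.

(** Pointwise core of [energy_ineq]: replacing the true gradient [(a, b)] by an approximation
    [(A, B)] costs at most [L] times the error, whatever the weight [d] in [[0, L]]. *)
Lemma weighted_ge0 (d L s0 s1 a b A B : R) : 0 <= d -> d <= L -> 0 <= s0 * a + s1 * b ->
  0 <= s0 * (d * A) + s1 * (d * B) + L * (`|s0 * (A - a)| + `|s1 * (B - b)|).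
Proof.
move=> d0 dL ab.
have H (w : R) : 0 <= d * w + L * `|w|.
  have mw : - `|w| <= w by rewrite lerNl -normrN ler_norm.
  move: (normr_ge0 w) mw; move: (`|w|) => m m0 mw.
  have h1 : 0 <= d * (w + m) by apply: mulr_ge0 => //; lra.
  have h2 : 0 <= (L - d) * m by apply: mulr_ge0 => //; lra.
  by move: h1 h2; rewrite mulrDr mulrBl; lra.
by have := H (s0 * (A - a)); have := H (s1 * (B - b)); have := mulr_ge0 d0 ab; lra.
Qed.

(** No chain rule for Sobolev functions is invoked: the equation is tested with [h (phi n)] for test
    functions [phi n] tending to [u]. The bound [L] on the derivative of [h] makes the error an
    [L^1] norm of [s] times the gradient difference, which tends to zero. *)
Lemma energy_ineq (u k : R * R -> R) (s : 'I_2 -> R * R -> R) (h : R -> R) (L : R) :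
  H10 u -> (forall i, L2O (s i)) -> L2O k ->
  (forall v, H10 v -> ip2 s (fun i => pd i v) = ip Omega k v) ->
  {ae mu2, forall x, Omega x -> 0 <= s 0 x * pd 0 u x + s 1 x * pd 1 u x} ->
  smooth1 h -> h 0 = 0 -> (forall t, 0 <= derive1 h t <= L) ->
  0 <= ip Omega k (fun x => h (u x)).
Proof.
move=> Hu Ls Lk wf pos sh h0 hL; have [Lu Lg [phi [tp pu pg]]] := H10_graph oO bO Hu.
have lip : forall x y, `|h x - h y| <= L * `|x - y|.
  apply: lipschitz_derive1 => [x|x]; first exact: smooth1_derivable.
  by have /andP[? ?] := hL x; rewrite ger0_norm.
have L0 : 0 <= L by have /andP[a b] := hL 0; exact: le_trans a b.
have Lp n : L2O (phi n) := test_L2 oO bO (tp n).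
have tw n : test (fun x => h (phi n x)) by apply: test_comp.
have mh w : L2O w -> L2O (fun x => h (w x)).
  move=> Lw; apply: (L2_le mO _ (L2Z mO L Lw)).
    by apply: measurableT_comp => //; [apply: continuous_measurable_fun; exact: smooth1_continuous|exact: Lw.1].
  by apply: aeW => x _; have := lip (w x) 0; rewrite h0 !subr0 normrM (ger0_norm L0).
have dh : (fun n => dist2 (fun x => h (phi n x)) (fun x => h (u x))) @ \oo --> 0.
  apply: (@cvg0_le _ _ (fun n => L ^+ 2 * dist2 (phi n) u)); last first.
    by rewrite -(mulr0 (L ^+ 2)); apply: cvgM; [exact: cvg_cst|exact: pu].
  move=> n; rewrite dist2_ge0 /=.
  have [_ i1] := L2B mO (Lp n) Lu; have [_ i2] := L2B mO (mh _ (Lp n)) (mh _ Lu).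
  rewrite -(I_Z mO (L ^+ 2) i1); apply: (I_le mO i2); first exact: (Int_Z mO _ i1).
  apply: aeW => x _; rewrite -exprMn -[leLHS]real_normK ?num_real//.
  rewrite -[leRHS]real_normK ?num_real// ler_sqr ?nnegrE// normrM (ger0_norm L0).
  exact: lip.
have ck : (fun n => ip Omega k (fun x => h (phi n x))) @ \oo --> ip Omega k (fun x => h (u x)).
  have := ip_linear_cvg oO bO (fun n => mh _ (Lp n)) (mh _ Lu) Lk dh.
  by rewrite [X in _ --> X](ipC _ _ k); apply: cvg_seq_ext => n; rewrite ipC.
have LD n i : L2O ('d_ i (phi n)) := test_L2 oO bO (test_D i (tp n)).
have LB n i : L2O (fun x => 'D_(e_ R i) (phi n) x - pd i u x) := L2B mO (LD n i) (Lg i).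
pose err n i := I (fun x => `|s i x * ('D_(e_ R i) (phi n) x - pd i u x)|).
have cerr i : (fun n => err n i) @ \oo --> 0 by apply: I_abs_cvg0; [move=> n; exact: LB|exact: Ls|exact: pg].
have key n : 0 <= ip Omega k (fun x => h (phi n x)) + L * (err n 0 + err n 1).
  have Hw := test_H10 oO bO (tw n); rewrite -(wf _ Hw).
  have Ew i : ip Omega (s i) (pd i (fun x => h (phi n x))) =
      I (fun x => s i x * (derive1 h (phi n x) * 'D_(e_ R i) (phi n) x)).
    rewrite (ip_eq_ae_r (Ls i) (H10_pd oO bO i Hw) _ (test_pd oO bO i (tw n))); last first.
      exact: (test_L2 oO bO (test_D i (tw n))).
    apply: eq_Rintegral => x _; rewrite (derive_smooth1_comp _ _ sh)//.
    exact: test_smooth (tp n).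
  have Lh i : L2O (fun x => derive1 h (phi n x) * 'D_(e_ R i) (phi n) x).
    apply: (L2_bM mO (K := L)) => //; last first.
      by apply: aeW => x _; have /andP[? ?] := hL (phi n x); rewrite ger0_norm.
    apply: measurableT_comp; last exact: (Lp n).1.
    by apply: continuous_measurable_fun; apply: smooth1_continuous; exact: smooth1_derive.
  rewrite /ip2 (Ew 0) (Ew 1).
  have iE i := Int_abs (L2M mO (Ls i) (LB n i)).
  have iS i := L2M mO (Ls i) (Lh i).
  rewrite -(I_D mO (iS 0) (iS 1)) /err -(I_D mO (iE 0) (iE 1)).
  have i1 := Int_D mO (iS 0) (iS 1); have i2 := Int_D mO (iE 0) (iE 1).
  rewrite -(I_Z mO L i2) -(I_D mO i1 (Int_Z mO L i2)).
  apply: (I_ge0_ae mO (Int_D mO i1 (Int_Z mO L i2))).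
  apply: aeS pos => x hx Ox; have := hx Ox; have /andP[d0 dL] := hL (phi n x).
  by move=> ab; exact: weighted_ge0.
have c : (fun n => ip Omega k (fun x => h (phi n x)) + L * (err n 0 + err n 1)) @ \oo -->
    ip Omega k (fun x => h (u x)) + L * (0 + 0).
  apply: cvgD; first exact: ck.
  by apply: cvgM; [exact: cvg_cst|apply: cvgD; exact: cerr].
by have := cvg_ge0 c key; rewrite addr0 mulr0 addr0.
Qed.
End Energy.

(** * Admissible coefficients and their energy forms *)

Section Form.
Variable R : realType.
Local Notation P := (measurableTypeR R * measurableTypeR R)%type.
Local Notation mu2 := (leb2 R).
Variable (Omega : set (R * R)).
Hypothesis oO : open Omega.
Hypothesis bO : bounded_set Omega.
Local Notation I f := (\int[mu2]_(x in Omega) f x)%R.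
Local Notation Int f := (mu2.-integrable Omega (EFin \o f)).
Local Notation L2O := (L2 mu2 Omega).
Local Notation test := (test_function Omega).
Local Notation "'d_ i f" := (fun x => 'D_(e_ R i) f x) (at level 10, i, f at level 9).
Local Notation ae_eqO f g := {ae mu2, forall x, Omega x -> f x = g x}.
Local Notation mO := (mOmega oO).
Local Notation finO := (finOmega oO bO).
Local Notation pH2 := (preHilbert_L2 mO finO).
Local Notation graph := (H1graph Omega).
Local Notation dist2 := (sqdist Omega).
Local Notation pd i u := (weak_partial Omega i u).
Implicit Types (f u v w phi : R * R -> R) (g h : 'I_2 -> R * R -> R).
Variables qmin qmax : R.
Hypothesis qmin0 : 0 < qmin.
Local Notation Qad := (Qad Omega qmin qmax).
Local Notation H10 := (H10 Omega).
Implicit Types (q : R * R -> 'M[R]_2).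
Local Notation D2 := (grad_sq Omega).
Local Notation ip2 := (pairing2 Omega).

Lemma loewner2 (A B : 'M[R]_2) : loewner_le A B <-> forall a b, 0 <= (B 0 0 - A 0 0) * a ^+ 2 +
  (B 0 1 - A 0 1 + (B 1 0 - A 1 0)) * (a * b) + (B 1 1 - A 1 1) * b ^+ 2.
Proof.
have E (x : 'cV[R]_2) : (x^T *m (B - A) *m x) 0 0 = (B 0 0 - A 0 0) * x 0 0 ^+ 2 +
  (B 0 1 - A 0 1 + (B 1 0 - A 1 0)) * (x 0 0 * x 1 0) + (B 1 1 - A 1 1) * x 1 0 ^+ 2.
  by rewrite mxE big_ord2 !mxE !big_ord2 !mxE; ring.
split=> [h a b|h x]; last by rewrite E.
by have := h (\col_i (if i == 0 then a else b)); rewrite E !mxE.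
Qed.

Definition ell (A : 'M[R]_2) : Prop := A 0 1 = A 1 0 /\ forall a b,
  qmin * (a ^+ 2 + b ^+ 2) <= A 0 0 * a ^+ 2 + 2 * A 0 1 * (a * b) + A 1 1 * b ^+ 2
    <= qmax * (a ^+ 2 + b ^+ 2).

Lemma quadratic_form_bound (m M a b c : R) : 0 < m -> (forall x y,
    m * (x ^+ 2 + y ^+ 2) <= a * x ^+ 2 + 2 * b * (x * y) + c * y ^+ 2 <= M * (x ^+ 2 + y ^+ 2)) ->
  [/\ `|a| <= M, `|b| <= M & `|c| <= M].
Proof.
move=> m0 h; have := h 1 0; have := h 0 1; have := h 1 1; have := h 1 (-1).
rewrite !expr1n !expr0n sqrrN expr1n /=.
move=> /andP[a1 a2] /andP[b1 b2] /andP[c1 c2] /andP[d1 d2].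
by split; rewrite ler_norml; apply/andP; split; lra.
Qed.

Lemma ell_bound A i j : ell A -> `|A i j| <= qmax.
Proof.
move=> [sA /(quadratic_form_bound qmin0)[h0 h1 h2]].
by have [->|->] := ord2 i; have [->|->] := ord2 j; rewrite -?sA; first [exact: h0|exact: h1|exact: h2].
Qed.

Lemma ellP (A : 'M[R]_2) : ell A <-> A^T = A /\ (loewner_le qmin%:M A /\ loewner_le A qmax%:M).
Proof.
have e01 : ((0 : 'I_2) == 1) = false by [].
have e10 : ((1 : 'I_2) == 0) = false by [].
rewrite /ell !loewner2 !mxE !eqxx e01 e10 /=; split.
  move=> [sA hA]; split.
    apply/matrixP => i j; rewrite mxE.
    by have [->|->] := ord2 i; have [->|->] := ord2 j.
  by split => a b; have /andP[] := hA a b; rewrite -?sA; lra.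
move=> [sA [h1 h2]]; have s01 : A 0 1 = A 1 0 by rewrite -[in LHS]sA mxE.
split => // a b; have := h1 a b; have := h2 a b; rewrite -s01 => k1 k2.
by apply/andP; split; lra.
Qed.

Lemma QadP q : Qad q <-> (forall i j, measurable_fun (Omega : set P) (fun x => q x i j)) /\
  {ae mu2, forall x, Omega x -> ell (q x)}.
Proof.
split=> [[Lq sq hq]|[mq hq]].
  split; first by move=> i j; have /(Lp2P mO)[] := Lq i j.
  by apply: aeS2 sq hq => x h1 h2 Ox; apply/ellP; split; [exact: h1|exact: h2].
split.
- move=> i j; apply/(Lp2P mO).
  apply: (L2_le mO (mq i j) (L2_cst mO finO qmax)); apply: aeS hq => x h Ox.
  exact: le_trans (ell_bound i j (h Ox)) (ler_norm _).
- by apply: aeS hq => x h Ox; have /ellP[] := h Ox.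
- by apply: aeS hq => x h Ox; have /ellP[] := h Ox.
Qed.

Lemma Qad_L2M q i j a : Qad q -> L2O a -> L2O (fun x => q x i j * a x).
Proof.
move=> /QadP[mq hq] La; apply: (L2_bM mO (K := qmax)) => //.
by apply: aeS hq => x h Ox; apply: ell_bound; exact: h.
Qed.

Definition flux q u (i : 'I_2) x := q x i 0 * pd 0 u x + q x i 1 * pd 1 u x.

Lemma flux_L2 q u i : Qad q -> H10 u -> L2O (flux q u i).
Proof. by move=> Qq Hu; apply: (L2D mO); apply: Qad_L2M => //; exact: H10_pd. Qed.

Definition energy q u v : R := ip2 (flux q u) (fun i => pd i v).
Local Notation En := energy.

Lemma ip2E (s g : 'I_2 -> R * R -> R) : (forall i, L2O (s i)) -> (forall i, L2O (g i)) ->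
  ip2 s g = I (fun x => s 0 x * g 0 x + s 1 x * g 1 x).
Proof. by move=> Ls Lg; rewrite (I_D mO (L2M mO (Ls 0) (Lg 0)) (L2M mO (Ls 1) (Lg 1))). Qed.

Lemma ip_mx_En q u v : Qad q -> H10 u -> H10 v ->
  ip_mx Omega (fun x => q x *m grad Omega u x) (grad Omega v) = En q u v.
Proof.
move=> Qq Hu Hv; rewrite /En ip2E; last 2 first.
- by move=> i; exact: flux_L2.
- by move=> i; exact: H10_pd.
by apply: eq_Rintegral => x _; rewrite dot_col !mulmx_col2 !gradE.
Qed.

Lemma sym_form_sym (a b b' c x y z w : R) : b = b' ->
  (a * x + b * y) * z + (b' * x + c * y) * w = (a * z + b * w) * x + (b' * z + c * w) * y.
Proof. by move=> <-; ring. Qed.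

Lemma sym_formE (a b b' c x y : R) : b = b' ->
  (a * x + b * y) * x + (b' * x + c * y) * y = a * x ^+ 2 + 2 * b * (x * y) + c * y ^+ 2.
Proof. by move=> <-; ring. Qed.

Lemma form_linear (a b k x y x' y' : R) :
  a * (k * x + x') + b * (k * y + y') = k * (a * x + b * y) + (a * x' + b * y').
Proof. by ring. Qed.

Lemma En_sym q u v : Qad q -> H10 u -> H10 v -> En q u v = En q v u.
Proof.
move=> Qq Hu Hv; rewrite /En !ip2E => [|i|i|i|i]; try exact: flux_L2; try exact: H10_pd.
have m w w' : H10 w -> H10 w' ->
    measurable_fun Omega (fun x => flux q w 0 x * pd 0 w' x + flux q w 1 x * pd 1 w' x).
  move=> Hw Hw'; apply: measurable_funD; apply: measurable_funM;
    by [exact: (flux_L2 _ Qq Hw).1|exact: (H10_pd oO bO _ Hw').1].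
apply: (I_eq_ae mO); [exact: m|exact: m|].
have [_ hq] := (QadP q).1 Qq; apply: aeS hq => x h Ox; have [s _] := h Ox.
exact: sym_form_sym s.
Qed.

Lemma En_ge q u : Qad q -> H10 u -> qmin * D2 u <= En q u u.
Proof.
move=> Qq Hu; rewrite /En ip2E => [|i|i]; try exact: flux_L2; try exact: H10_pd.
have i0 i := (H10_pd oO bO i Hu).2.
rewrite /grad_sq -(I_D mO (i0 0) (i0 1)) -(I_Z mO _ (Int_D mO (i0 0) (i0 1))).
apply: (I_le mO).
- exact: (Int_Z mO _ (Int_D mO (i0 0) (i0 1))).
- by apply: (Int_D mO); apply: (L2M mO); [exact: flux_L2|exact: H10_pd|exact: flux_L2|exact: H10_pd].
have [_ hq] := (QadP q).1 Qq; apply: aeS hq => x h Ox; have [s e] := h Ox.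
by have /andP[k _] := e (pd 0 u x) (pd 1 u x); rewrite /flux (sym_formE _ _ _ _ s).
Qed.

Lemma En_le q u : Qad q -> H10 u -> En q u u <= qmax * D2 u.
Proof.
move=> Qq Hu; rewrite /En ip2E => [|i|i]; try exact: flux_L2; try exact: H10_pd.
have i0 i := (H10_pd oO bO i Hu).2.
rewrite /grad_sq -(I_D mO (i0 0) (i0 1)) -(I_Z mO _ (Int_D mO (i0 0) (i0 1))).
apply: (I_le mO).
- by apply: (Int_D mO); apply: (L2M mO); [exact: flux_L2|exact: H10_pd|exact: flux_L2|exact: H10_pd].
- exact: (Int_Z mO _ (Int_D mO (i0 0) (i0 1))).
have [_ hq] := (QadP q).1 Qq; apply: aeS hq => x h Ox; have [s e] := h Ox.
by have /andP[_ k] := e (pd 0 u x) (pd 1 u x); rewrite /flux (sym_formE _ _ _ _ s).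
Qed.

Lemma ip2_lin_l a (s t g : 'I_2 -> R * R -> R) : (forall i, L2O (s i)) -> (forall i, L2O (t i)) ->
  (forall i, L2O (g i)) -> ip2 (fun i x => a * s i x + t i x) g = a * ip2 s g + ip2 t g.
Proof.
move=> Ls Lt Lg; have E i : ip Omega (fun x => a * s i x + t i x) (g i) =
    a * ip Omega (s i) (g i) + ip Omega (t i) (g i).
  by rewrite (ipD_l oO bO (L2Z mO a (Ls i)) (Lt i) (Lg i)) (ipZ_l oO bO a (Ls i) (Lg i)).
by rewrite /pairing2 !E; ring.
Qed.

Lemma En_lin_l q a u v w : Qad q -> H10 u -> H10 v -> H10 w ->
  En q (fun x => a * u x + v x) w = a * En q u w + En q v w.
Proof.
move=> Qq Hu Hv Hw; have Huv := H10_lin oO bO a Hu Hv.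
have Lw i : L2O (pd i w) by exact: H10_pd.
have Lf z i : H10 z -> L2O (flux q z i) by move=> Hz; exact: flux_L2.
rewrite /En -(ip2_lin_l a (fun i => Lf u i Hu) (fun i => Lf v i Hv) Lw).
have E i : ip Omega (flux q (fun x => a * u x + v x) i) (pd i w) =
    ip Omega (fun x => a * flux q u i x + flux q v i x) (pd i w).
  apply: (ip_eq_ae oO); [exact: (Lf _ i Huv).1| |exact: (Lw i).1|].
    by apply: (L2D mO (L2Z mO a (Lf u i Hu)) (Lf v i Hv)).1.
  apply: aeS2 (pd_lin oO bO a 0 Hu Hv) (pd_lin oO bO a 1 Hu Hv) => x e0 e1 Ox.
  by rewrite /flux (e0 Ox) (e1 Ox); exact: form_linear.
by rewrite /pairing2 !E.
Qed.

Lemma H10_0 : H10 (fun=> 0). Proof. by apply: (test_H10 oO bO); exact: test_0. Qed.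

Lemma H10B u v : H10 u -> H10 v -> H10 (fun x => u x - v x).
Proof.
move=> Hu Hv; have := H10_lin oO bO (-1) Hv Hu.
by congr H10; apply/funext => x; rewrite mulN1r addrC.
Qed.

Lemma pdB i u v : H10 u -> H10 v ->
  ae_eqO (pd i (fun x => u x - v x)) (fun x => pd i u x - pd i v x).
Proof.
move=> Hu Hv; have := pd_lin oO bO (-1) i Hv Hu.
have -> : (fun x => -1 * v x + u x) = (fun x => u x - v x).
  by apply/funext => x; rewrite mulN1r addrC.
by apply: aeS => x h Ox; rewrite h// mulN1r addrC.
Qed.

Lemma D2B u v : H10 u -> H10 v ->
  D2 (fun x => u x - v x) = dist2 (pd 0 u) (pd 0 v) + dist2 (pd 1 u) (pd 1 v).
Proof.
move=> Hu Hv; have Lu i : L2O (pd i u) by exact: H10_pd.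
have Lv i : L2O (pd i v) by exact: H10_pd.
have E i : I (fun x => pd i (fun x => u x - v x) x ^+ 2) = dist2 (pd i u) (pd i v).
  apply: (I_eq_ae mO).
  - by apply: measurable_funX; exact: (H10_pd oO bO i (H10B Hu Hv)).1.
  - by apply: measurable_funX; exact: (L2B mO (Lu i) (Lv i)).1.
  by apply: aeS (pdB i Hu Hv) => x h Ox; rewrite h.
exact: (f_equal2 +%R (E 0) (E 1)).
Qed.

Lemma poincare u : H10 u -> I (fun x => u x ^+ 2) <= I (fun=> 1) * D2 u.
Proof. by move=> Hu; exact: (graph_poincare oO bO (H10_graph oO bO Hu)). Qed.

Lemma D2_ge0 u : 0 <= D2 u.
Proof. by apply: addr_ge0; exact: I_sq_ge0. Qed.

Local Opaque energy grad_sq.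
(** Ellipticity and Poincare bound the [L^2] distances of functions and derivatives by this form, so
    completeness comes from [L2_complete] and [graph_closed]. The weight is [k = gamma] in the
    existence proof for states and [k = 0] for weak compactness in [H10]. *)
Lemma preHilbert_En q k : Qad q -> 0 <= k ->
  preHilbert H10 (fun u v => En q u v + k * ip Omega u v).
Proof.
move=> Qq k0.
have addE (x y : R * R -> R) : x + y = (fun z => 1 * x z + y z).
  by apply/funext => z; rewrite mul1r.
have sclE a (x : R * R -> R) : a *: x = (fun z => a * x z + 0).
  by apply/funext => z; rewrite addr0.
have subE (x y : R * R -> R) : x - y = (fun z => x z - y z) by [].
have En0 w : H10 w -> En q (fun=> 0) w = 0.
  move=> Hw; have h : En q (fun=> 0) w = -1 * En q (fun=> 0) w + En q (fun=> 0) w.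
    apply: etrans (En_lin_l (-1) Qq H10_0 H10_0 Hw); congr (En q _ w).
    by apply/funext => x; rewrite mulr0 addr0.
  by rewrite h mulN1r addNr.
split.
- exact: H10_0.
- by move=> x y Hx Hy; rewrite addE; exact: H10_lin.
- by move=> a x Hx; rewrite (sclE a x); exact: (H10_lin oO bO a Hx H10_0).
- move=> x y Hx Hy; exact: (f_equal2 (fun a b => a + k * b) (En_sym Qq Hx Hy) (ipC Omega x y)).
- move=> x y z Hx Hy Hz.
  have e1 := En_lin_l 1 Qq Hx Hy Hz; rewrite mul1r in e1.
  have e2 := ipD_l oO bO (H10_L2 oO bO Hx) (H10_L2 oO bO Hy) (H10_L2 oO bO Hz).
  have -> : En q (x + y) z = En q x z + En q y z by rewrite addE; exact: e1.
  have -> : ip Omega (x + y) z = ip Omega x z + ip Omega y z by exact: e2.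
  by rewrite mulrDr addrACA.
- move=> a x y Hx Hy.
  have e1 := En_lin_l a Qq Hx H10_0 Hy; rewrite (En0 _ Hy) addr0 in e1.
  have e2 := ipZ_l oO bO a (H10_L2 oO bO Hx) (H10_L2 oO bO Hy).
  have -> : En q (a *: x) y = a * En q x y by rewrite sclE; exact: e1.
  have -> : ip Omega (a *: x) y = a * ip Omega x y by exact: e2.
  have alg (E F : R) : a * E + k * (a * F) = a * (E + k * F) by ring.
  exact: alg.
- move=> x Hx; apply: addr_ge0.
    by apply: le_trans (En_ge Qq Hx); rewrite mulr_ge0 ?D2_ge0// ltW.
  by apply: mulr_ge0 => //; exact: I_sq_ge0.
move=> x Hx cx; pose c := I (fun=> 1).
have c0 : 0 <= c by apply: I_ge0.
have cD (e : R) : 0 < e -> exists N, forall m n, (N <= m)%N -> (N <= n)%N ->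
    D2 (fun z => x m z - x n z) <= e.
  move=> e0; have [N NP] := cx (qmin * e) (mulr_gt0 qmin0 e0).
  exists N => m n Nm Nn; have Hb := H10B (Hx m) (Hx n).
  have := NP m n Nm Nn; rewrite subE => h.
  have kk : 0 <= k * ip Omega (fun z => x m z - x n z) (fun z => x m z - x n z).
    by apply: mulr_ge0 => //; exact: I_sq_ge0.
  by rewrite -(ler_pM2l qmin0); apply: le_trans (En_ge Qq Hb) _; apply: le_trans h; rewrite lerDl.
have Lx n : L2O (x n) := H10_L2 oO bO (Hx n).
have Lpx n i : L2O (pd i (x n)) := H10_pd oO bO i (Hx n).
have [v Lv cv] : exists2 v, L2O v & (fun n => I (fun z => (x n z - v z) ^+ 2)) @ \oo --> 0.
  apply: (L2_complete mO finO Lx) => e e0.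
  have e1 : 0 < e / (1 + c) by rewrite divr_gt0//; lra.
  have [N NP] := cD _ e1; exists N => m n Nm Nn.
  apply: (le_trans (poincare (H10B (Hx m) (Hx n)))).
  have := NP m n Nm Nn; rewrite ler_pdivlMr; last by lra.
  by rewrite -/c; have := D2_ge0 (fun z => x m z - x n z); move: (D2 _) => d; lra.
have hh i : exists2 h, L2O h & (fun n => I (fun z => (pd i (x n) z - h z) ^+ 2)) @ \oo --> 0.
  apply: (L2_complete mO finO (fun n => Lpx n i)) => e e0.
  have [N NP] := cD _ e0; exists N => m n Nm Nn.
  apply: le_trans (NP m n Nm Nn); rewrite (D2B (Hx m) (Hx n)).
  have d0 := dist2_ge0 Omega (pd 0 (x m)) (pd 0 (x n)).
  have d1 := dist2_ge0 Omega (pd 1 (x m)) (pd 1 (x n)).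
  have kl (a b : R) : 0 <= b -> a <= a + b by rewrite lerDl.
  have kr (a b : R) : 0 <= a -> b <= a + b by rewrite lerDr.
  by have [->|->] := ord2 i; [exact: (kl _ _ d1)|exact: (kr _ _ d0)].
have [h0 Lh0 ch0] := hh 0; have [h1 Lh1 ch1] := hh 1.
pose h (i : 'I_2) := if i == 0 then h0 else h1.
have Lh i : L2O (h i) by rewrite /h; case: ifP.
have ch i : (fun n => dist2 (pd i (x n)) (h i)) @ \oo --> 0.
  by have [->|->] := ord2 i; rewrite /h.
have Gv : graph v h := graph_closed oO bO (fun n => H10_graph oO bO (Hx n)) Lv Lh cv ch.
have Hv := graph_H10 oO bO Gv; exists v => //.
have cd i : (fun n => dist2 (pd i (x n)) (pd i v)) @ \oo --> 0.
  have e n : dist2 (pd i (x n)) (h i) = dist2 (pd i (x n)) (pd i v).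
    apply: (dist2_ae oO (Lpx n i) (Lpx n i) (Lh i) (H10_pd oO bO i Hv)); first exact: aeW.
    by apply: aeS (graph_pd_ae oO bO i Gv) => z e Oz; rewrite e.
  exact: (cvg_seq_ext e (ch i)).
apply: (@cvg0_le _ _ (fun n => qmax * (dist2 (pd 0 (x n)) (pd 0 v) + dist2 (pd 1 (x n)) (pd 1 v))
   + k * dist2 (x n) v)); last first.
  rewrite -[X in _ --> X](_ : qmax * (0 + 0) + k * 0 = 0); last by rewrite !mulr0 !addr0 mulr0.
  apply: cvgD; apply: cvgM; try exact: cvg_cst; last exact: cv.
  by apply: cvgD; exact: cd.
move=> n; rewrite subE -(D2B (Hx n) Hv); have Hb := H10B (Hx n) Hv; apply/andP; split.
  apply: addr_ge0; last by apply: mulr_ge0 => //; exact: I_sq_ge0.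
  by apply: le_trans (En_ge Qq Hb); rewrite mulr_ge0 ?D2_ge0// ltW.
by apply: lerD; [exact: En_le|].
Qed.
End Form.

Local Transparent energy grad_sq.

(** * Properties of the smoothed penalty *)

Section SmoothedMax.
Variables (R : realType) (M c1 c2 psi : R) (maxs : R -> R -> R).
Hypothesis psi0 : psi < 0.
Hypothesis sm : smoothed_max M c1 c2 maxs.
Variable gamma : R.
Hypothesis g0 : 0 < gamma.
Local Notation r := (r_ maxs psi gamma).

Lemma maxs_ge0 x : 0 <= maxs gamma x. Proof. by have [_ /(_ x)/andP[]] := sm g0. Qed.

Lemma maxs_eq0 x : x <= 0 -> maxs gamma x = 0.
Proof. by move=> x0; have [_ _ /(_ x (or_intror x0)) ->] := sm g0; rewrite max_l. Qed.

Lemma maxs_approx x : maxs gamma x <= Num.max 0 x <= maxs gamma x + (2 * gamma)^-1.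
Proof.
have [_ b e _ _] := sm g0; have /andP[_ ->] := b x; rewrite /=.
have i0 : 0 < (2 * gamma)^-1 by rewrite invr_gt0 mulr_gt0.
have [xl|xl] := leP (2 * gamma)^-1 x; first by rewrite (e x (or_introl xl)) lerDl ltW.
have m0 := maxs_ge0 x; rewrite ge_max; apply/andP; split; last by lra.
by rewrite addr_ge0// ltW.
Qed.

Lemma r_le0 s : r s <= 0.
Proof. by rewrite /r_ mulNr oppr_le0 mulr_ge0 ?maxs_ge0// ltW. Qed.

Lemma r_eq0 s : psi <= s -> r s = 0.
Proof. by move=> h; rewrite /r_ maxs_eq0 ?mulr0// subr_le0. Qed.

(** At [t >= psi] the penalty vanishes, so this monotonicity needs only the sign of [r] and where it
    is nonzero. *)
Lemma r_mul_sub_ge0 s t : psi <= t -> 0 <= r s * (s - t).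
Proof.
move=> pt; have [ps|sp] := leP psi s; first by rewrite r_eq0// mul0r.
by rewrite mulr_le0 ?r_le0//; lra.
Qed.

(** The error [2] of [softneg_approx] plus [gamma / (2 gamma) = 1 / 2] from the smoothing of the
    maximum; the bound does not depend on [gamma]. *)
Lemma r_softneg s : `|softneg gamma psi s - r s| <= 3.
Proof.
have hs := softneg_approx s g0 psi0; have /andP[a b] := maxs_approx (psi - s).
have e : gamma * (2 * gamma)^-1 = 2^-1 by field; rewrite gt_eqF.
have hb := ler_wpM2l (ltW g0) b; have ha := ler_wpM2l (ltW g0) a.
rewrite mulrDr e in hb; move: ha hb hs; rewrite /r_ mulNr opprK.
move: (gamma * Num.max 0 _) (gamma * maxs _ _) (softneg _ _ _) => X Y Z h1 h2.
by rewrite !ler_norml => /andP[? ?]; apply/andP; split; lra.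
Qed.

Lemma maxs_derivable x : derivable (maxs gamma) x 1.
Proof. by have [[d _] _ _ _ _] := sm g0. Qed.

Lemma maxs_derive x : 0 <= derive1 (maxs gamma) x <= 2.
Proof. by have [_ _ _ /(_ x)[]] := sm g0. Qed.

Lemma r_continuous : continuous r.
Proof.
move=> s; apply: (@continuousM R R (fun=> - gamma) (fun s => maxs gamma (psi - s))).
  exact: cst_continuous.
apply: (@continuous_comp R R R (fun s => psi - s) (maxs gamma)).
  by apply: continuousB; [exact: cst_continuous|exact: cvg_id].
exact: (derivable1_continuous maxs_derivable).
Qed.

Lemma dr_bounds s : 0 <= dr_ maxs psi gamma s <= 2 * gamma.
Proof.
have /andP[a b] := maxs_derive (psi - s); rewrite /dr_ mulr_ge0 ?(ltW g0)//=.
by rewrite mulrC ler_wpM2r// ltW.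
Qed.

Lemma dr_continuous : continuous (dr_ maxs psi gamma).
Proof.
have [[_ [d _]] _ _ _ _] := sm g0.
move=> s; apply: (@continuousM R R (fun=> gamma) (fun s => derive1 (maxs gamma) (psi - s))).
  exact: cst_continuous.
apply: (@continuous_comp R R R (fun s => psi - s) (derive1 (maxs gamma))).
  by apply: continuousB; [exact: cst_continuous|exact: cvg_id].
exact: (derivable1_continuous d).
Qed.

(* The derivative of [gamma s - r s] lies in [-gamma, gamma] because [maxs' <= 2]. *)
Lemma r_lipschitz s t : `|(gamma * s - r s) - (gamma * t - r t)| <= gamma * `|s - t|.
Proof.
pose h x := maxs gamma x - x.
have ih (x : R) : is_derive x 1 h (derive1 (maxs gamma) x - 1).
  have dm : is_derive x 1 (maxs gamma) (derive1 (maxs gamma) x).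
    by apply: DeriveDef; [exact: maxs_derivable|rewrite derive1E].
  exact: (is_deriveB dm (is_derive_id x 1)).
have dh (x : R) : derivable h x 1 by have [] := ih x.
have hb x : `|derive1 h x| <= 1.
  have -> : derive1 h x = derive1 (maxs gamma) x - 1 by rewrite derive1E; have [_ ->] := ih x.
  by have /andP[? ?] := maxs_derive x; rewrite ler_norml; apply/andP; split; lra.
have := lipschitz_derive1 dh hb (psi - s) (psi - t); rewrite mul1r.
have -> : psi - s - (psi - t) = t - s by ring.
rewrite distrC (distrC t) => /(ler_wpM2l (ltW g0)); apply: le_trans.
rewrite -[X in X * `|h _ - _|](gtr0_norm g0) -normrM.
suff -> : gamma * s - r s - (gamma * t - r t) = - (gamma * (h (psi - t) - h (psi - s))) by rewrite normrN.
by rewrite /r_ /h; ring.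
Qed.
End SmoothedMax.

(** * A priori bounds for states, uniform in the penalty parameter *)

Section States.
Variable R : realType.
Local Notation P := (measurableTypeR R * measurableTypeR R)%type.
Local Notation mu2 := (leb2 R).
Variable (Omega : set (R * R)).
Hypothesis oO : open Omega.
Hypothesis bO : bounded_set Omega.
Local Notation I f := (\int[mu2]_(x in Omega) f x)%R.
Local Notation Int f := (mu2.-integrable Omega (EFin \o f)).
Local Notation L2O := (L2 mu2 Omega).
Local Notation test := (test_function Omega).
Local Notation "'d_ i f" := (fun x => 'D_(e_ R i) f x) (at level 10, i, f at level 9).
Local Notation ae_eqO f g := {ae mu2, forall x, Omega x -> f x = g x}.
Local Notation mO := (mOmega oO).
Local Notation finO := (finOmega oO bO).
Local Notation pH2 := (preHilbert_L2 mO finO).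
Local Notation graph := (H1graph Omega).
Local Notation dist2 := (sqdist Omega).
Local Notation pd i u := (weak_partial Omega i u).
Implicit Types (f u v w phi : R * R -> R) (g h : 'I_2 -> R * R -> R).
Variables qmin qmax : R.
Hypothesis qmin0 : 0 < qmin.
Local Notation Qad := (Qad Omega qmin qmax).
Local Notation H10 := (H10 Omega).
Implicit Types (q : R * R -> 'M[R]_2).
Local Notation D2 := (grad_sq Omega).
Local Notation ip2 := (pairing2 Omega).
Local Opaque energy grad_sq.
Local Notation En := (energy Omega).
Variables (M c1 c2 psi : R) (maxs : R -> R -> R).
Hypothesis psi0 : psi < 0.
Hypothesis sm : smoothed_max M c1 c2 maxs.
Local Notation r gamma := (r_ maxs psi gamma).
Local Notation c := (1 + I (fun=> 1)).

Lemma c_gt0 : 0 < c.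
Proof. by rewrite ltr_pwDl//; apply: I_ge0. Qed.

Lemma poincare1 u : H10 u -> I (fun x => u x ^+ 2) <= c * D2 u.
Proof.
move=> Hu; apply: (le_trans (poincare oO bO Hu)); rewrite mulrDl mul1r lerDr.
exact: D2_ge0.
Qed.

(** Square the hypothesis, insert Cauchy-Schwarz and Poincare, and divide by the Dirichlet integral,
    whose vanishing is a separate case. *)
Lemma energy_bound u k : H10 u -> L2O k -> qmin * D2 u <= ip Omega k u ->
  D2 u <= c / qmin ^+ 2 * I (fun x => k x ^+ 2).
Proof.
move=> Hu Lk h; have p := poincare1 Hu; have cs := ip_CS oO bO Lk (H10_L2 oO bO Hu).
have alg (D X K U C : R) : 0 <= D -> 0 <= K -> 0 < C -> U <= C * D -> X ^+ 2 <= K * U -> qmin * D <= X ->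
    D <= C / qmin ^+ 2 * K.
  move=> D0 K0 C0 UD XK DX.
  rewrite mulrAC ler_pdivlMr ?exprn_gt0//.
  have [->|Dn] := eqVneq D 0; first by rewrite mul0r mulr_ge0// ltW.
  have Dp : 0 < D by rewrite lt_def Dn.
  rewrite -(ler_pM2l Dp).
  have h1 : (qmin * D) ^+ 2 <= X ^+ 2.
    by rewrite lerXn2r ?nnegrE//; [rewrite mulr_ge0// ltW|apply: le_trans DX; rewrite mulr_ge0// ltW].
  have h2 : K * U <= K * (C * D) by rewrite ler_wpM2l.
  by move: (le_trans h1 (le_trans XK h2)); rewrite exprMn expr2; lra.
exact: (alg _ _ _ _ _ (D2_ge0 Omega u) (I_sq_ge0 _ k) c_gt0 p cs h).
Qed.

Lemma is_stateP f gamma q u : Qad q -> is_state Omega maxs psi f gamma q u <->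
  H10 u /\ forall v, H10 v -> En q u v + ip Omega (fun x => r gamma (u x)) v = ip Omega f v.
Proof.
move=> Qq; split=> -[Hu h]; split=> // v Hv; have := h v Hv.
  by rewrite (ip_mx_En oO bO qmin0 Qq Hu Hv).
by rewrite (ip_mx_En oO bO qmin0 Qq Hu Hv).
Qed.

Lemma r_measurable gamma u : 0 < gamma -> L2O u -> measurable_fun Omega (fun x => r gamma (u x)).
Proof.
move=> g0 Lu; apply: measurableT_comp; last exact: Lu.1.
by apply: continuous_measurable_fun; exact: (r_continuous (psi := psi) sm g0).
Qed.

Lemma r_L2 gamma u : 0 < gamma -> L2O u -> L2O (fun x => r gamma (u x)).
Proof.
move=> g0 Lu; apply: (L2_le mO (r_measurable g0 Lu) (L2Z mO (2 * gamma) Lu)); apply: aeW => x _.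
have := ler_normB (gamma * u x) (gamma * u x - r gamma (u x)); rewrite subKr => /le_trans; apply.
have := r_lipschitz psi sm g0 (u x) 0; rewrite (r_eq0 sm g0 (ltW psi0)) mulr0 !subr0 => h.
by rewrite -mulrA (normrM 2) (normrM gamma) (gtr0_norm g0) (gtr0_norm (_ : 0 < 2))//; lra.
Qed.

Section Bounds.
Variables (f : R * R -> R) (gamma : R) (q : R * R -> 'M[R]_2) (u : R * R -> R).
Hypothesis Lf : L2O f.
Hypothesis g0 : 0 < gamma.
Hypothesis Qq : Qad q.
Hypothesis st : is_state Omega maxs psi f gamma q u.

Lemma state_H10 : H10 u. Proof. by have [] := st. Qed.
Let Hu := state_H10.
Let Lu := H10_L2 oO bO Hu.
Let Lr := r_L2 g0 Lu.

Lemma state_weak v : H10 v -> En q u v = ip Omega (fun x => f x - r gamma (u x)) v.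
Proof.
move=> Hv; have [_ /(_ v Hv) h] := (is_stateP f gamma u Qq).1 st.
have Lv := H10_L2 oO bO Hv.
apply: (addIr (ip Omega (fun x => r gamma (u x)) v)).
apply: (etrans h); apply: (etrans _ (ipD_l oO bO (L2B mO Lf Lr) Lr Lv)).
by apply: eq_Rintegral => x _; rewrite subrK.
Qed.

(** Zero lies above the obstacle, so in the equation tested with [u] the penalty term has a
    favourable sign and drops out. *)
Lemma state_D2 : D2 u <= c / qmin ^+ 2 * I (fun x => f x ^+ 2).
Proof.
apply: (energy_bound Hu Lf); apply: (le_trans (En_ge oO bO qmin0 Qq Hu)).
rewrite (state_weak Hu); apply: (I_le mO (L2M mO (L2B mO Lf Lr) Lu) (L2M mO Lf Lu)).
apply: aeW => x _; rewrite mulrBl lerBlDr lerDl.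
by have := r_mul_sub_ge0 sm g0 (u x) (ltW psi0); rewrite subr0.
Qed.

(** The natural test function would be the penalty itself, which is only twice differentiable;
    [softneg] replaces it at distance at most [3]. The resulting [L^2] bound on the right-hand sides
    of the flux equations is what the div-curl argument requires. *)
Lemma state_r_L2 : I (fun x => r gamma (u x) ^+ 2) <= 3 * I (fun x => f x ^+ 2) + 27 * I (fun=> 1).
Proof.
have Lk := L2B mO Lf Lr.
pose e x := softneg gamma psi (u x) - r gamma (u x).
have me : measurable_fun Omega (fun x => softneg gamma psi (u x)).
  apply: measurableT_comp; last exact: Lu.1.
  by apply: continuous_measurable_fun; apply: smooth1_continuous; exact: smooth1_softneg.
have Le : L2O e.
  apply: (L2_bounded mO finO (K := 3)); first by apply: measurable_funB; [exact: me|exact: Lr.1].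
  by move=> x _; exact: (r_softneg psi0 sm g0).
have Ls : L2O (fun x => softneg gamma psi (u x)).
  apply: (L2_ae oO me (L2D mO Le Lr)); apply: aeW => x _; by rewrite /e subrK.
have En0 : 0 <= ip Omega (fun x => f x - r gamma (u x)) (fun x => softneg gamma psi (u x)).
  apply: (energy_ineq oO bO (L := gamma) Hu (fun i => flux_L2 oO bO qmin0 i Qq Hu) Lk).
  - by move=> v Hv; exact: (state_weak Hv).
  - have [_ hq] := (QadP oO bO qmax qmin0 q).1 Qq; apply: aeS hq => x h Ox; have [s h2] := h Ox.
    have /andP[h3 _] := h2 (pd 0 u x) (pd 1 u x).
    rewrite /flux (sym_formE _ _ _ _ s); apply: le_trans h3.
    by apply: mulr_ge0; [exact: ltW|apply: addr_ge0; exact: sqr_ge0].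
  - exact: smooth1_softneg.
  - exact: softneg0.
  move=> t; have d := softneg_derive gamma psi t.
  have -> : derive1 (softneg gamma psi) t = gamma * (1 - sigmoid (- gamma) (gamma * psi) t).
    by rewrite derive1E; have [_ ->] := d.
  have /andP[a b] := sigmoid_bounds (- gamma) (gamma * psi) t.
  by rewrite mulr_ge0 ?(ltW g0)//= ?ger_pMr//; lra.
have [[mr ir] [mf jf]] := (Lr, Lf).
have i1 := Int_cst mO finO 1.
have iR := Int_D mO (Int_Z mO 3 jf) (Int_Z mO 27 i1).
rewrite -(I_Z mO 3 jf) -(I_Z mO 27 i1) -(I_D mO (Int_Z mO 3 jf) (Int_Z mO 27 i1)).
have iL := Int_Z mO 2 (L2M mO Lk Ls).
rewrite -subr_ge0 -(I_B mO iR ir).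
have E0 : 0 <= I (fun x => 2 * ((f x - r gamma (u x)) * softneg gamma psi (u x))).
  by rewrite (I_Z mO 2 (L2M mO Lk Ls)) mulr_ge0.
apply: (le_trans E0); apply: (I_le mO iL (Int_B mO iR ir)); apply: aeW => x _.
have := r_softneg psi0 sm g0 (u x).
(* With [e = h - s], the right side minus the left side is [(s - k + e)^2 + 2 k^2 + 27 - e^2], and
   [e^2 <= 9]. *)
move: (softneg gamma psi (u x)) (r gamma (u x)) (f x) => h s k; rewrite ler_norml => /andP[h1 h2].
have : (h - s) ^+ 2 <= 9 by nra.
have := sqr_ge0 (s + (h - s)); have := sqr_ge0 (s - k); have := sqr_ge0 (k - (h - s)).
have := sqr_ge0 (s - 2 * k); have := sqr_ge0 (s + 2 * (h - s)); nra.
Qed.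
End Bounds.
End States.

Local Transparent energy grad_sq.

(** * Existence of regularized states by a fixed point argument *)

Section Existence.
Variable R : realType.
Local Notation P := (measurableTypeR R * measurableTypeR R)%type.
Local Notation mu2 := (leb2 R).
Variable (Omega : set (R * R)).
Hypothesis oO : open Omega.
Hypothesis bO : bounded_set Omega.
Local Notation I f := (\int[mu2]_(x in Omega) f x)%R.
Local Notation Int f := (mu2.-integrable Omega (EFin \o f)).
Local Notation L2O := (L2 mu2 Omega).
Local Notation test := (test_function Omega).
Local Notation "'d_ i f" := (fun x => 'D_(e_ R i) f x) (at level 10, i, f at level 9).
Local Notation ae_eqO f g := {ae mu2, forall x, Omega x -> f x = g x}.
Local Notation mO := (mOmega oO).
Local Notation finO := (finOmega oO bO).
Local Notation pH2 := (preHilbert_L2 mO finO).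
Local Notation graph := (H1graph Omega).
Local Notation dist2 := (sqdist Omega).
Local Notation pd i u := (weak_partial Omega i u).
Implicit Types (f u v w phi : R * R -> R) (g h : 'I_2 -> R * R -> R).
Variables qmin qmax : R.
Hypothesis qmin0 : 0 < qmin.
Local Notation Qad := (Qad Omega qmin qmax).
Local Notation H10 := (H10 Omega).
Implicit Types (q : R * R -> 'M[R]_2).
Local Notation D2 := (grad_sq Omega).
Local Notation ip2 := (pairing2 Omega).
Local Opaque energy grad_sq.
Local Notation En := (energy Omega).
Variables (M c1 c2 psi : R) (maxs : R -> R -> R).
Hypothesis psi0 : psi < 0.
Hypothesis sm : smoothed_max M c1 c2 maxs.
Local Notation r gamma := (r_ maxs psi gamma).
Local Notation c := (1 + I (fun=> 1)).

(** Banach's fixed point theorem in terms of squared distances; since functions are not identified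
    when they agree a.e., the fixed point is one up to distance zero. *)
Lemma L2_contraction (T : (R * R -> R) -> R * R -> R) (th : R) : 0 <= th < 1 ->
  (forall s, L2O s -> L2O (T s)) ->
  (forall s t, L2O s -> L2O t -> dist2 (T s) (T t) <= th * dist2 s t) ->
  exists2 u, L2O u & dist2 u (T u) = 0.
Proof.
move=> /andP[th0 th1] LT ct; pose x n := iter n T (fun=> 0).
have Lx n : L2O (x n) by elim: n => [|n IH]; [exact: (L2_cst mO finO)|exact: LT].
(* Squared distances obey the triangle inequality only with weights [1 + de] and [1 + 1 / de]. As
   [th = 1 - 2 de], one has [(1 + de) th + de <= 1], which keeps all iterates within squared
   distance [C] of the first. *)
pose de := (1 - th) / 2; have de0 : 0 < de by rewrite /de; lra.
have wtri u v w : L2O u -> L2O v -> L2O w ->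
    dist2 u w <= (1 + de) * dist2 u v + (1 + de^-1) * dist2 v w.
  move=> Lu Lv Lw; have [_ i1] := L2B mO Lu Lv; have [_ i2] := L2B mO Lv Lw.
  have [_ i3] := L2B mO Lu Lw.
  rewrite /sqdist -(I_Z mO (1 + de) i1) -(I_Z mO (1 + de^-1) i2).
  have j1 := Int_Z mO (1 + de) i1; have j2 := Int_Z mO (1 + de^-1) i2.
  rewrite -(I_D mO j1 j2); apply: (I_le mO i3 (Int_D mO j1 j2)); apply: aeW => z _.
  have -> : u z - w z = (u z - v z) + (v z - w z) by ring.
  move: (u z - v z) (v z - w z) => a b; rewrite -subr_ge0.
  have -> : (1 + de) * a ^+ 2 + (1 + de^-1) * b ^+ 2 - (a + b) ^+ 2 = de^-1 * (de * a - b) ^+ 2.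
    by field; rewrite gt_eqF.
  by rewrite mulr_ge0 ?sqr_ge0// invr_ge0 ltW.
pose a := dist2 (x 1%N) (x 0%N); have a0 : 0 <= a by exact: dist2_ge0.
pose C := (1 + de^-1) * a / de.
have di0 : 0 < de^-1 by rewrite invr_gt0.
have Ce : de * C = (1 + de^-1) * a by rewrite /C; field; rewrite gt_eqF.
have alg (d t D : R) : d = (1 - t) / 2 -> 0 <= d -> 0 <= D -> t <= 1 -> (1 + d) * (t * D) + d * D <= D.
  move=> dE d0 D0 t1; have -> : t = 1 - 2 * d by rewrite dE; lra.
  by have := mulr_ge0 (mulr_ge0 d0 d0) D0; nra.
have C0 : 0 <= C by rewrite /C divr_ge0 ?(ltW de0)// mulr_ge0//; lra.
have bx n : dist2 (x n) (x 0%N) <= C.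
  elim: n => [|n IH].
    by rewrite /sqdist (_ : (fun _ => _) = fun=> 0) ?I_0//; apply/funext => z; rewrite subrr expr0n.
  apply: (le_trans (wtri _ _ _ (Lx n.+1) (Lx 1%N) (Lx 0%N))).
  have h1 := ct _ _ (Lx n) (Lx 0%N); rewrite -/a -Ce.
  have h2 : dist2 (x n.+1) (x 1%N) <= th * C by apply: (le_trans h1); rewrite ler_wpM2l.
  have h3 : (1 + de) * dist2 (x n.+1) (x 1%N) <= (1 + de) * (th * C) by rewrite ler_wpM2l//; lra.
  by apply: (le_trans (lerD h3 (lexx _))); exact: (alg _ _ _ (erefl de) (ltW de0) C0 (ltW th1)).
have geo n k : dist2 (x (n + k)%N) (x n) <= th ^+ n * C.
  elim: n => [|n IH]; first by rewrite expr0 mul1r add0n.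
  rewrite exprS -mulrA addSn; apply: (le_trans (ct _ _ (Lx _) (Lx _))).
  by rewrite ler_wpM2l.
have cth : (fun n => th ^+ n * C) @ \oo --> 0.
  rewrite -[X in _ --> X](mul0r C); apply: cvgM; last exact: cvg_cst.
  by apply: cvg_expr; rewrite ger0_norm.
have [u Lu cu] : exists2 u, L2O u & (fun n => I (fun z => (x n z - u z) ^+ 2)) @ \oo --> 0.
  apply: (L2_complete mO finO Lx) => e e0.
  have [N NP] := (cvg_epsP _ _).1 cth e e0; exists N => m n Nm Nn.
  have key k l : (N <= k)%N -> (k <= l)%N -> dist2 (x l) (x k) <= e.
    move=> Nk kl; rewrite -(subnKC kl); apply: (le_trans (geo _ _)).
    by apply: le_trans (NP k Nk); rewrite subr0 ler_norm.
  have [mn|nm] := leqP m n; last exact: (key _ _ Nn (ltnW nm)).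
  by rewrite -/(sqdist Omega (x m) (x n)) dist2_sym; exact: (key _ _ Nm mn).
exists u => //; apply/eqP; rewrite eq_le dist2_ge0 andbT.
have cvr : (fun n => 2 * dist2 (x n.+1) u + 2 * (th * dist2 (x n) u)) @ \oo --> 0.
  rewrite -[X in _ --> X](_ : 2 * 0 + 2 * (th * 0) = 0); last by rewrite !mulr0 addr0.
  apply: cvgD; apply: cvgM; try exact: cvg_cst; last by apply: cvgM; [exact: cvg_cst|exact: cu].
  have -> : (fun n => dist2 (x n.+1) u) = (fun n => dist2 (x n) u) \o S by [].
  by apply: (cvg_subseq _ cu) => i j.
rewrite -oppr_ge0.
have cvs : (fun n => 2 * dist2 (x n.+1) u + 2 * (th * dist2 (x n) u) - dist2 u (T u)) @ \oo -->
    0 - dist2 u (T u) by apply: cvgB; [exact: cvr|exact: cvg_cst].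
rewrite -[X in 0 <= X]add0r; apply: (cvg_ge0 cvs) => n; rewrite subr_ge0.
apply: (le_trans (dist2_triangle oO Lu (Lx n.+1) (LT _ Lu))); rewrite dist2_sym lerD2l ler_wpM2l//.
exact: ct.
Qed.

Section Fixed.
Variables (f : R * R -> R) (gamma : R) (q : R * R -> 'M[R]_2).
Hypothesis Lf : L2O f.
Hypothesis g0 : 0 < gamma.
Hypothesis Qq : Qad q.
Local Notation b := (fun u v => En q u v + gamma * ip Omega u v).
Let pH := preHilbert_En oO bO qmin0 Qq (ltW g0).
Let N (s : R * R -> R) x := gamma * s x - r gamma (s x).

Lemma riesz_En k : L2O k -> exists w, H10 w /\ forall v, H10 v -> b w v = ip Omega k v.
Proof.
move=> Lk; have [|w Hw h] := riesz pH (F := fun v => ip Omega k v); last by exists w.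
split.
- by move=> x y /(H10_L2 oO bO) Lx /(H10_L2 oO bO) Ly; rewrite !(ipC _ k); exact: ipD_l.
- by move=> t x /(H10_L2 oO bO) Lx; rewrite !(ipC _ k); exact: ipZ_l.
exists (I (fun x => k x ^+ 2) * (c / qmin)).
  by rewrite mulr_ge0 ?I_sq_ge0// divr_ge0 ?(ltW qmin0)// ltW// c_gt0.
move=> x Hx; apply: (le_trans (ip_CS oO bO Lk (H10_L2 oO bO Hx))).
rewrite -mulrA ler_wpM2l ?I_sq_ge0//; apply: (le_trans (poincare1 oO bO Hx)).
rewrite -mulrA ler_wpM2l ?(ltW (c_gt0 _))// ler_pdivlMl//; apply: (le_trans (En_ge oO bO qmin0 Qq Hx)).
by rewrite lerDl mulr_ge0 ?(ltW g0)// I_sq_ge0.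
Qed.

Lemma N_L2 s : L2O s -> L2O (N s).
Proof. by move=> Ls; apply: (L2B mO (L2Z mO gamma Ls)); apply: (r_L2 oO psi0 sm g0 Ls). Qed.

Lemma N_dist s t : L2O s -> L2O t -> dist2 (N s) (N t) <= gamma ^+ 2 * dist2 s t.
Proof.
move=> Ls Lt; have [_ i1] := L2B mO Ls Lt; have [_ i2] := L2B mO (N_L2 Ls) (N_L2 Lt).
rewrite /sqdist -(I_Z mO _ i1); apply: (I_le mO i2 (Int_Z mO _ i1)); apply: aeW => x _.
rewrite -exprMn -[leLHS]real_normK ?num_real// -[leRHS]real_normK ?num_real// ler_sqr ?nnegrE//.
by rewrite [leRHS]normrM (gtr0_norm g0); exact: (r_lipschitz psi sm g0).
Qed.

(** Iteration for the linear problem with form [b] and right side [f + N s], where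
    [N s = gamma s - r s]. The shift by [gamma] makes [N] Lipschitz with constant [gamma], while
    Poincare adds [e = qmin / c] to the coercivity in [L^2]; the squared contraction factor is that
    of [gamma / (e + gamma)], without any smallness condition. *)
Lemma exists_state : exists u, is_state Omega maxs psi f gamma q u.
Proof.
have hT s : exists w, L2O s -> H10 w /\ forall v, H10 v -> b w v = ip Omega (fun x => f x + N s x) v.
  (* [choice] asks for a value at every function; outside [L^2] it is arbitrary. *)
  have [Ls|nLs] := pselect (L2O s); last by exists s.
  by have [w hw] := riesz_En (L2D mO Lf (N_L2 Ls)); exists w.
have [T hTT] := choice hT.
have HT s : L2O s -> H10 (T s) by move=> /hTT[].
have LT s : L2O s -> L2O (T s) by move=> /HT; exact: H10_L2.
pose e := qmin / c; have e0 : 0 < e by rewrite divr_gt0// c_gt0.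
pose th := gamma ^+ 2 / (e + gamma) ^+ 2.
have eg0 : 0 < e + gamma by rewrite addr_gt0.
have [||u Lu du] := L2_contraction (th := th) _ LT.
- by rewrite divr_ge0 ?sqr_ge0//= ltr_pdivrMr ?exprn_gt0// mul1r ltr_pXn2r ?nnegrE ?ltW// ltrDr.
- move=> s t Ls Lt; have [Hs hs] := hTT s Ls; have [Ht ht] := hTT t Lt.
  pose w x := T s x - T t x; have Hw : H10 w := H10B oO bO Hs Ht.
  have Lk := L2B mO (N_L2 Ls) (N_L2 Lt).
  have E : b w w = ip Omega (fun x => N s x - N t x) w.
    have h : b w w = b (T s) w - b (T t) w := pHbBl pH Hs Ht Hw.
    have e1 : b (T s) w - b (T t) w = ip Omega (fun x => f x + N s x) w - ip Omega (fun x => f x + N t x) w.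
      exact: (f_equal2 (fun x y => x - y) (hs w Hw) (ht w Hw)).
    have Lw := H10_L2 oO bO Hw.
    have e2 : ip Omega (fun x => (f x + N s x) - (f x + N t x)) w =
        ip Omega (fun x => f x + N s x) w - ip Omega (fun x => f x + N t x) w.
      exact: (pHbBl pH2 (L2D mO Lf (N_L2 Ls)) (L2D mO Lf (N_L2 Lt)) Lw).
    apply: (etrans h); apply: (etrans e1); apply: (etrans (esym e2)).
    by apply: eq_Rintegral => x _; congr (_ * _); rewrite opprD addrACA subrr add0r.
  have h1 := En_ge oO bO qmin0 Qq Hw; have h2 := poincare1 oO bO Hw.
  have h3 := ip_CS oO bO Lk (H10_L2 oO bO Hw); rewrite -E in h3.
  have h4 := N_dist Ls Lt.
  have alg (W D X K d : R) : 0 <= W -> 0 <= K -> W <= c * D -> qmin * D <= X -> (X + gamma * W) ^+ 2 <= K * W ->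
      K <= gamma ^+ 2 * d -> W <= th * d.
    move=> W0 K0 hW hX hK hd; have cp := c_gt0 Omega.
    have eW : e * W <= X by apply: le_trans hX; rewrite /e mulrAC ler_pdivrMr// -mulrA ler_pM2l// mulrC.
    rewrite /th mulrAC ler_pdivlMr ?exprn_gt0//; apply: le_trans hd.
    have [->|Wn] := eqVneq W 0; first by rewrite mul0r.
    have Wp : 0 < W by rewrite lt_def Wn.
    rewrite -(ler_pM2r Wp); apply: le_trans hK.
    have -> : W * (e + gamma) ^+ 2 * W = (e * W + gamma * W) ^+ 2 by ring.
    have eW0 : 0 <= e * W by rewrite mulr_ge0// ltW.
    have gW0 : 0 <= gamma * W by rewrite mulr_ge0// ltW.
    by apply: lerXn2r; rewrite ?nnegrE ?lerD2r//; apply: addr_ge0 => //; exact: le_trans eW.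
  exact: (alg _ _ _ _ _ (I_sq_ge0 _ w) (I_sq_ge0 _ _) h2 h1 h3 h4).
have [Hw hw] := hTT u Lu; have LTu := LT u Lu; have Lr := r_L2 oO psi0 sm g0 LTu.
(* The state is [T u] and not [u]: both agree in [L^2], but only [T u] is known to lie in [H10]. The
   Lipschitz bound on [N] then allows [N u] to be replaced by [N (T u)]. *)
exists (T u); apply/(is_stateP oO bO qmin0); [exact: Qq|split=> // v Hv].
have Lv := H10_L2 oO bO Hv; have := hw v Hv.
have -> : ip Omega (fun x => f x + N u x) v = ip Omega f v + ip Omega (N u) v :=
  ipD_l oO bO Lf (N_L2 Lu) Lv.
have -> : ip Omega (N u) v = ip Omega (N (T u)) v.
  apply/eqP; rewrite -subr_eq0; apply/eqP.
  have <- : ip Omega (fun x => N u x - N (T u) x) v = ip Omega (N u) v - ip Omega (N (T u)) v :=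
    pHbBl pH2 (N_L2 Lu) (N_L2 LTu) Lv.
  apply/eqP; rewrite -sqrf_eq0 eq_le sqr_ge0 andbT.
  apply: (le_trans (ip_CS oO bO (L2B mO (N_L2 Lu) (N_L2 LTu)) Lv)).
  have := N_dist Lu LTu; rewrite du mulr0 => h.
  by rewrite mulr_le0_ge0// I_sq_ge0.
have -> : ip Omega (N (T u)) v = gamma * ip Omega (T u) v - ip Omega (fun x => r gamma (T u x)) v.
  rewrite -(ipZ_l oO bO gamma LTu Lv).
  exact: (pHbBl pH2 (L2Z mO gamma LTu) Lr Lv).
have alg2 (A B C D : R) : A + B = C + (B - D) -> A + D = C by lra.
exact: alg2.
Qed.
End Fixed.
End Existence.

Local Transparent energy grad_sq.

Lemma div_curl_alg (R : realDomainType) (A B A' B' a b c d X : R) :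
  A = A' - a + b -> B = B' - c + d -> A' + B' = X -> X - a - c + b + d = A + B.
Proof. lra. Qed.

Lemma sqr_sub_le2 (F : realFieldType) (a b : F) :
  (a + - b) ^+ 2 <= 2 * a ^+ 2 + 2 * b ^+ 2.
Proof. by have := sqr_ge0 (a + b); lra. Qed.

(** * Weak convergence in [L^2] and the div-curl argument *)

Section WeakLimits.
Variable R : realType.
Local Notation P := (measurableTypeR R * measurableTypeR R)%type.
Local Notation mu2 := (leb2 R).
Variable (Omega : set (R * R)).
Hypothesis oO : open Omega.
Hypothesis bO : bounded_set Omega.
Local Notation I f := (\int[mu2]_(x in Omega) f x)%R.
Local Notation Int f := (mu2.-integrable Omega (EFin \o f)).
Local Notation L2O := (L2 mu2 Omega).
Local Notation test := (test_function Omega).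
Local Notation "'d_ i f" := (fun x => 'D_(e_ R i) f x) (at level 10, i, f at level 9).
Local Notation ae_eqO f g := {ae mu2, forall x, Omega x -> f x = g x}.
Local Notation mO := (mOmega oO).
Local Notation finO := (finOmega oO bO).
Local Notation pH2 := (preHilbert_L2 mO finO).
Local Notation graph := (H1graph Omega).
Local Notation dist2 := (sqdist Omega).
Local Notation pd i u := (weak_partial Omega i u).
Implicit Types (f u v w phi : R * R -> R) (g h : 'I_2 -> R * R -> R).
Variables qmin qmax : R.
Hypothesis qmin0 : 0 < qmin.
Local Notation Qad := (Qad Omega qmin qmax).
Local Notation H10 := (H10 Omega).
Implicit Types (q : R * R -> 'M[R]_2).
Local Notation D2 := (grad_sq Omega).
Local Notation ip2 := (pairing2 Omega).

Definition wcv (a : nat -> R * R -> R) (b : R * R -> R) : Prop :=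
  forall k, L2O k -> (fun n => ip Omega (a n) k) @ \oo --> ip Omega b k.

Lemma wcv_subseq a b s : {homo s : i j / (i < j)%N} -> wcv a b -> wcv (a \o s) b.
Proof. by move=> hs w k Lk; exact: (cvg_subseq hs (w k Lk)). Qed.

Lemma wcv_lin (t : R) a a' b b' : (forall n, L2O (a n)) -> (forall n, L2O (b n)) ->
  L2O a' -> L2O b' -> wcv a a' -> wcv b b' ->
  wcv (fun n x => t * a n x + b n x) (fun x => t * a' x + b' x).
Proof.
move=> La Lb La' Lb' wa wb k Lk.
have E u v : L2O u -> L2O v -> t * ip Omega u k + ip Omega v k = ip Omega (fun x => t * u x + v x) k.
  by move=> Lu Lv; rewrite (ipD_l oO bO (L2Z mO t Lu) Lv Lk) (ipZ_l oO bO t Lu Lk).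
rewrite -(E _ _ La' Lb'); apply: (cvg_seq_ext (fun n => E _ _ (La n) (Lb n))).
by apply: cvgD; [apply: cvgM; [exact: cvg_cst|exact: wa]|exact: wb].
Qed.

Lemma wcv_cst b : wcv (fun=> b) b. Proof. by move=> k _; exact: cvg_cst. Qed.

Lemma wcv_strong a b : (forall n, L2O (a n)) -> L2O b ->
  (fun n => dist2 (a n) b) @ \oo --> 0 -> wcv a b.
Proof. by move=> La Lb h k Lk; exact: (ip_linear_cvg oO bO La Lb Lk h). Qed.

Lemma ip_bounded_cvg0 a b C : (forall n, L2O (a n)) -> (forall n, L2O (b n)) ->
  (forall n, I (fun x => a n x ^+ 2) <= C) -> (fun n => I (fun x => b n x ^+ 2)) @ \oo --> 0 ->
  (fun n => ip Omega (a n) (b n)) @ \oo --> 0.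
Proof.
move=> La Lb aC b0; apply: sq_cvg0.
apply: (@cvg0_le _ _ (fun n => C * I (fun x => b n x ^+ 2))); last first.
  by rewrite -(mulr0 C); apply: cvgM; [exact: cvg_cst|exact: b0].
move=> n; rewrite sqr_ge0 /=; apply: (le_trans (ip_CS oO bO (La n) (Lb n))).
by rewrite ler_wpM2r// I_sq_ge0.
Qed.

Lemma ip_subK a b b' : L2O a -> L2O b -> L2O b' ->
  ip Omega a (fun x => b x - b' x) + ip Omega a b' = ip Omega a b.
Proof.
move=> La Lb Lb'; apply: (etrans (f_equal2 +%R (ipC _ _ _) (ipC _ _ _))).
apply: (etrans (esym (ipD_l oO bO (L2B mO Lb Lb') Lb' La))).
by rewrite [RHS]ipC; apply: eq_Rintegral => x _; rewrite subrK.
Qed.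

Lemma wcv_ip a a' b b' C : (forall n, L2O (a n)) -> L2O a' -> (forall n, L2O (b n)) -> L2O b' ->
  (forall n, I (fun x => a n x ^+ 2) <= C) -> wcv a a' -> (fun n => dist2 (b n) b') @ \oo --> 0 ->
  (fun n => ip Omega (a n) (b n)) @ \oo --> ip Omega a' b'.
Proof.
move=> La La' Lb Lb' aC wa hb.
have h := ip_bounded_cvg0 La (fun n => L2B mO (Lb n) Lb') aC hb.
rewrite -[X in _ --> X]add0r.
apply: (cvg_seq_ext (fun n => ip_subK (La n) (Lb n) Lb')).
by apply: cvgD; [exact: h|exact: wa].
Qed.

Lemma wcv_ge0 a b : (forall n, L2O (a n)) -> L2O b -> wcv a b ->
  (forall n, {ae mu2, forall x, Omega x -> 0 <= a n x}) -> {ae mu2, forall x, Omega x -> 0 <= b x}.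
Proof.
move=> La Lb w a0; apply: (nonneg_of_test oO (L2_loc oO bO Lb)) => phi tp p0.
have Lp := test_L2 oO bO tp; apply: (cvg_ge0 (w phi Lp)) => n.
apply: (I_ge0_ae mO (L2M mO (La n) Lp)); apply: aeS (a0 n) => x h Ox.
by rewrite mulr_ge0 ?h.
Qed.

Lemma weak_extract (a : nat -> nat -> R * R -> R) C m : (forall j n, L2O (a j n)) ->
  (forall j n, I (fun x => a j n x ^+ 2) <= C) ->
  exists2 s : nat -> nat, {homo s : i j / (i < j)%N} &
    forall j, (j < m)%N -> exists2 b, L2O b & wcv (fun n => a j (s n)) b.
Proof.
move=> La aC; elim: m => [|m [s hs IH]]; first by exists id.
have [t [ht [b Lb wb]]] := weak_compactness pH2 (fun n => La m (s n)) (fun n => aC m (s n)).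
exists (s \o t); first exact: homo_ltn_comp.
move=> j; rewrite ltnS leq_eqVlt => /predU1P[->|jm]; last first.
  by have [b' Lb' wb'] := IH j jm; exists b' => //; exact: (wcv_subseq ht wb').
exists b => // k Lk; have := wb _ (bounded_linear_b pH2 Lk).
have -> : ipL2 mu2 Omega k b = ip Omega b k by exact: ipC.
by apply: cvg_seq_ext => n; exact: ipC.
Qed.

Lemma flux_bound q u i : Qad q -> H10 u -> I (fun x => flux Omega q u i x ^+ 2) <= 2 * qmax ^+ 2 * D2 u.
Proof.
move=> Qq Hu; have i0 j := (H10_pd oO bO j Hu).2.
have alg (a b x y : R) : `|a| <= qmax -> `|b| <= qmax ->
    (a * x + b * y) ^+ 2 <= 2 * qmax ^+ 2 * (x ^+ 2 + y ^+ 2).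
  move=> ha hb; have q0 : 0 <= qmax by exact: le_trans ha.
  have sq z : `|z| <= qmax -> z ^+ 2 <= qmax ^+ 2.
    by move=> hz; rewrite -[leLHS]real_normK ?num_real// ler_sqr ?nnegrE.
  have h1 := ler_wpM2r (sqr_ge0 x) (sq a ha); have h2 := ler_wpM2r (sqr_ge0 y) (sq b hb).
  have := sqr_ge0 (a * x - b * y); rewrite -exprMn in h1; rewrite -exprMn in h2; lra.
rewrite /grad_sq -(I_D mO (i0 0) (i0 1)) -(I_Z mO _ (Int_D mO (i0 0) (i0 1))).
apply: (I_le mO (flux_L2 oO bO qmin0 i Qq Hu).2 (Int_Z mO _ (Int_D mO (i0 0) (i0 1)))).
have [_ hq] := (QadP oO bO qmax qmin0 q).1 Qq; apply: aeS hq => x h Ox.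
exact: (alg _ _ _ _ (ell_bound qmin0 i 0 (h Ox)) (ell_bound qmin0 i 1 (h Ox))).
Qed.

(* Multipliers of [H10]: test functions, and the constant function 1. *)
Definition multiplier (phi : R * R -> R) (dphi : 'I_2 -> R * R -> R) : Prop :=
  [/\ measurable_fun (Omega : set P) phi,
      forall i, measurable_fun (Omega : set P) (dphi i),
      exists K, forall x, `|phi x| <= K /\ forall i, `|dphi i x| <= K
    & forall w, H10 w -> graph (fun x => phi x * w x) (fun i x => phi x * pd i w x + w x * dphi i x)].

Lemma multiplier_test phi : test phi -> multiplier phi (fun i => 'd_ i phi).
Proof.
move=> tp; split.
- exact: (test_measurable tp mO).
- by move=> i; exact: (test_measurable (test_D i tp) mO).
- have [K K0 hK] := test_bounded tp; have [K0' _ hK0] := test_bounded (test_D 0 tp).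
  have [K1' _ hK1] := test_bounded (test_D 1 tp).
  have m1 (a b c : R) : [/\ a <= Num.max a (Num.max b c), b <= Num.max a (Num.max b c)
      & c <= Num.max a (Num.max b c)] by rewrite !le_max !lexx !orbT.
  have [l0 l1 l2] := m1 K K0' K1'.
  exists (Num.max K (Num.max K0' K1')) => x; split; first exact: le_trans (hK x) l0.
  by move=> i; have [->|->] := ord2 i; [exact: le_trans (hK0 x) l1|exact: le_trans (hK1 x) l2].
by move=> w Hw; exact: (graph_mul_test oO bO (H10_graph oO bO Hw) tp).
Qed.

Section DivCurl.
Variables (q : nat -> R * R -> 'M[R]_2) (u : nat -> R * R -> R) (us : R * R -> R)
  (s : 'I_2 -> R * R -> R) (k : nat -> R * R -> R) (C : R).
Hypothesis Qq : forall n, Qad (q n).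
Hypothesis Hu : forall n, H10 (u n).
Hypothesis Hus : H10 us.
Hypothesis Ls : forall i, L2O (s i).
Hypothesis Lk : forall n, L2O (k n).
Hypothesis kC : forall n, I (fun x => k n x ^+ 2) <= C.
Hypothesis uC : forall n, D2 (u n) <= C.
Local Notation En := (energy Omega).
Hypothesis weak_u : forall n v, H10 v -> En (q n) (u n) v = ip Omega (k n) v.
Hypothesis wpd : forall i, wcv (fun n => pd i (u n)) (pd i us).
Hypothesis wflux : forall i, wcv (fun n => flux Omega (q n) (u n) i) (s i).

(** Rellich's theorem for the differences: their gradients are bounded and tend weakly to zero. *)
Lemma weak_limit_strong : (fun n => dist2 (u n) us) @ \oo --> 0.
Proof.
have Lpu n i : L2O (pd i (u n)) := H10_pd oO bO i (Hu n).
have Lps i : L2O (pd i us) := H10_pd oO bO i Hus.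
apply: (rellich0 oO bO (w := fun n x => u n x - us x)
  (g := fun n i x => 1 * pd i (u n) x + - pd i us x) (C := 2 * C + 2 * D2 us)).
- move=> n; have := graph_lin oO bO (-1) (H10_graph oO bO Hus) (H10_graph oO bO (Hu n)).
  congr (H1graph _ _ _); first by apply/funext => x; rewrite mulN1r addrC.
  by apply/funext => i; apply/funext => x; rewrite mulN1r mul1r addrC.
- move=> n i; have [_ i1] := Lpu n i; have [_ i2] := Lps i.
  have Le : L2O (fun x => 1 * pd i (u n) x + - pd i us x).
    by apply: (L2D mO (L2Z mO 1 (Lpu n i)) (L2N mO (Lps i))).
  have h : I (fun x => (1 * pd i (u n) x + - pd i us x) ^+ 2) <=
      2 * I (fun x => pd i (u n) x ^+ 2) + 2 * I (fun x => pd i us x ^+ 2).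
    have j1 := Int_Z mO 2 i1; have j2 := Int_Z mO 2 i2.
    have e := etrans (I_D mO j1 j2) (f_equal2 +%R (I_Z mO 2 i1) (I_Z mO 2 i2)).
    refine (eq_ind _ (fun z => _ <= z) _ _ e).
    apply: (I_le mO Le.2 (Int_D mO j1 j2)); apply: aeW => x _; rewrite mul1r.
    exact: sqr_sub_le2.
  apply: (le_trans h); have D v : I (fun x => pd i v x ^+ 2) <= D2 v.
    have kl (a b : R) : 0 <= b -> a <= a + b by rewrite lerDl.
    have kr (a b : R) : 0 <= a -> b <= a + b by rewrite lerDr.
    by have [->|->] := ord2 i; [exact: (kl _ _ (I_sq_ge0 _ _))|exact: (kr _ _ (I_sq_ge0 _ _))].
  exact: (lerD (ler_wpM2l (ler0n R 2) (le_trans (D (u n)) (uC n))) (ler_wpM2l (ler0n R 2) (D us))).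
move=> l Ll; have := wcv_lin (t := 1) (fun n => Lpu n 1) (fun=> L2N mO (Lps 1)) (Lps 1) (L2N mO (Lps 1))
  (@wpd 1) (@wcv_cst _) Ll.
have -> // : ip Omega (fun x => 1 * pd 1 us x + - pd 1 us x) l = 0.
by rewrite -[RHS](I_0 Omega); apply: eq_Rintegral => x _; rewrite mul1r subrr mul0r.
Qed.

Lemma mul_cvg0 phi K (w : nat -> R * R -> R) : measurable_fun (Omega : set P) phi ->
  (forall x, `|phi x| <= K) -> (forall n, L2O (w n)) ->
  (fun n => I (fun x => w n x ^+ 2)) @ \oo --> 0 ->
  (forall n, L2O (fun x => phi x * w n x)) /\ (fun n => I (fun x => (phi x * w n x) ^+ 2)) @ \oo --> 0.
Proof.
move=> mphi hK Lw w0; have L n : L2O (fun x => phi x * w n x).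
  by apply: (L2_bM mO mphi _ (Lw n)); exact: aeW.
split => //; apply: (@cvg0_le _ _ (fun n => K ^+ 2 * I (fun x => w n x ^+ 2))); last first.
  by rewrite -(mulr0 (K ^+ 2)); apply: cvgM; [exact: cvg_cst|exact: w0].
move=> n; rewrite I_sq_ge0 /= -(I_Z mO _ (Lw n).2).
apply: (I_le mO (L n).2 (Int_Z mO _ (Lw n).2)); apply: aeW => x _.
rewrite exprMn ler_wpM2r ?sqr_ge0// -[leLHS]real_normK ?num_real// ler_sqr ?nnegrE//.
exact: le_trans (hK x).
Qed.

(** The equation is tested with [phi (u_n - us)]. Its right side tends to zero because [k] is
    bounded and [u_n - us] tends to zero strongly, and so does the part where the derivative falls
    on [phi]. What remains is the flux paired with the fixed field [phi] times the gradient of [us],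
    for which weak convergence suffices. *)
Lemma div_curl phi dphi : multiplier phi dphi ->
  (fun n => ip2 (flux Omega (q n) (u n)) (fun i x => phi x * pd i (u n) x)) @ \oo -->
  ip2 s (fun i x => phi x * pd i us x).
Proof.
move=> [mphi mdphi [K hK] hG].
have Lpu n i : L2O (pd i (u n)) := H10_pd oO bO i (Hu n).
have Lps i : L2O (pd i us) := H10_pd oO bO i Hus.
pose w n x := u n x - us x; have Hw n : H10 (w n) := H10B oO bO (Hu n) Hus.
have Lw n : L2O (w n) := H10_L2 oO bO (Hw n).
have w0 : (fun n => I (fun x => w n x ^+ 2)) @ \oo --> 0 := weak_limit_strong.
have Lfl n i : L2O (flux Omega (q n) (u n) i) := flux_L2 oO bO qmin0 i (Qq n) (Hu n).
have flC n i : I (fun x => flux Omega (q n) (u n) i x ^+ 2) <= 2 * qmax ^+ 2 * C.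
  by apply: (le_trans (flux_bound i (Qq n) (Hu n))); rewrite ler_wpM2l// mulr_ge0// sqr_ge0.
have [La a0] := mul_cvg0 mphi (fun x => (hK x).1) Lw w0.
have Hb i := mul_cvg0 (mdphi i) (fun x => (hK x).2 i) Lw w0.
have c1 := ip_bounded_cvg0 Lk La kC a0.
have c2 i := ip_bounded_cvg0 (fun n => Lfl n i) (Hb i).1 (fun n => flC n i) (Hb i).2.
have Lp f : L2O f -> L2O (fun x => phi x * f x).
  by move=> Lf; apply: (L2_bM mO mphi _ Lf); apply: aeW => x _; exact: (hK x).1.
have c3 i := @wflux i _ (Lp _ (Lps i)).
have Ei n i : ip Omega (flux Omega (q n) (u n) i) (fun x => phi x * pd i (u n) x) =
    ip Omega (flux Omega (q n) (u n) i) (pd i (fun x => phi x * w n x)) -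
    ip Omega (flux Omega (q n) (u n) i) (fun x => dphi i x * w n x) +
    ip Omega (flux Omega (q n) (u n) i) (fun x => phi x * pd i us x).
  have Lt := H10_pd oO bO i (graph_H10 oO bO (hG _ (Hw n))).
  rewrite [X in X - _ + _](ipC Omega (flux _ _ _ _)) [X in _ - X + _](ipC Omega (flux _ _ _ _)).
  rewrite [X in _ + X](ipC Omega (flux _ _ _ _)) [LHS]ipC.
  have e1 : ip Omega (fun x => pd i (fun x => phi x * w n x) x - dphi i x * w n x) (flux Omega (q n) (u n) i)
    = _ - _ := pHbBl pH2 Lt ((Hb i).1 n) (Lfl n i).
  have e2 := ipD_l oO bO (L2B mO Lt ((Hb i).1 n)) (Lp _ (Lps i)) (Lfl n i).
  apply: (etrans _ (etrans e2 (f_equal (fun z => z + _) e1))).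
  apply: (ip_eq_ae oO); [exact: (Lp _ (Lpu n i)).1| |exact: (Lfl n i).1|].
    exact: (L2D mO (L2B mO Lt ((Hb i).1 n)) (Lp _ (Lps i))).1.
  apply: aeS2 (graph_pd_ae oO bO i (hG _ (Hw n))) (pdB oO bO i (Hu n) Hus) => x h1 h2 Ox.
  rewrite h1// (h2 Ox); move: (pd i (u n) x) (pd i us x) (phi x) (w n x) (dphi i x) => a b c d e.
  by ring.
have key n : ip Omega (k n) (fun x => phi x * w n x)
   - ip Omega (flux Omega (q n) (u n) 0) (fun x => dphi 0 x * w n x)
   - ip Omega (flux Omega (q n) (u n) 1) (fun x => dphi 1 x * w n x)
   + ip Omega (flux Omega (q n) (u n) 0) (fun x => phi x * pd 0 us x)
   + ip Omega (flux Omega (q n) (u n) 1) (fun x => phi x * pd 1 us x) =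
   ip2 (flux Omega (q n) (u n)) (fun i x => phi x * pd i (u n) x).
  have := weak_u n (graph_H10 oO bO (hG _ (Hw n))); rewrite /En /pairing2 => e.
  exact: (div_curl_alg (Ei n 0) (Ei n 1) e).
apply: (cvg_seq_ext key).
rewrite -[X in _ --> X](_ : 0 - 0 - 0 + ip Omega (s 0) (fun x => phi x * pd 0 us x) +
  ip Omega (s 1) (fun x => phi x * pd 1 us x) = _); last by rewrite !subr0 add0r.
by apply: cvgD; [apply: cvgD; [apply: cvgB; [apply: cvgB; [exact: c1|exact: c2]|exact: c2]|exact: c3]|exact: c3].
Qed.
End DivCurl.
End WeakLimits.

(** * Algebra of the block form and its Schur complement *)

Section Quadratic.
Variable R : realType.
Implicit Types (a b c x y z t m : R).

(** By continuity a negative value at [t] would persist on an interval of length [d], which contains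
    a rational. The lemma lets exceptional null sets be collected over countably many parameters
    only. *)
Lemma quadratic_rat_ge0 a b c : (forall q : rat, 0 <= a * ratr q ^+ 2 + b * ratr q + c) ->
  forall t, 0 <= a * t ^+ 2 + b * t + c.
Proof.
move=> h t; rewrite leNgt; apply/negP => f0.
(* [K - 1] bounds the difference quotient of the polynomial between [t] and any point of
   [[t, t + 1]]. *)
pose f := a * t ^+ 2 + b * t + c; pose K := `|a| * (2 * `|t| + 1) + `|b| + 1.
have K0 : 0 < K by rewrite ltr_wpDl// addr_ge0// mulr_ge0// addr_ge0// mulr_ge0.
pose d := Num.min 1 (- f / K).
have d0 : 0 < d by rewrite lt_min ltr01 divr_gt0// oppr_gt0.
have d1 : d <= 1 by rewrite ge_min lexx.
have dK : d * K <= - f by rewrite -ler_pdivlMr// ge_min lexx orbT.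
have td : t < t + d by rewrite ltrDl.
have [q] := rat_in_itvoo td.
rewrite in_itv /= => /andP[q1 q2]; have := h q; set s := ratr q in q1 q2 *.
have -> : a * s ^+ 2 + b * s + c = f + (s - t) * (a * (s + t) + b) by rewrite /f; ring.
have e0 : 0 < s - t by rewrite subr_gt0.
have e1 : s - t < d by lra.
have bnd : a * (s + t) + b <= `|a| * (2 * `|t| + 1) + `|b|.
  apply: lerD; last exact: ler_norm.
  apply: (le_trans (ler_norm _)); rewrite normrM ler_wpM2l//.
  have -> : s + t = (s - t) + 2 * t by ring.
  by apply: (le_trans (ler_normD _ _)); rewrite (gtr0_norm e0) normrM (gtr0_norm (_ : 0 < 2))//; lra.
have h1 : (s - t) * (a * (s + t) + b) <= (s - t) * (K - 1).
  by rewrite ler_wpM2l ?(ltW e0)//; apply: (le_trans bnd); rewrite /K; lra.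
have h2 : (s - t) * K <= d * K by rewrite ler_wpM2r ?(ltW e0)// ltW.
by move: h1; rewrite mulrBr; lra.
Qed.

(* Positivity of [H] is that of the quadratic form [q - qmin] at [z + t * xi],
   plus [t^2 * qmin * |xi - xi*|^2]. *)
Lemma block_form_ge0 m a b b' c z0 z1 t x y x' y' phi : 0 <= m -> 0 <= phi -> b = b' ->
  (forall v w, m * (v ^+ 2 + w ^+ 2) <= a * v ^+ 2 + 2 * b * (v * w) + c * w ^+ 2) ->
  0 <= (z0 ^+ 2 * a + (2 * (z0 * z1) * b + (z1 ^+ 2 * c + (2 * t * z0 * (a * x + b * y) +
      (2 * t * z1 * (b' * x + c * y) + (- (2 * t * z0 * m) * x + (- (2 * t * z1 * m) * y +
      - (m * (z0 ^+ 2 + z1 ^+ 2))))))))) * phi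
    + (t ^+ 2 * ((a * x + b * y) * (phi * x) + (b' * x + c * y) * (phi * y))
    + (- (2 * (t ^+ 2 * m)) * (x * (phi * x') + y * (phi * y'))
    + t ^+ 2 * m * (x' * (phi * x') + y' * (phi * y')))).
Proof.
move=> m0 p0 <- h; have := h (z0 + t * x) (z1 + t * y).
rewrite -subr_ge0 => h1.
have h2 : 0 <= t ^+ 2 * m * ((x - x') ^+ 2 + (y - y') ^+ 2).
  by apply: mulr_ge0; [apply: mulr_ge0 => //|apply: addr_ge0]; exact: sqr_ge0.
have := mulr_ge0 p0 (addr_ge0 h1 h2); congr (0 <= _); ring.
Qed.

Lemma linear_eq0 p l : (forall t, 0 <= p + t * l) -> l = 0.
Proof.
move=> h; apply/eqP; apply/negP => /negP l0; have := h (- (p + 1) / l).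
by rewrite -mulrA mulVf// mulr1; lra.
Qed.

(* Schur complement: [t t^T / rho] is the smallest matrix allowed by the block form. *)
Lemma schur_complement m M A B C t0 t1 rho (x y : R) : 0 < m ->
  (forall z0 z1 t, 0 <= z0 ^+ 2 * A + 2 * (z0 * z1) * B + z1 ^+ 2 * C - m * (z0 ^+ 2 + z1 ^+ 2)
     + 2 * t * (z0 * t0 + z1 * t1) + t ^+ 2 * rho) ->
  (forall z0 z1, z0 ^+ 2 * A + 2 * (z0 * z1) * B + z1 ^+ 2 * C <= M * (z0 ^+ 2 + z1 ^+ 2)) ->
  rho = t0 * x + t1 * y ->
  let a := m + t0 * t0 * rho^-1 in let b := t0 * t1 * rho^-1 in let c := m + t1 * t1 * rho^-1 in
  [/\ 0 <= rho,
      forall v w, m * (v ^+ 2 + w ^+ 2) <= a * v ^+ 2 + 2 * b * (v * w) + c * w ^+ 2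
        <= M * (v ^+ 2 + w ^+ 2),
      a * x + b * y = t0 + m * x, b * x + c * y = t1 + m * y
    & 0 <= (A - a) * a + 2 * ((B - b) * b) + (C - c) * c].
Proof.
move=> m0 hG hM rE a b c.
have r0 : 0 <= rho by have := hG 0 0 1; rewrite !expr0n !expr1n /=; lra.
have aE v w : a * v ^+ 2 + 2 * b * (v * w) + c * w ^+ 2 =
    m * (v ^+ 2 + w ^+ 2) + rho^-1 * (t0 * v + t1 * w) ^+ 2 by rewrite /a /b /c; ring.
have ri0 : 0 <= rho^-1 by rewrite invr_ge0.
have le v w : a * v ^+ 2 + 2 * b * (v * w) + c * w ^+ 2 <= A * v ^+ 2 + 2 * B * (v * w) + C * w ^+ 2.
  (* This parameter minimizes the form in [t] at the vector [(v, w)]; the minimal value is the Schur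
     complement. *)
  rewrite aE; have := hG v w (- (v * t0 + w * t1) * rho^-1).
  have [r00|rn0] := eqVneq rho 0; first by rewrite r00 invr0; lra.
  suff -> : v ^+ 2 * A + 2 * (v * w) * B + w ^+ 2 * C - m * (v ^+ 2 + w ^+ 2)
     + 2 * (- (v * t0 + w * t1) * rho^-1) * (v * t0 + w * t1) +
     (- (v * t0 + w * t1) * rho^-1) ^+ 2 * rho =
     v ^+ 2 * A + 2 * (v * w) * B + w ^+ 2 * C - m * (v ^+ 2 + w ^+ 2) -
       rho^-1 * (t0 * v + t1 * w) ^+ 2 by lra.
  by field.
(* For [rho = 0] the form is affine in [t], which forces the vector [(t0, t1)] to vanish; since the
   inverse of zero is zero, [a], [b], [c] then describe [m] times the identity. *)
have tz : rho = 0 -> t0 = 0 /\ t1 = 0.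
  move=> r00; split.
    apply: (@linear_eq0 (A - m)) => t; have := hG 1 0 (t / 2); rewrite r00 !expr0n !expr1n /=; lra.
  apply: (@linear_eq0 (C - m)) => t; have := hG 0 1 (t / 2); rewrite r00 !expr0n !expr1n /=; lra.
split => //.
- move=> v w; apply/andP; split; first by rewrite aE lerDl mulr_ge0 ?sqr_ge0.
  by apply: (le_trans (le v w)); have := hM v w; lra.
- have [r00|rn0] := eqVneq rho 0.
    by have [e0 e1] := tz r00; rewrite /a /b e0 r00 invr0; ring.
  have -> : a * x + b * y = m * x + t0 * (t0 * x + t1 * y) * rho^-1 by rewrite /a /b; ring.
  by rewrite -rE -mulrA divff// mulr1 addrC.
- have [r00|rn0] := eqVneq rho 0.
    by have [e0 e1] := tz r00; rewrite /c /b e1 r00 invr0; ring.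
  have -> : b * x + c * y = m * y + t1 * (t0 * x + t1 * y) * rho^-1 by rewrite /c /b; ring.
  by rewrite -rE -mulrA divff// mulr1 addrC.
(* The quantity is a trace [tr (D S)] with [S = m + t t^T / rho] and [D] the difference of the two
   matrices. It equals [m tr D + t^T D t / rho], and [D] is positive semidefinite by [le]. *)
have h0 := le 1 0; have h1 := le 0 1; have h2 := le t0 t1.
rewrite !expr0n !expr1n /= in h0 h1.
have -> : (A - a) * a + 2 * ((B - b) * b) + (C - c) * c = m * ((A - a) + (C - c)) +
   rho^-1 * (A * t0 ^+ 2 + 2 * B * (t0 * t1) + C * t1 ^+ 2 -
     (a * t0 ^+ 2 + 2 * b * (t0 * t1) + c * t1 ^+ 2)).
  by rewrite [in LHS]/a [in LHS]/b [in LHS]/c; rewrite /a /b /c; ring.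
by rewrite addr_ge0// mulr_ge0 ?(ltW m0)// ?subr_ge0//; lra.
Qed.
Lemma factor_test a t m m' (x0 x1 s0 s1 phi : R) :
  a * phi + (t * (s0 * (phi * x0) + s1 * (phi * x1)) + (m * (x0 * (phi * x0) + x1 * (phi * x1)) +
    m' * (x0 * (phi * x0) + x1 * (phi * x1)))) =
  (a + (t * (s0 * x0 + s1 * x1) + (m * (x0 * x0 + x1 * x1) + m' * (x0 * x0 + x1 * x1)))) * phi.
Proof. by ring. Qed.

Lemma le_of_eq x y : x = y -> x <= y. Proof. by move=> ->. Qed.
End Quadratic.

(** * Pointwise positivity of the limit block form *)

Section Homogenized.
Variable R : realType.
Local Notation P := (measurableTypeR R * measurableTypeR R)%type.
Local Notation mu2 := (leb2 R).
Variable (Omega : set (R * R)).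
Hypothesis oO : open Omega.
Hypothesis bO : bounded_set Omega.
Local Notation I f := (\int[mu2]_(x in Omega) f x)%R.
Local Notation Int f := (mu2.-integrable Omega (EFin \o f)).
Local Notation L2O := (L2 mu2 Omega).
Local Notation test := (test_function Omega).
Local Notation "'d_ i f" := (fun x => 'D_(e_ R i) f x) (at level 10, i, f at level 9).
Local Notation ae_eqO f g := {ae mu2, forall x, Omega x -> f x = g x}.
Local Notation mO := (mOmega oO).
Local Notation finO := (finOmega oO bO).
Local Notation pH2 := (preHilbert_L2 mO finO).
Local Notation graph := (H1graph Omega).
Local Notation dist2 := (sqdist Omega).
Local Notation pd i u := (weak_partial Omega i u).
Implicit Types (f u v w phi : R * R -> R) (g h : 'I_2 -> R * R -> R).
Variables qmin qmax : R.
Hypothesis qmin0 : 0 < qmin.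
Local Notation Qad := (Qad Omega qmin qmax).
Local Notation H10 := (H10 Omega).
Implicit Types (q : R * R -> 'M[R]_2).
Local Notation D2 := (grad_sq Omega).
Local Notation ip2 := (pairing2 Omega).
Local Notation wcv := (wcv Omega).

Lemma I_lin4 (a b c : R) F1 F2 F3 F4 : Int F1 -> Int F2 -> Int F3 -> Int F4 ->
  Int (fun x => F1 x + (a * F2 x + (b * F3 x + c * F4 x))) /\
  I (fun x => F1 x + (a * F2 x + (b * F3 x + c * F4 x))) =
  I F1 + (a * I F2 + (b * I F3 + c * I F4)).
Proof.
move=> i1 i2 i3 i4; have j3 := Int_Z mO b i3; have j4 := Int_Z mO c i4; have j2 := Int_Z mO a i2.
have k := Int_D mO j3 j4; have l := Int_D mO j2 k.
split; first exact: (Int_D mO i1 l).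
by rewrite (I_D mO i1 l) (I_D mO j2 k) (I_D mO j3 j4) (I_Z mO a i2) (I_Z mO b i3) (I_Z mO c i4).
Qed.

Variables (q : nat -> R * R -> 'M[R]_2) (u : nat -> R * R -> R) (us : R * R -> R)
  (s : 'I_2 -> R * R -> R) (k : nat -> R * R -> R) (C : R) (qs : 'I_2 -> 'I_2 -> R * R -> R).
Hypothesis Qq : forall n, Qad (q n).
Hypothesis Hu : forall n, H10 (u n).
Hypothesis Hus : H10 us.
Hypothesis Ls : forall i, L2O (s i).
Hypothesis Lk : forall n, L2O (k n).
Hypothesis kC : forall n, I (fun x => k n x ^+ 2) <= C.
Hypothesis uC : forall n, D2 (u n) <= C.
Hypothesis weak_u : forall n v, H10 v -> energy Omega (q n) (u n) v = ip Omega (k n) v.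
Hypothesis wpd : forall i, wcv (fun n => pd i (u n)) (pd i us).
Hypothesis wflux : forall i, wcv (fun n => flux Omega (q n) (u n) i) (s i).
Hypothesis Lqs : forall i j, L2O (qs i j).
Hypothesis wqs : forall i j, wcv (fun n x => q n x i j) (qs i j).

Lemma Qad_L2 n i j : L2O (fun x => q n x i j).
Proof. by apply/(Lp2P mO); have [h _ _] := Qq n; exact: h. Qed.

(** The terms of [(q - qmin)(z + t xi) . (z + t xi)] that are affine in the weakly converging
    quantities: [a], [b], [c] stand for entries of [q], [g] for the flux [q xi] and [h] for [xi].
    The terms quadratic in [xi] are treated apart. *)
Definition linear_part (z0 z1 t : R) (a b c : R * R -> R) g h :=
  fun y => z0 ^+ 2 * a y + (2 * (z0 * z1) * b y + (z1 ^+ 2 * c y + (2 * t * z0 * g 0 y +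
      (2 * t * z1 * g 1 y + (- (2 * t * z0 * qmin) * h 0 y + (- (2 * t * z1 * qmin) * h 1 y +
      - (qmin * (z0 ^+ 2 + z1 ^+ 2)))))))).

Lemma linear_part_L2 (z0 z1 t : R) (a b c : R * R -> R) g h : L2O a -> L2O b -> L2O c ->
  (forall i, L2O (g i)) -> (forall i, L2O (h i)) -> L2O (linear_part z0 z1 t a b c g h).
Proof.
move=> La Lb Lc Lg Lh; have L0 := L2_cst mO finO (- (qmin * (z0 ^+ 2 + z1 ^+ 2))).
have H (e : R) v w : L2O v -> L2O w -> L2O (fun y => e * v y + w y).
  by move=> Lv; exact: (L2D mO (L2Z mO e Lv)).
have L1 := H (- (2 * t * z1 * qmin)) _ _ (Lh 1) L0.
have L2 := H (- (2 * t * z0 * qmin)) _ _ (Lh 0) L1.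
have L3 := H (2 * t * z1) _ _ (Lg 1) L2; have L4 := H (2 * t * z0) _ _ (Lg 0) L3.
have L5 := H (z1 ^+ 2) _ _ Lc L4; have L6 := H (2 * (z0 * z1)) _ _ Lb L5.
exact: (H (z0 ^+ 2) _ _ La L6).
Qed.

Let Lpu n i : L2O (pd i (u n)) := H10_pd oO bO i (Hu n).
Let Lps i : L2O (pd i us) := H10_pd oO bO i Hus.
Let Lfl n i : L2O (flux Omega (q n) (u n) i) := flux_L2 oO bO qmin0 i (Qq n) (Hu n).

Lemma linear_part_wcv z0 z1 t : wcv (fun n => linear_part z0 z1 t (fun x => q n x 0 0)
    (fun x => q n x 0 1) (fun x => q n x 1 1) (flux Omega (q n) (u n)) (fun i => pd i (u n)))
  (linear_part z0 z1 t (qs 0 0) (qs 0 1) (qs 1 1) s (fun i => pd i us)).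
Proof.
have L0 := L2_cst mO finO (- (qmin * (z0 ^+ 2 + z1 ^+ 2))).
pose good (a : nat -> R * R -> R) a' := [/\ forall n, L2O (a n), L2O a' & wcv a a'].
have H (e : R) a a' b b' : good a a' -> good b b' ->
    good (fun n y => e * a n y + b n y) (fun y => e * a' y + b' y).
  move=> [Lv Lv' wv] [Lw Lw' ww]; split; [|exact: (L2D mO (L2Z mO e Lv') Lw')|].
    by move=> n; exact: (L2D mO (L2Z mO e (Lv n)) (Lw n)).
  exact: (wcv_lin oO bO Lv Lw Lv' Lw' wv ww).
have gx i : good (fun n => pd i (u n)) (pd i us) by split; [by move=> n|by []|exact: wpd].
have gf i : good (fun n => flux Omega (q n) (u n) i) (s i) by split; [by move=> n|by []|exact: wflux].
have gq i j : good (fun n x => q n x i j) (qs i j).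
  by split; [by move=> n; exact: Qad_L2|by []|exact: wqs].
have g0 : good (fun=> (fun=> - (qmin * (z0 ^+ 2 + z1 ^+ 2)))) (fun=> - (qmin * (z0 ^+ 2 + z1 ^+ 2))).
  by split => //; exact: wcv_cst.
have g1 := H (- (2 * t * z1 * qmin)) _ _ _ _ (gx 1) g0.
have g2 := H (- (2 * t * z0 * qmin)) _ _ _ _ (gx 0) g1.
have g3 := H (2 * t * z1) _ _ _ _ (gf 1) g2; have g4 := H (2 * t * z0) _ _ _ _ (gf 0) g3.
have g5 := H (z1 ^+ 2) _ _ _ _ (gq 1 1) g4; have g6 := H (2 * (z0 * z1)) _ _ _ _ (gq 0 1) g5.
by have [_ _] := H (z0 ^+ 2) _ _ _ _ (gq 0 0) g6.
Qed.

Definition block_form z0 z1 t x :=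
  linear_part z0 z1 t (qs 0 0) (qs 0 1) (qs 1 1) s (fun i => pd i us) x +
  (t ^+ 2 * (s 0 x * pd 0 us x + s 1 x * pd 1 us x) +
  (- (2 * (t ^+ 2 * qmin)) * (pd 0 us x * pd 0 us x + pd 1 us x * pd 1 us x) +
    t ^+ 2 * qmin * (pd 0 us x * pd 0 us x + pd 1 us x * pd 1 us x))).

(** Before the limit the form is nonnegative by [block_form_ge0]. Integrated against a nonnegative
    test function it converges: the affine part weakly, the energy density by [div_curl], the mixed
    term because [us] is fixed. The sign of the limit is localized by [nonneg_of_test]. *)
Lemma block_form_ae_ge0 z0 z1 t : {ae mu2, forall x, Omega x -> 0 <= block_form z0 z1 t x}.
Proof.
have iP (f g : 'I_2 -> R * R -> R) : (forall i, L2O (f i)) -> (forall i, L2O (g i)) ->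
    Int (fun x => f 0 x * g 0 x + f 1 x * g 1 x).
  by move=> Lf Lg; exact: (Int_D mO (L2M mO (Lf 0) (Lg 0)) (L2M mO (Lf 1) (Lg 1))).
have LA := linear_part_L2 z0 z1 t (Lqs 0 0) (Lqs 0 1) (Lqs 1 1) Ls Lps.
have iG : Int (block_form z0 z1 t).
  exact: (I_lin4 (t ^+ 2) (- (2 * (t ^+ 2 * qmin))) (t ^+ 2 * qmin) (L2_Int mO finO LA)
    (iP _ _ Ls Lps) (iP _ _ Lps Lps) (iP _ _ Lps Lps)).1.
apply: (nonneg_of_test oO).
  by move=> K cK KO; apply: integrableS iG; [exact: mO|exact: compact_measurable2|exact: KO].
move=> phi tp p0; have [K K0 hK] := test_bounded tp.
have mphi := test_measurable tp mO; have Lphi := test_L2 oO bO tp.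
have Lm f : L2O f -> L2O (fun x => phi x * f x).
  by move=> Lf; apply: (L2_bM mO mphi _ Lf); apply: aeW => x _; exact: hK.
pose A n := linear_part z0 z1 t (fun x => q n x 0 0)
    (fun x => q n x 0 1) (fun x => q n x 1 1) (flux Omega (q n) (u n)) (fun i => pd i (u n)).
have LAn n : L2O (A n) := linear_part_L2 z0 z1 t (Qad_L2 n 0 0) (Qad_L2 n 0 1) (Qad_L2 n 1 1) (Lfl n) (Lpu n).
pose gs i x := phi x * pd i us x; have Lgs i : L2O (gs i) := Lm _ (Lps i).
pose gu n i x := phi x * pd i (u n) x; have Lgu n i : L2O (gu n i) := Lm _ (Lpu n i).
pose T n := ip Omega (A n) phi + (t ^+ 2 * ip2 (flux Omega (q n) (u n)) (gu n) +
  (- (2 * (t ^+ 2 * qmin)) * ip2 (fun i => pd i (u n)) gs + t ^+ 2 * qmin * ip2 (fun i => pd i us) gs)).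
have T0 n : 0 <= T n.
  have i1 := L2M mO (LAn n) Lphi.
  have [iT] := I_lin4 (t ^+ 2) (- (2 * (t ^+ 2 * qmin))) (t ^+ 2 * qmin) i1
    (iP _ _ (Lfl n) (Lgu n)) (iP _ _ (Lpu n) Lgs) (iP _ _ Lps Lgs).
  rewrite -(ip2E oO (Lfl n) (Lgu n)) -(ip2E oO (Lpu n) Lgs) -(ip2E oO Lps Lgs) => E.
  apply: (le_trans _ (le_of_eq E)).
  apply: (I_ge0_ae mO iT); have [_ hq] := (QadP oO bO qmax qmin0 (q n)).1 (Qq n).
  apply: aeS hq => x h Ox; have [e1 e2] := h Ox.
  apply: (block_form_ge0 _ _ _ _ _ _ _ (ltW qmin0) (p0 x) e1).
  by move=> v w; have /andP[] := e2 v w.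
have cD := div_curl oO bO qmin0 Qq Hu Hus Lk kC uC weak_u wpd wflux (multiplier_test oO bO tp).

have cT : T @ \oo --> ip Omega (linear_part z0 z1 t (qs 0 0) (qs 0 1) (qs 1 1) s (fun i => pd i us)) phi +
  (t ^+ 2 * ip2 s gs + (- (2 * (t ^+ 2 * qmin)) * ip2 (fun i => pd i us) gs +
   t ^+ 2 * qmin * ip2 (fun i => pd i us) gs)).
  apply: cvgD; first exact: (@linear_part_wcv z0 z1 t _ Lphi).
  apply: cvgD.
    apply: cvgM; first exact: cvg_cst.
    exact: cD.
  apply: cvgD; last exact: cvg_cst.
  apply: cvgM; first exact: cvg_cst.
  by apply: cvgD; [exact: (@wpd 0 _ (Lgs 0))|exact: (@wpd 1 _ (Lgs 1))].
have := cvg_ge0 cT T0.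
have [_] := I_lin4 (t ^+ 2) (- (2 * (t ^+ 2 * qmin))) (t ^+ 2 * qmin) (L2M mO LA Lphi)
    (iP _ _ Ls Lgs) (iP _ _ Lps Lgs) (iP _ _ Lps Lgs).
rewrite -(ip2E oO Ls Lgs) -(ip2E oO Lps Lgs) => E.
move=> /le_trans; apply; apply: (le_trans (le_of_eq (esym E))); apply: le_of_eq.
apply: eq_Rintegral => x _; rewrite /block_form /gs; exact: factor_test.
Qed.
End Homogenized.

(** The expression is quadratic in each of the three parameters separately, so they are freed from
    being rational one at a time. *)
Lemma block_form_real (R : realType) (A B C m t0 t1 rho : R) :
  (forall a b c : rat, 0 <= ratr a ^+ 2 * A + 2 * (ratr a * ratr b) * B + ratr b ^+ 2 * C
     - m * (ratr a ^+ 2 + ratr b ^+ 2) + 2 * ratr c * (ratr a * t0 + ratr b * t1) + ratr c ^+ 2 * rho) ->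
  forall z0 z1 t : R, 0 <= z0 ^+ 2 * A + 2 * (z0 * z1) * B + z1 ^+ 2 * C - m * (z0 ^+ 2 + z1 ^+ 2)
     + 2 * t * (z0 * t0 + z1 * t1) + t ^+ 2 * rho.
Proof.
move=> h.
have h1 (a b : rat) t : 0 <= ratr a ^+ 2 * A + 2 * (ratr a * ratr b) * B + ratr b ^+ 2 * C
     - m * (ratr a ^+ 2 + ratr b ^+ 2) + 2 * t * (ratr a * t0 + ratr b * t1) + t ^+ 2 * rho.
  have := @quadratic_rat_ge0 R rho (2 * (ratr a * t0 + ratr b * t1))
    (ratr a ^+ 2 * A + 2 * (ratr a * ratr b) * B + ratr b ^+ 2 * C - m * (ratr a ^+ 2 + ratr b ^+ 2)) _ t.
  by move=> k; apply: (le_trans (k _)) => [c|]; [apply: (le_trans (h a b c))|]; apply: le_of_eq; ring.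
have h2 (a : rat) z1 t : 0 <= ratr a ^+ 2 * A + 2 * (ratr a * z1) * B + z1 ^+ 2 * C
     - m * (ratr a ^+ 2 + z1 ^+ 2) + 2 * t * (ratr a * t0 + z1 * t1) + t ^+ 2 * rho.
  have := @quadratic_rat_ge0 R (C - m) (2 * ratr a * B + 2 * t * t1)
    (ratr a ^+ 2 * A - m * ratr a ^+ 2 + 2 * t * (ratr a * t0) + t ^+ 2 * rho) _ z1.
  by move=> k; apply: (le_trans (k _)) => [c|]; [apply: (le_trans (h1 a c t))|]; apply: le_of_eq; ring.
move=> z0 z1 t; have := @quadratic_rat_ge0 R (A - m) (2 * z1 * B + 2 * t * t0)
    (z1 ^+ 2 * C - m * z1 ^+ 2 + 2 * t * (z1 * t1) + t ^+ 2 * rho) _ z0.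
by move=> k; apply: (le_trans (k _)) => [c|]; [apply: (le_trans (h2 c z1 t))|]; apply: le_of_eq; ring.
Qed.

Lemma block_form_expand (R : realType) (z0 z1 t m a b c s0 s1 x y : R) :
  z0 ^+ 2 * a + (2 * (z0 * z1) * b + (z1 ^+ 2 * c + (2 * t * z0 * s0 + (2 * t * z1 * s1 +
    (- (2 * t * z0 * m) * x + (- (2 * t * z1 * m) * y + - (m * (z0 ^+ 2 + z1 ^+ 2)))))))) +
    (t ^+ 2 * (s0 * x + s1 * y) + (- (2 * (t ^+ 2 * m)) * (x * x + y * y) + t ^+ 2 * m * (x * x + y * y))) =
  z0 ^+ 2 * a + 2 * (z0 * z1) * b + z1 ^+ 2 * c - m * (z0 ^+ 2 + z1 ^+ 2)
     + 2 * t * (z0 * (s0 - m * x) + z1 * (s1 - m * y)) + t ^+ 2 * ((s0 - m * x) * x + (s1 - m * y) * y).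
Proof. by ring. Qed.

Lemma upper_form_expand (R : realType) (z0 z1 t m M a b c s0 s1 x y : R) : t = 0 ->
  -1 * (z0 ^+ 2 * a + (2 * (z0 * z1) * b + (z1 ^+ 2 * c + (2 * t * z0 * s0 + (2 * t * z1 * s1 +
    (- (2 * t * z0 * m) * x + (- (2 * t * z1 * m) * y + - (m * (z0 ^+ 2 + z1 ^+ 2))))))))) +
    (M - m) * (z0 ^+ 2 + z1 ^+ 2) =
  M * (z0 ^+ 2 + z1 ^+ 2) - (a * z0 ^+ 2 + 2 * b * (z0 * z1) + c * z1 ^+ 2).
Proof. by move=> ->; ring. Qed.

(** * A coefficient that carries the limit flux *)

Section Coefficient.
Variable R : realType.
Local Notation P := (measurableTypeR R * measurableTypeR R)%type.
Local Notation mu2 := (leb2 R).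
Variable (Omega : set (R * R)).
Hypothesis oO : open Omega.
Hypothesis bO : bounded_set Omega.
Local Notation I f := (\int[mu2]_(x in Omega) f x)%R.
Local Notation Int f := (mu2.-integrable Omega (EFin \o f)).
Local Notation L2O := (L2 mu2 Omega).
Local Notation test := (test_function Omega).
Local Notation "'d_ i f" := (fun x => 'D_(e_ R i) f x) (at level 10, i, f at level 9).
Local Notation ae_eqO f g := {ae mu2, forall x, Omega x -> f x = g x}.
Local Notation mO := (mOmega oO).
Local Notation finO := (finOmega oO bO).
Local Notation pH2 := (preHilbert_L2 mO finO).
Local Notation graph := (H1graph Omega).
Local Notation dist2 := (sqdist Omega).
Local Notation pd i u := (weak_partial Omega i u).
Implicit Types (f u v w phi : R * R -> R) (g h : 'I_2 -> R * R -> R).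
Variables qmin qmax : R.
Hypothesis qmin0 : 0 < qmin.
Local Notation Qad := (Qad Omega qmin qmax).
Local Notation H10 := (H10 Omega).
Implicit Types (q : R * R -> 'M[R]_2).
Local Notation D2 := (grad_sq Omega).
Local Notation ip2 := (pairing2 Omega).
Local Notation wcv := (wcv Omega).
Variables (q : nat -> R * R -> 'M[R]_2) (u : nat -> R * R -> R) (us : R * R -> R)
  (s : 'I_2 -> R * R -> R) (k : nat -> R * R -> R) (C : R) (qs : 'I_2 -> 'I_2 -> R * R -> R).
Hypothesis Qq : forall n, Qad (q n).
Hypothesis Hu : forall n, H10 (u n).
Hypothesis Hus : H10 us.
Hypothesis Ls : forall i, L2O (s i).
Hypothesis Lk : forall n, L2O (k n).
Hypothesis kC : forall n, I (fun x => k n x ^+ 2) <= C.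
Hypothesis uC : forall n, D2 (u n) <= C.
Hypothesis weak_u : forall n v, H10 v -> energy Omega (q n) (u n) v = ip Omega (k n) v.
Hypothesis wpd : forall i, wcv (fun n => pd i (u n)) (pd i us).
Hypothesis wflux : forall i, wcv (fun n => flux Omega (q n) (u n) i) (s i).
Hypothesis Lqs : forall i j, L2O (qs i j).
Hypothesis wqs : forall i j, wcv (fun n x => q n x i j) (qs i j).

Lemma ae_rat3 (Q : R -> R -> R -> R * R -> Prop) :
  (forall a b c, {ae mu2, forall x, Q a b c x}) ->
  {ae mu2, forall x, forall a b c : rat, Q (ratr a) (ratr b) (ratr c) x}.
Proof.
move=> h; pose d n : rat * rat * rat := odflt (0, 0, 0) (unpickle n).
have hd n := h (ratr (d n).1.1) (ratr (d n).1.2) (ratr (d n).2).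
apply: aeS (ae_foralln hd) => x hx a b c; have := hx (pickle (a, b, c)).
by rewrite /d pickleK.
Qed.

Let Lps i : L2O (pd i us) := H10_pd oO bO i Hus.
Let th (i : 'I_2) x := s i x - qmin * pd i us x.
Let rho x := th 0 x * pd 0 us x + th 1 x * pd 1 us x.

Lemma block_ae : {ae mu2, forall x, Omega x -> forall z0 z1 t,
  0 <= z0 ^+ 2 * qs 0 0 x + 2 * (z0 * z1) * qs 0 1 x + z1 ^+ 2 * qs 1 1 x
    - qmin * (z0 ^+ 2 + z1 ^+ 2) + 2 * t * (z0 * th 0 x + z1 * th 1 x) + t ^+ 2 * rho x}.
Proof.
have h a b c := block_form_ae_ge0 oO bO qmin0 Qq Hu Hus Ls Lk kC uC weak_u wpd wflux Lqs wqs a b c.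
apply: aeS (ae_rat3 h) => x hx Ox; apply: block_form_real => a b c.
by apply: (le_trans (hx a b c Ox)); apply: le_of_eq; exact: block_form_expand.
Qed.

(** An inequality linear in [q] survives weak limits directly. The convergence of [linear_part] is
    reused at parameter zero, where flux and gradient drop out; a dummy third parameter fits the
    shape of [ae_rat3]. *)
Lemma upper_ae : {ae mu2, forall x, Omega x -> forall z0 z1,
  z0 ^+ 2 * qs 0 0 x + 2 * (z0 * z1) * qs 0 1 x + z1 ^+ 2 * qs 1 1 x <= qmax * (z0 ^+ 2 + z1 ^+ 2)}.
Proof.
have Lq n i j := Qad_L2 oO Qq n i j.
have Lfl n i : L2O (flux Omega (q n) (u n) i) := flux_L2 oO bO qmin0 i (Qq n) (Hu n).
have Lpu n i : L2O (pd i (u n)) := H10_pd oO bO i (Hu n).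
have h (z0 z1 t : R) : {ae mu2, forall x, Omega x -> 0 <= -1 * linear_part qmin z0 z1 0
    (qs 0 0) (qs 0 1) (qs 1 1) s (fun i => pd i us) x + (qmax - qmin) * (z0 ^+ 2 + z1 ^+ 2)}.
  have LA n := linear_part_L2 oO bO qmin z0 z1 0 (Lq n 0 0) (Lq n 0 1) (Lq n 1 1) (Lfl n) (Lpu n).
  have LB := linear_part_L2 oO bO qmin z0 z1 0 (Lqs 0 0) (Lqs 0 1) (Lqs 1 1) Ls Lps.
  have Lc := L2_cst mO finO ((qmax - qmin) * (z0 ^+ 2 + z1 ^+ 2)).
  have w := linear_part_wcv (z0 := z0) (z1 := z1) (t := 0) oO bO qmin0 Qq Hu Hus Ls wpd wflux Lqs wqs.
  apply: (wcv_ge0 oO bO (fun n => L2D mO (L2Z mO (-1) (LA n)) Lc) (L2D mO (L2Z mO (-1) LB) Lc)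
    (wcv_lin oO bO LA (fun=> Lc) LB Lc w (@wcv_cst _ _ _))).
  move=> n; have [_ hq] := (QadP oO bO qmax qmin0 (q n)).1 (Qq n).
  apply: aeS hq => x e Ox; have [e1 e2] := e Ox; have /andP[_ e3] := e2 z0 z1.
  rewrite -subr_ge0 in e3; apply: (le_trans e3); apply: le_of_eq; symmetry.
  exact: upper_form_expand.
apply: aeS (ae_rat3 h) => x hx Ox z0 z1.
have := @block_form_real R (- qs 0 0 x) (- qs 0 1 x) (- qs 1 1 x) (- qmax) 0 0 0 _ z0 z1 0.
move=> kk; rewrite -subr_ge0; apply: (le_trans (kk _)); last by apply: le_of_eq; ring.
move=> a b c; apply: (le_trans (hx a b c Ox)); apply: le_of_eq.
rewrite /linear_part (upper_form_expand _ _ _ _ _ _ _ _ _ _ _ (erefl 0)); ring.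
Qed.

(** The Schur complement [qmin + th th^T / rho]. The inverse is written as the power [-1] so that
    measurability follows from that of [powR]; where [rho >= 0], hence a.e. in [Omega], the two
    agree. *)
Definition homogenized_mx x : 'M[R]_2 :=
  \matrix_(i, j) ((if i == j then qmin else 0) + th i x * th j x * rho x `^ (-1)).

Lemma homogenized_ae : {ae mu2, forall x, Omega x ->
  [/\ ell qmin qmax (homogenized_mx x),
    forall i, flux Omega homogenized_mx us i x = s i x
  & 0 <= (qs 0 0 x - homogenized_mx x 0 0) * homogenized_mx x 0 0
    + 2 * ((qs 0 1 x - homogenized_mx x 0 1) * homogenized_mx x 0 1)
    + (qs 1 1 x - homogenized_mx x 1 1) * homogenized_mx x 1 1]}.
Proof.
apply: aeS2 block_ae upper_ae => x h1 h2 Ox.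
have [r0 e1 e2 e3 e4] := schur_complement qmin0 (h1 Ox) (h2 Ox) (erefl (rho x)).
have ri : rho x `^ (-1) = (rho x)^-1 by rewrite powR_inv1.
have e01 : ((0 : 'I_2) == 1) = false by [].
have e10 : ((1 : 'I_2) == 0) = false by [].
have m00 : homogenized_mx x 0 0 = qmin + th 0 x * th 0 x * (rho x)^-1.
  by rewrite mxE eqxx ri; reflexivity.
have m11 : homogenized_mx x 1 1 = qmin + th 1 x * th 1 x * (rho x)^-1.
  by rewrite mxE eqxx ri; reflexivity.
have m01 : homogenized_mx x 0 1 = th 0 x * th 1 x * (rho x)^-1.
  by rewrite mxE e01 ri add0r; reflexivity.
have m10 : homogenized_mx x 1 0 = th 0 x * th 1 x * (rho x)^-1.
  rewrite mxE e10 ri add0r.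
  exact: (f_equal (fun z => z * (rho x)^-1) (mulrC (th 1 x) (th 0 x))).
split.
- by split; [rewrite m01 m10|move=> a b; rewrite m00 m01 m11; exact: e1].
- move=> i; rewrite /flux; have [->|->] := ord2 i; first by rewrite m00 m01; exact: (etrans e2 (subrK _ _)).
  by rewrite m10 m11; exact: (etrans e3 (subrK _ _)).
- by rewrite m00 m01 m11; exact: e4.
Qed.

Lemma homogenized_measurable i j : measurable_fun (Omega : set P) (fun x => homogenized_mx x i j).
Proof.
have mth l : measurable_fun (Omega : set P) (th l).
  exact: (L2B mO (Ls l) (L2Z mO qmin (Lps l))).1.
have -> : (fun x => homogenized_mx x i j) =
    (fun x => (if i == j then qmin else 0) + th i x * th j x * rho x `^ (-1)).
  by apply/funext => x; rewrite mxE.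
apply: measurable_funD; first exact: measurable_cst.
apply: measurable_funM; first exact: measurable_funM.
apply: (measurableT_comp (measurable_powR (-1))).
by apply: measurable_funD; apply: measurable_funM => //; exact: (Lps _).1.
Qed.

(** The last inequality is [(qs - qh, qh) >= 0] for the Frobenius product, with the off-diagonal
    entry counted twice by symmetry. It implies that [qh] has no larger norm than [qs] and is the
    form that [coefficient_strong] uses. *)
Theorem homogenized_coefficient : exists qh, [/\ Qad qh,
  forall i, ae_eqO (flux Omega qh us i) (s i)
  & 0 <= ip Omega (fun x => qs 0 0 x - qh x 0 0) (fun x => qh x 0 0)
    + 2 * ip Omega (fun x => qs 0 1 x - qh x 0 1) (fun x => qh x 0 1)
    + ip Omega (fun x => qs 1 1 x - qh x 1 1) (fun x => qh x 1 1)].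
Proof.
have Qh : Qad homogenized_mx.
  apply/(QadP oO bO qmax qmin0); split; first exact: homogenized_measurable.
  by apply: aeS homogenized_ae => x h Ox; have [] := h Ox.
exists homogenized_mx; split => //.
  by move=> i; apply: aeS homogenized_ae => x h Ox; have [_ e _] := h Ox; exact: e.
have Lh i j : L2O (fun x => homogenized_mx x i j).
  by apply/(Lp2P mO); have [e _ _] := Qh; exact: e.
have iI i j := L2M mO (L2B mO (Lqs i j) (Lh i j)) (Lh i j).
have j1 := Int_Z mO 2 (iI 0 1); have j2 := Int_D mO (iI 0 0) j1.
rewrite /ip -(I_Z mO 2 (iI 0 1)) -(I_D mO (iI 0 0) j1) -(I_D mO j2 (iI 1 1)).
apply: (I_ge0_ae mO (Int_D mO j2 (iI 1 1))).
by apply: aeS homogenized_ae => x h Ox; have [_ _ e] := h Ox.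
Qed.
End Coefficient.

Lemma cvg_inv_pinfty (R : realType) (gamma : nat -> R) : (forall n, 0 < gamma n) ->
  gamma @ \oo --> +oo -> (fun n => (gamma n)^-1) @ \oo --> 0.
Proof.
move=> g0 /cvgryPge h; apply/cvg_epsP => e e0; have [N _ NP] := h e^-1.
exists N => n Nn; have := NP n Nn; rewrite /= subr0 gtr0_norm ?invr_gt0// => k.
by rewrite -[leRHS]invrK lef_pV2// posrE ?invr_gt0.
Qed.

Lemma squeeze_le0 (R : realType) (a b : nat -> R) (l : R) : (forall n, 0 <= a n <= b n) ->
  b @ \oo --> l -> l <= 0 -> a @ \oo --> 0.
Proof.
move=> ab bl l0; apply: (@cvg0_le _ _ (fun n => b n - l)).
  by move=> n; have /andP[-> h] := ab n; rewrite /=; lra.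
by rewrite -(subrr l); apply: cvgB; [exact: bl|exact: cvg_cst].
Qed.

(** * The limit obstacle problem, convergence of the competitors, and strong convergence *)

Section Recovery.
Variable R : realType.
Local Notation P := (measurableTypeR R * measurableTypeR R)%type.
Local Notation mu2 := (leb2 R).
Variable (Omega : set (R * R)).
Hypothesis oO : open Omega.
Hypothesis bO : bounded_set Omega.
Local Notation I f := (\int[mu2]_(x in Omega) f x)%R.
Local Notation Int f := (mu2.-integrable Omega (EFin \o f)).
Local Notation L2O := (L2 mu2 Omega).
Local Notation test := (test_function Omega).
Local Notation "'d_ i f" := (fun x => 'D_(e_ R i) f x) (at level 10, i, f at level 9).
Local Notation ae_eqO f g := {ae mu2, forall x, Omega x -> f x = g x}.
Local Notation mO := (mOmega oO).
Local Notation finO := (finOmega oO bO).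
Local Notation pH2 := (preHilbert_L2 mO finO).
Local Notation graph := (H1graph Omega).
Local Notation dist2 := (sqdist Omega).
Local Notation pd i u := (weak_partial Omega i u).
Implicit Types (f u v w phi : R * R -> R) (g h : 'I_2 -> R * R -> R).
Variables qmin qmax : R.
Hypothesis qmin0 : 0 < qmin.
Local Notation Qad := (Qad Omega qmin qmax).
Local Notation H10 := (H10 Omega).
Implicit Types (q : R * R -> 'M[R]_2).
Local Notation D2 := (grad_sq Omega).
Local Notation ip2 := (pairing2 Omega).
Local Notation wcv := (wcv Omega).
Local Notation En := (energy Omega).
Variables (M c1 c2 psi : R) (maxs : R -> R -> R).
Hypothesis psi0 : psi < 0.
Hypothesis sm : smoothed_max M c1 c2 maxs.
Local Notation r gamma := (r_ maxs psi gamma).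
Variables (f : R * R -> R) (gamma : nat -> R).
Hypothesis Lf : L2O f.
Hypothesis g0 : forall n, 0 < gamma n.
Hypothesis ginf : gamma @ \oo --> +oo.
Let posp (u : R * R -> R) x := Num.max 0 (psi - u x).

Lemma posp_L2 u : L2O u -> L2O (posp u).
Proof.
move=> Lu; have Ld : L2O (fun x => psi - u x) := L2B mO (L2_cst mO finO psi) Lu.
apply: (L2_le mO _ Ld); first by apply: measurable_maxr; [exact: measurable_cst|exact: Ld.1].
apply: aeW => x _; rewrite /posp; have [h|h] := leP 0 (psi - u x); rewrite ?normr0//.
Qed.

(** The penalty is [gamma] times the smoothed violation of the obstacle, so an [L^2] bound on it
    makes the violation of order [1 / gamma]; the smoothing contributes at most [1 / (2 gamma)]
    more. *)
Lemma posp_cvg0 (u : nat -> R * R -> R) K : (forall n, L2O (u n)) ->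
  (forall n, I (fun x => r (gamma n) (u n x) ^+ 2) <= K) ->
  (fun n => I (fun x => posp (u n) x ^+ 2)) @ \oo --> 0.
Proof.
move=> Lu rK; have i1 := Int_cst mO finO 1.
apply: (@cvg0_le _ _ (fun n => (gamma n)^-1 ^+ 2 * (2 * K + I (fun=> 1)))); last first.
  rewrite -[X in _ --> X](mul0r (2 * K + I (fun=> 1))); apply: cvgM; last exact: cvg_cst.
  by have := cvg_sqr (cvg_inv_pinfty g0 ginf); rewrite expr0n.
move=> n; rewrite I_sq_ge0 /=; have Lr := r_L2 oO psi0 sm (g0 n) (Lu n).
have iR := Int_D mO (Int_Z mO 2 Lr.2) i1.
apply: (@le_trans _ _ ((gamma n)^-1 ^+ 2 * (2 * I (fun x => r (gamma n) (u n x) ^+ 2) + I (fun=> 1)))); last first.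
  by rewrite ler_wpM2l ?sqr_ge0// lerD2r ler_wpM2l.
rewrite -(I_Z mO 2 Lr.2) -(I_D mO (Int_Z mO 2 Lr.2) i1) -(I_Z mO _ iR).
apply: (I_le mO (posp_L2 (Lu n)).2 (Int_Z mO _ iR)); apply: aeW => x _.
have /andP[a b] := maxs_approx sm (g0 n) (psi - u n x).
have e : maxs (gamma n) (psi - u n x) = (gamma n)^-1 * - r (gamma n) (u n x).
  by rewrite /r_ mulNr opprK mulrA mulVf ?mul1r// gt_eqF.
have e2 : (2 * gamma n)^-1 = (gamma n)^-1 * 2^-1 by rewrite invfM mulrC.
rewrite e e2 -mulrDr in b.
apply: (@le_trans _ _ (((gamma n)^-1 * (- r (gamma n) (u n x) + 2^-1)) ^+ 2)).
  have p0 : 0 <= posp (u n) x by rewrite /posp le_max lexx.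
  by apply: lerXn2r; rewrite ?nnegrE//; exact: le_trans b.
rewrite exprMn; apply: ler_wpM2l; first exact: sqr_ge0.
by move: (r (gamma n) (u n x)) => z; have := sqr_ge0 (z + 2^-1); lra.
Qed.

Section Obstacle.
Variables (u : nat -> R * R -> R) (us rs : R * R -> R) (K : R).
Hypothesis Lu : forall n, L2O (u n).
Hypothesis Lus : L2O us.
Hypothesis Lrs : L2O rs.
Hypothesis rK : forall n, I (fun x => r (gamma n) (u n x) ^+ 2) <= K.
Hypothesis us_cvg : (fun n => dist2 (u n) us) @ \oo --> 0.
Hypothesis wr : wcv (fun n x => r (gamma n) (u n x)) rs.

Let Lps : L2O (fun=> psi) := L2_cst mO finO psi.

(** The sum of [posp (u n)] and [u n - psi] is nonnegative, its first summand tends to zero, and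
    signs survive in weak limits. *)
Lemma obstacle_limit : {ae mu2, forall x, Omega x -> 0 <= us x - psi}.
Proof.
have z0 := L2_cst mO finO 0.
have w1 : wcv (fun n => posp (u n)) (fun=> 0).
  apply: (wcv_strong oO bO (fun n => posp_L2 (Lu n)) z0).
  apply: (cvg_seq_ext _ (posp_cvg0 Lu rK)) => n.
  by apply: eq_Rintegral => x _; rewrite subr0.
have w2 : wcv (fun n x => u n x - psi) (fun x => us x - psi).
  apply: (wcv_strong oO bO (fun n => L2B mO (Lu n) Lps) (L2B mO Lus Lps)).
  apply: (cvg_seq_ext _ us_cvg) => n; apply: eq_Rintegral => x _.
  by rewrite opprB addrA subrK.
have Lp n := posp_L2 (Lu n); have Lb n := L2B mO (Lu n) Lps.
have w := wcv_lin (t := 1) oO bO Lp Lb z0 (L2B mO Lus Lps) w1 w2.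
have := wcv_ge0 oO bO (fun n => L2D mO (L2Z mO 1 (Lp n)) (Lb n)) (L2D mO (L2Z mO 1 z0) (L2B mO Lus Lps)) w.
move=> h; apply: aeS (h _) => [x hx Ox|n]; first by have := hx Ox; rewrite mulr0 add0r.
apply: aeW => x _; rewrite mul1r.
have : psi - u n x <= posp (u n) x by rewrite /posp le_max lexx orbT.
lra.
Qed.

Lemma multiplier_limit_le0 : {ae mu2, forall x, Omega x -> 0 <= - rs x}.
Proof.
have Lr n := r_L2 oO psi0 sm (g0 n) (Lu n); have z0 := L2_cst mO finO 0.
have w := wcv_lin (t := -1) oO bO Lr (fun=> z0) Lrs z0 wr (@wcv_cst _ _ _).
have h := wcv_ge0 oO bO (fun n => L2D mO (L2Z mO (-1) (Lr n)) z0) (L2D mO (L2Z mO (-1) Lrs) z0) w.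
apply: aeS (h _) => [x hx Ox|n]; first by have := hx Ox; rewrite mulN1r addr0.
apply: aeW => x _; rewrite mulN1r addr0 oppr_ge0.
exact: (r_le0 psi sm (g0 n)).
Qed.

(** One inequality is the sign of the limits: [rs <= 0] and [us >= psi]. The other is the limit of
    the nonnegative products of [r (u n)] and [u n - psi], where one factor converges weakly and the
    other strongly. *)
Lemma complementarity : ip Omega rs (fun x => us x - psi) = 0.
Proof.
have Lr n := r_L2 oO psi0 sm (g0 n) (Lu n); have Lb := L2B mO Lus Lps.
apply/eqP; rewrite eq_le; apply/andP; split.
  have iP := Int_Z mO (-1) (L2M mO Lrs Lb).
  suff : 0 <= -1 * ip Omega rs (fun x => us x - psi) by rewrite mulN1r oppr_ge0.
  rewrite -(I_Z mO (-1) (L2M mO Lrs Lb)); apply: (I_ge0_ae mO iP).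
  apply: aeS2 obstacle_limit multiplier_limit_le0 => x h1 h2 Ox.
  by rewrite mulN1r -mulNr mulr_ge0 ?h1 ?h2.
have c := wcv_ip oO bO Lr Lrs (fun n => L2B mO (Lu n) Lps) Lb rK wr.
apply: (cvg_ge0 (c _)) => [|n].
  apply: (cvg_seq_ext _ us_cvg) => n; apply: eq_Rintegral => x _.
  by rewrite opprB addrA subrK.
by apply: I_ge0 => x _; exact: (r_mul_sub_ge0 sm (g0 n)).
Qed.

Variables (qh : R * R -> 'M[R]_2) (uh : nat -> R * R -> R).
Hypothesis Qh : Qad qh.
Hypothesis Hus : H10 us.
Hypothesis limit_eq : forall v, H10 v -> En qh us v = ip Omega (fun x => f x - rs x) v.
Hypothesis sth : forall n, is_state Omega maxs psi f (gamma n) qh (uh n).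

(** Testing the difference of the two equations with [uh - us] gives the energy of the difference.
    Since [us >= psi], the penalty term has a good sign; by complementarity the multiplier term is
    at most the pairing of [- rs] with the positive part of [psi - uh], which tends to zero. *)
Lemma recovery_cvg : (fun n => dist2 (uh n) us) @ \oo --> 0.
Proof.
have Huh n : H10 (uh n) by have [] := sth n.
have Luh n := H10_L2 oO bO (Huh n).
have rhK n := state_r_L2 oO bO qmin0 psi0 sm Lf (g0 n) Qh (sth n).
have p0 := posp_cvg0 Luh rhK.
pose X n := ip Omega (fun x => - rs x) (posp (uh n)).
have LN := L2N mO Lrs.
have cX : X @ \oo --> 0.
  apply: (cvg_seq_ext _ (ip_cvg0 oO bO (fun n => posp_L2 (Luh n)) LN p0)) => n; exact: ipC.
have cp := c_gt0 Omega.
apply: (@cvg0_le _ _ (fun n => (1 + I (fun=> 1)) / qmin * X n)); last first.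
  by rewrite -(mulr0 ((1 + I (fun=> 1)) / qmin)); apply: cvgM; [exact: cvg_cst|exact: cX].
move=> n; rewrite dist2_ge0 /=; have Hw := H10B oO bO (Huh n) Hus.
have Lw := H10_L2 oO bO Hw.
apply: (le_trans (poincare1 oO bO Hw)); rewrite -mulrA ler_wpM2l ?(ltW cp)// ler_pdivlMl//.
apply: (le_trans (En_ge oO bO qmin0 Qh Hw)).
have pH := preHilbert_En oO bO qmin0 Qh (lexx 0).
have Lr := r_L2 oO psi0 sm (g0 n) (Luh n).
have e1 := En_lin_l oO bO qmin0 (-1) Qh Hus (Huh n) Hw.
have e2 : (fun x => -1 * us x + uh n x) = (fun x => uh n x - us x).
  by apply/funext => x; rewrite mulN1r addrC.
rewrite e2 mulN1r (limit_eq Hw) (state_weak oO bO qmin0 psi0 sm Lf (g0 n) Qh (sth n) Hw) in e1.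
have iA := L2M mO (L2B mO Lf Lrs) Lw; have iB := L2M mO (L2B mO Lf Lr) Lw.
have iC := L2M mO Lrs (L2B mO Lus Lps); have iX := L2M mO LN (posp_L2 (Luh n)).
(* Inserting the vanishing complementarity term makes the comparison of the integrals a pointwise
   one. *)
have -> : X n = X n - ip Omega rs (fun x => us x - psi) by rewrite complementarity subr0.
rewrite e1 addrC -(I_B mO iB iA) -(I_B mO iX iC).
apply: (I_le mO (Int_B mO iB iA) (Int_B mO iX iC)).
apply: aeS2 obstacle_limit multiplier_limit_le0 => x h1 h2 Ox.
have k1 := h1 Ox; have k2 := h2 Ox.
have k3 := @r_mul_sub_ge0 R M c1 c2 psi maxs sm (gamma n) (g0 n) (uh n x) (us x) _.
have k4 : psi - uh n x <= posp (uh n) x by rewrite /posp le_max lexx orbT.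
have k5 := ler_wpM2l k2 k4.
have {}k3 : 0 <= r (gamma n) (uh n x) * (uh n x - us x) by apply: k3; lra.
move: k3 k5; move: (r (gamma n) (uh n x)) (posp (uh n) x) => a b; lra.
Qed.
End Obstacle.

Section Strong.
Variables (q : nat -> R * R -> 'M[R]_2) (qh : R * R -> 'M[R]_2) (qs : 'I_2 -> 'I_2 -> R * R -> R).
Hypothesis Qq : forall n, Qad (q n).
Hypothesis Qh : Qad qh.
Hypothesis Lqs : forall i j, L2O (qs i j).
Hypothesis wqs : forall i j, wcv (fun n x => q n x i j) (qs i j).

Definition sqnorm (q : R * R -> 'M[R]_2) := I (fun x => q x 0 0 ^+ 2) +
  2 * I (fun x => q x 0 1 ^+ 2) + I (fun x => q x 1 1 ^+ 2).

(** Expanding the square, [|q_n - qh|^2] is at most [2 |qh|^2 + e_n - 2 (q_n, qh)]. Its limit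
    [2 |qh|^2 - 2 (qs, qh)] is nonpositive, so the whole tends to zero and the weak limit is
    identified with [qh] at the same time. *)
Lemma coefficient_strong (e : nat -> R) : e @ \oo --> 0 ->
  (forall n, sqnorm (q n) <= sqnorm qh + e n) ->
  0 <= ip Omega (fun x => qs 0 0 x - qh x 0 0) (fun x => qh x 0 0)
    + 2 * ip Omega (fun x => qs 0 1 x - qh x 0 1) (fun x => qh x 0 1)
    + ip Omega (fun x => qs 1 1 x - qh x 1 1) (fun x => qh x 1 1) ->
  (fun n => dist2 (fun x => q n x 0 0) (fun x => qh x 0 0) +
    2 * dist2 (fun x => q n x 0 1) (fun x => qh x 0 1) +
    dist2 (fun x => q n x 1 1) (fun x => qh x 1 1)) @ \oo --> 0.
Proof.
move=> e0 le pos.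
have Lq n i j : L2O (fun x => q n x i j) := Qad_L2 oO Qq n i j.
have Lh i j : L2O (fun x => qh x i j) := Qad_L2 oO (fun=> Qh) 0%N i j.
have S i j : ip Omega (fun x => qs i j x - qh x i j) (fun x => qh x i j) =
    ip Omega (qs i j) (fun x => qh x i j) - ip Omega (fun x => qh x i j) (fun x => qh x i j).
  exact: (pHbBl pH2 (Lqs i j) (Lh i j) (Lh i j)).
rewrite !S in pos.
pose b n i j := ip Omega (fun x => q n x i j) (fun x => qh x i j).
pose h i j := ip Omega (fun x => qh x i j) (fun x => qh x i j).
pose t i j := ip Omega (qs i j) (fun x => qh x i j).
have cb i j : (fun n => b n i j) @ \oo --> t i j := @wqs i j _ (Lh i j).
have hE : sqnorm qh = h 0 0 + 2 * h 0 1 + h 1 1 by [].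
have E n i j : dist2 (fun x => q n x i j) (fun x => qh x i j) =
    I (fun x => q n x i j ^+ 2) - 2 * b n i j + h i j := dist2_expand oO bO (Lq n i j) (Lh i j).
apply: (@squeeze_le0 _ _ (fun n => 2 * sqnorm qh + e n - 2 * (b n 0 0 + 2 * b n 0 1 + b n 1 1))
   (2 * sqnorm qh + 0 - 2 * (t 0 0 + 2 * t 0 1 + t 1 1))).
- move=> n; apply/andP; split.
    by rewrite !addr_ge0// ?mulr_ge0// dist2_ge0.
  rewrite !E; have := le n; rewrite {1}/sqnorm hE.
  move: (I (fun x => q n x 0 0 ^+ 2)) (I (fun x => q n x 0 1 ^+ 2)) (I (fun x => q n x 1 1 ^+ 2)).
  move: (b n 0 0) (b n 0 1) (b n 1 1) (h 0 0) (h 0 1) (h 1 1) (e n) => *; lra.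
- apply: cvgB; first by apply: cvgD; [exact: cvg_cst|exact: e0].
  apply: cvgM; first exact: cvg_cst.
  by apply: cvgD; [apply: cvgD; [exact: cb|apply: cvgM; [exact: cvg_cst|exact: cb]]|exact: cb].
by move: pos; rewrite hE -/(t _ _) -/(h _ _) /t /h; lra.
Qed.

Variables (u : nat -> R * R -> R) (us : R * R -> R) (s : 'I_2 -> R * R -> R)
  (k : nat -> R * R -> R) (C : R).
Hypothesis Hu : forall n, H10 (u n).
Hypothesis Hus : H10 us.
Hypothesis Ls : forall i, L2O (s i).
Hypothesis Lk : forall n, L2O (k n).
Hypothesis kC : forall n, I (fun x => k n x ^+ 2) <= C.
Hypothesis weak_u : forall n v, H10 v -> En (q n) (u n) v = ip Omega (k n) v.
Hypothesis us_cvg : (fun n => dist2 (u n) us) @ \oo --> 0.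
Hypothesis wflux : forall i, wcv (fun n => flux Omega (q n) (u n) i) (s i).
Hypothesis flux_h : forall i, ae_eqO (flux Omega qh us i) (s i).
Hypothesis q_ae : forall i j, {ae mu2, forall x, Omega x -> (fun n => q n x i j) @ \oo --> qh x i j}.

(** The energy of [u_n - us] in the coefficient [q_n] splits into the right side paired with
    [u_n - us], which tends to zero, minus the energy of the pair [u_n], [us], plus that of [us].
    The last two have the same limit: the flux converges weakly to [s], and by dominated convergence
    [q_n] applied to the gradient of [us] is replaced by [qh], which gives [s] again. *)
Lemma gradient_strong : (fun n => D2 (fun x => u n x - us x)) @ \oo --> 0.
Proof.
have Lps i : L2O (pd i us) := H10_pd oO bO i Hus.
have Lfl n i : L2O (flux Omega (q n) us i) := flux_L2 oO bO qmin0 i (Qq n) Hus.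
have Lfh i : L2O (flux Omega qh us i) := flux_L2 oO bO qmin0 i Qh Hus.
have iD := Int_Z mO qmax (Int_D mO (Lps 0).2 (Lps 1).2).
have cE : (fun n => En (q n) us us) @ \oo --> ip2 s (fun i => pd i us).
  have -> : ip2 s (fun i => pd i us) = En qh us us.
    have e i : ip Omega (s i) (pd i us) = ip Omega (flux Omega qh us i) (pd i us).
      apply: (ip_eq_ae oO); [exact: (Ls i).1|exact: (Lfh i).1|exact: (Lps i).1|].
      by apply: aeS (flux_h i) => x h Ox; rewrite h.
    exact: (f_equal2 +%R (e 0) (e 1)).
  have mF q' : (forall i, L2O (flux Omega q' us i)) ->
      measurable_fun Omega (fun x => flux Omega q' us 0 x * pd 0 us x + flux Omega q' us 1 x * pd 1 us x).
    by move=> L; apply: measurable_funD; apply: measurable_funM; by [exact: (L _).1|exact: (Lps _).1].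
  have [|||||_ _ c] := @dct_real _ _ _ mu2 Omega mO
     (fun n x => flux Omega (q n) us 0 x * pd 0 us x + flux Omega (q n) us 1 x * pd 1 us x)
     (fun x => flux Omega qh us 0 x * pd 0 us x + flux Omega qh us 1 x * pd 1 us x)
     (fun x => qmax * (pd 0 us x ^+ 2 + pd 1 us x ^+ 2)).
  - by move=> n; exact: mF.
  - exact: mF.
  - apply: aeS2 (aeS2 (fun x a b => conj a b) (q_ae 0 0) (q_ae 0 1))
      (aeS2 (fun x a b => conj a b) (q_ae 1 0) (q_ae 1 1)) => x [h1 h2] [h3 h4] Ox.
    have k1 i j (z : R) : (fun n => q n x i j) @ \oo --> qh x i j ->
      (fun n => q n x i j * z) @ \oo --> qh x i j * z.
      by move=> l; apply: cvgM; [exact: l|exact: cvg_cst].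
    apply: cvgD; apply: cvgM; try exact: cvg_cst; apply: cvgD; apply: k1; by [exact: h1|exact: h2|exact: h3|exact: h4].
  - exact: iD.
  - move=> n; have [_ hq] := (QadP oO bO qmax qmin0 (q n)).1 (Qq n).
    apply: aeS hq => x e Ox; have [e1 e2] := e Ox; have /andP[l1 l2] := e2 (pd 0 us x) (pd 1 us x).
    rewrite /flux (sym_formE _ _ _ _ e1) ger0_norm//; apply: le_trans l1.
    by rewrite mulr_ge0 ?(ltW qmin0)// addr_ge0// sqr_ge0.
  rewrite /energy (ip2E oO Lfh Lps); apply: (cvg_seq_ext _ c) => n.
  exact: (esym (ip2E oO (Lfl n) Lps)).
have Lw n := H10_L2 oO bO (H10B oO bO (Hu n) Hus).
have ck : (fun n => ip Omega (k n) (fun x => u n x - us x)) @ \oo --> 0.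
  exact: (ip_bounded_cvg0 oO bO Lk Lw kC us_cvg).
have cf : (fun n => En (q n) (u n) us) @ \oo --> ip2 s (fun i => pd i us).
  by apply: cvgD; [exact: (@wflux 0 _ (Lps 0))|exact: (@wflux 1 _ (Lps 1))].
apply: (@cvg0_le _ _ (fun n => qmin^-1 * (ip Omega (k n) (fun x => u n x - us x) -
   En (q n) (u n) us + En (q n) us us))).
  move=> n; apply/andP; split; [exact: D2_ge0|rewrite (ler_pdivlMl _ _ qmin0)].
  have Hw := H10B oO bO (Hu n) Hus.
  apply: (le_trans (En_ge oO bO qmin0 (Qq n) Hw)); rewrite -(weak_u n Hw).
  have l1 := En_lin_l oO bO qmin0 (-1) (Qq n) Hus (Hu n) Hw.
  have l2 := En_lin_l oO bO qmin0 (-1) (Qq n) Hus (Hu n) Hus.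
  have e2 : (fun x => -1 * us x + u n x) = (fun x => u n x - us x).
    by apply/funext => x; rewrite mulN1r addrC.
  rewrite e2 mulN1r in l1; rewrite e2 mulN1r in l2.
  rewrite (En_sym oO bO qmin0 (Qq n) Hus Hw) l2 in l1.
  by apply: le_of_eq; rewrite l1; move: (En _ _ _) (En _ _ us) (En _ _ us) => *; ring.
rewrite -[X in _ --> X](_ : qmin^-1 * (0 - ip2 s (fun i => pd i us) + ip2 s (fun i => pd i us)) = 0).
  apply: cvgM; first exact: cvg_cst.
  by apply: cvgD; [apply: cvgB; [exact: ck|exact: cf]|exact: cE].
by rewrite sub0r addNr mulr0.
Qed.
End Strong.
End Recovery.

Lemma powR_mono (R : realType) (r x y : R) : 0 <= r -> 0 <= x -> x <= y -> x `^ r <= y `^ r.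
Proof.
by move=> r0 x0 xy; apply: ge0_ler_powR; rewrite ?nnegrE//; exact: le_trans xy.
Qed.

(** For [t <= T] the first term dominates, for [t > T] the second, the exponent [s - p] being
    nonpositive. This splitting takes the place of Hoelder's inequality in the interpolation. *)
Lemma powR_split_le (R : realType) (t T s p : R) : 0 <= t -> 0 < T -> 2 <= s -> s <= p ->
  t `^ s <= T `^ (s - 2) * t ^+ 2 + T `^ (s - p) * t `^ p.
Proof.
move=> t0 T0 s2 sp; have s0 : 0 < s by lra.
have [->|tn] := eqVneq t 0; first by rewrite powR0 ?gt_eqF// addr_ge0// mulr_ge0 ?powR_ge0.
have tp : 0 < t by rewrite lt_def tn.
have [tT|Tt] := leP t T.
  have -> : t `^ s = t `^ (s - 2) * t ^+ 2.
    by rewrite -powR_mulrn// -powRD ?tn ?implybT// subrK.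
  apply: ler_wpDr; first by rewrite mulr_ge0 ?powR_ge0.
  by rewrite ler_wpM2r ?sqr_ge0// powR_mono ?subr_ge0.
have -> : t `^ s = t `^ (s - p) * t `^ p by rewrite -powRD ?tn ?implybT// subrK.
apply: ler_wpDl; first by rewrite mulr_ge0 ?powR_ge0 ?sqr_ge0.
rewrite ler_wpM2r ?powR_ge0//.
have -> : s - p = - (p - s) by ring.
by rewrite !powRN lef_pV2 ?posrE ?powR_gt0// powR_mono ?subr_ge0// ltW.
Qed.

Lemma powR_add_le (R : realType) (a b p : R) : 0 <= a -> 0 <= b -> 0 < p ->
  (a + b) `^ p <= 2 `^ p * (a `^ p + b `^ p).
Proof.
move=> a0 b0 p0.
have key (x y : R) : 0 <= x -> 0 <= y -> x <= y -> (x + y) `^ p <= 2 `^ p * (x `^ p + y `^ p).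
  move=> x0 y0 xy; apply: (@le_trans _ _ ((2 * y) `^ p)).
    by apply: powR_mono; [exact: ltW|exact: addr_ge0|lra].
  by rewrite powRM// ler_wpM2l ?powR_ge0// lerDr powR_ge0.
have [ab|ba] := leP a b; first exact: key.
by rewrite (addrC a) (addrC (a `^ p)); apply: key => //; exact: ltW.
Qed.

(** * Interpolation between exponents, and the cost in terms of squared norms *)

Section Interpolation.
Variable R : realType.
Local Notation P := (measurableTypeR R * measurableTypeR R)%type.
Local Notation mu2 := (leb2 R).
Variable (Omega : set (R * R)).
Hypothesis oO : open Omega.
Hypothesis bO : bounded_set Omega.
Local Notation I f := (\int[mu2]_(x in Omega) f x)%R.
Local Notation Int f := (mu2.-integrable Omega (EFin \o f)).
Local Notation L2O := (L2 mu2 Omega).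
Local Notation mO := (mOmega oO).
Local Notation finO := (finOmega oO bO).
Implicit Types (s p : R).

Lemma Int_powR_interp (F : R * R -> R) s p : L2O F -> 2 <= s -> s <= p ->
  Int (fun x => `|F x| `^ p) -> Int (fun x => `|F x| `^ s).
Proof.
move=> LF s2 sp ip; apply: (Int_le_pt mO _ (Int_D mO LF.2 ip)).
  by apply: measurable_powR_abs; exact: LF.1.
move=> x _; rewrite ger0_norm ?powR_ge0//.
have := powR_split_le (normr_ge0 (F x)) ltr01 s2 sp.
by rewrite !powR1 !mul1r real_normK ?num_real.
Qed.

(** The level [T] is fixed first and makes the part with exponent [p] small uniformly in [n],
    because [s - p] is negative; then [n] is taken large for the quadratic part. *)
Lemma interp_cvg0 (F : nat -> R * R -> R) s p K : (forall n, L2O (F n)) -> 2 <= s -> s < p ->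
  (fun n => I (fun x => F n x ^+ 2)) @ \oo --> 0 ->
  (forall n, Int (fun x => `|F n x| `^ p)) -> (forall n, I (fun x => `|F n x| `^ p) <= K) ->
  (fun n => I (fun x => `|F n x| `^ s)) @ \oo --> 0.
Proof.
move=> LF s2 sp F0 ip bK; apply/cvg_epsP => e e0.
have ps0 : 0 < p - s by rewrite subr_gt0.
have K0 : 0 <= K by apply: le_trans (bK 0%N); apply: I_ge0 => x _; exact: powR_ge0.
have := powR_seq_cvg0 ps0 (fun n => _) (@cvg_inv_succ R).
move=> /(_ (fun n => (_ : 0 <= n.+1%:R^-1))) h.
have {}h : (fun n : nat => (n.+1%:R^-1 : R) `^ (p - s)) @ \oo --> 0.
  by apply: h => n; rewrite invr_ge0.
have e1 : 0 < e / (2 * (K + 1)) by rewrite divr_gt0// mulr_gt0//; lra.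
have [m NP] := (cvg_epsP _ _).1 h _ e1; pose T : R := m.+1%:R.
have T0 : 0 < T by rewrite /T ltr0n.
have hT : T `^ (s - p) <= e / (2 * (K + 1)).
  have -> : T `^ (s - p) = T^-1 `^ (p - s) by rewrite -(powR_inv1 (ltW T0)) -powRrM mulN1r opprB.
  by have := NP m (leqnn m); rewrite subr0 ger0_norm ?powR_ge0.
have Tp : 0 <= T `^ (s - 2) := powR_ge0 _ _.
have e2 : 0 < e / (2 * (T `^ (s - 2) + 1)) by rewrite divr_gt0// mulr_gt0//; lra.
have [N NN] := (cvg_epsP _ _).1 F0 _ e2; exists N => n Nn.
have := NN n Nn; rewrite !subr0 !ger0_norm; last 2 first.
- by apply: I_ge0 => x _; exact: powR_ge0.
- by apply: I_ge0 => x _; exact: sqr_ge0.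
move=> h2; have i1 := Int_Z mO (T `^ (s - 2)) (LF n).2; have i2 := Int_Z mO (T `^ (s - p)) (ip n).
apply: (@le_trans _ _ (T `^ (s - 2) * I (fun x => F n x ^+ 2) + T `^ (s - p) * I (fun x => `|F n x| `^ p))).
  rewrite -(I_Z mO _ (LF n).2) -(I_Z mO _ (ip n)) -(I_D mO i1 i2).
  apply: (I_le mO (Int_powR_interp (LF n) s2 (ltW sp) (ip n)) (Int_D mO i1 i2)); apply: aeW => x _.
  have := powR_split_le (normr_ge0 (F n x)) T0 s2 (ltW sp).
  by rewrite real_normK ?num_real.
have q1 : T `^ (s - p) * I (fun x => `|F n x| `^ p) <= e / (2 * (K + 1)) * K.
  by apply: ler_pM => //; [exact: powR_ge0|apply: I_ge0 => x _; exact: powR_ge0].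
have q2 : T `^ (s - 2) * I (fun x => F n x ^+ 2) <= T `^ (s - 2) * (e / (2 * (T `^ (s - 2) + 1))).
  by rewrite ler_wpM2l.
have fr (a : R) : 0 <= a -> a * (e / (2 * (a + 1))) <= e / 2.
  move=> a0; rewrite mulrA ler_pdivrMr; last by lra.
  by rewrite (_ : e / 2 * (2 * (a + 1)) = a * e + e) ?lerDl ?ltW//; field.
have := fr _ Tp; have := fr _ K0; rewrite [K * _]mulrC; lra.
Qed.

Lemma Linfty_L2 f : Lp Omega +oo%E f -> L2O f.
Proof.
rewrite /Lp inE => /andP[]; rewrite !inE /= => m fin.
have mf : measurable_fun Omega f by apply/(measurable_restrictT _ mO).
have [K hK] : exists K, {ae mu2, forall x, `|(f \_ Omega) x| <= K}.
  move: fin; rewrite /finite_norm unlock /Lnorm; case: ifPn => [_ /ess_supr_bounded//|m0 _].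
  (* The essential supremum norm is defined by cases on the measure of the whole space; in the null
     case any bound holds a.e. *)
  exists 0; exists setT; split => //; apply/eqP; rewrite eq_le measure_ge0 andbT.
  by rewrite leNgt.
apply: (L2_le mO mf (L2_cst mO finO K)); apply: aeS hK => x; rewrite patchE => h Ox.
by move: h; rewrite mem_set// => h; exact: le_trans h (ler_norm _).
Qed.

Lemma fnorm_L2 (q : R * R -> 'M[R]_2) : (forall i j, L2O (fun x => q x i j)) ->
  L2O (fun x => fnorm (q x)) /\ I (fun x => fnorm (q x) ^+ 2) =
  I (fun x => q x 0 0 ^+ 2) + I (fun x => q x 0 1 ^+ 2) + (I (fun x => q x 1 0 ^+ 2) + I (fun x => q x 1 1 ^+ 2)).
Proof.
move=> Lq; have fE x : fnorm (q x) ^+ 2 = q x 0 0 ^+ 2 + q x 0 1 ^+ 2 + (q x 1 0 ^+ 2 + q x 1 1 ^+ 2).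
  by rewrite fnorm_mx2 sqr_sqrtr// !addr_ge0 ?sqr_ge0.
have La := L2_sqrt_sum oO (Lq 0 0) (Lq 0 1); have Lb := L2_sqrt_sum oO (Lq 1 0) (Lq 1 1).
split.
  have := L2_sqrt_sum oO La Lb; congr (L2 _ _ _); apply/funext => x.
  by rewrite fnorm_mx2 !sqr_sqrtr// addr_ge0 ?sqr_ge0.
have i0 := Int_D mO (Lq 0 0).2 (Lq 0 1).2; have i1 := Int_D mO (Lq 1 0).2 (Lq 1 1).2.
rewrite -(I_D mO (Lq 0 0).2 (Lq 0 1).2) -(I_D mO (Lq 1 0).2 (Lq 1 1).2) -(I_D mO i0 i1).
by apply: eq_Rintegral => x _; exact: fE.
Qed.

Variables qmin qmax : R.
Hypothesis qmin0 : 0 < qmin.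
Local Notation Qad := (Qad Omega qmin qmax).

Lemma Qad_entry_L2 q i j : Qad q -> L2O (fun x => q x i j).
Proof. by move=> Qq; exact: (Qad_L2 oO (fun=> Qq) 0%N i j). Qed.

Lemma Qad_sqnorm q : Qad q -> fine (Lpnorm_mx Omega 2%:E q) ^+ 2 = sqnorm Omega q.
Proof.
move=> Qq; have Lq i j := Qad_entry_L2 i j Qq; have [Lf E] := fnorm_L2 Lq.
rewrite /Lpnorm_mx (Lpnorm2E mO Lf) /= sqr_sqrtr; last first.
  by apply: I_ge0 => x _; exact: sqr_ge0.
rewrite E /sqnorm; have -> : I (fun x => q x 1 0 ^+ 2) = I (fun x => q x 0 1 ^+ 2).
  apply: (I_eq_ae mO); [exact: measurable_funX (Lq 1 0).1|exact: measurable_funX (Lq 0 1).1|].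
  by have [_ hq] := (QadP oO bO qmax qmin0 q).1 Qq; apply: aeS hq => x h Ox; have [-> _] := h Ox.
by rewrite addrA mulr_natl mulr2n !addrA.
Qed.

Lemma JE ud alpha q u : L2O ud -> Qad q -> L2O u ->
  Defs.J Omega ud alpha q u = 2^-1 * sqdist Omega u ud + alpha / 2 * sqnorm Omega q.
Proof.
move=> Lud Qq Lu; rewrite /Defs.J (Qad_sqnorm Qq) (Lpnorm2E mO (L2B mO Lu Lud)) /= sqr_sqrtr//.
by apply: I_ge0 => x _; exact: sqr_ge0.
Qed.
End Interpolation.

(** * Extraction of the subsequence of minimizers and adjoints *)

Section MinimizerSubsequence.
Variable R : realType.
Local Notation P := (measurableTypeR R * measurableTypeR R)%type.
Local Notation mu2 := (leb2 R).
Variable (Omega : set (R * R)).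
Hypothesis oO : open Omega.
Hypothesis bO : bounded_set Omega.
Local Notation I f := (\int[mu2]_(x in Omega) f x)%R.
Local Notation Int f := (mu2.-integrable Omega (EFin \o f)).
Local Notation L2O := (L2 mu2 Omega).
Local Notation test := (test_function Omega).
Local Notation "'d_ i f" := (fun x => 'D_(e_ R i) f x) (at level 10, i, f at level 9).
Local Notation ae_eqO f g := {ae mu2, forall x, Omega x -> f x = g x}.
Local Notation mO := (mOmega oO).
Local Notation finO := (finOmega oO bO).
Local Notation pH2 := (preHilbert_L2 mO finO).
Local Notation graph := (H1graph Omega).
Local Notation dist2 := (sqdist Omega).
Local Notation pd i u := (weak_partial Omega i u).
Implicit Types (f u v w phi : R * R -> R) (g h : 'I_2 -> R * R -> R).
Local Notation H10 := (H10 Omega).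
Implicit Types (q : R * R -> 'M[R]_2).
Local Notation D2 := (grad_sq Omega).
Local Notation ip2 := (pairing2 Omega).
Local Notation wcv := (wcv Omega).
Lemma Qad_1 : Qad Omega 1 1 (fun=> 1%:M : 'M[R]_2).
Proof.
apply/(QadP oO bO 1 ltr01); split; first by move=> i j; exact: measurable_cst.
have e01 : ((0 : 'I_2) == 1) = false by [].
have e10 : ((1 : 'I_2) == 0) = false by [].
apply: aeW => x _; rewrite /ell !mxE !eqxx e01 e10; split => // a b.
by rewrite !mul1r mulr0 mul0r addr0 lexx.
Qed.

(** The summand with factor [0] keeps the form literally an instance of [preHilbert_En], with the
    identity matrix as coefficient. *)
Definition dirichlet u v : R := energy Omega (fun=> 1%:M) u v + 0 * ip Omega u v.

Lemma preHilbert_H10 : preHilbert H10 dirichlet.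
Proof. exact: (preHilbert_En oO bO ltr01 Qad_1 (lexx 0)). Qed.

Lemma dirichletE u : H10 u -> dirichlet u u = D2 u.
Proof.
move=> Hu; rewrite /dirichlet mul0r addr0; apply/eqP; rewrite eq_le; apply/andP; split.
  by have := En_le oO bO ltr01 Qad_1 Hu; rewrite mul1r.
by have := En_ge oO bO ltr01 Qad_1 Hu; rewrite mul1r.
Qed.

Lemma H10_extract (v : nat -> R * R -> R) K : (forall n, H10 (v n)) -> (forall n, D2 (v n) <= K) ->
  exists s : nat -> nat, {homo s : i j / (i < j)%N} /\ exists2 w, H10 w &
    forall F, bounded_linear H10 dirichlet F -> (fun n => F (v (s n))) @ \oo --> F w.
Proof.
move=> Hv vK; apply: (weak_compactness preHilbert_H10 (C := K) Hv) => n.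
by rewrite dirichletE.
Qed.

Lemma pd_sq_le i u : I (fun x => pd i u x ^+ 2) <= D2 u.
Proof.
have kl (a b : R) : 0 <= b -> a <= a + b by rewrite lerDl.
have kr (a b : R) : 0 <= a -> b <= a + b by rewrite lerDr.
by have [->|->] := ord2 i; [exact: (kl _ _ (I_sq_ge0 _ _))|exact: (kr _ _ (I_sq_ge0 _ _))].
Qed.

Lemma bounded_linear_H10 (F : (R * R -> R) -> R) K : 0 <= K ->
  (forall (a : R) u v, H10 u -> H10 v -> F (fun x => a * u x + v x) = a * F u + F v) ->
  (forall u, H10 u -> F u ^+ 2 <= K * D2 u) -> bounded_linear H10 dirichlet F.
Proof.
move=> K0 lin bd; have H0 := H10_0 oO bO.
have F0 : F (fun=> 0) = 0.
  have h : F (fun=> 0) = -1 * F (fun=> 0) + F (fun=> 0).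
    apply: (etrans _ (lin (-1) _ _ H0 H0)); congr F.
    by apply/funext => x; rewrite mulr0 addr0.
  by rewrite h mulN1r addNr.
split.
- move=> x y Hx Hy; have := lin 1 x y Hx Hy; rewrite mul1r => <-.
  by congr F; apply/funext => z; rewrite mul1r.
- move=> a x Hx; have := lin a x _ Hx H0; rewrite F0 addr0 => <-.
  by congr F; apply/funext => z; rewrite addr0.
by exists K => // x Hx; rewrite dirichletE//; exact: bd.
Qed.

Lemma pd_bounded_linear i k : L2O k -> bounded_linear H10 dirichlet (fun v => ip Omega (pd i v) k).
Proof.
move=> Lk; apply: (bounded_linear_H10 (K := I (fun x => k x ^+ 2)) (I_sq_ge0 _ _)).
  move=> a u v Hu Hv; have Lu := H10_pd oO bO i Hu; have Lv := H10_pd oO bO i Hv.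
  have Luv := H10_pd oO bO i (H10_lin oO bO a Hu Hv).
  rewrite (ip_eq_ae oO Luv.1 (L2D mO (L2Z mO a Lu) Lv).1 Lk.1 (pd_lin oO bO a i Hu Hv)).
  by rewrite (ipD_l oO bO (L2Z mO a Lu) Lv Lk) (ipZ_l oO bO a Lu Lk).
move=> u Hu; apply: (le_trans (ip_CS oO bO (H10_pd oO bO i Hu) Lk)).
by rewrite mulrC ler_wpM2l ?I_sq_ge0// pd_sq_le.
Qed.

(** On [H10] the Poincare inequality bounds the full norm by the Dirichlet form. Weak convergence
    extracted in [H10] is therefore weak convergence against every functional on [W^{1,2}]. *)
Lemma W1p_dual_bounded_linear F : W1p_dual Omega 2%:E F -> bounded_linear H10 dirichlet F.
Proof.
move=> [lin [K hK]]; have cp := c_gt0 Omega.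
have HW u : H10 u -> W1p Omega 2%:E u by case.
apply: (bounded_linear_H10 (K := K ^+ 2 * (2 * (1 + I (fun=> 1)) + 2))).
- by rewrite mulr_ge0 ?sqr_ge0//; lra.
- by move=> a u v /HW Hu /HW Hv; exact: lin.
move=> u Hu; have := hK u (HW u Hu).
rewrite (W1pnorm2E oO (H10_L2 oO bO Hu) (fun i => H10_pd oO bO i Hu)); last first.
  by move=> i; exact: (graph_weak_partial oO bO i (H10_graph oO bO Hu)).
rewrite -EFinM lee_fin -/(grad_sq Omega u).
have := poincare1 oO bO Hu; have := D2_ge0 Omega u; have := I_sq_ge0 Omega u.
move: (D2 u) (I (fun x => u x ^+ 2)) => D U U0 D0 hU.
set S := _ + _ => h; have S0 : 0 <= S by rewrite addr_ge0.
have S2 : S ^+ 2 <= 2 * U + 2 * D.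
  have := sqr_ge0 (Num.sqrt U - Num.sqrt D); rewrite sqrrB => e.
  rewrite /S sqrrD; move: e; rewrite !sqr_sqrtr//.
  by move: (Num.sqrt U * Num.sqrt D) => m; lra.
have h2 : F u ^+ 2 <= (K * S) ^+ 2.
  rewrite -[leLHS]real_normK ?num_real//; apply: lerXn2r; rewrite ?nnegrE//.
  exact: le_trans h.
apply: (le_trans h2); rewrite exprMn -[leRHS]mulrA ler_wpM2l ?sqr_ge0//; apply: (le_trans S2).
by move: hU; move: (1 + I (fun=> 1)) => c; lra.
Qed.

Lemma I_sqB a b : L2O a -> L2O b ->
  I (fun x => (a x - b x) ^+ 2) <= 2 * I (fun x => a x ^+ 2) + 2 * I (fun x => b x ^+ 2).
Proof.
move=> La Lb; have j1 := Int_Z mO 2 La.2; have j2 := Int_Z mO 2 Lb.2.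
rewrite -(I_Z mO 2 La.2) -(I_Z mO 2 Lb.2) -(I_D mO j1 j2).
apply: (I_le mO (L2B mO La Lb).2 (Int_D mO j1 j2)); apply: aeW => x _.
by move: (a x) (b x) => y z; have := sqr_ge0 (y + z); lra.
Qed.

Lemma dist2_cvg (a : nat -> R * R -> R) b d : (forall n, L2O (a n)) -> L2O b -> L2O d ->
  (fun n => dist2 (a n) b) @ \oo --> 0 -> (fun n => dist2 (a n) d) @ \oo --> dist2 b d.
Proof.
move=> La Lb Ld h.
apply: (sq_cvg oO bO (fun n => L2B mO (La n) Ld) (L2B mO Lb Ld)).
by apply: (cvg_seq_ext _ h) => n; apply: eq_Rintegral => x _; rewrite opprB addrA subrK.
Qed.

Variables (psi alpha qmin qmax M c1 c2 : R) (f ud : R * R -> R) (maxs : R -> R -> R)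
  (gamma : nat -> R) (q : nat -> R * R -> 'M[R]_2) (u p : nat -> R * R -> R).
Local Notation Qad := (Qad Omega qmin qmax).
Local Notation r gamma := (r_ maxs psi gamma).
Hypothesis psi0 : psi < 0.
Hypothesis alpha0 : 0 < alpha.
Hypothesis qmin0 : 0 < qmin.
Hypothesis sm : smoothed_max M c1 c2 maxs.
Hypothesis Lf : L2O f.
Hypothesis Lud : L2O ud.
Hypothesis g0 : forall k, 0 < gamma k.
Hypothesis ginf : gamma k @[k --> \oo] --> +oo.
Hypothesis sol : forall k, solves_P Omega maxs psi f ud alpha qmin qmax (gamma k) (q k) (u k).
Hypothesis adj : forall k, is_adjoint Omega maxs psi ud (gamma k) (q k) (u k) (p k).

Let Qq k : Qad (q k). Proof. by have [] := sol k. Qed.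
Let st k : is_state Omega maxs psi f (gamma k) (q k) (u k). Proof. by have [] := sol k. Qed.
Let Hu k : H10 (u k). Proof. by have [] := st k. Qed.
Let Hp k : H10 (p k). Proof. by have [] := adj k. Qed.
Let Lu k := H10_L2 oO bO (Hu k).
Let Lp k := H10_L2 oO bO (Hp k).
Let KD := (1 + I (fun=> 1)) / qmin ^+ 2 * I (fun x => f x ^+ 2).
Let KR := 3 * I (fun x => f x ^+ 2) + 27 * I (fun=> 1).
Let uK k : D2 (u k) <= KD := state_D2 oO bO qmin0 psi0 sm Lf (g0 k) (Qq k) (st k).
Let rK k : I (fun x => r (gamma k) (u k x) ^+ 2) <= KR :=
  state_r_L2 oO bO qmin0 psi0 sm Lf (g0 k) (Qq k) (st k).
Let Lr k := r_L2 oO psi0 sm (g0 k) (Lu k).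

(** When the adjoint equation is tested with [p] itself, the term with the derivative of the penalty
    times [p^2] is nonnegative and drops out; what remains does not see the size of [gamma]. *)
Lemma adjoint_D2 k : D2 (p k) <= (1 + I (fun=> 1)) / qmin ^+ 2 *
  (2 * ((1 + I (fun=> 1)) * KD) + 2 * I (fun x => ud x ^+ 2)).
Proof.
have cp := c_gt0 Omega; have Ld := L2B mO (Lu k) Lud.
have Ldr : L2O (fun x => dr_ maxs psi (gamma k) (u k x) * p k x).
  apply: (L2_bM mO (K := 2 * gamma k) _ _ (Lp k)).
    apply: measurableT_comp; last exact: (Lu k).1.
    by apply: continuous_measurable_fun; exact: (dr_continuous (psi := psi) sm (g0 k)).
  by apply: aeW => x _; have /andP[a b] := dr_bounds psi sm (g0 k) (u k x); rewrite ger0_norm.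
have h : qmin * D2 (p k) <= ip Omega (fun x => u k x - ud x) (p k).
  apply: (le_trans (En_ge oO bO qmin0 (Qq k) (Hp k))).
  have [_ /(_ _ (Hp k))] := adj k; rewrite (ip_mx_En oO bO qmin0 (Qq k) (Hp k) (Hp k)) => ->.
  apply: (I_le mO (L2M mO (L2B mO Ld Ldr) (Lp k)) (L2M mO Ld (Lp k))); apply: aeW => x _.
  rewrite mulrBl lerBlDr lerDl -mulrA mulr_ge0//; last by rewrite -expr2 sqr_ge0.
  by have /andP[] := dr_bounds psi sm (g0 k) (u k x).
apply: (le_trans (energy_bound oO bO qmin0 (Hp k) Ld h)).
rewrite ler_wpM2l//; first by rewrite divr_ge0 ?sqr_ge0// ltW.
apply: (le_trans (I_sqB (Lu k) Lud)); rewrite lerD2r ler_wpM2l//.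
by apply: (le_trans (poincare1 oO bO (Hu k))); rewrite ler_wpM2l ?(ltW cp).
Qed.

Theorem minimizer_subsequence : exists sigma : nat -> nat, {homo sigma : i j / (i < j)%N} /\
  exists (qh : R * R -> 'M[R]_2) (us ps : R * R -> R), [/\ Qad qh, H10 us, H10 ps &
  [/\ (forall i j, (fun n => dist2 (fun x => q (sigma n) x i j) (fun x => qh x i j)) @ \oo --> 0),
      (fun n => D2 (fun x => u (sigma n) x - us x)) @ \oo --> 0
    & forall F, bounded_linear H10 dirichlet F -> (fun n => F (p (sigma n))) @ \oo --> F ps]].
Proof.
have f0 : 0 <= I (fun x => f x ^+ 2) := I_sq_ge0 _ _.
have o0 : 0 <= I (fun=> 1) by apply: I_ge0.
have KD0 : 0 <= KD := le_trans (D2_ge0 _ _) (uK 0%N).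
have KR0 : 0 <= KR by rewrite /KR; lra.
(* One extraction serves seven sequences: both flux components, the penalty, and the four entries of
   the coefficient. *)
pose a j k : R * R -> R := match j with
  | 0%N => flux Omega (q k) (u k) 0 | 1%N => flux Omega (q k) (u k) 1
  | 2%N => fun x => r (gamma k) (u k x) | 3%N => fun x => q k x 0 0 | 4%N => fun x => q k x 0 1
  | 5%N => fun x => q k x 1 0 | _ => fun x => q k x 1 1 end.
have La j k : L2O (a j k).
  by move: j => [|[|[|[|[|[|j]]]]]]; [exact: (flux_L2 oO bO qmin0 _ (Qq k) (Hu k))
    |exact: (flux_L2 oO bO qmin0 _ (Qq k) (Hu k))|exact: Lr|exact: (Qad_entry_L2 oO _ _ (Qq k))
    |exact: (Qad_entry_L2 oO _ _ (Qq k))|exact: (Qad_entry_L2 oO _ _ (Qq k))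
    |exact: (Qad_entry_L2 oO _ _ (Qq k))].
have qK i j k : I (fun x => q k x i j ^+ 2) <= I (fun=> qmax ^+ 2).
  apply: (I_le mO (Qad_entry_L2 oO i j (Qq k)).2 (Int_cst mO finO _)).
  have [_ hq] := (QadP oO bO qmax qmin0 (q k)).1 (Qq k); apply: aeS hq => x h Ox.
  rewrite -[leLHS]real_normK ?num_real//; have b := ell_bound qmin0 i j (h Ox).
  by apply: lerXn2r; rewrite ?nnegrE//; exact: le_trans b.
have fK i k : I (fun x => flux Omega (q k) (u k) i x ^+ 2) <= 2 * qmax ^+ 2 * KD.
  apply: (le_trans (flux_bound oO bO qmin0 i (Qq k) (Hu k))).
  by rewrite ler_wpM2l// mulr_ge0// sqr_ge0.
have F0 : 0 <= 2 * qmax ^+ 2 * KD := le_trans (I_sq_ge0 _ _) (fK 0 0%N).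
have Q0 : 0 <= I (fun=> qmax ^+ 2) by apply: I_ge0 => x _; exact: sqr_ge0.
pose C' := 2 * qmax ^+ 2 * KD + KR + I (fun=> qmax ^+ 2).
have t1 : 2 * qmax ^+ 2 * KD <= C' by rewrite /C' -addrA lerDl addr_ge0.
have t2 : KR <= C' by rewrite /C' addrAC lerDr addr_ge0.
have t3 : I (fun=> qmax ^+ 2) <= C' by rewrite /C' lerDr addr_ge0.
have aK j k : I (fun x => a j k x ^+ 2) <= C'.
  by move: j => [|[|[|[|[|[|j]]]]]]; [exact: le_trans (fK _ _) t1|exact: le_trans (fK _ _) t1
    |exact: le_trans (rK _) t2|exact: le_trans (qK _ _ _) t3|exact: le_trans (qK _ _ _) t3
    |exact: le_trans (qK _ _ _) t3|exact: le_trans (qK _ _ _) t3].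
have [s1 hs1 ws1] := weak_extract oO bO 7 La aK.
have [s2 [hs2 [us Hus ws2]]] := H10_extract (fun n => Hu (s1 n)) (fun n => uK (s1 n)).
have [s3 [hs3 [ps Hps ws3]]] := H10_extract (fun n => Hp (s1 (s2 n))) (fun n => adjoint_D2 (s1 (s2 n))).
pose t := s2 \o s3; have ht : {homo t : i j / (i < j)%N} := homo_ltn_comp hs2 hs3.
pose sg := s1 \o t; have hsg : {homo sg : i j / (i < j)%N} := homo_ltn_comp hs1 ht.
have W j : (j < 7)%N -> exists2 b, L2O b & wcv (fun n => a j (sg n)) b.
  by move=> j7; have [b Lb wb] := ws1 j j7; exists b => //; exact: (wcv_subseq ht wb).
have [b0 L0 w0] := W 0 isT; have [b1 L1 w1] := W 1 isT; have [rs Lrs wr] := W 2 isT.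
have [q00 M00 w00] := W 3 isT; have [q01 M01 w01] := W 4 isT.
have [q10 M10 w10] := W 5 isT; have [q11 M11 w11] := W 6 isT.
pose s (i : 'I_2) := if i == 0 then b0 else b1.
pose qs (i j : 'I_2) := if i == 0 then (if j == 0 then q00 else q01) else (if j == 0 then q10 else q11).
have Ls i : L2O (s i) by rewrite /s; case: ifP.
have Lqs i j : L2O (qs i j) by rewrite /qs; case: ifP; case: ifP.
have wflux i : wcv (fun n => flux Omega (q (sg n)) (u (sg n)) i) (s i).
  by have [->|->] := ord2 i; [exact: w0|exact: w1].
have wqs i j : wcv (fun n x => q (sg n) x i j) (qs i j).
  have [->|->] := ord2 i; have [->|->] := ord2 j; by [exact: w00|exact: w01|exact: w10|exact: w11].
have wpd i : wcv (fun n => pd i (u (sg n))) (pd i us).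
  by move=> k Lk; exact: (cvg_subseq hs3 (ws2 _ (pd_bounded_linear i Lk))).
pose k n x := f x - r (gamma (sg n)) (u (sg n) x).
have Lk n : L2O (k n) := L2B mO Lf (Lr (sg n)).
pose C := KD + (2 * I (fun x => f x ^+ 2) + 2 * KR).
have kC n : I (fun x => k n x ^+ 2) <= C.
  apply: (le_trans (I_sqB Lf (Lr (sg n)))); rewrite /C ler_wpDl// lerD2l ler_wpM2l//.
have uC n : D2 (u (sg n)) <= C.
  by apply: (le_trans (uK _)); rewrite /C lerDl addr_ge0// mulr_ge0.
have weak_u n v : H10 v -> energy Omega (q (sg n)) (u (sg n)) v = ip Omega (k n) v.
  exact: (state_weak oO bO qmin0 psi0 sm Lf (g0 (sg n)) (Qq (sg n)) (st (sg n))).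
have Hun n := Hu (sg n); have Qqn n := Qq (sg n); have Lus := H10_L2 oO bO Hus.
have us_cvg := weak_limit_strong oO bO Hun Hus uC wpd.
have [qh [Qh flux_h pos]] := homogenized_coefficient oO bO qmin0 Qqn Hun Hus Ls Lk kC uC weak_u wpd wflux Lqs wqs.
have gsg0 n : 0 < gamma (sg n) := g0 (sg n).
have gsginf : (fun n => gamma (sg n)) @ \oo --> +oo.
  have /cvgryPge h := ginf; apply/cvgryPge => A; have [N _ NP] := h A; exists N => // n Nn.
  by apply: NP; exact: leq_trans Nn (homo_ltn_ge hsg n).
have limit_eq v : H10 v -> energy Omega qh us v = ip Omega (fun x => f x - rs x) v.
  move=> Hv; have Lv i : L2O (pd i v) := H10_pd oO bO i Hv; have Lv' := H10_L2 oO bO Hv.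
  have e i : ip Omega (flux Omega qh us i) (pd i v) = ip Omega (s i) (pd i v).
    apply: (ip_eq_ae oO); [exact: (flux_L2 oO bO qmin0 i Qh Hus).1|exact: (Ls i).1|exact: (Lv i).1|].
    exact: flux_h.
  apply: (etrans (f_equal2 +%R (e 0) (e 1))).
  (* The limit of [ip Omega (k n) v] is computed twice, through the equation and through the weak
     limit of the penalty; uniqueness of limits gives the limit equation. *)
  have cl1 : (fun n => ip Omega (k n) v) @ \oo --> ip Omega (s 0) (pd 0 v) + ip Omega (s 1) (pd 1 v).
    apply: (cvg_seq_ext (fun n => weak_u n v Hv)).
    by apply: cvgD; [exact: (wflux 0 _ (Lv 0))|exact: (wflux 1 _ (Lv 1))].
  have sB w : L2O w -> ip Omega f v - ip Omega w v = ip Omega (fun x => f x - w x) v.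
    by move=> Lw; exact: (esym (pHbBl pH2 Lf Lw Lv')).
  have cl2 : (fun n => ip Omega (k n) v) @ \oo --> ip Omega (fun x => f x - rs x) v.
    rewrite -(sB _ Lrs); apply: (cvg_seq_ext (fun n => sB _ (Lr (sg n)))).
    by apply: cvgB; [exact: cvg_cst|exact: (wr _ Lv')].
  by rewrite -(cvg_lim (@Rhausdorff R) cl1) (cvg_lim (@Rhausdorff R) cl2).
(* The competitors are states of [qh] for the same penalty parameters, hence admissible in the
   problems solved by [q (sg n)]. *)
have [uh huh] := choice (fun n => exists_state oO bO qmin0 psi0 sm Lf (gsg0 n) Qh).
have rec := recovery_cvg oO bO qmin0 psi0 sm Lf gsg0 gsginf (fun n => Lu (sg n)) Lus Lrs
  (fun n => rK (sg n)) us_cvg wr Qh Hus limit_eq huh.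
have Luh n : L2O (uh n) by apply: (H10_L2 oO bO); have [] := huh n.
(* Solving the optimality inequality for the norm of the coefficient leaves this difference of
   tracking terms, which tends to zero because [uh] and the minimizing states have the same limit
   [us]. *)
pose e n := alpha^-1 * (dist2 (uh n) ud - dist2 (u (sg n)) ud).
have e0 : e @ \oo --> 0.
  rewrite -[X in _ --> X](_ : alpha^-1 * (dist2 us ud - dist2 us ud) = 0); last by rewrite subrr mulr0.
  apply: cvgM; first exact: cvg_cst.
  apply: cvgB; [exact: (dist2_cvg Luh Lus Lud rec)|exact: (dist2_cvg (fun n => Lu (sg n)) Lus Lud us_cvg)].
have nle n : sqnorm Omega (q (sg n)) <= sqnorm Omega qh + e n.
  have [_ _ /(_ qh (uh n) Qh (huh n))] := sol (sg n).
  rewrite (JE oO bO qmin0 alpha Lud (Qqn n) (Lu (sg n))) (JE oO bO qmin0 alpha Lud Qh (Luh n)) /e.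
  move: (sqnorm _ _) (sqnorm _ qh) (dist2 _ _) (dist2 (uh n) _) => A B X Y h.
  rewrite -(ler_pM2l alpha0) mulrDr mulVKf ?gt_eqF//; lra.
have cq := coefficient_strong oO bO Qqn Qh Lqs wqs e0 nle pos.
have d0 (i j : 'I_2) n := dist2_ge0 Omega (fun x => q (sg n) x i j) (fun x => qh x i j).
have Lqn n i j : L2O (fun x => q (sg n) x i j) := Qad_entry_L2 oO i j (Qqn n).
have Lqh i j : L2O (fun x => qh x i j) := Qad_entry_L2 oO i j Qh.
have cij i j : (fun n => dist2 (fun x => q (sg n) x i j) (fun x => qh x i j)) @ \oo --> 0.
  have s10 n : dist2 (fun x => q (sg n) x 1 0) (fun x => qh x 1 0) =
      dist2 (fun x => q (sg n) x 0 1) (fun x => qh x 0 1).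
    have [_ h1] := (QadP oO bO qmax qmin0 (q (sg n))).1 (Qqn n).
    have [_ h2] := (QadP oO bO qmax qmin0 qh).1 Qh.
    apply: (dist2_ae oO (Lqn n 1 0) (Lqn n 0 1) (Lqh 1 0) (Lqh 0 1)).
      by apply: aeS h1 => x h Ox; have [-> _] := h Ox.
    by apply: aeS h2 => x h Ox; have [-> _] := h Ox.
  have key (A B D : R) : 0 <= A -> 0 <= B -> 0 <= D ->
      [/\ A <= A + 2 * B + D, B <= A + 2 * B + D & D <= A + 2 * B + D].
    by move=> *; split; lra.
  have kn n := key _ _ _ (d0 0 0 n) (d0 0 1 n) (d0 1 1 n).
  have [->|->] := ord2 i; have [->|->] := ord2 j; apply: cvg0_le cq => n; apply/andP; split;
    try exact: d0; rewrite ?s10; by have [] := kn n.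
(* Convergence in [L^2] gives a.e. convergence along a further subsequence only; it is taken entry
   by entry, for the dominated convergence in [gradient_strong]. *)
have ae_ext i j (tt : nat -> nat) : {homo tt : i j / (i < j)%N} ->
    exists2 t' : nat -> nat, {homo t' : i j / (i < j)%N} &
    {ae mu2, forall x, Omega x -> (fun n => q (sg (tt (t' n))) x i j) @ \oo --> qh x i j}.
  move=> htt; exact: (dist2_ae_subseq oO bO (fun n => Lqn (tt n) i j) (Lqh i j) (cvg_subseq htt (cij i j))).
have [r0 hr0 ae0] := ae_ext 0 0 id (fun _ _ lt => lt).
have [r1 hr1 ae1] := ae_ext 0 1 r0 hr0; have h01 := homo_ltn_comp hr0 hr1.
have [r2 hr2 ae2] := ae_ext 1 0 _ h01; have h012 := homo_ltn_comp h01 hr2.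
have [r3 hr3 ae3] := ae_ext 1 1 _ h012; have hr := homo_ltn_comp h012 hr3.
pose tau n := r0 (r1 (r2 (r3 n))).
have htau : {homo tau : i j / (i < j)%N} := hr.
have qae i j : {ae mu2, forall x, Omega x -> (fun n => q (sg (tau n)) x i j) @ \oo --> qh x i j}.
  have [->|->] := ord2 i; have [->|->] := ord2 j.
  - by apply: aeS ae0 => x h Ox; exact: (cvg_subseq (homo_ltn_comp hr1 (homo_ltn_comp hr2 hr3)) (h Ox)).
  - by apply: aeS ae1 => x h Ox; exact: (cvg_subseq (homo_ltn_comp hr2 hr3) (h Ox)).
  - by apply: aeS ae2 => x h Ox; exact: (cvg_subseq hr3 (h Ox)).
  - by apply: aeS ae3 => x h Ox; exact: (h Ox).
exists (sg \o tau); split; first exact: homo_ltn_comp hsg htau.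
exists qh, us, ps; split; [exact: Qh|exact: Hus|exact: Hps|split].
- by move=> i j; exact: (cvg_subseq htau (cij i j)).
- exact: (gradient_strong oO bO qmin0 (fun n => Qqn (tau n)) Qh (fun n => Hun (tau n)) Hus Ls
    (fun n => Lk (tau n)) (fun n => kC (tau n)) (fun n => weak_u (tau n)) (cvg_subseq htau us_cvg)
    (fun i => wcv_subseq htau (wflux i)) flux_h qae).
- by move=> F bF; exact: (cvg_subseq htau (ws3 F bF)).
Qed.
End MinimizerSubsequence.

Lemma powR_seq_cvg (R : realType) (t : nat -> R) (l r : R) : 0 < r -> (forall n, 0 <= t n) ->
  t @ \oo --> l -> (fun n => t n `^ r) @ \oo --> l `^ r.
Proof.
move=> r0 t0 tl; have := cvg_ge0 tl t0; rewrite le_eqVlt => /predU1P[l0|l0].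
  rewrite -l0 powR0 ?gt_eqF//; apply: powR_seq_cvg0 => //.
  by rewrite l0.
have c : (fun n => expR (r * ln (t n))) @ \oo --> expR (r * ln l).
  apply: (@cvg_comp _ _ _ (fun n => r * ln (t n)) expR); last exact: continuous_expR.
  apply: cvgM; first exact: cvg_cst.
  by apply: (@cvg_comp _ _ _ t (@ln R)) tl _; exact: continuous_ln.
have -> : l `^ r = expR (r * ln l) by rewrite /powR gt_eqF.
apply: cvg_trans c; apply: near_eq_cvg; have [N NP] := (cvg_epsP _ _).1 tl _ (divr_gt0 l0 (ltr0Sn R 1)).
exists N => // n Nn /=; rewrite /powR gt_eqF//.
by have := NP n Nn; rewrite ler_norml => /andP[h _]; lra.
Qed.

Lemma double_sum_le (R : realDomainType) (a0 a1 b0 b1 K : R) : a0 + a1 <= K ->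
  2 * a0 + 2 * b0 + (2 * a1 + 2 * b1) <= 2 * K + 2 * (b0 + b1).
Proof. lra. Qed.

(** * Convergence in the stronger norms *)

Section LpConvergence.
Variable R : realType.
Local Notation P := (measurableTypeR R * measurableTypeR R)%type.
Local Notation mu2 := (leb2 R).
Variable (Omega : set (R * R)).
Hypothesis oO : open Omega.
Hypothesis bO : bounded_set Omega.
Local Notation I f := (\int[mu2]_(x in Omega) f x)%R.
Local Notation Int f := (mu2.-integrable Omega (EFin \o f)).
Local Notation L2O := (L2 mu2 Omega).
Local Notation mO := (mOmega oO).
Local Notation finO := (finOmega oO bO).
Local Notation pd i u := (weak_partial Omega i u).
Local Notation H10 := (H10 Omega).
Local Notation D2 := (grad_sq Omega).
Local Notation dist2 := (sqdist Omega).
Implicit Types (s p : R) (v w : R * R -> R).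

Lemma Int_bounded (F : R * R -> R) (K p : R) : 0 <= p -> measurable_fun (Omega : set P) F ->
  {ae mu2, forall x, Omega x -> `|F x| <= K} ->
  Int (fun x => `|F x| `^ p) /\ I (fun x => `|F x| `^ p) <= I (fun=> K `^ p).
Proof.
move=> p0 mF FK; have ic := Int_cst mO finO (K `^ p).
have iF : Int (fun x => `|F x| `^ p).
  apply: (Int_le mO (measurable_powR_abs p mF) ic); apply: aeS FK => x h Ox.
  by rewrite ger0_norm ?powR_ge0//; apply: powR_mono => //; exact: h.
split; [exact: iF|apply: (I_le mO iF ic)]; apply: aeS FK => x h Ox.
by apply: powR_mono => //; exact: h.
Qed.

Lemma Lpnorm_le_Int (F : R * R -> R) p B : 0 < p -> measurable_fun (Omega : set P) F ->
  (Lpnorm Omega p%:E F <= B%:E)%E ->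
  Int (fun x => `|F x| `^ p) /\ I (fun x => `|F x| `^ p) <= B `^ p.
Proof.
move=> p0 mF FB; have E := @powR_Lpnorm R Omega F p (lt0r_neq0 p0).
have n0 : (0 <= Lpnorm Omega p%:E F)%E by exact: Lnorm_ge0.
have fin : Lpnorm Omega p%:E F \is a fin_num by rewrite ge0_fin_numE// (le_lt_trans FB) ?ltry.
have mp := measurable_powR_abs p mF.
have iF : Int (fun x => `|F x| `^ p).
  apply/integrableP; split; first exact/measurable_EFinP.
  under eq_integral do rewrite /= ger0_norm ?powR_ge0//.
  by rewrite -E -(fineK fin) poweR_EFin ltry.
split; first exact: iF.
rewrite -lee_fin -(I_EFin mO iF) -E -(fineK fin) poweR_EFin lee_fin.
by apply: powR_mono; [exact: ltW|exact: fine_ge0|rewrite -lee_fin fineK].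
Qed.

Section Coefficients.
Variables (qmin qmax : R) (q : nat -> R * R -> 'M[R]_2) (qh : R * R -> 'M[R]_2).
Hypothesis qmin0 : 0 < qmin.
Hypothesis Qq : forall n, Qad Omega qmin qmax (q n).
Hypothesis Qh : Qad Omega qmin qmax qh.
Hypothesis cq : forall i j, (fun n => dist2 (fun x => q n x i j) (fun x => qh x i j)) @ \oo --> 0.

Lemma Qad_Lp q' s : 2 <= s -> Qad Omega qmin qmax q' -> Lp_mx Omega s%:E q'.
Proof.
move=> s2 Qq' i j; have s0 : 0 < s by lra.
have [mq hq] := (QadP oO bO qmax qmin0 q').1 Qq'.
apply/(LpP mO _ s0); split; first exact: mq.
apply: (Int_bounded (K := qmax) (ltW s0) (mq i j) _).1.
by apply: aeS hq => x h Ox; exact: (ell_bound qmin0 i j (h Ox)).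
Qed.

Lemma coefficient_Lp s : 2 <= s -> cvg_Lp_mx Omega s%:E q qh.
Proof.
move=> s2; split; [by move=> n; exact: Qad_Lp|exact: Qad_Lp|].
pose F n x := fnorm (q n x - qh x).
have s0 : 0 < s by lra.
have Lqn n i j := Qad_entry_L2 oO i j (Qq n); have Lqh i j := Qad_entry_L2 oO i j Qh.
have Ld n i j : L2O (fun x => (q n x - qh x) i j).
  have := L2B mO (Lqn n i j) (Lqh i j); congr (L2 _ _ _).
  by apply/funext => x; rewrite !mxE.
have Ed n i j : I (fun x => (q n x - qh x) i j ^+ 2) = dist2 (fun x => q n x i j) (fun x => qh x i j).
  by apply: eq_Rintegral => x _; rewrite !mxE.
have LF n : L2O (F n) := (fnorm_L2 oO (Ld n)).1.
have F0 : (fun n => I (fun x => F n x ^+ 2)) @ \oo --> 0.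
  have E n : dist2 (fun x => q n x 0 0) (fun x => qh x 0 0) + dist2 (fun x => q n x 0 1) (fun x => qh x 0 1)
    + (dist2 (fun x => q n x 1 0) (fun x => qh x 1 0) + dist2 (fun x => q n x 1 1) (fun x => qh x 1 1))
    = I (fun x => F n x ^+ 2).
    by rewrite -!Ed; exact: (esym (fnorm_L2 oO (Ld n)).2).
  apply: (cvg_seq_ext E); rewrite -[X in _ --> X](_ : 0 + 0 + (0 + 0) = 0); last by rewrite !addr0.
  by apply: cvgD; apply: cvgD; exact: cq.
(* Each of the four entries of the difference is at most [2 * qmax] in absolute value, so the
   Frobenius norm is at most twice that. *)
have bF n : {ae mu2, forall x, Omega x -> `|F n x| <= 4 * qmax}.
  have [_ h1] := (QadP oO bO qmax qmin0 (q n)).1 (Qq n); have [_ h2] := (QadP oO bO qmax qmin0 qh).1 Qh.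
  apply: aeS2 h1 h2 => x e1 e2 Ox; rewrite /F fnorm_mx2 ger0_norm ?sqrtr_ge0//.
  have b i j : ((q n x - qh x) i j) ^+ 2 <= (2 * qmax) ^+ 2.
    rewrite -[leLHS]real_normK ?num_real//; have a1 := ell_bound qmin0 i j (e1 Ox).
    have a2 := ell_bound qmin0 i j (e2 Ox); rewrite !mxE.
    have t := ler_normB (q n x i j) (qh x i j).
    have q0 : 0 <= qmax := le_trans (normr_ge0 _) a1.
    by apply: lerXn2r; rewrite ?nnegrE ?mulr_ge0//; lra.
  have q0 : 0 <= qmax := le_trans (normr_ge0 _) (ell_bound qmin0 0 0 (e1 Ox)).
  rewrite -[leRHS]ger0_norm ?mulr_ge0// -sqrtr_sqr ler_wsqrtr//.
  have := b 0 0; have := b 0 1; have := b 1 0; have := b 1 1.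
  move: (_ 0 0 ^+ 2) (_ 0 1 ^+ 2) (_ 1 0 ^+ 2) (_ 1 1 ^+ 2) => a1 a2 a3 a4; lra.
(* Boundedness makes every exponent available; [s + 1] is just one strictly above [s], as the
   interpolation requires. *)
have sp0 : 0 <= s + 1 by lra.
have B n := Int_bounded sp0 (LF n).1 (bF n).
have ss : s < s + 1 by lra.
have c := interp_cvg0 oO LF s2 ss F0 (fun n => (B n).1) (fun n => (B n).2).
apply: (Lpnorm_cvg0 mO s0 _ c) => n.
exact: (Int_powR_interp oO (LF n) s2 (ltW ss) (B n).1).
Qed.
End Coefficients.

Definition gradn v x := Num.sqrt (pd 0 v x ^+ 2 + pd 1 v x ^+ 2).

Lemma gradn_L2 v : H10 v -> L2O (gradn v).
Proof. by move=> Hv; exact: (L2_sqrt_sum oO (H10_pd oO bO 0 Hv) (H10_pd oO bO 1 Hv)). Qed.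

Lemma gradn_ge0 v x : 0 <= gradn v x. Proof. exact: sqrtr_ge0. Qed.

Lemma gradn_sq v x : gradn v x ^+ 2 = pd 0 v x ^+ 2 + pd 1 v x ^+ 2.
Proof. by rewrite sqr_sqrtr// addr_ge0 ?sqr_ge0. Qed.

Lemma H10_weak_partial v i : H10 v -> is_weak_partial Omega i v (pd i v).
Proof. by move=> Hv; exact: (graph_weak_partial oO bO i (H10_graph oO bO Hv)). Qed.

Lemma Lpnorm_gradE v p : 0 < p -> H10 v -> Lpnorm_mx Omega p%:E (grad Omega v) = Lpnorm Omega p%:E (gradn v).
Proof. by move=> p0 Hv; exact: (Lpnorm_grad_ae oO p0 (fun i => H10_weak_partial i Hv)). Qed.

(** The summand [1] provides the strict inequality that [graph_moment] asks for. Even integer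
    exponents suffice, since every real one is reached by interpolation. *)
Lemma even_moment v m : H10 v -> Int (fun x => `|v x| `^ (2 * m)%:R) /\
  I (fun x => `|v x| `^ (2 * m)%:R) <= (m`!%:R) ^+ 2 * I (fun=> 1) * (D2 v + 1) ^+ m.
Proof.
move=> Hv; have := graph_moment oO bO m (H10_graph oO bO Hv) (_ : _ < D2 v + 1).
have -> : (fun x => `|v x| `^ (2 * m)%:R) = (fun x => v x ^+ (2 * m)).
  by apply/funext => x; rewrite powR_mulrn// !exprM real_normK ?num_real.
by apply; rewrite ltrDl.
Qed.

Lemma H10_W1p v s p : H10 v -> 2 <= s -> s <= p -> Int (fun x => `|gradn v x| `^ p) -> W1p Omega s%:E v.
Proof.
move=> Hv s2 sp ip; have s0 : 0 < s by lra.
have Lv := H10_L2 oO bO Hv; split.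
  apply/(LpP mO _ s0); split; first exact: Lv.1.
  pose m := Num.bound s; have sm : s <= (2 * m)%:R.
    have := archi_boundP (ltW s0); rewrite -/m => h; rewrite (le_trans (ltW h))// ler_nat.
    by rewrite mul2n -addnn leq_addr.
  exact: (Int_powR_interp oO Lv s2 sm (even_moment m Hv).1).
move=> i; exists (pd i v); first exact: H10_weak_partial.
have Lpd := H10_pd oO bO i Hv.
apply/(LpP mO _ s0); split; first exact: Lpd.1.
have is' := Int_powR_interp oO (gradn_L2 Hv) s2 sp ip.
apply: (Int_le_pt mO (measurable_powR_abs s Lpd.1) is') => x _.
rewrite ger0_norm ?powR_ge0//; apply: powR_mono => //; first exact: ltW.
rewrite (ger0_norm (gradn_ge0 v x)) -[leLHS]ger0_norm// -sqrtr_sqr ler_wsqrtr//.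
rewrite real_normK ?num_real//.
have kl (a b : R) : 0 <= b -> a <= a + b by rewrite lerDl.
have kr (a b : R) : 0 <= a -> b <= a + b by rewrite lerDr.
by have [->|->] := ord2 i; [exact: (kl _ _ (sqr_ge0 _))|exact: (kr _ _ (sqr_ge0 _))].
Qed.

Lemma sqrt_sum_sub_le (a b c d : R) : Num.sqrt ((a - c) ^+ 2 + (b - d) ^+ 2) <=
  2 * (Num.sqrt (a ^+ 2 + b ^+ 2) + Num.sqrt (c ^+ 2 + d ^+ 2)).
Proof.
have x0 : 0 <= a ^+ 2 + b ^+ 2 by rewrite addr_ge0 ?sqr_ge0.
have y0 : 0 <= c ^+ 2 + d ^+ 2 by rewrite addr_ge0 ?sqr_ge0.
set S := Num.sqrt (a ^+ 2 + b ^+ 2); set T := Num.sqrt (c ^+ 2 + d ^+ 2).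
have S0 : 0 <= S := sqrtr_ge0 _; have T0 : 0 <= T := sqrtr_ge0 _.
have ST : 0 <= 2 * (S + T) by rewrite mulr_ge0 ?addr_ge0.
rewrite -[leRHS]ger0_norm// -sqrtr_sqr ler_wsqrtr//.
have e1 : S ^+ 2 = a ^+ 2 + b ^+ 2 by rewrite sqr_sqrtr.
have e2 : T ^+ 2 = c ^+ 2 + d ^+ 2 by rewrite sqr_sqrtr.
have := mulr_ge0 S0 T0; have := sqr_ge0 (a + c); have := sqr_ge0 (b + d); move: e1 e2.
by clearbody S T; clear ST; rewrite -/(S ^+ 2); nra.
Qed.

Section States.
Variables (u : nat -> R * R -> R) (us : R * R -> R) (p K KD : R).
Hypothesis Hu : forall n, H10 (u n).
Hypothesis Hus : H10 us.
Hypothesis p2 : 2 < p.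
Hypothesis ip : forall n, Int (fun x => `|gradn (u n) x| `^ p).
Hypothesis pK : forall n, I (fun x => `|gradn (u n) x| `^ p) <= K.
Hypothesis uK : forall n, D2 (u n) <= KD.
Hypothesis cD : (fun n => D2 (fun x => u n x - us x)) @ \oo --> 0.

(** The available bound concerns only the approximating states; the limit inherits it by Fatou's
    lemma along a subsequence whose gradients converge a.e. *)
Lemma limit_gradient_Lp : Int (fun x => `|gradn us x| `^ p) /\ I (fun x => `|gradn us x| `^ p) <= K.
Proof.
have p0 : 0 < p := lt_trans (ltr0Sn R 1) p2.
have cpd i : (fun n => dist2 (pd i (u n)) (pd i us)) @ \oo --> 0.
  have kl (a b : R) : 0 <= b -> a <= a + b by rewrite lerDl.
  have kr (a b : R) : 0 <= a -> b <= a + b by rewrite lerDr.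
  apply: cvg0_le cD => n; rewrite dist2_ge0 /= (D2B oO bO (Hu n) Hus).
  by have [->|->] := ord2 i; [exact: (kl _ _ (dist2_ge0 _ _ _))|exact: (kr _ _ (dist2_ge0 _ _ _))].
have Lpn n i := H10_pd oO bO i (Hu n); have Lps i := H10_pd oO bO i Hus.
have [t1 ht1 ae1] := dist2_ae_subseq oO bO (fun n => Lpn n 0) (Lps 0) (cpd 0).
have [t2 ht2 ae2] := dist2_ae_subseq oO bO (fun n => Lpn (t1 n) 1) (Lps 1) (cvg_subseq ht1 (cpd 1)).
apply: (fatou_real mO (g := fun n x => `|gradn (u (t1 (t2 n))) x| `^ p)).
- by move=> n; exact: ip.
- by move=> n x _; exact: powR_ge0.
- by apply: measurable_powR_abs; exact: (gradn_L2 Hus).1.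
- apply: aeS2 ae1 ae2 => x h1 h2 Ox; apply: powR_seq_cvg => //.
  apply: (@cvg_comp _ _ _ (fun n => gradn (u (t1 (t2 n))) x) Num.norm); last exact: norm_continuous.
  apply: (@cvg_comp _ _ _ (fun n => pd 0 (u (t1 (t2 n))) x ^+ 2 + pd 1 (u (t1 (t2 n))) x ^+ 2) Num.sqrt);
    last exact: sqrt_continuous.
  by apply: cvgD; apply: cvg_sqr; [exact: (cvg_subseq ht2 (h1 Ox))|exact: (h2 Ox)].
- by exists 0%N => n _; exact: pK.
Qed.

(** Gradients are interpolated between strong convergence in [L^2] and the bound in [L^p], the
    functions between [L^2] and an even moment of order [2 m > s], which the Dirichlet integral
    controls. *)
Lemma state_W1p s : 2 <= s -> s < p -> cvg_W1p Omega s%:E u us.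
Proof.
move=> s2 sp; have s0 : 0 < s by lra.
have p0 : 0 < p := lt_trans (ltr0Sn R 1) p2.
have [ius iusK] := limit_gradient_Lp.
split; [by move=> n; exact: (H10_W1p (Hu n) s2 (ltW sp) (ip n))|exact: (H10_W1p Hus s2 (ltW sp) ius)|].
pose w n x := u n x - us x; have Hw n : H10 (w n) := H10B oO bO (Hu n) Hus.
have Lw n : L2O (w n) := H10_L2 oO bO (Hw n).
have LG n := gradn_L2 (Hw n).
have DG n : I (fun x => gradn (w n) x ^+ 2) = D2 (w n).
  have i0 i := (H10_pd oO bO i (Hw n)).2; rewrite /grad_sq -(I_D mO (i0 0) (i0 1)).
  by apply: eq_Rintegral => x _; exact: gradn_sq.
have G0 : (fun n => I (fun x => gradn (w n) x ^+ 2)) @ \oo --> 0.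
  by apply: (cvg_seq_ext (fun n => esym (DG n))); exact: cD.
have hG n : Int (fun x => `|gradn (w n) x| `^ p) /\
    I (fun x => `|gradn (w n) x| `^ p) <= 2 `^ p * (2 `^ p * (K + K)).
  have iB := Int_Z mO (2 `^ p) (Int_Z mO (2 `^ p) (Int_D mO (ip n) ius)).
  have pt : {ae mu2, forall x, Omega x -> `|gradn (w n) x| `^ p <=
      2 `^ p * (2 `^ p * (`|gradn (u n) x| `^ p + `|gradn us x| `^ p))}.
    apply: aeS2 (pdB oO bO 0 (Hu n) Hus) (pdB oO bO 1 (Hu n) Hus) => x h0 h1 Ox.
    rewrite !(ger0_norm (gradn_ge0 _ _)).
    have h : gradn (w n) x <= 2 * (gradn (u n) x + gradn us x).
      by rewrite /gradn (h0 Ox) (h1 Ox); exact: sqrt_sum_sub_le.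
    apply: (le_trans (powR_mono (ltW p0) (gradn_ge0 _ _) h)).
    rewrite powRM ?addr_ge0 ?gradn_ge0//; apply: ler_wpM2l; first exact: powR_ge0.
    by apply: powR_add_le; rewrite ?gradn_ge0.
  have iG : Int (fun x => `|gradn (w n) x| `^ p).
    apply: (Int_le mO (measurable_powR_abs p (LG n).1) iB).
    by apply: aeS pt => x h Ox; rewrite ger0_norm ?powR_ge0//; exact: h.
  split; first exact: iG.
  apply: (le_trans (I_le mO iG iB pt)).
  rewrite (I_Z mO _ (Int_Z mO (2 `^ p) (Int_D mO (ip n) ius))) (I_Z mO _ (Int_D mO (ip n) ius)).
  rewrite (I_D mO (ip n) ius); apply: ler_wpM2l; first exact: powR_ge0.
  by apply: ler_wpM2l; [exact: powR_ge0|exact: (lerD (pK n) iusK)].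
have cG := interp_cvg0 oO LG s2 sp G0 (fun n => (hG n).1) (fun n => (hG n).2).
have iGs n := Int_powR_interp oO (LG n) s2 (ltW sp) (hG n).1.
have w0 : (fun n => I (fun x => w n x ^+ 2)) @ \oo --> 0.
  apply: (@cvg0_le _ _ (fun n => (1 + I (fun=> 1)) * D2 (w n))).
    by move=> n; rewrite I_sq_ge0 /=; exact: (poincare1 oO bO (Hw n)).
  by rewrite -(mulr0 (1 + I (fun=> 1))); apply: cvgM; [exact: cvg_cst|exact: cD].
have DK n : D2 (w n) + 1 <= 2 * KD + 2 * D2 us + 1.
  rewrite lerD2r /w (D2B oO bO (Hu n) Hus).
  have b i := I_sqB oO (H10_pd oO bO i (Hu n)) (H10_pd oO bO i Hus).
  exact: (le_trans (lerD (b 0) (b 1)) (double_sum_le _ _ (uK n))).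
pose m := Num.bound s; have sm : s < (2 * m)%:R.
  have := archi_boundP (ltW s0); rewrite -/m => h; apply: (lt_le_trans h); rewrite ler_nat.
  by rewrite mul2n -addnn leq_addr.
have bm n : I (fun x => `|w n x| `^ (2 * m)%:R) <=
    (m`!%:R) ^+ 2 * I (fun=> 1) * (2 * KD + 2 * D2 us + 1) ^+ m.
  apply: (le_trans (even_moment m (Hw n)).2); apply: ler_wpM2l.
    by rewrite mulr_ge0 ?sqr_ge0//; apply: I_ge0.
  have d0 : 0 <= D2 (w n) + 1 by rewrite addr_ge0 ?D2_ge0.
  by apply: lerXn2r; rewrite ?nnegrE//; exact: le_trans (DK n).
have cw := interp_cvg0 oO Lw s2 sm w0 (fun n => (even_moment m (Hw n)).1) bm.
have iws n := Int_powR_interp oO (Lw n) s2 (ltW sm) (even_moment m (Hw n)).1.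
have n1 := Lpnorm_cvg0 mO s0 iws cw; have n2 := Lpnorm_cvg0 mO s0 iGs cG.
have -> : (fun n => W1pnorm Omega s%:E (fun x => u n x - us x)) =
    (fun n => Lpnorm Omega s%:E (w n) + Lpnorm Omega s%:E (gradn (w n)))%E.
  by apply/funext => n; rewrite /W1pnorm (Lpnorm_gradE s0 (Hw n)).
by rewrite -[X in _ --> X](adde0 0%E); apply: cvgeD.
Qed.
End States.
End LpConvergence.

Theorem theorem4p4 (R : realType) (Omega : set (R * R))
  (psi alpha qmin qmax M c1 c2 phat : R) (f ud : R * R -> R)
  (maxs : R -> R -> R)
  (gamma : nat -> R) (q : nat -> R * R -> 'M[R]_2) (u p : nat -> R * R -> R)
  (Omega_domain : bounded_domain Omega) (Omega_regular : groger_regular Omega)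
  (psi_lt0 : psi < 0) (f_Linfty : Lp Omega +oo%E f) (ud_L2 : Lp Omega 2%:E ud)
  (alpha_gt0 : 0 < alpha) (qmin_gt0 : 0 < qmin) (qmin_lt_qmax : qmin < qmax)
  (M_gt0 : 0 < M) (c1_ge1 : 1 <= c1) (c2_ge1 : 1 <= c2)
  (maxs_smoothed : smoothed_max M c1 c2 maxs)
  (phat_exponent : regularity_exponent Omega maxs psi f qmin qmax phat)
  (gamma_gt0 : forall k, 0 < gamma k)
  (gamma_infty : gamma k @[k --> \oo] --> +oo)
  (qu_solution : forall k,
     solves_P Omega maxs psi f ud alpha qmin qmax (gamma k) (q k) (u k))
  (p_adjoint : forall k,
     is_adjoint Omega maxs psi ud (gamma k) (q k) (u k) (p k)) :
  exists sigma : nat -> nat,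
    {homo sigma : i j / (i < j)%N} /\
    exists (qbar : R * R -> 'M[R]_2) (ubar pbar : R * R -> R),
      [/\ Qad Omega qmin qmax qbar, H10 Omega ubar, H10 Omega pbar &
      [/\ forall s : R, 2 <= s ->
            cvg_Lp_mx Omega s%:E (fun k => q (sigma k)) qbar,
          forall s : R, 2 <= s < phat ->
            cvg_W1p Omega s%:E (fun k => u (sigma k)) ubar
        & weak_cvg_W1p Omega 2%:E (fun k => p (sigma k)) pbar]].
Proof.
have [_ oO _ bO] := Omega_domain.
have Lf := Linfty_L2 oO bO f_Linfty.
have Lud : L2 (leb2 R) Omega ud := (Lp2P (mOmega oO) ud).1 ud_L2.
have [sigma [hs [qh [us [ps [Qh Hus Hps [cq cD cp]]]]]]] := minimizer_subsequence oO bO psi_lt0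
  alpha_gt0 qmin_gt0 maxs_smoothed Lf Lud gamma_gt0 gamma_infty qu_solution p_adjoint.
have Qq n : Qad Omega qmin qmax (q n) by have [] := qu_solution n.
have st n : is_state Omega maxs psi f (gamma n) (q n) (u n) by have [] := qu_solution n.
have Hu n : H10 Omega (u n) by have [] := st n.
have Hp n : H10 Omega (p n) by have [] := p_adjoint n.
exists sigma; split; first exact: hs.
exists qh, us, ps; split; [exact: Qh|exact: Hus|exact: Hps|split].
- by move=> s s2; exact: (coefficient_Lp oO bO qmin_gt0 (fun n => Qq (sigma n)) Qh cq s2).
(* Interpolation needs a bound at an exponent strictly above [s], and [phat_exponent] provides
   bounds strictly below [phat]; the midpoint satisfies both. *)
- move=> s /andP[s2 sp]; pose t := (s + phat) / 2.
  have st' : s < t by rewrite /t; lra.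
  have tp : t < phat by rewrite /t; lra.
  have t2 : 2 < t by lra.
  have t0 : 0 < t by lra.
  have [_ /(_ t)] := phat_exponent; rewrite (ltW t2) tp => /(_ isT)[C hC].
  have B n : (Lpnorm Omega t%:E (gradn Omega (u n)) <=
      (C * Num.sqrt (\int[leb2 R]_(x in Omega) f x ^+ 2))%:E)%E.
    have := hC (gamma n) (q n) (u n) (gamma_gt0 n) (Qq n) (st n).
    by rewrite (Lpnorm2E (mOmega oO) Lf) (Lpnorm_gradE oO bO t0 (Hu n)).
  have iB n := Lpnorm_le_Int oO t0 (gradn_L2 oO bO (Hu n)).1 (B n).
  exact: (state_W1p oO bO (fun n => Hu (sigma n)) Hus t2 (fun n => (iB (sigma n)).1)
    (fun n => (iB (sigma n)).2) (fun n => state_D2 oO bO qmin_gt0 psi_lt0 maxs_smoothed Lf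
    (gamma_gt0 (sigma n)) (Qq (sigma n)) (st (sigma n))) cD s2 st').
- split; [by move=> n; have [] := Hp (sigma n)|by have [] := Hps|move=> F dF].
  exact: (cp F (W1p_dual_bounded_linear oO bO dF)).
Qed.
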